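(* Let $M\in\mathbb{R}^{n\times n}$ be tridiagonal, symmetric and positive semidefinite. Then the Cholesky factorization of the principal submatrices of $M$ can be obtained in linear time by successive pivoting on the diagonal entries of the Schur complements, each pivot requiring only a constant number of operations; consequently, the algebraic computations of the vectors $\bar q,\bar p$ in each iteration of the PPPA (described in the context) can be accomplished in linear time by such factorization. As a result, the total complexity of solving, by the PPPA implemented in this way, the quadratic program $$\underset{0 \leq x \leq u}{\text{minimize}} \ \ q^{\top} x + \tfrac12\, x^{\top} M x$$ is $\mathrm{O}(n^2)$.
   Context: Here $q\in\mathbb{R}^n$ and $0<u_i\le\infty$ for $i=1,\dots,n$; $u_i=\infty$ means that $x_i$ has no upper bound. To solve (resolve) the problem means either to compute an optimal solution or to determine that the problem is unbounded below. The comparison matrix $\overline{M}$ of $M$ has entries $\overline{M}_{ii}=m_{ii}$ and $\overline{M}_{ij}=-|m_{ij}|$ for $i\ne j$; for tridiagonal symmetric $M$, $\overline M$ is positive semidefinite if and only if $M$ is. $M_{\alpha\beta}$ is the submatrix with rows $\alpha$ and columns $\beta$; for nonsingular $M_{\alpha\alpha}$ with complementary index set $\bar\alpha$, $(M/M_{\alpha\alpha})=M_{\bar\alpha\bar\alpha}-M_{\bar\alpha\alpha}M_{\alpha\alpha}^{-1}M_{\alpha\bar\alpha}$ is the Schur complement. **The PPPA (parametric principal pivoting algorithm)**, for a symmetric $M$ with $\overline M$ positive semidefinite. *Preparation.* Decompose $M$ into irreducible diagonal blocks and treat each block separately ($1\times1$ zero blocks by inspection). For an irreducible block, again called $M$,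 take $d>0$ with $\overline Md\ge 0$ (the solution of $\overline Md=0$ with last component $1$ if it exists, otherwise $\overline M^{-1}r$ for any $r>0$) and set $p=\frac12(M+\overline M)d$, which is nonnegative. If $p_i=0$ and $q_i<0$ for some $i$, reduce the problem and repeat: if $u_i=\infty$, eliminate $x_i=-\frac{1}{m_{ii}}[q_i+\sum_{k\ne i}m_{ik}x_k]$, which gives the problem in the remaining variables, with their bounds unchanged, matrix $(M/m_{ii})$ and linear term $q_j-\frac{m_{ji}}{m_{ii}}q_i$ ($j\ne i$); if $u_i<\infty$, substitute $x_i=u_i-z_i$ and keep only $z_i\ge0$ as bound on $z_i$ (the other bounds being unchanged), which gives linear term $q_j+m_{ji}u_i$ for $j\neq i$ and $-(q_i+m_{ii}u_i)$ for $j=i$, and the matrix obtained from $M$ by changing the sign of the off-diagonal entries of row and column $i$. Continue until $q+\tau_0p\ge0$ for some $\tau_0>0$. *Pivoting.* Start with $\alpha=\gamma=\emptyset$ and $\beta$ the set of all indices ($\alpha$: variables between bounds; $\beta$: at $0$; $\gamma$: at upper bound). At each iteration compute $\bar q,\bar p$: solve $M_{\alpha\alpha}(\bar q_\alpha,\bar p_\alpha)=(q_\alpha+M_{\alpha\gamma}u_\gamma,\,p_\alpha)$ and, for $\delta\in\{\beta,\gamma\}$, set $(\bar q_\delta,\bar p_\delta)=(q_\delta+M_{\delta\gamma}u_\gamma,\,p_\delta)-M_{\delta\alpha}(\bar q_\alpha,\bar p_\alpha)$. Let $\tau_{\rm new}=\max\{\rho_0,\rho_u,0\}$ with $\rho_0=\max\{-\bar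 q_i/\bar p_i: i\in\beta,\ \bar p_i>0\}$ and $\rho_u=\max\{-(u_i+\bar q_i)/\bar p_i: i\in\alpha,\ \bar p_i>0,\ u_i<\infty\}$ (the maximum over the empty set is $-\infty$). If $\tau_{\rm new}=0$, stop with the optimal solution $(x_\alpha,x_\beta,x_\gamma)=(-\bar q_\alpha,0,u_\gamma)$. Otherwise let $\bar i$ be a maximizing index. If $\bar i\in\alpha$, move $\bar i$ from $\alpha$ to $\gamma$. If $\bar i\in\beta$ and $(M/M_{\alpha\alpha})_{\bar i\bar i}>0$, move $\bar i$ from $\beta$ to $\alpha$. If $\bar i\in\beta$ and $(M/M_{\alpha\alpha})_{\bar i\bar i}=0$, let $\hat m_{j\bar i}$ ($j\in\alpha$) be the components of $M_{\alpha\alpha}^{-1}M_{\alpha\bar i}$ and let $\rho_{\min}$ be the minimum of the ratios $(-\bar q_j-\tau_{\rm new}\bar p_j)/\hat m_{j\bar i}$ ($j\in\alpha$, $\hat m_{j\bar i}>0$), the ratios $(u_j+\bar q_j+\tau_{\rm new}\bar p_j)/(-\hat m_{j\bar i})$ ($j\in\alpha$, $u_j<\infty$, $\hat m_{j\bar i}<0$), and $u_{\bar i}$ if finite; if $\rho_{\min}=\infty$ (no candidate), stop: the problem is unbounded below; if $\rho_{\min}=u_{\bar i}$, move $\bar i$ from $\beta$ to $\gamma$; if $\rho_{\min}$ is a ratio of the first kind attained at $\bar j$, move $\bar i$ from $\beta$ to $\alpha$ and $\bar j$ from $\alpha$ to $\beta$; if of the second kind attained at $\bar j$, move $\bar i$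 from $\beta$ to $\alpha$ and $\bar j$ from $\alpha$ to $\gamma$. Then iterate. *)

(* Defs.v *)
(* MathComp, with the real numbers given by an arbitrary [R : realType]. *)
From HB Require Import structures.
From mathcomp Require Import all_boot all_order all_algebra.
From mathcomp Require Import constructive_ereal reals.

Set Implicit Arguments.
Unset Strict Implicit.
Unset Printing Implicit Defensive.

Import Order.TTheory GRing.Theory Num.Theory.

Local Open Scope ring_scope.

(* * Real random-access machine                                               *)

(* Costs are counted on a machine whose programs are first-order syntax, fixed
   once and for all (independent of the input and of its size).  The memory
   consists of arrays of naturals and arrays of reals; both kinds are addressed
   by a constant array name and a computed natural index.  Naturals can only be
   added, subtracted and compared; reals can be combined by + - * / and square
   root and compared; there is no conversion between reals and computed
   naturals (in particular no rounding).  Every such operation, literal, memory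
   access, branch and loop iteration has cost 1.  As in the library, x / 0 = 0
   and the square root of a negative number is 0. *)

Inductive nexp :=
| NLit of nat
| NGet of nat & nexp
| NAdd of nexp & nexp
| NSub of nexp & nexp.

Inductive rexp :=
| RLit of nat
| RGet of nat & nexp
| RAdd of rexp & rexp
| RSub of rexp & rexp
| RMul of rexp & rexp
| RDiv of rexp & rexp
| RSqrt of rexp.

Inductive bexp :=
| BLt of nexp & nexp
| BLe of rexp & rexp
| BNot of bexp
| BAnd of bexp & bexp.

(* [For a e c] runs [c] once for each k = 0, ..., N - 1, where N is the value of
   [e] on entry, after storing k in cell 0 of the array [a] of naturals.
   [Probe t] leaves the computation unchanged: it records, for the purpose of
   stating theorems, the label t, the cost so far and the current memory. *)
Inductive cmd :=
| Skip
| Seq of cmd & cmd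
| NSet of nat & nexp & nexp
| RSet of nat & nexp & rexp
| If of bexp & cmd & cmd
| For of nat & nexp & cmd
| Probe of nat.

Fixpoint ncost (e : nexp) : nat :=
  match e with
  | NLit _ => 1
  | NGet _ i => (ncost i).+1
  | NAdd e1 e2 | NSub e1 e2 => (ncost e1 + ncost e2).+1
  end.

Fixpoint rcost (e : rexp) : nat :=
  match e with
  | RLit _ => 1
  | RGet _ i => (ncost i).+1
  | RAdd e1 e2 | RSub e1 e2 | RMul e1 e2 | RDiv e1 e2 =>
      (rcost e1 + rcost e2).+1
  | RSqrt e1 => (rcost e1).+1
  end.

Fixpoint bcost (e : bexp) : nat :=
  match e with
  | BLt e1 e2 => (ncost e1 + ncost e2).+1
  | BLe e1 e2 => (rcost e1 + rcost e2).+1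
  | BNot e1 => (bcost e1).+1
  | BAnd e1 e2 => (bcost e1 + bcost e2).+1
  end.

Section Machine.
Variable R : rcfType.

Record memory := Memory {
  nmem : nat -> nat -> nat;
  rmem : nat -> nat -> R }.

Record snapshot := Snapshot { label : nat; time : nat; snap : memory }.

Record machine := Machine { store : memory; clock : nat; log : seq snapshot }.

Definition upd (T : Type) (f : nat -> nat -> T) (a i : nat) (v : T) :=
  fun a' i' => if (a' == a) && (i' == i) then v else f a' i'.

Fixpoint nval (m : memory) (e : nexp) : nat :=
  match e with
  | NLit k => k
  | NGet a i => nmem m a (nval m i)
  | NAdd e1 e2 => (nval m e1 + nval m e2)%N
  | NSub e1 e2 => (nval m e1 - nval m e2)%N
  end.

Fixpoint rval (m : memory) (e : rexp) : R :=
  match e with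
  | RLit k => k%:R
  | RGet a i => rmem m a (nval m i)
  | RAdd e1 e2 => rval m e1 + rval m e2
  | RSub e1 e2 => rval m e1 - rval m e2
  | RMul e1 e2 => rval m e1 * rval m e2
  | RDiv e1 e2 => rval m e1 / rval m e2
  | RSqrt e1 => Num.sqrt (rval m e1)
  end.

Fixpoint bval (m : memory) (e : bexp) : bool :=
  match e with
  | BLt e1 e2 => (nval m e1 < nval m e2)%N
  | BLe e1 e2 => rval m e1 <= rval m e2
  | BNot e1 => ~~ bval m e1
  | BAnd e1 e2 => bval m e1 && bval m e2
  end.

Definition tick (k : nat) (s : machine) : machine :=
  Machine (store s) (clock s + k) (log s).

Definition nstore (a i v : nat) (s : machine) : machine :=
  Machine (Memory (upd (nmem (store s)) a i v) (rmem (store s))) (clock s) (log s).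

Definition rstore (a i : nat) (v : R) (s : machine) : machine :=
  Machine (Memory (nmem (store s)) (upd (rmem (store s)) a i v)) (clock s) (log s).

Fixpoint exec (c : cmd) (s : machine) : machine :=
  match c with
  | Skip => s
  | Seq c1 c2 => exec c2 (exec c1 s)
  | NSet a i e =>
      nstore a (nval (store s) i) (nval (store s) e)
             (tick (ncost i + ncost e).+1 s)
  | RSet a i e =>
      rstore a (nval (store s) i) (rval (store s) e)
             (tick (ncost i + rcost e).+1 s)
  | If b c1 c2 =>
      if bval (store s) b then exec c1 (tick (bcost b).+1 s)
      else exec c2 (tick (bcost b).+1 s)
  | For a e c1 =>
      iteri (nval (store s) e)
            (fun k s' => exec c1 (tick 1 (nstore a 0 k s')))
            (tick (ncost e).+1 s)
  | Probe t =>
      Machine (store s) (clock s)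
              (rcons (log s) (Snapshot t (clock s) (store s)))
  end.

Definition start (m : memory) : machine := Machine m 0 [::].

(* The cost between consecutive probes, and before the first one, is <= c. *)
Definition paced (c : nat) (l : seq snapshot) : bool :=
  path (fun t t' : nat => t' <= t + c)%N 0%N [seq time e | e <- l].

End Machine.

(* * Matrices and quadratic programs                                          *)

Section Problem.
Variable R : realType.

Definition tridiagonal n (M : 'M[R]_n) : Prop :=
  forall i j : 'I_n, (i.+1 < j)%N || (j.+1 < i)%N -> M i j = 0.

Definition symmetric_mx n (M : 'M[R]_n) : Prop := M^T = M.

Definition pos_semidef n (M : 'M[R]_n) : Prop :=
  forall x : 'cV[R]_n, 0 <= (x^T *m M *m x) 0 0.

Definition cmp_mx n (M : 'M[R]_n) : 'M[R]_n :=
  \matrix_(i, j) (if i == j then M i j else - `|M i j|).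

(* The submatrix M_{AB}, rows and columns in increasing order of index. *)
Definition submx_on n (M : 'M[R]_n) (A B : {set 'I_n}) : 'M[R]_(#|A|, #|B|) :=
  mxsub (fun k : 'I_#|A| => enum_val k) (fun l : 'I_#|B| => enum_val l) M.

(* [sel A *m v] is the subvector v_A and [(sel A)^T] pads a vector indexed by A
   with zeros. *)
Definition sel n (A : {set 'I_n}) : 'M[R]_(#|A|, n) :=
  rowsub (fun k : 'I_#|A| => enum_val k) 1%:M.

(* The Schur complement (M/M_{AA}) consists of the entries of this matrix with
   both indices outside A.  If A is a singleton {i} with M_ii = 0 the result is
   M: a zero pivot is skipped (in a positive semidefinite matrix the row and
   column of a zero diagonal entry vanish). *)
Definition schur n (M : 'M[R]_n) (A : {set 'I_n}) : 'M[R]_n :=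
  M - M *m ((sel A)^T *m invmx (submx_on M A A) *m sel A) *m M.

(* What is left of M_{AA} when the diagonal entries with index in A smaller than
   i have been pivoted on, in increasing order. *)
Definition pivoted n (M : 'M[R]_n) (A : {set 'I_n}) (i : 'I_n) : 'M[R]_n :=
  foldl (fun (S : 'M[R]_n) (j : 'I_n) => schur S [set j]) M
        [seq j : 'I_n <- enum A | (j < i)%N].

Definition is_cholesky k (A G : 'M[R]_k) : Prop :=
  [/\ is_trig_mx G, forall i, 0 <= G i i & A = G *m G^T].

(* The lower bidiagonal matrix with rows and columns indexed by A, with
   diagonal [d] and subdiagonal [s], both stored at the row index. *)
Definition bidiag n (A : {set 'I_n}) (d s : nat -> R) : 'M[R]_#|A| :=
  \matrix_(k < #|A|, l < #|A|)
    let i : 'I_n := enum_val k in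
    if l == k then d i else if l.+1 == k :> nat then s i else 0.

Definition obj n (M : 'M[R]_n) (q x : 'cV[R]_n) : R :=
  (q^T *m x) 0 0 + 2^-1 * (x^T *m M *m x) 0 0.

Definition feasible n (u : 'I_n -> \bar R) (x : 'cV[R]_n) : Prop :=
  forall i, 0 <= x i 0 /\ ((x i 0)%:E <= u i)%E.

Inductive answer n := Optimal of 'cV[R]_n | Unbounded.
Arguments Unbounded {n}.

Definition resolves n (M : 'M[R]_n) (q : 'cV[R]_n) (u : 'I_n -> \bar R)
    (a : answer n) : Prop :=
  match a with
  | Optimal x =>
      feasible u x /\ forall y, feasible u y -> obj M q x <= obj M q y
  | Unbounded => forall b, exists2 y, feasible u y & obj M q y < b
  end.

(* * The PPPA                                                                 *)

(* The current problem: it involves only the variables with index in [vars];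
   entries of the data with other indices are irrelevant. *)
Record qp n := QP {
  vars : {set 'I_n};
  mat : 'M[R]_n;
  lin : 'cV[R]_n;
  ub : 'I_n -> \bar R }.

Definition blocks n (M : 'M[R]_n) : {set {set 'I_n}} :=
  equivalence_partition (connect (fun i j => M i j != 0)) [set: 'I_n].

Definition zero_block n (P : qp n) (i : 'I_n) : Prop :=
  vars P = [set i] /\ mat P i i = 0.

Definition is_last n (S : {set 'I_n}) (i : 'I_n) : Prop :=
  i \in S /\ forall j, j \in S -> (j <= i)%N.

Definition supported n (S : {set 'I_n}) (d : 'cV[R]_n) : Prop :=
  forall i, i \notin S -> d i 0 = 0.

Definition normalized_kernel n (P : qp n) (d : 'cV[R]_n) : Prop :=
  [/\ supported (vars P) d,
      forall i, i \in vars P -> (cmp_mx (mat P) *m d) i 0 = 0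
    & forall i, is_last (vars P) i -> d i 0 = 1].

Definition inverse_image n (P : qp n) (d : 'cV[R]_n) : Prop :=
  supported (vars P) d /\
  exists2 r : 'cV[R]_#|vars P|, (forall k, 0 < r k 0)
    & sel (vars P) *m d
      = invmx (submx_on (cmp_mx (mat P)) (vars P) (vars P)) *m r.

Definition valid_d n (P : qp n) (d : 'cV[R]_n) : Prop :=
  [/\ forall i, i \in vars P -> 0 < d i 0,
      forall i, i \in vars P -> 0 <= (cmp_mx (mat P) *m d) i 0
    & normalized_kernel P d
      \/ ((forall e, ~ normalized_kernel P e) /\ inverse_image P d)].

Definition param_vec n (P : qp n) (d : 'cV[R]_n) : 'cV[R]_n :=
  2^-1 *: ((mat P + cmp_mx (mat P)) *m d).

Definition eliminate n (P : qp n) (i : 'I_n) : qp n :=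
  QP (vars P :\ i) (schur (mat P) [set i])
     (\col_j (lin P j 0 - mat P j i / mat P i i * lin P i 0))
     (ub P).

Definition recover_eliminated n (P : qp n) (i : 'I_n) (x : 'cV[R]_n) :
    'cV[R]_n :=
  \col_j if j == i
         then - (mat P i i)^-1
              * (lin P i 0 + \sum_(k in vars P | k != i) mat P i k * x k 0)
         else x j 0.

Definition reflect_var n (P : qp n) (i : 'I_n) (ui : R) : qp n :=
  QP (vars P)
     (\matrix_(j, k) if (j == i) (+) (k == i) then - mat P j k else mat P j k)
     (\col_j if j == i then - (lin P i 0 + mat P i i * ui)
             else lin P j 0 + mat P j i * ui)
     (fun j => if j == i then +oo%E else ub P j).

Definition recover_reflected n (i : 'I_n) (ui : R) (z : 'cV[R]_n) : 'cV[R]_n :=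
  \col_j if j == i then ui - z j 0 else z j 0.

(* Solve M_{AA} z_A = r_A; the result is z_A in A and r - M_{.A} z_A elsewhere. *)
Definition principal_pivot n (M : 'M[R]_n) (A : {set 'I_n}) (r : 'cV[R]_n) :
    'cV[R]_n :=
  let z := (sel A)^T *m (invmx (submx_on M A A) *m (sel A *m r)) in
  \col_i if i \in A then z i 0 else (r - M *m z) i 0.

Definition at_ub n (C : {set 'I_n}) (u : 'I_n -> \bar R) : 'cV[R]_n :=
  \col_i if i \in C then fine (u i) else 0.

Definition qbar n (P : qp n) (A C : {set 'I_n}) : 'cV[R]_n :=
  principal_pivot (mat P) A (lin P + mat P *m at_ub C (ub P)).

Definition pbar n (P : qp n) (p : 'cV[R]_n) (A : {set 'I_n}) : 'cV[R]_n :=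
  principal_pivot (mat P) A p.

Section Iteration.
Variables (n : nat) (P : qp n) (p : 'cV[R]_n) (A B C : {set 'I_n}).

Let q' (i : 'I_n) : R := qbar P A C i 0.
Let p' (i : 'I_n) : R := pbar P p A i 0.
Let u (i : 'I_n) : R := fine (ub P i).

Definition ratio0 (i : 'I_n) : R := - q' i / p' i.
Definition ratiou (i : 'I_n) : R := - (u i + q' i) / p' i.

Definition cand0 (i : 'I_n) : bool := (i \in B) && (0 < p' i).
Definition candu (i : 'I_n) : bool :=
  [&& i \in A, 0 < p' i & (ub P i < +oo)%E].

Definition rho0 : \bar R := \big[maxe/-oo%E]_(i | cand0 i) (ratio0 i)%:E.
Definition rhou : \bar R := \big[maxe/-oo%E]_(i | candu i) (ratiou i)%:E.
Definition tau_new : \bar R := maxe (maxe rho0 rhou) 0%E.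

Definition mhat (i j : 'I_n) : R :=
  ((sel A)^T *m (invmx (submx_on (mat P) A A) *m (sel A *m col i (mat P)))) j 0.

Let tau : R := fine tau_new.

Definition exch0 (i j : 'I_n) : bool := (j \in A) && (0 < mhat i j).
Definition exchu (i j : 'I_n) : bool :=
  [&& j \in A, (ub P j < +oo)%E & mhat i j < 0].
Definition eratio0 (i j : 'I_n) : R := (- q' j - tau * p' j) / mhat i j.
Definition eratiou (i j : 'I_n) : R :=
  (u j + q' j + tau * p' j) / (- mhat i j).

Definition rho_min (i : 'I_n) : \bar R :=
  mine (mine (\big[mine/+oo%E]_(j | exch0 i j) (eratio0 i j)%:E)
             (\big[mine/+oo%E]_(j | exchu i j) (eratiou i j)%:E))
       (ub P i).

Definition entering (i : 'I_n) : Prop := cand0 i /\ (ratio0 i)%:E = tau_new.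
Definition leaving (i : 'I_n) : Prop := candu i /\ (ratiou i)%:E = tau_new.

(* The possible results of an iteration that changes the index sets. *)
Inductive pivot : {set 'I_n} -> {set 'I_n} -> {set 'I_n} -> Prop :=
| pivot_upper i : leaving i ->
    pivot (A :\ i) B (i |: C)
| pivot_diagonal i : entering i -> 0 < schur (mat P) A i i ->
    pivot (i |: A) (B :\ i) C
| pivot_bound i : entering i -> schur (mat P) A i i = 0 ->
    (ub P i < +oo)%E -> rho_min i = ub P i ->
    pivot A (B :\ i) (i |: C)
| pivot_exchange0 i j : entering i -> schur (mat P) A i i = 0 ->
    exch0 i j -> rho_min i = (eratio0 i j)%:E ->
    pivot (i |: A :\ j) (j |: B :\ i) C
| pivot_exchangeu i j : entering i -> schur (mat P) A i i = 0 ->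
    exchu i j -> rho_min i = (eratiou i j)%:E ->
    pivot (i |: A :\ j) (B :\ i) (j |: C).

Definition ray : Prop :=
  exists i, [/\ entering i, schur (mat P) A i i = 0 & rho_min i = +oo%E].

Definition pivot_solution : 'cV[R]_n :=
  \col_i if i \in A then - q' i else if i \in C then u i else 0.

End Iteration.

(* Configurations of the PPPA.  [todo] lists the irreducible blocks still to be
   treated, [x] is the solution assembled so far, and [rec] maps a solution of
   the current problem to the solution assembled so far extended to the current
   block, undoing the reductions. *)
Inductive config n :=
| Idle (todo : seq {set 'I_n}) (x : 'cV[R]_n)
| Preparing (todo : seq {set 'I_n}) (P : qp n) (rec : 'cV[R]_n -> 'cV[R]_n)
| Prepared (todo : seq {set 'I_n}) (P : qp n) (rec : 'cV[R]_n -> 'cV[R]_n)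
    (d p : 'cV[R]_n)
| Pivoting (todo : seq {set 'I_n}) (P : qp n) (rec : 'cV[R]_n -> 'cV[R]_n)
    (p : 'cV[R]_n) (A B C : {set 'I_n})
| Answered (a : answer n).

Definition paste n (S : {set 'I_n}) (x y : 'cV[R]_n) : 'cV[R]_n :=
  \col_i if i \in S then y i 0 else x i 0.

Inductive step n (M : 'M[R]_n) (q : 'cV[R]_n) (u : 'I_n -> \bar R) :
    config n -> config n -> Prop :=
| step_finish x :
    step M q u (Idle [::] x) (Answered (Optimal x))
| step_block S todo x :
    step M q u (Idle (S :: todo) x)
               (Preparing todo (QP S M q u) (paste S x))
| step_inspect_lower todo (P : qp n) rec i : zero_block P i -> 0 <= lin P i 0 ->
    step M q u (Preparing todo P rec) (Idle todo (rec 0))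
| step_inspect_upper todo (P : qp n) rec i ui : zero_block P i -> lin P i 0 < 0 ->
    ub P i = ui%:E ->
    step M q u (Preparing todo P rec)
               (Idle todo (rec (ui *: delta_mx i 0)))
| step_inspect_ray todo (P : qp n) rec i : zero_block P i -> lin P i 0 < 0 ->
    ub P i = +oo%E ->
    step M q u (Preparing todo P rec) (Answered Unbounded)
| step_prepare todo (P : qp n) rec d :
    (forall i, ~ zero_block P i) -> valid_d P d ->
    step M q u (Preparing todo P rec)
               (Prepared todo P rec d (param_vec P d))
| step_eliminate todo (P : qp n) rec d (p : 'cV[R]_n) i :
    i \in vars P -> p i 0 = 0 ->
    lin P i 0 < 0 -> ub P i = +oo%E ->
    step M q u (Prepared todo P rec d p)
               (Preparing todo (eliminate P i)
                          (fun x => rec (recover_eliminated P i x)))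
| step_reflect todo (P : qp n) rec d (p : 'cV[R]_n) i ui :
    i \in vars P -> p i 0 = 0 ->
    lin P i 0 < 0 -> ub P i = ui%:E ->
    step M q u (Prepared todo P rec d p)
               (Preparing todo (reflect_var P i ui)
                          (fun z => rec (recover_reflected i ui z)))
| step_ready todo (P : qp n) rec d (p : 'cV[R]_n) :
    (exists2 tau0, 0 < tau0
       & forall i, i \in vars P -> 0 <= lin P i 0 + tau0 * p i 0) ->
    step M q u (Prepared todo P rec d p)
               (Pivoting todo P rec p set0 (vars P) set0)
| step_pivot todo P rec p A B C A' B' C' : (0 < tau_new P p A B C)%E ->
    pivot P p A B C A' B' C' ->
    step M q u (Pivoting todo P rec p A B C) (Pivoting todo P rec p A' B' C')
| step_ray todo P rec p A B C : (0 < tau_new P p A B C)%E ->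
    ray P p A B C ->
    step M q u (Pivoting todo P rec p A B C) (Answered Unbounded)
| step_optimal todo P rec p A B C : tau_new P p A B C = 0%E ->
    step M q u (Pivoting todo P rec p A B C)
               (Idle todo (rec (pivot_solution P A C))).

(* [c :: cs] is a run of the PPPA. *)
Fixpoint steps n (M : 'M[R]_n) (q : 'cV[R]_n) (u : 'I_n -> \bar R)
    (c : config n) (cs : seq (config n)) : Prop :=
  if cs is c' :: cs' then step M q u c c' /\ steps M q u c' cs' else True.

(* The blocks may be treated in any order. *)
Definition initial n (M : 'M[R]_n) (c : config n) : Prop :=
  exists2 bs, perm_eq bs (enum (blocks M)) & c = Idle bs 0.

(* * Memory layout                                                            *)

Definition nSize := 0%N.
Definition nStatus := 1%N.
Definition nFinite := 2%N.
Definition nVars := 3%N.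
Definition nVerdict := 4%N.

Definition rDiag := 0%N.
Definition rOff := 1%N.
Definition rLin := 2%N.
Definition rUb := 3%N.
Definition rD := 4%N.
Definition rP := 5%N.
Definition rPivot := 6%N.
Definition rGdiag := 7%N.
Definition rGsub := 8%N.
Definition rQbar := 9%N.
Definition rPbar := 10%N.
Definition rTau := 11%N.
Definition rSol := 12%N.

Section Layout.
Variables (n : nat) (m : memory R).

Definition holds_size : Prop := nmem m nSize 0 = n.

Definition holds_vec (a : nat) (S : {set 'I_n}) (v : 'cV[R]_n) : Prop :=
  forall i : 'I_n, i \in S -> rmem m a i = v i 0.

Definition holds_set (a k : nat) (S : {set 'I_n}) : Prop :=
  forall i : 'I_n, (i \in S) = (nmem m a i == k).

(* A symmetric matrix M such that M_{SS} is tridiagonal is stored by its diagonal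
   and the entries M_ij with i, j consecutive elements of S. *)
Definition holds_mat (S : {set 'I_n}) (M : 'M[R]_n) : Prop :=
  (forall i : 'I_n, i \in S -> rmem m rDiag i = M i i) /\
  (forall i j : 'I_n, i \in S -> j \in S -> (i < j)%N ->
     (forall k : 'I_n, k \in S -> ~~ (i < k < j)%N) -> rmem m rOff i = M i j).

Definition holds_ub (S : {set 'I_n}) (u : 'I_n -> \bar R) : Prop :=
  forall i : 'I_n, i \in S ->
    if u i is r%:E then nmem m nFinite i = 1%N /\ rmem m rUb i = r
    else nmem m nFinite i = 0%N.

Definition holds_qp (P : qp n) : Prop :=
  [/\ holds_mat (vars P) (mat P), holds_vec rLin (vars P) (lin P)
    & holds_ub (vars P) (ub P)].

Definition holds_status (A B C : {set 'I_n}) : Prop :=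
  [/\ holds_set nStatus 0 B, holds_set nStatus 1 A & holds_set nStatus 2 C].

Definition held_factor (A : {set 'I_n}) : 'M[R]_#|A| :=
  bidiag A (rmem m rGdiag) (rmem m rGsub).

Definition holds_answer (a : answer n) : Prop :=
  match a with
  | Optimal x => nmem m nVerdict 0 = 1%N /\ holds_vec rSol [set: 'I_n] x
  | Unbounded => nmem m nVerdict 0 = 2%N
  end.

End Layout.

(* What a probe must record when the configuration is [c].  During the pivoting
   phase this includes the Cholesky factor of M_{AA}. *)
Definition records n (c : config n) (e : snapshot R) : Prop :=
  let m := snap e in
  match c with
  | Idle _ _ => label e = 0%N
  | Preparing _ P _ =>
      [/\ label e = 1%N, holds_set m nVars 1 (vars P) & holds_qp m P]
  | Prepared _ P _ d p =>
      [/\ label e = 2%N, holds_set m nVars 1 (vars P), holds_qp m P,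
          holds_vec m rD (vars P) d & holds_vec m rP (vars P) p]
  | Pivoting _ P _ p A B C =>
      label e = 3%N /\
      [/\ holds_status m A B C,
          is_cholesky (submx_on (mat P) A A) (held_factor m A),
          holds_vec m rQbar (vars P) (qbar P A C),
          holds_vec m rPbar (vars P) (pbar P p A)
        & (rmem m rTau 0)%:E = tau_new P p A B C]
  | Answered a => label e = 4%N /\ holds_answer m a
  end.

Fixpoint all_records n (cs : seq (config n)) (l : seq (snapshot R)) : Prop :=
  match cs, l with
  | [::], [::] => True
  | c :: cs', e :: l' => records c e /\ all_records cs' l'
  | _, _ => False
  end.

End Problem.

(* Main.v *)
(* Up to a signature s with s_i s_j M_ij <= 0 for i <> j, the matrix M is its
   comparison matrix, and this is preserved by Schur complements and reflections.
   Comparison of M-matrices then shows that pbar >= 0 throughout, so that a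
   variable only ever moves from its lower bound to the interior and from there to
   its upper bound; moreover a zero pivot forces pbar_i = 0, so that the entering
   pivots are all positive and the exchange and ray cases never occur.  A block of
   N variables therefore takes O(N) steps, reductions included, because each
   reduction removes a variable or a finite bound.  A variable with p_i = 0 has
   nonpositive off-diagonal entries in its row, whence optimality is transported
   back through the reductions as the Karush-Kuhn-Tucker conditions, which are
   sufficient for a convex problem.

   An irreducible tridiagonal block stays a chain: the nonzero off-diagonal entries
   are those between consecutive variables, and eliminating a variable links its
   two neighbours.  Hence each pivot of the Cholesky factorization changes one
   diagonal entry only, the two triangular systems, the vector d and the updates of
   the data are recurrences along the chain, and each of them is a single loop. *)
Require Import Defs.
From mathcomp Require Import all_boot all_order all_algebra.
From mathcomp Require Import constructive_ereal reals.
From mathcomp Require Import zify ring lra.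
From Stdlib Require Import FunctionalExtensionality.

Set Implicit Arguments.
Unset Strict Implicit.
Unset Printing Implicit Defensive.

Import Order.TTheory GRing.Theory Num.Theory.

Local Open Scope ring_scope.

(** * Quadratic forms and Schur complements *)

Section BilinearForms.
Variables (R : realType) (n : nat).
Implicit Types (M : 'M[R]_n) (x y z : 'cV[R]_n) (A V : {set 'I_n}).

(** The point does not move at a pivot: at the critical parameter the old complementary solution
    also solves the system of the new index sets, and nonsingularity identifies the two. Progress is
    measured by the index sets and not by the parameter, so ties in the ratios do no harm. The
    reductions are more delicate: each drops a bound, which has to be recovered from the optimality
    conditions of the smaller problem. Unboundedness is a statement about objectives and cannot
    travel with those conditions; hence objectives are compared as well, as long as no reflection
    has occurred. On the machine, memory and cost are treated apart. Cost is bounded from the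
    syntax, because all loops run over one size cell. Memory is described by equations that hold
    after a sequence of passes over arrays, which turns program correctness into the algebra of
    recurrences. Missing neighbours get coefficient 0, so that boundary indices need no special
    code, and sentinels at index [n] start the downward scans. *)

Definition dot x y : R := \sum_i x i 0 * y i 0.
Definition bil M x y : R := dot x (M *m y).

Lemma dotE x y : (x^T *m y) 0 0 = dot x y.
Proof. by rewrite mxE; apply: eq_bigr => i _; rewrite mxE. Qed.

Lemma dotC x y : dot x y = dot y x.
Proof. by apply: eq_bigr => i _; rewrite mulrC. Qed.

Lemma dotDl x y z : dot (x + y) z = dot x z + dot y z.
Proof. by rewrite -big_split; apply: eq_bigr => i _; rewrite mxE mulrDl. Qed.

Lemma dotZl a x y : dot (a *: x) y = a * dot x y.
Proof. by rewrite mulr_sumr; apply: eq_bigr => i _; rewrite mxE mulrA. Qed.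

Lemma dotNl x y : dot (- x) y = - dot x y.
Proof. by rewrite -scaleN1r dotZl mulN1r. Qed.

Lemma dotBl x y z : dot (x - y) z = dot x z - dot y z.
Proof. by rewrite dotDl dotNl. Qed.

Lemma dotDr x y z : dot x (y + z) = dot x y + dot x z.
Proof. by rewrite !(dotC x) dotDl. Qed.

Lemma dotZr a x y : dot x (a *: y) = a * dot x y.
Proof. by rewrite !(dotC x) dotZl. Qed.

Lemma dotNr x y : dot x (- y) = - dot x y.
Proof. by rewrite !(dotC x) dotNl. Qed.

Lemma dotBr x y z : dot x (y - z) = dot x y - dot x z.
Proof. by rewrite dotDr dotNr. Qed.

Lemma dot_delta x (i : 'I_n) : dot x (delta_mx i 0) = x i 0.
Proof.
rewrite /dot (bigD1 i) //= mxE !eqxx mulr1 big1 ?addr0 // => j ji.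
by rewrite mxE (negbTE ji) mulr0.
Qed.

Lemma quadE M x y : (x^T *m M *m y) 0 0 = bil M x y.
Proof. by rewrite -mulmxA dotE. Qed.

Lemma bilDr M x y z : bil M x (y + z) = bil M x y + bil M x z.
Proof. by rewrite /bil mulmxDr dotDr. Qed.

Lemma bilZr M a x y : bil M x (a *: y) = a * bil M x y.
Proof. by rewrite /bil -scalemxAr dotZr. Qed.

Lemma bilDl M x y z : bil M (x + y) z = bil M x z + bil M y z.
Proof. by rewrite /bil dotDl. Qed.

Lemma bilZl M a x y : bil M (a *: x) y = a * bil M x y.
Proof. by rewrite /bil dotZl. Qed.

Lemma bilNl M x y : bil M (- x) y = - bil M x y.
Proof. by rewrite /bil dotNl. Qed.

Lemma bilNr M x y : bil M x (- y) = - bil M x y.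
Proof. by rewrite /bil mulmxN dotNr. Qed.

Lemma bilE M x y : bil M x y = \sum_i \sum_j x i 0 * M i j * y j 0.
Proof.
apply: eq_bigr => i _; rewrite mxE mulr_sumr.
by apply: eq_bigr => j _; rewrite mulrA.
Qed.

Lemma bilC M x y : symmetric_mx M -> bil M x y = bil M y x.
Proof.
move=> sM; rewrite !bilE exchange_big; apply: eq_bigr => i _.
by apply: eq_bigr => j _; rewrite -{1}sM mxE mulrC mulrA mulrAC -mulrA mulrCA mulrA.
Qed.

Lemma sym_entry M i j : symmetric_mx M -> M i j = M j i.
Proof. by move=> sM; rewrite -{1}sM mxE. Qed.

Lemma psd_bil M : pos_semidef M -> forall x, 0 <= bil M x x.
Proof. by move=> pM x; rewrite -quadE. Qed.

Lemma psd_ker M x : symmetric_mx M -> pos_semidef M -> bil M x x = 0 ->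
  M *m x = 0.
Proof.
move=> sM pM xx0; apply/colP => i; rewrite [RHS]mxE.
set e : 'cV[R]_n := delta_mx i 0.
have -> : (M *m x) i 0 = bil M e x by rewrite /bil dotC dot_delta.
set a := bil M e x; set b := bil M e e.
apply/eqP/negPn/negP => a0.
(* On the line [e + c x] the form is affine in [c], equal to [b + 2 c a]; this [c] gives it the
   value -1, against semidefiniteness. *)
have := psd_bil pM (e + (- (b + 1) / (2 * a)) *: x).
rewrite !bilDl !bilDr !bilZl !bilZr xx0 (bilC x e sM) -/a -/b !mulr0 addr0.
have -> : b + - (b + 1) / (2 * a) * a + - (b + 1) / (2 * a) * a = -1 by field.
by rewrite lerNr oppr0 ler10.
Qed.

Lemma psd_diag M i : pos_semidef M -> 0 <= M i i.
Proof.
move=> /psd_bil/(_ (delta_mx i 0)); rewrite /bil dotC dot_delta.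
by rewrite -colE mxE.
Qed.

Lemma psd_diag0 M i j : symmetric_mx M -> pos_semidef M -> M i i = 0 ->
  M i j = 0.
Proof.
move=> sM pM Mii.
have /(psd_ker sM pM) : bil M (delta_mx i 0) (delta_mx i 0) = 0.
  by rewrite /bil dotC dot_delta -colE mxE.
by rewrite -colE => /matrixP/(_ j 0); rewrite !mxE (sym_entry _ _ sM).
Qed.

Lemma dot_supp A x y : supported A x -> dot x y = \sum_(i in A) x i 0 * y i 0.
Proof.
move=> sx; rewrite /dot [RHS]big_mkcond; apply: eq_bigr => i _.
by case: ifPn => // /sx ->; rewrite mul0r.
Qed.

(** For a symmetric positive semidefinite [M] this is nonsingularity of [M_AA] ([pd_unit],
    [unit_pd]). Vectors padded with zeros avoid a change of index type, and restriction to a subset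
    of [A] becomes immediate. *)
Definition pd_on M A : Prop :=
  forall x, supported A x -> bil M x x = 0 -> x = 0.

Lemma pd_onS M (A B : {set 'I_n}) : A \subset B -> pd_on M B -> pd_on M A.
Proof.
move=> AB pB x sx; apply: pB => i iB; apply: sx.
by apply: contra iB; apply: (subsetP AB).
Qed.

Lemma selE A x k : (sel R A *m x) k 0 = x (enum_val k) 0.
Proof. by rewrite /sel mul_rowsub_mx mul1mx mxE. Qed.

Lemma selT_notin A (w : 'cV[R]_#|A|) i : i \notin A -> ((sel R A)^T *m w) i 0 = 0.
Proof.
move=> iA; rewrite mxE big1 // => k _; rewrite !mxE.
case: eqP => [ik|_]; last by rewrite mul0r.
by rewrite -ik enum_valP in iA.
Qed.

Lemma selT_in A (w : 'cV[R]_#|A|) k : ((sel R A)^T *m w) (enum_val k) 0 = w k 0.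
Proof.
rewrite mxE (bigD1 k) //= !mxE eqxx mul1r big1 ?addr0 // => l lk.
by rewrite !mxE (inj_eq enum_val_inj) (negbTE lk) mul0r.
Qed.

Lemma selT_supp A (w : 'cV[R]_#|A|) : supported A ((sel R A)^T *m w).
Proof. by move=> i; apply: selT_notin. Qed.

Lemma selK A (w : 'cV[R]_#|A|) : sel R A *m ((sel R A)^T *m w) = w.
Proof. by apply/colP => k; rewrite selE selT_in. Qed.

Lemma enum_val_ex A i : i \in A -> exists k : 'I_#|A|, i = enum_val k.
Proof. by move=> iA; exists (enum_rank_in iA i); rewrite enum_rankK_in. Qed.

Lemma selTK A x : supported A x -> (sel R A)^T *m (sel R A *m x) = x.
Proof.
move=> sx; apply/colP => i; case: (boolP (i \in A)) => iA.
  by have [k ->] := enum_val_ex iA; rewrite selT_in selE.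
by rewrite selT_notin ?sx.
Qed.

Lemma submx_onE M A : submx_on M A A = sel R A *m M *m (sel R A)^T.
Proof.
rewrite /submx_on /sel mul_rowsub_mx mul1mx; apply/matrixP => k l.
rewrite !mxE (bigD1 (enum_val l)) //= !mxE eqxx mulr1 big1 ?addr0 // => j jl.
by rewrite !mxE eq_sym (negbTE jl) mulr0.
Qed.

Lemma submx_on_mul M A x : supported A x ->
  submx_on M A A *m (sel R A *m x) = sel R A *m (M *m x).
Proof. by move=> sx; rewrite submx_onE -!mulmxA selTK. Qed.

Lemma supp_eq0 A x : supported A x -> sel R A *m x = 0 -> x = 0.
Proof. by move=> /selTK {2}<- ->; rewrite mulmx0. Qed.

(** A kernel vector of [M_AA], padded with zeros, makes [M x] vanish on [A], where [x] lives, so its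
    form is 0. *)
Lemma pd_unit M A : pd_on M A -> submx_on M A A \in unitmx.
Proof.
move=> pA; rewrite -unitmx_tr -row_free_unit -kermx_eq0.
apply/eqP/row_matrixP => k; rewrite row0.
set v := row k _; have Av : v *m (submx_on M A A)^T = 0.
  by rewrite -row_mul mulmx_ker row0.
set x := (sel R A)^T *m v^T.
have sx : supported A x by apply: selT_supp.
have : sel R A *m (M *m x) = 0.
  rewrite -submx_on_mul // selK.
  by rewrite -[submx_on _ _ _]trmxK -trmx_mul Av trmx0.
move=> MxA; have /(pA x sx) x0 : bil M x x = 0.
  rewrite /bil (dot_supp _ sx) big1 // => i iA.
  have [l ->] := enum_val_ex iA; have := congr1 (fun w : 'cV_ _ => w l 0) MxA.
  by rewrite selE [in RHS]mxE => ->; rewrite mulr0.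
have /(congr1 trmx) : v^T = 0 by rewrite -(selK v^T) -/x x0 mulmx0.
by rewrite trmxK trmx0.
Qed.

Lemma unit_pd M A : symmetric_mx M -> pos_semidef M ->
  submx_on M A A \in unitmx -> pd_on M A.
Proof.
move=> sM pM uA x sx /(psd_ker sM pM) Mx; apply: (supp_eq0 sx).
by rewrite -[LHS](mulKmx uA) submx_on_mul // Mx !mulmx0.
Qed.

(** The explicit inverse is handled through uniqueness: any padded solution of the system may be
    substituted for it. *)
Lemma principal_pivotE M A (r z : 'cV[R]_n) i : submx_on M A A \in unitmx ->
  supported A z -> (forall j, j \in A -> (M *m z) j 0 = r j 0) ->
  principal_pivot M A r i 0 = if i \in A then z i 0 else (r - M *m z) i 0.
Proof.
move=> uA sz Mz; rewrite /principal_pivot mxE.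
suff -> : (sel R A)^T *m (invmx (submx_on M A A) *m (sel R A *m r)) = z by [].
have -> : sel R A *m r = submx_on M A A *m (sel R A *m z).
  rewrite submx_on_mul //; apply/colP => k.
  by rewrite !selE Mz ?enum_valP.
by rewrite mulKmx // selTK.
Qed.

Lemma solution_ex M A (r : 'cV[R]_n) : submx_on M A A \in unitmx ->
  exists2 z, supported A z
    & (forall j, j \in A -> (M *m z) j 0 = r j 0) /\
      z = (sel R A)^T *m (invmx (submx_on M A A) *m (sel R A *m r)).
Proof.
move=> uA; exists ((sel R A)^T *m (invmx (submx_on M A A) *m (sel R A *m r))).
  exact: selT_supp.
split=> // j jA; have [k ->] := enum_val_ex jA.
by rewrite -!selE mulmxA mulmxA -submx_onE mulKVmx.
Qed.

(** The formula also covers a zero pivot: both sides are then [M a b], since the inverse of 0 is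
    0. *)
Lemma schur1E M i a b : schur M [set i] a b = M a b - M a i * M i b / M i i.
Proof.
(* The cardinality of a singleton is 1 only propositionally, so the 1 by 1 inverse is computed for a
   variable dimension together with an equality. *)
have invE m (e : m = 1%N) (S : 'M[R]_m) k l : invmx S k l = (S k l)^-1.
  rewrite e in S k l *; rewrite [S]mx11_scalar invmx_scalar !mxE !ord1 /=.
  by rewrite !mulr1n.
rewrite /schur mxE [X in _ + X]mxE; congr (_ - _).
have ev (k : 'I_#|[set i]|) : enum_val k = i by have /set1P := enum_valP k.
have c1 := cards1 i.
rewrite mxE (bigD1 i) //= [X in _ + X]big1 => [|j ji]; last first.
  suff -> : (M *m ((sel R [set i])^T *m invmx (submx_on M [set i] [set i])
       *m sel R [set i])) a j = 0 by rewrite mul0r.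
  rewrite mxE big1 // => l _; rewrite [X in _ * X]mxE big1 ?mulr0 // => k _.
  by rewrite [X in _ * X]mxE ev [X in _ * X]mxE eq_sym (negbTE ji) mulr0.
rewrite addr0 mulrAC; congr (_ * _).
rewrite mxE (bigD1 i) //= big1 ?addr0 => [|j ji]; last first.
  rewrite [X in _ * X]mxE big1 ?mulr0 // => k _.
  rewrite [X in X * _]mxE big1 ?mul0r // => l _.
  by rewrite !mxE ev (negbTE (_ : i != j)) ?mul0r // eq_sym.
congr (_ * _).
have k0 : 'I_#|[set i]| by rewrite c1; exact: ord0.
have U (k : 'I_#|[set i]|) : k = k0 by apply: enum_val_inj; rewrite !ev.
rewrite mxE (bigD1 k0) //= big1 ?addr0 => [|k]; last by rewrite (U k) eqxx.
rewrite [X in X * _]mxE (bigD1 k0) //= big1 ?addr0 => [|k]; last by rewrite (U k) eqxx.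
by rewrite invE // !mxE ev eqxx mul1r mulr1.
Qed.

Lemma schur_sym M i : symmetric_mx M -> symmetric_mx (schur M [set i]).
Proof.
move=> sM; apply/matrixP => a b; rewrite mxE !schur1E.
by rewrite (sym_entry b a sM) (sym_entry b i sM) (sym_entry i a sM) (mulrC (M i b)).
Qed.

Lemma schur_mul M i x :
  schur M [set i] *m x = M *m x - ((M *m x) i 0 / M i i) *: col i M.
Proof.
apply/colP => a; rewrite !mxE -[in RHS]mulrA [in RHS]mulr_suml -sumrB.
apply: eq_bigr => b _; rewrite schur1E; ring.
Qed.

Lemma schur_bil M i x : symmetric_mx M ->
  bil (schur M [set i]) x x = bil M x x - ((M *m x) i 0) ^+ 2 / M i i.
Proof.
move=> sM; rewrite /bil schur_mul dotBr dotZr; congr (_ - _).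
have -> : dot x (col i M) = (M *m x) i 0.
  by rewrite mxE; apply: eq_bigr => j _; rewrite mxE mulrC sym_entry.
by rewrite mulrAC expr2.
Qed.

(* Completing the square: the value of the Schur complement at x is that of M at
   the point of the line x + R e_i minimizing it. *)
Lemma schur_psd M i : symmetric_mx M -> pos_semidef M ->
  pos_semidef (schur M [set i]).
Proof.
move=> sM pM x; rewrite quadE schur_bil //.
have [Mii|Mii] := eqVneq (M i i) 0; first by rewrite Mii invr0 mulr0 subr0 psd_bil.
have := psd_bil pM (x + (- (M *m x) i 0 / M i i) *: delta_mx i 0).
rewrite bilDl !bilDr !bilZl !bilZr (bilC x (delta_mx i 0) sM) /bil.
rewrite !(dotC (delta_mx i 0)).
rewrite !dot_delta -colE [col _ _ _ _]mxE.
set s := (M *m x) i 0; set b := dot x _.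
suff -> : b + - s / M i i * s +
   (- s / M i i * s + - s / M i i * (- s / M i i * M i i)) = b - s ^+ 2 / M i i by [].
by field.
Qed.

End BilinearForms.

(** * Comparison matrices and the parametric vector *)

Section Signature.
Variables (R : realType) (n : nat).
Implicit Types (M : 'M[R]_n) (x y z d : 'cV[R]_n) (A V : {set 'I_n}).

Lemma colD x y i : (x + y) i 0 = x i 0 + y i 0.
Proof. by rewrite mxE. Qed.

Lemma colN x i : (- x) i 0 = - x i 0.
Proof. by rewrite mxE. Qed.

Lemma colB x y i : (x - y) i 0 = x i 0 - y i 0.
Proof. by rewrite colD colN. Qed.

Lemma colZ a x i : (a *: x) i 0 = a * x i 0.
Proof. by rewrite mxE. Qed.

(** The squares encode that [s] takes the values 1 and -1. Conjugation by [s] carries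
    semidefiniteness and definiteness over to the comparison matrix, in [cmp_psd] and [cmp_pd]. *)
Definition signed (s : 'I_n -> R) M : Prop :=
  (forall i, s i ^+ 2 = 1) /\ forall i j, i != j -> s i * s j * M i j <= 0.

Definition twist (s : 'I_n -> R) x : 'cV[R]_n := \col_i (s i * x i 0).

Lemma signed_cmp s M i j : signed s M -> cmp_mx M i j = s i * s j * M i j.
Proof.
move=> [s2 sM]; rewrite mxE; case: eqVneq => [->|ij].
  by rewrite -expr2 s2 mul1r.
have s1 k : `|s k| = 1.
    by apply/eqP; rewrite -sqrp_eq1 // -normrX s2 normr1.
  have /ler0_norm := sM _ _ ij.
  by rewrite !normrM !s1 !mul1r => ->; rewrite opprK.
Qed.

Definition absv x : 'cV[R]_n := \col_i `|x i 0|.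

Lemma mul_diagE M x i :
  (M *m x) i 0 = M i i * x i 0 + \sum_(j | j != i) M i j * x j 0.
Proof. by rewrite mxE (bigD1 i). Qed.

Lemma cmp_diagE M x i :
  (cmp_mx M *m x) i 0 = M i i * x i 0 - \sum_(j | j != i) `|M i j| * x j 0.
Proof.
rewrite mul_diagE mxE eqxx -sumrN; congr (_ + _); apply: eq_bigr => j ji.
by rewrite mxE eq_sym (negbTE ji) mulNr.
Qed.

Lemma cmp_abs_le M x i : 0 <= M i i -> (cmp_mx M *m absv x) i 0 <= `|(M *m x) i 0|.
Proof.
move=> Mii; rewrite cmp_diagE mul_diagE mxE.
have -> : M i i * `|x i 0| = `|M i i * x i 0| by rewrite normrM (ger0_norm Mii).
rewrite lerBlDr -{1}(addrK (\sum_(j | j != i) M i j * x j 0) (M i i * x i 0)).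
apply: (le_trans (ler_normB _ _)); rewrite lerD2l.
apply: (le_trans (ler_norm_sum _ _ _)).
by apply: ler_sum => j _; rewrite mxE normrM.
Qed.

Lemma cmp_bil s M x y : signed s M ->
  bil (cmp_mx M) x y = bil M (twist s x) (twist s y).
Proof.
move=> sM; rewrite !bilE; apply: eq_bigr => i _; apply: eq_bigr => j _.
by rewrite (signed_cmp _ _ sM) !mxE; ring.
Qed.

Lemma cmp_sym M : symmetric_mx M -> symmetric_mx (cmp_mx M).
Proof.
by move=> sM; apply/matrixP => i j; rewrite !mxE eq_sym (sym_entry i j sM); case: eqP => // ->.
Qed.

Lemma cmp_psd s M : signed s M -> pos_semidef M -> pos_semidef (cmp_mx M).
Proof. by move=> sM pM x; rewrite quadE (cmp_bil _ _ sM) psd_bil. Qed.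

Lemma twistK s M : signed s M -> involutive (twist s).
Proof. by move=> [s2 _] x; apply/colP => i; rewrite !mxE mulrA -expr2 s2 mul1r. Qed.

Lemma twist_supp s A x : supported A x -> supported A (twist s x).
Proof. by move=> sx i iA; rewrite mxE sx // mulr0. Qed.

Lemma cmp_pd s M A : signed s M -> pd_on M A -> pd_on (cmp_mx M) A.
Proof.
move=> sM pA x sx; rewrite (cmp_bil _ _ sM) => /(pA _ (twist_supp _ sx)) xx.
rewrite -(twistK sM x) xx; apply/colP => i.
by rewrite !mxE mulr0.
Qed.

Lemma schur_signed s M i : symmetric_mx M -> pos_semidef M -> signed s M ->
  signed s (schur M [set i]).
Proof.
move=> yM pM [s2 sM]; split=> // a b ab; rewrite schur1E mulrBr subr_le0.
have [ai|ai] := eqVneq a i.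
  rewrite -ai; have [->|Ma] := eqVneq (M a a) 0.
    by rewrite invr0 !mulr0 sM.
  by rewrite (mulrC (M a a)) mulfK.
have [bi|bi] := eqVneq b i.
  rewrite -bi; have [->|Mb] := eqVneq (M b b) 0.
    by rewrite invr0 !mulr0 sM.
  by rewrite mulfK.
apply: (le_trans (sM _ _ ab)).
(* Inserting [s i ^+ 2 = 1] writes the correction term as a product of two nonpositive signed
   entries over a nonnegative pivot. *)
have -> : s a * s b * (M a i * M i b / M i i) =
  (s a * s i * M a i) * (s i * s b * M i b) * (M i i)^-1.
  by rewrite -[LHS]mul1r -(s2 i); ring.
by rewrite mulr_ge0 ?invr_ge0 ?psd_diag // mulr_le0 // sM // eq_sym.
Qed.

(* With e = 2x + d, where x solves the complementary system, M-matrix theory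
   gives |e| <= d: the vector (|e| - d)^+ is supported on A and comparison of the
   two systems shows that its quadratic form for the comparison matrix is <= 0. *)
Lemma pivot_abs_le s M V A d x : symmetric_mx M -> pos_semidef M ->
  signed s M -> supported V d ->
  (forall i, i \in V -> 0 < d i 0) ->
  (forall i, i \in V -> 0 <= (cmp_mx M *m d) i 0) ->
  A \subset V -> pd_on M A -> supported A x ->
  (forall i, i \in A ->
     (M *m x) i 0 = - (2^-1 *: ((M + cmp_mx M) *m d)) i 0) ->
  forall i, `|(2 *: x + d) i 0| <= d i 0.
Proof.
move=> yM pM sM sd d0 r0 AV pA sx Mx.
set e := 2 *: x + d; pose f := absv e - d.
have dge i : 0 <= d i 0.
  by case: (boolP (i \in V)) => [/d0/ltW|/sd ->].
have sf i : i \notin A -> f i 0 = 0.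
  by move=> iA; rewrite !mxE sx // mulr0 add0r ger0_norm ?subrr.
have fA i : i \in A -> (cmp_mx M *m f) i 0 <= 0.
  move=> iA; have iV := subsetP AV _ iA.
  have Me : (M *m e) i 0 = - (cmp_mx M *m d) i 0.
    rewrite /e mulmxDr -scalemxAr colD colZ Mx // mulmxDl.
    by rewrite !(colZ, colD); field.
  rewrite /f mulmxBr colB subr_le0.
  apply: (le_trans (cmp_abs_le _ (psd_diag i pM))).
  by rewrite Me normrN ger0_norm // r0.
pose g : 'cV[R]_n := \col_i Num.max (f i 0) 0.
have sg : supported A g by move=> i iA; rewrite mxE sf // maxxx.
have g0 i : 0 <= g i 0 by rewrite mxE le_max lexx orbT.
have gf i : f i 0 <= g i 0 by rewrite [g _ _]mxE le_max lexx.
(* Replacing the second [g] by [f] can only increase the form: off the diagonal the entries are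
   nonpositive and [f <= g], on it [g_i (g_i - f_i) = 0]. On [A], which supports [g], the row values
   of [f] are nonpositive. *)
have gz : g = 0.
  apply: (cmp_pd sM pA sg); apply/le_anti/andP; split; last first.
    exact: psd_bil (cmp_psd sM pM) _.
  apply: (@le_trans _ _ (bil (cmp_mx M) g f)); last first.
    rewrite /bil (dot_supp _ sg) -oppr_ge0 -sumrN sumr_ge0 // => i iA.
    by rewrite oppr_ge0 mulr_ge0_le0 // fA.
  rewrite -subr_le0 -bilNr -bilDr bilE -oppr_ge0 -sumrN sumr_ge0 // => i _.
  rewrite -sumrN sumr_ge0 // => j _; rewrite oppr_ge0.
  have [<-|ij] := eqVneq i j.
    have -> : g i 0 * cmp_mx M i i * (g - f) i 0 = 0; last by [].
    rewrite colB [g i 0]mxE.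
    by case: leP => _; rewrite ?subrr ?mulr0 ?mul0r.
  rewrite [cmp_mx _ _ _]mxE (negbTE ij) mulrN mulNr oppr_le0 mulr_ge0 //.
    by rewrite mulr_ge0.
  by rewrite colB subr_ge0.
move=> i; have := gf i; rewrite gz !mxE; lra.
Qed.

(** Take [x = - z] in [pivot_abs_le], so that [e = d - 2 z]. On [A], [z = (d - e) / 2]. Off [A],
    [e_i = d_i] and [p - M z] is half of [M e + cmp_mx M d], where [|e| <= d] bounds [(M e)_i] below
    by [(cmp_mx M d)_i]. *)
Lemma param_pivot_ge0 s M V A d z :
  let p : 'cV[R]_n := 2^-1 *: ((M + cmp_mx M) *m d) in
  symmetric_mx M -> pos_semidef M -> signed s M -> supported V d ->
  (forall i, i \in V -> 0 < d i 0) ->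
  (forall i, i \in V -> 0 <= (cmp_mx M *m d) i 0) ->
  A \subset V -> pd_on M A -> supported A z ->
  (forall i, i \in A -> (M *m z) i 0 = p i 0) ->
  forall i, i \in V -> 0 <= if i \in A then z i 0 else (p - M *m z) i 0.
Proof.
move=> p yM pM sM sd d0 r0 AV pA sz Mz i iV.
have le_ed j : `|(2 *: - z + d) j 0| <= d j 0.
  apply: (pivot_abs_le yM pM sM sd d0 r0 AV pA) => [k kA|k kA].
    by rewrite mxE sz ?oppr0.
  by rewrite mulmxN mxE Mz.
case: ifPn => iA.
  by have := le_ed i; rewrite !mxE ler_norml => /andP[_]; lra.
set e := 2 *: - z + d in le_ed.
have -> : (p - M *m z) i 0 = 2^-1 * ((M *m e) i 0 + (cmp_mx M *m d) i 0).
  rewrite /e /p mulmxDr mulmxDl -scalemxAr mulmxN.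
  by rewrite !(colB, colZ, colD, colN); field.
rewrite mulr_ge0 ?invr_ge0 ?ler0n //.
have ei : e i 0 = d i 0 by rewrite !mxE sz // oppr0 mulr0 add0r.
rewrite mul_diagE ei.
suff : - (\sum_(j | j != i) `|M i j| * d j 0) <= \sum_(j | j != i) M i j * e j 0.
  by have := r0 i iV; rewrite cmp_diagE; lra.
rewrite -sumrN; apply: ler_sum => j _.
rewrite lerNl (le_trans (ler_norm _)) // normrN normrM.
by rewrite ler_wpM2l.
Qed.

Lemma param_vec_ge0 s M V d i :
  symmetric_mx M -> pos_semidef M -> signed s M -> supported V d ->
  (forall i, i \in V -> 0 < d i 0) ->
  (forall i, i \in V -> 0 <= (cmp_mx M *m d) i 0) -> i \in V ->
  0 <= (2^-1 *: ((M + cmp_mx M) *m d)) i 0.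
Proof.
move=> yM pM sM sd d0 r0 iV.
have := @param_pivot_ge0 s M V set0 d 0 yM pM sM sd d0 r0 (sub0set _).
rewrite mulmx0 subr0 => /(_ _ _ _ i iV); rewrite inE; apply.
- by move=> x sx _; apply/colP => j; rewrite sx ?inE // mxE.
- by move=> j _; rewrite mxE.
- by move=> j; rewrite inE.
Qed.

(** [p_i] exceeds [(cmp_mx M d)_i] by half the sum of the nonnegative terms [(M_ij + |M_ij|) d_j],
    so [p_i = 0] forces each of them to vanish. *)
Lemma param_vec_eq0 M V d i : supported V d ->
  (forall i, i \in V -> 0 < d i 0) ->
  (forall i, i \in V -> 0 <= (cmp_mx M *m d) i 0) -> i \in V ->
  (2^-1 *: ((M + cmp_mx M) *m d)) i 0 = 0 ->
  forall j, j \in V -> j != i -> M i j <= 0.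
Proof.
move=> sd d0 r0 iV; rewrite mulmxDl colZ colD => p0 j jV ji.
have dge k : 0 <= d k 0.
  by case: (boolP (k \in V)) => [/d0/ltW|/sd ->].
have t0 k : 0 <= (M i k + `|M i k|) * d k 0.
  by rewrite mulr_ge0 // -lerBlDl sub0r; have := ler_norm (- M i k); rewrite normrN.
have : \sum_(k | k != i) (M i k + `|M i k|) * d k 0 = 0.
  apply/le_anti; rewrite sumr_ge0 ?andbT => [|k _ //].
  have := r0 i iV; move: p0; rewrite cmp_diagE mul_diagE.
  under [X in _ -> _ -> X <= _]eq_bigr do rewrite mulrDl.
  rewrite big_split /=; lra.
move=> /eqP; rewrite psumr_eq0 => [|k _ //].
move=> /allP/(_ j); rewrite mem_index_enum ji mulf_eq0 (gt_eqF (d0 _ jV)) orbF.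
by move=> /(_ isT)/eqP; have := normr_ge0 (M i j); lra.
Qed.

(* A zero entering pivot makes k = e_i - z a kernel vector of M; then |k| is a
   kernel vector of the comparison matrix, hence orthogonal to its range, and
   this forces the i-th component of the parametric vector to vanish. *)
Lemma pivot_kernel0 s M V A d z (k : 'cV[R]_n) i :
  let p : 'cV[R]_n := 2^-1 *: ((M + cmp_mx M) *m d) in
  symmetric_mx M -> pos_semidef M -> signed s M ->
  (forall i, i \in V -> 0 <= (cmp_mx M *m d) i 0) ->
  A \subset V -> i \in V -> i \notin A ->
  (forall j, j \notin A -> k j 0 = (j == i)%:R) -> M *m k = 0 ->
  (forall i, i \in A -> (M *m z) i 0 = p i 0) ->
  (p - M *m z) i 0 = 0.
Proof.
move=> p yM pM sM r0 AV iV iA ki Mk Mz.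
have kV : supported V k.
  move=> j jV; rewrite ki; last by apply: contra jV; apply: (subsetP AV).
  by case: eqP jV => // ->; rewrite iV.
have -> : (p - M *m z) i 0 = dot k (p - M *m z).
  rewrite /dot (bigD1 i) //= ki // eqxx mul1r big1 ?addr0 // => j ji.
  have [jA|jA] := boolP (j \in A); last by rewrite ki // (negbTE ji) mul0r.
  by rewrite colB Mz // subrr mulr0.
have d00 x : dot x 0 = 0 by rewrite /dot big1 // => j _; rewrite mxE mulr0.
have -> : dot k (p - M *m z) = 2^-1 * dot k (cmp_mx M *m d).
  rewrite dotBr -/(bil M k z) (bilC _ _ yM) /bil Mk.
  rewrite /p dotZr mulmxDl dotDr -/(bil M k d) (bilC _ _ yM) /bil Mk.
  by rewrite !d00 add0r subr0.
(* Passing to absolute values and to the comparison matrix does not increase the form, so [absv k]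
   is isotropic for a semidefinite matrix. *)
have cMk : cmp_mx M *m absv k = 0.
  apply: (psd_ker (cmp_sym yM) (cmp_psd sM pM)); apply/le_anti/andP; split.
    have <- : bil M k k = 0 by rewrite /bil Mk d00.
    rewrite !bilE; apply: ler_sum => a _; apply: ler_sum => b _; rewrite !mxE.
    case: eqVneq => [<-|ab].
      rewrite -!mulrA !(mulrCA _ (M a a)) -normrM ger0_norm //.
      by rewrite -expr2 sqr_ge0.
    rewrite mulrN mulNr lerNl (le_trans (ler_norm _)) //.
    by rewrite normrN !normrM.
  exact: psd_bil (cmp_psd sM pM) _.
suff -> : dot k (cmp_mx M *m d) = 0 by rewrite mulr0.
apply/normr0_eq0/le_anti; rewrite normr_ge0 andbT.
have <- : dot (absv k) (cmp_mx M *m d) = 0.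
  by rewrite -/(bil _ _ _) (bilC _ _ (cmp_sym yM)) /bil cMk d00.
rewrite /dot; apply: (le_trans (ler_norm_sum _ _ _)); apply: ler_sum => j _.
rewrite normrM [absv _ _ _]mxE.
have [jV|jV] := boolP (j \in V); first by rewrite (ger0_norm (r0 _ jV)).
by rewrite kV // normr0 !mul0r.
Qed.

(** [k = e_i - z] is the point of [e_i + R^A] where the gradient of the form vanishes on [A], and
    the value of the form there is the Schur pivot. For a semidefinite matrix a zero pivot therefore
    puts [k] in the kernel. *)
Lemma schur_kernel M A i :
  submx_on M A A \in unitmx -> i \notin A ->
  exists2 k : 'cV[R]_n, forall j, j \notin A -> k j 0 = (j == i)%:R
    & (forall j, j \in A -> (M *m k) j 0 = 0) /\ bil M k k = schur M A i i.
Proof.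
move=> uA iA.
have [z sz [Mz ez]] := solution_ex (col i M) uA.
exists (delta_mx i 0 - z).
  by move=> j jA; rewrite !mxE eqxx andbT sz // subr0.
set k := _ - z.
have MkA j : j \in A -> (M *m k) j 0 = 0.
  by move=> jA; rewrite /k mulmxBr -colE colB Mz // subrr.
split=> //; have sE : schur M A i i = (M *m k) i 0.
  rewrite /k mulmxBr -colE ez /schur mxE colB [X in _ + X]mxE [X in _ = X - _]mxE; congr (_ - _).
  have -> : forall B : 'M[R]_n, B i i = (col i B) i 0 by move=> B; rewrite mxE.
  by rewrite colE -!mulmxA -!colE.
rewrite sE /bil /dot (bigD1 i) //= big1 ?addr0 => [|j ji].
  by rewrite /k colB sz // mxE !eqxx subr0 mul1r.
have [jA|jA] := boolP (j \in A).
  by rewrite MkA // mulr0.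
by rewrite /k colB sz // mxE (negbTE ji) subr0 mul0r.
Qed.
End Signature.

(** * Chains and reductions of the problem *)

Section Chains.
Variables (R : realType) (n : nat).
Implicit Types (M : 'M[R]_n) (V : {set 'I_n}) (i j k : 'I_n).

Definition consec V i j : bool :=
  [&& i \in V, j \in V, (i < j)%N & [forall k in V, ~~ (i < k < j)%N]].

Definition tri_on V M : Prop :=
  forall i j, i \in V -> j \in V -> (i < j)%N -> ~~ consec V i j -> M i j = 0.

(** Irreducibility and tridiagonality in one equivalence, relative to the order of [V] and not to
    the numbering, so that it can survive the removal of an index. The diagonal is unconstrained. *)
Definition chain_on V M : Prop :=
  forall i j, i \in V -> j \in V -> (i < j)%N -> (M i j != 0) = consec V i j.

Lemma chain_tri V M : chain_on V M -> tri_on V M.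
Proof. by move=> cM i j iV jV ij; rewrite -cM // negbK => /eqP. Qed.

Lemma consec_lt V i j : consec V i j -> (i < j)%N.
Proof. by case/and4P. Qed.

Lemma consec_gap V i j k : consec V i j -> k \in V -> (i < k < j)%N = false.
Proof. by case/and4P=> _ _ _ /forall_inP h kV; apply/negbTE/h. Qed.

Lemma consecP V i j : i \in V -> j \in V -> (i < j)%N ->
  (forall k, k \in V -> ~~ (i < k < j)%N) -> consec V i j.
Proof. by move=> iV jV ij h; apply/and4P; split=> //; apply/forall_inP. Qed.

Lemma consec_inj V i i' j : consec V i j -> consec V i' j -> i = i'.
Proof.
move=> c c'; have := consec_gap c; have := consec_gap c'.
case/and4P: c => iV _ ij _; case/and4P: c' => iV' _ ij' _ h h'.
by have := h i iV; have := h' i' iV'; move=> a b; apply: val_inj => /=; lia.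
Qed.

Lemma consec_inj_up V i j j' : consec V i j -> consec V i j' -> j = j'.
Proof.
move=> c c'; have := consec_gap c; have := consec_gap c'.
case/and4P: c => _ iV ij _; case/and4P: c' => _ iV' ij' _ h h'.
by have := h j iV; have := h' j' iV'; move=> a b; apply: val_inj => /=; lia.
Qed.

Lemma consec_up V i j : i \in V -> j \in V -> (i < j)%N ->
  exists2 k, consec V i k & (k <= j)%N.
Proof.
move=> iV jV ij; pose Q := [pred k : 'I_n | (k \in V) && (i < k)%N].
have Qj : Q j by rewrite /= jV.
case: (arg_minnP (@nat_of_ord n) Qj) => k /= /andP[kV ik] kmin.
exists k; last exact: kmin.
apply: consecP => // l lV; apply/negP => /andP[il lk].
by have := kmin l; rewrite lV il => /(_ isT); lia.
Qed.

Lemma consec_down V i j : i \in V -> j \in V -> (i < j)%N ->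
  exists2 k, consec V k j & (i <= k)%N.
Proof.
move=> iV jV ij; pose Q := [pred k : 'I_n | (k \in V) && (k < j)%N].
have Qi : Q i by rewrite /= iV.
case: (arg_maxnP (@nat_of_ord n) Qi) => k /= /andP[kV kj] kmax.
exists k; last exact: kmax.
apply: consecP => // l lV; apply/negP => /andP[il lk].
by have := kmax l; rewrite lV lk => /(_ isT); lia.
Qed.

Lemma chain_neighbor V M i j : symmetric_mx M -> chain_on V M ->
  i \in V -> j \in V -> j != i -> exists k, [/\ k \in V, k != i & M i k != 0].
Proof.
move=> sM cM iV jV ji; have [ij|ij|/val_inj] := ltngtP i j.
- have [k c _] := consec_up iV jV ij; exists k; move: (c) => /and4P[_ kV ik _].
  by split; rewrite ?cM //; apply: contraTneq ik => ->; rewrite ltnn.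
- have [k c _] := consec_down jV iV ij; exists k; move: (c) => /and4P[kV _ ik _].
  split; rewrite ?(sym_entry i k sM) ?cM //.
  by apply: contraTneq ik => ->; rewrite ltnn.
by move=> e; rewrite e eqxx in ji.
Qed.

Ltac slia := repeat match goal with
  | H : context [in_mem] |- _ => clear H
  | H : context [consec] |- _ => clear H
  | H : context [chain_on] |- _ => clear H
  | H : context [symmetric_mx] |- _ => clear H
  | H : context [@GRing.zero] |- _ => clear H
  end; lia.

(** The correction [M a i * M i b] is nonzero exactly when [a], [i], [b] are consecutive, and then
    [M a b = 0]. Hence nothing cancels, and the new link appears just where the removal of [i] makes
    [a] and [b] consecutive. *)
Lemma chain_schur V M i : symmetric_mx M -> chain_on V M -> i \in V ->
  M i i != 0 -> chain_on (V :\ i) (schur M [set i]).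
Proof.
move=> sM cM iV Mii a b; rewrite !in_setD1 => /andP[ai aV] /andP[bi bV] ab.
rewrite schur1E.
have ai' : (a : nat) != i by []. 
have bi' : (b : nat) != i by [].
have Mai : (M a i != 0) = if (a < i)%N then consec V a i else consec V i a.
  case: ltnP => h; first by rewrite cM.
  by rewrite (sym_entry a i sM) cM //; slia.
have Mib : (M i b != 0) = if (i < b)%N then consec V i b else consec V b i.
  case: ltnP => h; first by rewrite cM.
  by rewrite (sym_entry i b sM) cM //; slia.
have [cab|cab] := boolP (consec V a b).
  have g := consec_gap cab iV.
  suff z : M a i * M i b = 0.
    rewrite z mul0r subr0 cM // cab; apply/esym; apply: consecP => //.
    - by rewrite in_setD1 ai.
    - by rewrite in_setD1 bi.
    by move=> k /setD1P[_ kV]; rewrite (consec_gap cab kV).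
  apply/eqP; rewrite mulf_eq0; apply/orP.
  have [ia|ia] := ltnP i a.
    right; apply/negPn; rewrite Mib (ltn_trans ia ab).
    by apply/negP => /consec_gap/(_ aV); rewrite ia ab.
  left; apply/negPn; rewrite Mai (_ : (a < i)%N); last by slia.
  by apply/negP => /consec_gap/(_ bV); rewrite ab; slia.
have -> : M a b = 0 by apply/eqP/negPn; rewrite cM.
rewrite sub0r oppr_eq0 !mulf_eq0 invr_eq0 (negbTE Mii) orbF negb_or Mai Mib => {Mai Mib}.
apply/idP/idP.
  case: ltnP => ia; last first.
    move=> /andP[c1]; have ga := consec_gap c1 aV; have gb := consec_gap c1 bV.
    by case: ltnP => ib c2; [have := consec_gap c2 aV | have := consec_lt c2]; slia.
  case: ltnP => ib /andP[c1 c2]; last by have := consec_gap c1 bV; slia.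
  apply: consecP => //; rewrite ?in_setD1 ?ai ?bi // => k /setD1P[ki kV].
  have ki' : (k : nat) != i by [].
  by have := consec_gap c1 kV; have := consec_gap c2 kV; slia.
move=> cV'; have g k : k \in V -> k != i -> (a < k < b)%N = false.
  by move=> kV ki; apply: (consec_gap cV'); rewrite in_setD1 ki.
have /andP[ia ib] : (a < i < b)%N.
  apply/negPn/negP => h; move/negP: cab; apply; apply: consecP => // k kV.
  by have [->//|ki] := eqVneq k i; rewrite g.
rewrite ia ib; apply/andP; split; apply: consecP => // k kV; apply/negP => h.
  have ki : k != i by apply: contraTneq h => ->; rewrite ltnn andbF.
  by have := g k kV ki; slia.
have ki : k != i by apply: contraTneq h => ->; rewrite ltnn.
by have := g k kV ki; slia.
Qed.
End Chains.

(** * Optimality conditions and their transport through the two reductions *)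

Section Reductions.
Variables (R : realType) (n : nat).
Implicit Types (M : 'M[R]_n) (P : qp R n) (x y z q : 'cV[R]_n) (i j k : 'I_n).

Definition grad P y : 'cV[R]_n := lin P + mat P *m y.

(** The multipliers of the two bounds are left implicit, as the positive and negative parts of the
    gradient [g]. An infinite bound forces [0 <= g]. *)
Definition kkt1 (g x : R) (u : \bar R) : Prop :=
  [/\ 0 <= x, (x%:E <= u)%E, (0 < x -> g <= 0) & ((x%:E < u)%E -> 0 <= g)].

Definition kkt P y : Prop := supported (vars P) y /\
  forall i, i \in vars P -> kkt1 (grad P y i 0) (y i 0) (ub P i).

Record wfqp P : Prop := WfQP {
  wf_sym : symmetric_mx (mat P);
  wf_psd : pos_semidef (mat P);
  wf_sgn : exists s, signed s (mat P);
  wf_chain : chain_on (vars P) (mat P);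
  wf_ne : exists i, i \in vars P;
  wf_ub : forall i, (0 < ub P i)%E }.

Lemma objE M q x : obj M q x = dot q x + 2^-1 * bil M x x.
Proof. by rewrite /obj dotE quadE. Qed.

Lemma objD M q x y : symmetric_mx M ->
  obj M q (x + y) = obj M q x + dot (q + M *m x) y + 2^-1 * bil M y y.
Proof.
move=> sM; rewrite !objE dotDl !dotDr !bilDl !bilDr (bilC y x sM).
rewrite (_ : dot (M *m x) y = bil M x y); first by field.
by rewrite (bilC x y sM) /bil dotC.
Qed.

(** By convexity the difference of the objectives is at least the gradient paired with [y - x], and
    the conditions make each summand of this pairing nonnegative. *)
Lemma kkt_optimal M q (u : 'I_n -> \bar R) x :
  symmetric_mx M -> pos_semidef M ->
  (forall i, kkt1 ((q + M *m x) i 0) (x i 0) (u i)) ->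
  resolves M q u (Optimal x).
Proof.
move=> sM pM K; split=> [i|y fy]; first by case: (K i).
rewrite -[y](subrK x) addrC objD // -addrA lerDl addr_ge0 //; last first.
  by rewrite mulr_ge0 ?psd_bil // invr_ge0.
apply: sumr_ge0 => i _; rewrite colB.
have [x0 xu gx gu] := K i; have [y0 yu] := fy i.
set g := (q + _) i 0 in gx gu *.
have [g0|g0|->] := ltrgt0P g; last by rewrite mul0r.
  apply: mulr_ge0; first exact: ltW.
  rewrite subr_ge0; apply: le_trans y0.
  by rewrite leNgt; apply/negP => /gx; lra.
apply: mulr_le0; first exact: ltW.
rewrite subr_le0 -lee_fin (le_trans yu) //.
by rewrite leNgt; apply/negP => /gu; lra.
Qed.

(** A zero diagonal entry kills its row, which a chain with a second variable does not allow. *)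
Lemma wf_zero_block P i : wfqp P -> i \in vars P -> mat P i i = 0 ->
  zero_block P i.
Proof.
move=> wP iV Mii; split=> //.
apply/setP => j; rewrite in_set1; apply/idP/eqP => [jV|->//].
apply/eqP; have [//|ji] := eqVneq j i.
have [k [_ _]] := chain_neighbor (wf_sym wP) (wf_chain wP) iV jV ji.
by rewrite (psd_diag0 _ (wf_sym wP) (wf_psd wP) Mii) eqxx.
Qed.

Lemma wf_diag_gt0 P i : wfqp P -> (forall i, ~ zero_block P i) ->
  i \in vars P -> 0 < mat P i i.
Proof.
move=> wP nz iV; rewrite lt_def psd_diag ?andbT; last exact: wf_psd.
by apply/negP => /eqP Mii; apply: (nz i); apply: wf_zero_block.
Qed.

Lemma recover_eliminatedE P i y : supported (vars P :\ i) y ->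
  recover_eliminated P i y =
  y + (- (lin P i 0 + (mat P *m y) i 0) / mat P i i) *: delta_mx i 0.
Proof.
move=> sy; apply/colP => j; rewrite colD colZ !mxE eqxx andbT.
case: eqVneq => [->|ji]; last by rewrite mulr0 addr0.
rewrite sy ?in_setD1 ?eqxx // add0r mulr1 mulNr mulNr mulrC; congr (- (_ * _)).
congr (_ + _); rewrite [LHS]big_mkcond; apply: eq_bigr => k _.
case: andP => // h; rewrite sy ?mulr0 // in_setD1.
by apply/negP => /andP[a b]; apply: h.
Qed.

(** The eliminated variable is the partial minimizer: its gradient component vanishes, and the
    substitution turns the other components into those of the reduced problem. *)
Lemma eliminate_grad P i y : supported (vars P :\ i) y -> 0 < mat P i i ->
  symmetric_mx (mat P) ->
  forall j, grad P (recover_eliminated P i y) j 0 =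
    if j == i then 0 else grad (eliminate P i) y j 0.
Proof.
move=> sy mii sM j; rewrite recover_eliminatedE // /grad mulmxDr -scalemxAr.
rewrite -colE !colD colZ ![col _ _ _ _]mxE /= schur_mul colB colZ ![col _ _ _ _]mxE.
rewrite [(\col_ _ _) _ _]mxE; have m0 := lt0r_neq0 mii.
by case: eqVneq => [->|ji]; field.
Qed.

(** This makes it harmless to drop the bound [0 <= x_i]: at [x_i = 0] the gradient is [q_i] plus
    nonpositive terms, hence negative, and the partial minimizer lies to the right. *)
Lemma recover_eliminated_pos P i y : supported (vars P :\ i) y ->
  0 < mat P i i -> lin P i 0 < 0 ->
  (forall j, j \in vars P -> j != i -> mat P i j <= 0) ->
  (forall j, j \in vars P :\ i -> 0 <= y j 0) ->
  0 < recover_eliminated P i y i 0.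
Proof.
move=> sy mii li mij y0; rewrite recover_eliminatedE // colD colZ [delta_mx _ _ _ _]mxE !eqxx.
rewrite sy ?in_setD1 ?eqxx // add0r mulr1 divr_gt0 // oppr_gt0.
suff : (mat P *m y) i 0 <= 0 by lra.
rewrite mxE -oppr_ge0 -sumrN sumr_ge0 // => j _; rewrite oppr_ge0.
have [jV|jV] := boolP (j \in vars P :\ i); last by rewrite sy // mulr0.
by move: (jV) => /setD1P[ji jV']; rewrite mulr_le0_ge0 ?mij ?y0.
Qed.

Lemma recover_eliminated_ne P i j y : j != i ->
  recover_eliminated P i y j 0 = y j 0.
Proof. by move=> ji; rewrite mxE (negbTE ji). Qed.

Lemma recover_eliminated_supp P i y : i \in vars P ->
  supported (vars P :\ i) y -> supported (vars P) (recover_eliminated P i y).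
Proof.
move=> iV sy j jV; rewrite recover_eliminated_ne; last by apply: contraNneq jV => ->.
by apply: sy; rewrite in_setD1 (negbTE jV) andbF.
Qed.

Lemma kkt_eliminate P i y : symmetric_mx (mat P) ->
  i \in vars P -> 0 < mat P i i -> lin P i 0 < 0 -> ub P i = +oo%E ->
  (forall j, j \in vars P -> j != i -> mat P i j <= 0) ->
  kkt (eliminate P i) y -> kkt P (recover_eliminated P i y).
Proof.
move=> sM iV mii li ui mij [/= sy Ky]; split=> [|j jV].
  exact: recover_eliminated_supp.
rewrite eliminate_grad //; case: eqVneq => [->|ji].
  split; rewrite ?ui ?leey //; apply/ltW/recover_eliminated_pos => // k kV.
  by case: (Ky k kV).
by rewrite recover_eliminated_ne //; apply: Ky; rewrite in_setD1 ji.
Qed.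

(** The constant is the minimum of [q_i t + m_ii t^2 / 2] over [t]. It serves the transport of
    unboundedness, where objectives are compared. *)
Lemma obj_eliminate P i y : symmetric_mx (mat P) -> 0 < mat P i i ->
  supported (vars P :\ i) y ->
  obj (mat P) (lin P) (recover_eliminated P i y) =
  obj (mat (eliminate P i)) (lin (eliminate P i)) y
    - (lin P i 0) ^+ 2 / (2 * mat P i i).
Proof.
move=> sM mii sy; rewrite recover_eliminatedE // objD // !objE /=.
rewrite schur_bil // dotZr dot_delta bilZl bilZr /bil [dot (delta_mx _ _) _]dotC.
rewrite dot_delta -colE [col _ _ _ _]mxE colD.
have -> : \col_j (lin P j 0 - mat P j i / mat P i i * lin P i 0) =
   lin P - (lin P i 0 / mat P i i) *: col i (mat P).
  by apply/colP => j; rewrite !mxE; ring.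
rewrite dotBl dotZl.
have -> : dot (col i (mat P)) y = (mat P *m y) i 0.
  by rewrite mxE; apply: eq_bigr => j _; rewrite mxE sym_entry.
have m0 := lt0r_neq0 mii; field; exact: m0.
Qed.

Lemma wf_eliminate P i : wfqp P -> (forall i, ~ zero_block P i) ->
  i \in vars P -> (exists2 j, j \in vars P & j != i) -> wfqp (eliminate P i).
Proof.
move=> wP nz iV [j jV ji]; have [sM pM [s gM] cM _ uP] := wP; split=> //=.
- exact: schur_sym.
- exact: schur_psd.
- by exists s; apply: schur_signed.
- by apply: chain_schur => //; apply/lt0r_neq0/wf_diag_gt0.
by exists j; rewrite in_setD1 ji.
Qed.

Definition flip i x : 'cV[R]_n := \col_j if j == i then - x j 0 else x j 0.

Lemma recover_reflectedE i (v : R) z :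
  recover_reflected i v z = flip i z + v *: delta_mx i 0.
Proof.
apply/colP => j; rewrite colD colZ !mxE eqxx andbT.
by case: eqP => _; rewrite ?mulr1 ?mulr0 ?addr0 // addrC.
Qed.

Lemma reflect_mul P i (v : R) z j :
  (mat (reflect_var P i v) *m z) j 0 = flip i (mat P *m flip i z) j 0.
Proof.
rewrite [RHS]mxE -(fun_if (fun t => t)).
transitivity (\sum_k (if j == i then -1 else 1) * (mat P j k * flip i z k 0)).
  rewrite mxE; apply: eq_bigr => k _; rewrite !mxE.
  by case: (j == i); case: (k == i) => /=; ring.
by rewrite -mulr_sumr mxE; case: eqP => _; rewrite ?mulN1r ?mul1r.
Qed.

Lemma reflect_grad P i (v : R) z j :
  grad (reflect_var P i v) z j 0 =
  flip i (grad P (recover_reflected i v z)) j 0.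
Proof.
rewrite colD reflect_mul recover_reflectedE [RHS]mxE /grad mulmxDr -scalemxAr.
rewrite -colE !colD colZ [col _ _ _ _]mxE [(lin _) j 0]mxE [flip _ _ _ _]mxE.
by case: eqVneq => [->|ji]; ring.
Qed.

(** The bound dropped from [z_i] is [0 <= x_i]. If [z_i = 0] then [x_i] is the positive upper bound;
    otherwise the gradient vanishes and [m_ii x_i] is [- q_i] minus nonpositive terms, hence
    positive. *)
Lemma kkt_reflect P i (v : R) z : wfqp P ->
  i \in vars P -> 0 < mat P i i -> lin P i 0 < 0 -> ub P i = v%:E ->
  (forall j, j \in vars P -> j != i -> mat P i j <= 0) ->
  kkt (reflect_var P i v) z -> kkt P (recover_reflected i v z).
Proof.
move=> wP iV mii li ui mij [/= sz Kz].
set x := recover_reflected i v z.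
have xi : x i 0 = v - z i 0 by rewrite mxE eqxx.
have xj j : j != i -> x j 0 = z j 0 by move=> ji; rewrite mxE (negbTE ji).
have v0 : 0 < v by have := wf_ub wP i; rewrite ui lte_fin.
split=> [j jV|j jV].
  by rewrite xj ?sz //; apply: contraNneq jV => ->.
have := Kz j jV; rewrite reflect_grad -/x [flip _ _ _ _]mxE.
case: eqVneq => [->|ji] /=; last by rewrite xj.
set g := grad P x i 0; rewrite ?eqxx ui => -[z0 _ zg /(_ (ltey _)) g0].
have gle : g <= 0 by lra.
have x0 : 0 < x i 0.
  have [zi|zi] := eqVneq (z i 0) 0; first by rewrite xi zi subr0.
  have g00 : g = 0 by have := zg _; rewrite lt_def zi z0 => /(_ isT); lra.
  suff : 0 < mat P i i * x i 0 by rewrite pmulr_rgt0.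
  have : \sum_(k | k != i) mat P i k * x k 0 <= 0.
    rewrite -oppr_ge0 -sumrN sumr_ge0 // => k ki; rewrite oppr_ge0 xj //.
    have [kV|kV] := boolP (k \in vars P); last by rewrite sz // mulr0.
    by rewrite mulr_le0_ge0 ?mij //; case: (Kz k kV).
  by move: g00; rewrite /g colD mul_diagE; lra.
split; rewrite ?(ltW x0) // xi ?lee_fin ?lte_fin; first by lra.
by move=> h; rewrite -[X in _ <= X]opprK oppr_ge0 zg //; lra.
Qed.

(** Reflection is a congruence by one sign change, and the signature changes sign at the same
    index. *)
Lemma wf_reflect P i (v : R) : wfqp P -> wfqp (reflect_var P i v).
Proof.
move=> wP; have [sM pM [s gM] cM ne uP] := wP; split=> //=.
- apply/matrixP => a b; rewrite !mxE addbC (sym_entry b a sM).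
  by [].
- move=> x; rewrite quadE -/(mat (reflect_var P i v)).
  rewrite (_ : bil _ _ _ = bil (mat P) (flip i x) (flip i x)) ?psd_bil //.
  apply: eq_bigr => j _; rewrite (reflect_mul P i v) [flip i (mat _ *m _) _ _]mxE [flip i x j 0]mxE.
  by case: eqP => _; rewrite ?mulrN ?mulNr.
- exists (fun j => if j == i then - s j else s j); case: gM => s2 sg.
  split=> [a|a b ab]; first by case: eqP; rewrite ?sqrrN s2.
  have := sg a b ab; rewrite mxE.
  by case: eqP => _; case: eqP => _ /=; rewrite ?mulNr ?mulrN ?mulNr ?opprK.
- move=> a b aV bV ab; rewrite mxE -cM //.
  by case: ifP => // _; rewrite oppr_eq0.
by move=> j; case: eqP => // _; rewrite ltey.
Qed.
End Reductions.

(** * The parameter and the complementary solution *)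

Local Notation ratio0 := Defs.ratio0.

Section Pivots.
Variables (R : realType) (n : nat).
Implicit Types (M : 'M[R]_n) (P : qp R n) (x y z q p d : 'cV[R]_n).
Implicit Types (i j k : 'I_n) (A B C : {set 'I_n}).

Lemma bigmaxe_attained (Q : pred 'I_n) (F : 'I_n -> R) :
  (exists2 i, Q i & \big[maxe/-oo%E]_(i | Q i) (F i)%:E = (F i)%:E) \/
  \big[maxe/-oo%E]_(i | Q i) (F i)%:E = -oo%E.
Proof.
apply: (big_ind (fun r => (exists2 i, Q i & r = (F i)%:E) \/ r = -oo%E)).
- by right.
- move=> a b [[i Qi ->]|->] [[j Qj ->]|->].
  + by left; case: leP => _; [exists j|exists i].
  + by left; exists i => //; rewrite maxeNy.
  + by left; exists j => //; rewrite maxNye.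
  + by right; rewrite maxeNy.
by move=> i Qi; left; exists i.
Qed.

(** Bounds and attainment over the reals: the form in which a scan of the candidates produces
    [tau_new] and the descent argument uses it. By [tau_specP] these conditions determine [t]. *)
Definition tau_spec P p A B C (t : R) : Prop :=
  [/\ 0 <= t,
      forall i, cand0 P p A B i -> ratio0 P p A C i <= t,
      forall i, candu P p A i -> ratiou P p A C i <= t
    & [\/ t = 0, exists2 i, cand0 P p A B i & ratio0 P p A C i = t
        | exists2 i, candu P p A i & ratiou P p A C i = t]].

Lemma tau_new_ex P p A B C :
exists t, tau_spec P p A B C t /\ tau_new P p A B C = t%:E.
Proof.
have le0 i : cand0 P p A B i -> ((ratio0 P p A C i)%:E <= tau_new P p A B C)%E.
  by move=> ci; rewrite 2!le_max (le_bigmax_cond _ (fun i => (ratio0 P p A C i)%:E)).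
have leu i : candu P p A i -> ((ratiou P p A C i)%:E <= tau_new P p A B C)%E.
  by move=> ci; rewrite 2!le_max (le_bigmax_cond _ (fun i => (ratiou P p A C i)%:E)) ?orbT.
have ge0 : (0%:E <= tau_new P p A B C)%E by rewrite le_max lexx orbT.
suff [t' tE att] : exists2 t', tau_new P p A B C = t'%:E &
    [\/ t' = 0, exists2 i, cand0 P p A B i & ratio0 P p A C i = t'
      | exists2 i, candu P p A i & ratiou P p A C i = t'].
  exists t'; split=> //; rewrite tE in le0 leu ge0.
  by [].
rewrite /tau_new; case: leP => [_|]; first by exists 0; [|constructor 1].
have [[j cj rE]|rE] := bigmaxe_attained (candu P p A) (ratiou P p A C);
have [[i ci r0E]|r0E] := bigmaxe_attained (cand0 P p A B) (ratio0 P p A C);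
rewrite /rho0 /rhou rE r0E.
- move=> _; case: leP => _; first by exists (ratiou P p A C j) => //; constructor 3; exists j.
  by exists (ratio0 P p A C i) => //; constructor 2; exists i.
- by rewrite maxNye => _; exists (ratiou P p A C j) => //; constructor 3; exists j.
- by rewrite maxeNy => _; exists (ratio0 P p A C i) => //; constructor 2; exists i.
by rewrite maxeNy ltNge leNye.
Qed.

Lemma tau_specP P p A B C t : tau_spec P p A B C t <-> tau_new P p A B C = t%:E.
Proof.
have [t' [st' t'E]] := tau_new_ex P p A B C; split=> [st|]; last by rewrite t'E => -[<-].
rewrite t'E; congr _%:E; apply/le_anti.
have half a b : tau_spec P p A B C a -> tau_spec P p A B C b -> a <= b.
  move=> [_ _ _ [->|[i ci <-]|[i ci <-]]] [b0 bc bu _] //; first exact: bc.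
  exact: bu.
by rewrite (half _ _ st st') half.
Qed.

(* The complementary solution for q + t p: on A the values are those of -x, off A
   those of the gradient at x. *)
Lemma pivot_unique P p A C x t : submx_on (mat P) A A \in unitmx ->
  [disjoint A & C] ->
  (forall i, i \notin A -> x i 0 = if i \in C then fine (ub P i) else 0) ->
  (forall i, i \in A -> (lin P + t *: p + mat P *m x) i 0 = 0) ->
  forall i, qbar P A C i 0 + t * pbar P p A i 0 =
    if i \in A then - x i 0 else (lin P + t *: p + mat P *m x) i 0.
Proof.
move=> uA dAC xo xA i.
have [zq sq [Mq eq]] := solution_ex (lin P + mat P *m at_ub C (ub P)) uA.
have [zp sp [Mp ep]] := solution_ex p uA.
rewrite /qbar /pbar (principal_pivotE _ uA sq Mq) (principal_pivotE _ uA sp Mp).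
have : at_ub C (ub P) - x - (zq + t *: zp) = 0.
  apply: (supp_eq0 (A := A)).
    move=> j jA; rewrite !(colB, colD, colZ, colN) sq // sp // mulr0 addr0 subr0.
    by rewrite mxE xo // subrr.
  apply: (can_inj (mulKmx uA)); rewrite mulmx0 submx_on_mul; last first.
    move=> j jA; rewrite !(colB, colD, colZ, colN) sq // sp // mulr0 addr0 subr0.
    by rewrite mxE xo // subrr.
  apply/colP => k; rewrite selE [RHS]mxE.
  rewrite !mulmxBr mulmxDr -scalemxAr !(colB, colD, colZ, colN).
  have kA := enum_valP k; have := xA _ kA.
  by rewrite Mq // Mp // !(colB, colD, colZ, colN); lra.
move=> /colP e; case: ifPn => iA.
  have := e i; rewrite !(colB, colD, colZ, colN) !mxE.
  by rewrite (negbTE (_ : i \notin C)) ?(disjointFr dAC) //; lra.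
have xE : x = at_ub C (ub P) - (zq + t *: zp).
  by apply/colP => j; have := e j; rewrite !(colB, colD, colZ, colN) [RHS]mxE; lra.
rewrite [in RHS]xE mulmxBr mulmxDr -scalemxAr !(colB, colD, colZ, colN); ring.
Qed.

Definition pivot_point P p A C t : 'cV[R]_n :=
  \col_i if i \in A then - (qbar P A C i 0 + t * pbar P p A i 0)
         else if i \in C then fine (ub P i) else 0.

Lemma pivot_pointE P p A C t : submx_on (mat P) A A \in unitmx ->
  [disjoint A & C] ->
  forall i, (lin P + t *: p + mat P *m pivot_point P p A C t) i 0 =
    if i \in A then 0 else qbar P A C i 0 + t * pbar P p A i 0.
Proof.
move=> uA dAC.
have [z sz [Mz _]] := solution_ex (lin P + t *: p + mat P *m at_ub C (ub P)) uA.
have x'A i : i \in A -> (lin P + t *: p + mat P *m (at_ub C (ub P) - z)) i 0 = 0.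
  by move=> iA; rewrite mulmxBr !(colB, colD, colN) Mz // !(colB, colD, colN); lra.
have x'o i : i \notin A -> (at_ub C (ub P) - z) i 0 = if i \in C then fine (ub P i) else 0.
  by move=> iA; rewrite colB sz // subr0 mxE.
have U := pivot_unique uA dAC x'o x'A.
suff -> : pivot_point P p A C t = at_ub C (ub P) - z.
  by move=> i; rewrite U; case: ifP => iA; [apply: x'A | rewrite iA].
apply/colP => i; rewrite [LHS]mxE; case: ifP => iA; first by rewrite U iA opprK.
by rewrite x'o ?iA.
Qed.

(** Optimality of [pivot_point] at the parameter [t], expressed by the computed vectors: on [A] the
    value lies within its bounds, on [B] and [C] the gradient has the sign required at the bound. *)
Definition pivot_ok P p A B C t : Prop :=
  [/\ forall i, i \in A -> 0 <= - (qbar P A C i 0 + t * pbar P p A i 0) /\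
        ((- (qbar P A C i 0 + t * pbar P p A i 0))%:E <= ub P i)%E,
      forall i, i \in B -> 0 <= qbar P A C i 0 + t * pbar P p A i 0
    & forall i, i \in C -> qbar P A C i 0 + t * pbar P p A i 0 <= 0].

(** With [pbar >= 0], lowering the parameter keeps the variables of [A] nonnegative and the
    gradients on [C] nonpositive. The other conditions, the upper bounds on [A] and the signs on
    [B], have the ratios as thresholds. *)
Lemma pivot_ok_tau P p A B C t t' :
  (forall i, i \in A :|: B :|: C -> 0 <= pbar P p A i 0) ->
  0 < t -> pivot_ok P p A B C t -> tau_spec P p A B C t' ->
  t' <= t /\ pivot_ok P p A B C t'.
Proof.
move=> p0 t0 [oA oB oC] [t'0 c0 cu att].
have pA i : i \in A -> 0 <= pbar P p A i 0.
  by move=> iA; apply: p0; rewrite !inE iA.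
have pB i : i \in B -> 0 <= pbar P p A i 0.
  by move=> iB; apply: p0; rewrite !inE iB orbT.
have pC i : i \in C -> 0 <= pbar P p A i 0.
  by move=> iC; apply: p0; rewrite !inE iC orbT.
have tt : t' <= t.
  case: att => [->|[i /andP[iB pi] <-]|[i /and3P[iA pi ui] <-]]; first exact: ltW.
    by rewrite /ratio0 ler_pdivrMr //; have := oB i iB; lra.
  rewrite /ratiou ler_pdivrMr //; have [_] := oA i iA.
  case: (ub P i) ui => [r| |] //= _; first by rewrite lee_fin; lra.
split=> //; split=> i iX.
- have [a1 a2] := oA i iX; have pi := pA i iX.
  have h : (t - t') * pbar P p A i 0 >= 0 by rewrite mulr_ge0 // subr_ge0.
  split; first by lra.
  case E : (ub P i) => [r| |]; last by move: a2; rewrite E.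
    rewrite lee_fin; have [pi0|pi0] := eqVneq (pbar P p A i 0) 0.
      by move: a2; rewrite E lee_fin pi0; lra.
    have ppos : 0 < pbar P p A i 0 by rewrite lt_def pi0.
    have := cu i; rewrite /candu iX ppos E ltey /ratiou E /= => /(_ isT).
    by rewrite ler_pdivrMr //; lra.
  by rewrite leey.
- have [pi0|pi0] := eqVneq (pbar P p A i 0) 0.
    by have := oB i iX; rewrite pi0; lra.
  have ppos : 0 < pbar P p A i 0 by rewrite lt_def pi0 pB.
  have := c0 i; rewrite /cand0 iX ppos /ratio0 => /(_ isT).
  by rewrite ler_pdivrMr //; lra.
have := oC i iX; have pi := pC i iX.
have h : (t - t') * pbar P p A i 0 >= 0 by rewrite mulr_ge0 // subr_ge0.
lra.
Qed.

(** An isotropic [x] is in the kernel of [M]. If [x_i] were nonzero, subtracting a multiple of [x]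
    from [k] would leave a vector supported on [A], where [M k] vanishes, and the Schur pivot would
    be 0. *)
Lemma pd_adjoin M A i : symmetric_mx M -> pos_semidef M -> pd_on M A ->
  i \notin A -> 0 < schur M A i i -> pd_on M (i |: A).
Proof.
move=> sM pM pA iA s0 x sx xx.
have Mx := psd_ker sM pM xx.
have uA := pd_unit pA.
have [k ko [MkA kk]] := schur_kernel uA iA.
have [x0|x0] := eqVneq (x i 0) 0.
  apply: pA => // j jA; have [->//|ji] := eqVneq j i.
  by apply: sx; rewrite !inE negb_or ji.
suff : schur M A i i = 0 by move=> s00; rewrite s00 ltxx in s0.
rewrite -kk; set w := k - (x i 0)^-1 *: x.
have ws : supported A w.
  move=> j jA; rewrite colB colZ ko //; have [->|ji] := eqVneq j i.
    by rewrite mulVf // subrr.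
  by rewrite (sx j) ?mulr0 ?subr0 // !inE negb_or ji.
have -> : bil M k k = bil M w k.
  rewrite /w bilDl bilNl bilZl (bilC x k sM) [bil M k x]/bil Mx.
  by rewrite /dot big1 ?mulr0 ?subr0 // => j _; rewrite mxE mulr0.
by rewrite /bil (dot_supp _ ws) big1 // => j jA; rewrite MkA // mulr0.
Qed.
End Pivots.

(** * Irreducible blocks and invariants of the PPPA *)

Section Blocks.
Variables (R : realType) (n : nat) (M : 'M[R]_n).
Hypotheses (tM : tridiagonal M) (sM : symmetric_mx M).
Implicit Types (i j k : 'I_n) (S T : {set 'I_n}).

Let e := (fun i j => M i j != 0) : rel 'I_n.

Lemma conn_sym : connect_sym e.
Proof. by apply: sym_connect_sym => i j; rewrite /e (sym_entry i j sM). Qed.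

Lemma blocksP S : reflect (exists i, S = [set j | connect e i j]) (S \in blocks M).
Proof.
apply: (iffP imsetP) => [[i _ ->]|[i ->]]; exists i => //.
  by apply/setP => j; rewrite !inE.
by apply/setP => j; rewrite !inE.
Qed.

Lemma block_disjoint S T i : S \in blocks M -> T \in blocks M ->
  i \in S -> i \in T -> S = T.
Proof.
move=> /blocksP[a ->] /blocksP[b ->]; rewrite !inE => ai bi.
apply/setP => j; rewrite !inE; apply: same_connect conn_sym _ _ _ j => //.
by apply: connect_trans ai _; rewrite conn_sym.
Qed.

Lemma block_cross S i j : S \in blocks M -> i \in S -> j \notin S -> M i j = 0.
Proof.
move=> /blocksP[a ->]; rewrite !inE => ai aj; apply/eqP/negPn/negP => Mij.
by move/negP: aj; apply; apply: connect_trans ai (connect1 _).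
Qed.

Lemma block_ne S : S \in blocks M -> exists i, i \in S.
Proof. by move=> /blocksP[a ->]; exists a; rewrite inE connect0. Qed.

Lemma block_cover i : exists2 S, S \in blocks M & i \in S.
Proof.
exists [set j | connect e i j]; last by rewrite inE connect0.
by apply/blocksP; exists i.
Qed.

(** In a tridiagonal matrix a vanishing entry at [(k, k + 1)] is a cut of the graph: no edge crosses
    it, so the side is constant on connected components. *)
Lemma conn_cut (k : nat) i j :
  (forall a b : 'I_n, a = k :> nat -> b = k.+1 :> nat -> M a b = 0) ->
  connect e i j -> (i <= k)%N = (j <= k)%N.
Proof.
move=> cut; apply: (@closed_connect _ e [pred a : 'I_n | (a <= k)%N]).
move=> a b; rewrite /e !inE => Mab.
have Mba : M b a != 0 by rewrite (sym_entry b a sM).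
have near (x y : 'I_n) : M x y != 0 -> (x <= k)%N -> (y <= k)%N.
  move=> Mxy xk; rewrite leqNgt; apply: contra Mxy => yk; apply/eqP.
  have [xy|xy] := ltnP x.+1 y; first by apply: tM; rewrite xy.
  by apply: cut; apply/eqP; rewrite eqn_leq; lia.
by apply/idP/idP; apply: near.
Qed.

Lemma block_chain S : S \in blocks M -> chain_on S M.
Proof.
move=> bS i j iS jS ij; apply/idP/idP => [Mij|c].
  apply: consecP => // k _.
  have : ~~ ((i.+1 < j) || (j.+1 < i))%N by apply: contra Mij => /tM ->.
  by clear -ij; lia.
have cij : connect e i j.
  move/blocksP: bS => [a aE]; move: iS jS; rewrite aE !inE => ai aj.
  by apply: connect_trans aj; rewrite conn_sym.
have [k ki] : exists k : 'I_n, k = i.+1 :> nat.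
  by exists (Ordinal (leq_ltn_trans ij (ltn_ord j))).
(* If this entry vanished, the cut at [i] would separate [i] from [j]. *)
have Mik : M i k != 0.
  apply/eqP => Mik; have := @conn_cut i i j _ cij; rewrite leqnn leqNgt ij.
  suff h : forall a b : 'I_n, a = i :> nat -> b = i.+1 :> nat -> M a b = 0 by move/(_ h).
  by move=> a b ai bi; rewrite (ord_inj ai) (_ : b = k) //; apply: ord_inj; rewrite bi ki.
have kS : k \in S by apply/negPn/negP => kS; rewrite (block_cross bS iS kS) eqxx in Mik.
suff -> : j = k by [].
apply: ord_inj; have := consec_gap c kS; rewrite ki; clear -ij.
by lia.
Qed.

(** A path has no cycle that could obstruct a choice of signs: the signature is the running product
    of the [t k], where [t k] is -1 if the entry at [(k, k + 1)] is positive and 1 otherwise. *)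
Lemma tridiagonal_signed : exists s, signed s M.
Proof.
pose t (k : nat) : R := if [exists a : 'I_n, [exists b : 'I_n,
   [&& a == k :> nat, b == k.+1 :> nat & 0 < M a b]]] then -1 else 1.
pose f (k : nat) : R := \prod_(j < k) t j.
have t2 (k : nat) : t k ^+ 2 = 1 by rewrite /t; case: ifP; rewrite ?sqrrN expr1n.
have f2 (k : nat) : f k ^+ 2 = 1.
  rewrite /f; elim: k => [|k IH]; first by rewrite big_ord0 expr1n.
  by rewrite big_ord_recr /= exprMn IH t2 mulr1.
have key (i j : 'I_n) : (i < j)%N -> f i * f j * M i j <= 0.
  move=> ij; have [ij1|ij1] := ltnP i.+1 j; first by rewrite tM ?ij1 // mulr0.
  have jE : j = i.+1 :> nat by apply/eqP; rewrite eqn_leq ij1.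
  rewrite jE /f big_ord_recr /= -/(f i) mulrA -expr2 f2 mul1r /t.
  case: existsP => [[a /existsP[b /and3P[/eqP ai /eqP bi Mab]]]|h].
    have -> : i = a by apply: ord_inj.
    have -> : j = b by apply: ord_inj; rewrite jE bi.
    by rewrite mulN1r oppr_le0 ltW.
  rewrite mul1r leNgt; apply/negP => Mij; apply: h; exists i.
  by apply/existsP; exists j; rewrite eqxx jE eqxx.
exists (fun i => f i); split=> // i j ij.
have [h|h|/ord_inj h] := ltngtP i j; first exact: key.
  by rewrite (sym_entry i j sM) (mulrC (f i)) key.
by rewrite h eqxx in ij.
Qed.

Lemma sum_blocks : (\sum_(S in blocks M) #|S|)%N = n.
Proof.
rewrite -(card_partition (D := setT)) ?cardsT ?card_ord //.
apply: equivalence_partitionP => a b c _ _ _; split=> [|ab]; first exact: connect0.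
by apply: same_connect conn_sym _ _ _ _.
Qed.

End Blocks.

(** * Invariants of the configurations *)

Section Invariant.
Variables (R : realType) (n : nat) (M : 'M[R]_n) (q : 'cV[R]_n).
Variable (u : 'I_n -> \bar R).
Hypotheses (tM : tridiagonal M) (sM : symmetric_mx M) (pM : pos_semidef M).
Hypothesis (u0 : forall i, (0 < u i)%E).
Implicit Types (P : qp R n) (i j k : 'I_n) (x y : 'cV[R]_n).
Implicit Types (todo : seq {set 'I_n}) (rec : 'cV[R]_n -> 'cV[R]_n).

Definition todo_ok todo : Prop := uniq todo /\ {subset todo <= blocks M}.

(** The gradient is that of the whole problem. Distinct blocks do not interact, so pasting the
    solution of one block leaves the conditions of the others intact. *)
Definition good todo x : Prop := feasible u x /\
  forall i, ~~ has (fun S : {set 'I_n} => i \in S) todo ->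
    kkt1 ((q + M *m x) i 0) (x i 0) (u i).

(* After a reflection some off-diagonal entry stays positive, which excludes a
   zero block; without reflection [rec] preserves feasibility and, up to a
   constant, the objective, so that unboundedness carries over. *)
Definition rec_ok todo P rec : Prop :=
  (forall y, kkt P y -> good todo (rec y)) /\
  ((exists i j, [/\ i \in vars P, j \in vars P, i != j & 0 < mat P i j]) \/
   exists c, forall y, supported (vars P) y -> feasible (ub P) y ->
     feasible u (rec y) /\ obj M q (rec y) = obj (mat P) (lin P) y + c).

Definition preparing_ok todo P rec : Prop :=
  [/\ todo_ok todo, wfqp P & rec_ok todo P rec].

(** Counting memberships states covering and disjointness in one equation, to be decided by
    cases. *)
Definition part3 (V A B C : {set 'I_n}) : Prop :=
  forall i, ((i \in A) + (i \in B) + (i \in C))%N = (i \in V).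

Definition pivoting_ok P p A B C : Prop :=
  [/\ part3 (vars P) A B C, forall i, i \in C -> (ub P i < +oo)%E,
      pd_on (mat P) A & exists2 t, 0 < t & pivot_ok P p A B C t].

Definition config_ok (c : config R n) : Prop :=
  match c with
  | Idle todo x => todo_ok todo /\ good todo x
  | Preparing todo P rec => preparing_ok todo P rec
  | Prepared todo P rec d p => preparing_ok todo P rec /\
      [/\ forall i, ~ zero_block P i, valid_d P d & p = param_vec P d]
  | Pivoting todo P rec p A B C => preparing_ok todo P rec /\
      (exists d, valid_d P d /\ p = param_vec P d) /\ pivoting_ok P p A B C
  | Answered a => resolves M q u a
  end.

Lemma valid_dP P d : valid_d P d ->
  [/\ supported (vars P) d, forall i, i \in vars P -> 0 < d i 0
    & forall i, i \in vars P -> 0 <= (cmp_mx (mat P) *m d) i 0].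
Proof. by case=> d0 r0 [[sd _ _]|[_ [sd _]]]. Qed.

Lemma valid_pbar P d (A : {set 'I_n}) i : wfqp P -> valid_d P d -> A \subset vars P ->
  pd_on (mat P) A -> i \in vars P -> 0 <= pbar P (param_vec P d) A i 0.
Proof.
move=> wP /valid_dP[sd d0 r0] AV pA iV; have [yP pP [s gP] _ _ _] := wP.
have uA := pd_unit pA.
have [z sz [Mz _]] := solution_ex (param_vec P d) uA.
rewrite /pbar (principal_pivotE _ uA sz Mz).
exact: (param_pivot_ge0 yP pP gP sd d0 r0 AV pA sz Mz).
Qed.

Lemma valid_schur P d (A : {set 'I_n}) i : wfqp P -> valid_d P d -> A \subset vars P ->
  pd_on (mat P) A -> i \in vars P -> i \notin A ->
  0 < pbar P (param_vec P d) A i 0 -> 0 < schur (mat P) A i i.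
Proof.
move=> wP /valid_dP[sd d0 r0] AV pA iV iA pi; have [yP pP [s gP] _ _ _] := wP.
have uA := pd_unit pA.
have [k ko [_ kk]] := schur_kernel uA iA.
rewrite lt_def -kk psd_bil // andbT; apply/eqP => /(psd_ker yP pP) Mk.
have [z sz [Mz _]] := solution_ex (param_vec P d) uA.
move: pi; rewrite /pbar (principal_pivotE _ uA sz Mz) (negbTE iA).
by rewrite (pivot_kernel0 yP pP gP r0 AV iV iA ko Mk Mz) ltxx.
Qed.

Lemma valid_p_ge0 P d i : wfqp P -> valid_d P d -> i \in vars P ->
  0 <= param_vec P d i 0.
Proof.
move=> wP /valid_dP[sd d0 r0]; have [yP pP [s gP] _ _ _] := wP.
exact: param_vec_ge0 yP pP gP sd d0 r0.
Qed.

Lemma valid_p_eq0 P d i : valid_d P d -> i \in vars P -> param_vec P d i 0 = 0 ->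
  forall j, j \in vars P -> j != i -> mat P i j <= 0.
Proof. by move=> /valid_dP[sd d0 r0]; apply: param_vec_eq0. Qed.

(** An isolated variable would have [p_i = m_ii d_i > 0]. The strictly negative link keeps the
    problem nonempty after an elimination and supplies the positive entry after a reflection. *)
Lemma valid_p_neighbor P d i : wfqp P -> (forall i, ~ zero_block P i) ->
  valid_d P d -> i \in vars P -> param_vec P d i 0 = 0 ->
  exists j, [/\ j \in vars P, j != i & mat P i j < 0].
Proof.
move=> wP nz vd iV p0; have mij := valid_p_eq0 vd iV p0.
have [sd d0 r0] := valid_dP vd.
have mii := wf_diag_gt0 wP nz iV.
have [j jV ji] : exists2 j, j \in vars P & j != i.
  case: (pickP [pred j | (j \in vars P) && (j != i)]) => [j /andP[jV ji]|no]; first by exists j.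
  have {}no j : j != i -> j \notin vars P.
    by move=> ji; apply/negP => jV; have := no j; rewrite /= jV ji.
  move: p0; rewrite /param_vec mulmxDl colZ colD cmp_diagE mul_diagE !big1.
  - by have := d0 i iV; have := mulr_gt0 mii (d0 i iV); lra.
  - by move=> j ji; rewrite sd ?mulr0 // no.
  by move=> j ji; rewrite sd ?mulr0 // no.
have [k [kV ki Mk]] := chain_neighbor (wf_sym wP) (wf_chain wP) iV jV ji.
by exists k; split=> //; rewrite lt_def eq_sym Mk mij.
Qed.

Lemma wf_block S : S \in blocks M -> wfqp (QP S M q u).
Proof.
move=> bS; split=> //=; first exact: tridiagonal_signed.
  exact: block_chain.
exact: block_ne bS.
Qed.

Lemma block_inv S todo x : todo_ok (S :: todo) -> good (S :: todo) x ->
  preparing_ok todo (QP S M q u) (paste S x).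
Proof.
move=> [/= /andP[ST ut] bl] [fx gx].
have bS : S \in blocks M by apply: bl; rewrite mem_head.
have okt : todo_ok todo by split=> // T Tt; apply: bl; rewrite in_cons Tt orbT.
split; [exact: okt|exact: wf_block|split].
  move=> y [/= sy Ky]; split=> [i|i it].
    rewrite mxE; case: ifP => iS; last exact: fx.
    by case: (Ky i iS).
  pose x' : 'cV[R]_n := \col_i if i \in S then 0 else x i 0.
  have pE : paste S x y = x' + y.
    apply/colP => j; rewrite colD !mxE; case: ifPn => jS; first by rewrite add0r.
    by rewrite sy ?addr0.
  (* Second decomposition, for the rows outside [S]: the change from [x] is supported on [S] and
     does not reach them. *)
  have pE' : paste S x y = x + (y - \col_i if i \in S then x i 0 else 0).
    apply/colP => j; rewrite !colD colN !mxE; case: ifPn => jS; first by ring.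
    by rewrite sy //; ring.
  have [iS|iS] := boolP (i \in S).
    have -> : paste S x y i 0 = y i 0 by rewrite mxE iS.
    have := Ky i iS; rewrite /grad /= pE mulmxDr !colD.
    suff -> : (M *m x') i 0 = 0 by rewrite add0r.
    rewrite mxE big1 // => j _; rewrite mxE; case: ifPn => jS; rewrite ?mulr0 //.
    by rewrite (block_cross bS iS jS) mul0r.
  have : ~~ has (fun T : {set 'I_n} => i \in T) (S :: todo) by rewrite /= negb_or iS.
  move=> /gx; rewrite [paste _ _ _ i 0]mxE (negbTE iS) pE' mulmxDr !colD.
  suff -> : (M *m (y - \col_i if i \in S then x i 0 else 0)) i 0 = 0 by rewrite addr0.
  rewrite mxE big1 // => j _; rewrite colB !mxE; case: ifPn => jS.
    by rewrite (sym_entry i j sM) (block_cross bS jS iS) mul0r.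
  by rewrite sy // subr0 mulr0.
right; pose x' : 'cV[R]_n := \col_i if i \in S then 0 else x i 0.
exists (obj M q x') => y sy fy.
have pE : paste S x y = x' + y.
  apply/colP => j; rewrite colD !mxE; case: ifPn => jS; first by rewrite add0r.
  by rewrite sy ?addr0.
split=> [i|]; first by rewrite mxE; case: ifP => iS; [exact: fy|exact: fx].
rewrite /= pE objD // objE [obj M q y]objE dotDl.
suff -> : dot (M *m x') y = 0 by ring.
rewrite dotC (dot_supp _ sy) big1 // => i iS.
rewrite mxE big1 ?mulr0 // => j _; rewrite mxE; case: ifPn => jS; rewrite ?mulr0 //.
by rewrite (block_cross bS iS jS) mul0r.
Qed.

Lemma kkt_optimal_good x : good [::] x -> resolves M q u (Optimal x).
Proof. by move=> [_ gx]; apply: kkt_optimal => // i; apply: gx. Qed.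

Lemma zero_block_kkt P i (y : R) : zero_block P i ->
  kkt1 (lin P i 0) y (ub P i) -> symmetric_mx (mat P) -> pos_semidef (mat P) ->
  kkt P (y *: delta_mx i 0).
Proof.
move=> [vP mii] K sP pP; split=> [j|j].
  by rewrite vP in_set1 => ji; rewrite colZ mxE (negbTE ji) mulr0.
rewrite vP => /set1P ->; rewrite /grad -scalemxAr -colE colD !colZ !mxE !eqxx.
by rewrite mii mulr0 addr0 mulr1.
Qed.

Lemma inspect_ray todo P rec i : preparing_ok todo P rec -> zero_block P i ->
  lin P i 0 < 0 -> ub P i = +oo%E -> resolves M q u (Unbounded R n).
Proof.
move=> [_ wP [_ [[a [b [aV bV ab _]]]|[c rc]]]] [vP mii] li ui.
  by move: aV bV ab; rewrite vP => /set1P -> /set1P ->; rewrite eqxx.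
(* On the ray the objective is [t q_i + c], and this [t] brings it to at most [b - 1]. *)
move=> b; pose t := Num.max 0 ((b - c - 1) / lin P i 0).
have t0 : 0 <= t by rewrite le_max lexx.
have sy : supported (vars P) (t *: delta_mx i 0).
  by move=> j; rewrite vP in_set1 => ji; rewrite colZ mxE (negbTE ji) mulr0.
have [|fr fE] := rc _ sy.
  move=> j; rewrite colZ mxE eqxx andbT; case: eqVneq => [->|ji].
    by rewrite mulr1 ui leey.
  by rewrite mulr0; split=> //; apply/ltW/(wf_ub wP).
exists (rec (t *: delta_mx i 0)) => //.
rewrite fE (_ : obj _ _ _ = t * lin P i 0).
  have : t * lin P i 0 <= b - c - 1.
    by rewrite -ler_ndivrMr // le_max lexx orbT.
  lra.
rewrite objE dotZr dot_delta bilZl bilZr /bil dotC dot_delta -colE mxE mii; ring.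
Qed.

Lemma eliminate_inv todo P rec d i : preparing_ok todo P rec ->
  (forall i, ~ zero_block P i) -> valid_d P d -> i \in vars P ->
  param_vec P d i 0 = 0 -> lin P i 0 < 0 -> ub P i = +oo%E ->
  preparing_ok todo (eliminate P i) (fun x => rec (recover_eliminated P i x)).
Proof.
move=> [okt wP [r1 r2]] nz vd iV p0 li ui.
have mij := valid_p_eq0 vd iV p0.
have mii := wf_diag_gt0 wP nz iV; have sP := wf_sym wP.
have [j [jV ji _]] := valid_p_neighbor wP nz vd iV p0.
split=> //; first by apply: wf_eliminate => //; exists j.
split=> [y Ky|]; first by apply: r1; apply: kkt_eliminate.
case: r2 => [[a [b [aV bV ab Mab]]]|[c rc]]; [left|right].
  have ai : a != i.
    apply/eqP => E; move: Mab ab; rewrite E => Mib ib.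
    by have := mij b bV; rewrite eq_sym ib => /(_ isT); lra.
  have bi : b != i.
    apply/eqP => E; move: Mab ab; rewrite E (sym_entry a i sP) => Mia ai'.
    by have := mij a aV ai'; lra.
  exists a, b; rewrite /= !in_setD1 ai bi; split=> //; rewrite schur1E.
  (* Row [i] is nonpositive. If both [a] and [b] were linked to [i], the signature would give
     [s a * s b >= 0], whereas [M a b > 0] gives [s a * s b <= 0]. So this positive entry is left
     unchanged. *)
  suff -> : mat P a i * mat P i b = 0 by rewrite mul0r subr0.
  have [s [s2 sg]] := wf_sgn wP.
  have := sg _ _ ab; have := sg _ _ ai; have := sg i b; rewrite eq_sym => /(_ bi).
  have [//|x0] := eqVneq (mat P a i * mat P i b) 0.
  have pos : 0 < mat P a i * mat P i b.
    rewrite lt_def x0 mulr_le0 ?mij // (sym_entry a i sP) mij //.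
  move=> h1 h2 h3.
  have : 0 <= (s a * s i * mat P a i) * (s i * s b * mat P i b) by rewrite mulr_le0.
  rewrite (_ : _ * _ = s i ^+ 2 * (s a * s b * (mat P a i * mat P i b))); last by ring.
  rewrite s2 mul1r pmulr_lge0 // => sab.
  have : s a * s b = 0.
    apply/le_anti; rewrite sab andbT; move: h3; rewrite pmulr_lle0 //.
  move=> /eqP; rewrite mulf_eq0 => /orP[] /eqP z.
    by have := s2 a; rewrite z expr0n /= => /eqP; rewrite eq_sym oner_eq0.
  by have := s2 b; rewrite z expr0n /= => /eqP; rewrite eq_sym oner_eq0.
exists (c - (lin P i 0) ^+ 2 / (2 * mat P i i)) => y /= sy fy.
have [||f ->] := rc (recover_eliminated P i y).
- exact: recover_eliminated_supp.
- move=> k; have [->|ki] := eqVneq k i; last by rewrite recover_eliminated_ne.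
  rewrite ui leey; split=> //; apply/ltW/recover_eliminated_pos => // l _.
  by case: (fy l).
by split=> //; rewrite obj_eliminate //=; ring.
Qed.

Lemma reflect_inv todo P rec d i v : preparing_ok todo P rec ->
  (forall i, ~ zero_block P i) -> valid_d P d -> i \in vars P ->
  param_vec P d i 0 = 0 -> lin P i 0 < 0 -> ub P i = v%:E ->
  preparing_ok todo (reflect_var P i v) (fun x => rec (recover_reflected i v x)).
Proof.
move=> [okt wP [r1 r2]] nz vd iV p0 li ui.
have mij := valid_p_eq0 vd iV p0.
have mii := wf_diag_gt0 wP nz iV.
have [j [jV ji Mij]] := valid_p_neighbor wP nz vd iV p0.
split=> //; first exact: wf_reflect.
split=> [y Ky|]; first by apply: r1; apply: kkt_reflect.
left; exists i, j; split=> //=; first by rewrite eq_sym.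
by rewrite mxE eqxx (negbTE ji) /= oppr_gt0.
Qed.

Lemma ready_inv P d t : wfqp P -> valid_d P d -> 0 < t ->
  (forall i, i \in vars P -> 0 <= lin P i 0 + t * param_vec P d i 0) ->
  pivoting_ok P (param_vec P d) set0 (vars P) set0.
Proof.
move=> wP vd t0 rt; have p0 : pd_on (mat P) set0.
  by move=> x sx _; apply/colP => i; rewrite sx ?inE // mxE.
split=> //.
- by move=> i; rewrite !inE addn0.
- by move=> i; rewrite inE.
exists t => //; split=> i; rewrite ?inE // => iV.
have d0 : [disjoint (set0 : {set 'I_n}) & (set0 : {set 'I_n})].
  by apply/pred0P => j; rewrite /= inE.
have := @pivot_unique _ _ P (param_vec P d) set0 set0 0 t (pd_unit p0) d0 _ _ i.
rewrite !inE => -> => [|j|j]; rewrite ?inE //; last by rewrite mxE.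
by rewrite mulmx0 addr0 colD colZ rt.
Qed.

Lemma part3_disj (V A B C : {set 'I_n}) : part3 V A B C -> [disjoint A & C].
Proof.
move=> pt; apply/pred0P => i /=; apply/negP => /andP[iA iC].
by have := pt i; rewrite iA iC; case: (i \in B); case: (i \in V).
Qed.

Lemma part3_sub (V A B C : {set 'I_n}) : part3 V A B C -> A \subset V.
Proof.
move=> pt; apply/subsetP => i iA; apply/negPn/negP => /negbTE iV.
by have := pt i; rewrite iA iV.
Qed.

Lemma part3_U (V A B C : {set 'I_n}) : part3 V A B C -> forall i, (i \in A :|: B :|: C) = (i \in V).
Proof.
move=> pt i; have := pt i; rewrite !inE.
by case: (i \in A); case: (i \in B); case: (i \in C); case: (i \in V).
Qed.

End Invariant.

(** * The number of steps *)

Section Steps.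
Variables (R : realType) (n : nat) (M : 'M[R]_n) (q : 'cV[R]_n).
Variable (u : 'I_n -> \bar R).
Hypotheses (tM : tridiagonal M) (sM : symmetric_mx M) (pM : pos_semidef M).
Hypothesis (u0 : forall i, (0 < u i)%E).
Implicit Types (P : qp R n) (i j k : 'I_n) (x y d : 'cV[R]_n).
Implicit Types (todo : seq {set 'I_n}) (rec : 'cV[R]_n -> 'cV[R]_n).
Implicit Types (A B C V : {set 'I_n}).

(** At the critical parameter the index that moves either already has the value of its new bound or
    enters with zero gradient. The point is therefore also complementary for the new sets, and
    [pivot_unique] reads off their vectors. *)
Lemma pivot_ok_change P p A B C A' C' t i : pd_on (mat P) A ->
  pd_on (mat P) A' -> [disjoint A & C] -> [disjoint A' & C'] ->
  (forall j, j != i -> (j \in A') = (j \in A) /\ (j \in C') = (j \in C)) ->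
  (i \notin A' -> pivot_point P p A C t i 0 =
     if i \in C' then fine (ub P i) else 0) ->
  (i \in A' -> i \in A \/ qbar P A C i 0 + t * pbar P p A i 0 = 0) ->
  forall j, qbar P A' C' j 0 + t * pbar P p A' j 0 =
    if j \in A' then - pivot_point P p A C t j 0
    else if j \in A then 0 else qbar P A C j 0 + t * pbar P p A j 0.
Proof.
move=> pA pA' dAC dAC' oth xi wi j.
have E := @pivot_pointE _ _ P p A C t (pd_unit pA) dAC.
rewrite (@pivot_unique _ _ P p A' C' (pivot_point P p A C t) t (pd_unit pA') dAC').
- by rewrite E.
- move=> k; have [->|ki] := eqVneq k i => kA'; first exact: xi.
  by have [eA eC] := oth k ki; rewrite mxE eC -eA (negbTE kA').
move=> k kA'; rewrite E; have [ki|ki] := eqVneq k i.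
  by rewrite ki in kA' *; case: (wi kA') => [->//|->]; case: ifP.
by have [<- _] := oth k ki; rewrite kA'.
Qed.

Lemma pivot_inv P d A B C A' B' C' : let p := param_vec P d in
  wfqp P -> valid_d P d -> pivoting_ok P p A B C -> (0 < tau_new P p A B C)%E ->
  pivot P p A B C A' B' C' ->
  pivoting_ok P p A' B' C' /\ (2 * #|B'| + #|A'| < 2 * #|B| + #|A|)%N.
Proof.
move=> p wP vd [pt Cfin pA [t0 t00 ok0]] tpos pv.
have AV := part3_sub pt; have uA := pd_unit pA; have dAC := part3_disj pt.
have [sP pP _ _ _ _] := wP.
have [t [st tE]] := tau_new_ex P p A B C.
have tt : 0 < t by move: tpos; rewrite tE lte_fin.
have pb i : i \in A :|: B :|: C -> 0 <= pbar P p A i 0.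
  by rewrite (part3_U pt) => iV; apply: valid_pbar.
have [_ [okA okB okC]] := pivot_ok_tau pb t00 ok0 st.
have spos i : entering P p A B C i -> 0 < schur (mat P) A i i.
  move=> [/andP[iB pi] _]; apply: (valid_schur wP vd AV pA) => //.
    by rewrite -(part3_U pt) !inE iB orbT.
  by have := pt i; rewrite iB; case: (i \in A) => //; case: (i \in C); case: (i \in vars P).
case: pv => [i [ci]|i ei s0|i ei s0|i j ei s0|i j ei s0].
- rewrite tE => -[iE]; have /and3P[iA pi ui] := ci.
  have iB : i \notin B by have := pt i; rewrite iA; case: (i \in B) => //; case: (i \in C); case: (i \in vars P).
  have iC : i \notin C by rewrite (disjointFr dAC).
  have pA' : pd_on (mat P) (A :\ i) by apply: pd_onS pA; apply: subD1set.
  have pt' : part3 (vars P) (A :\ i) B (i |: C).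
    move=> j; have := pt j; rewrite in_setD1 in_setU1; case: eqVneq => [->|//].
    by rewrite iA (negbTE iB) (negbTE iC).
  have zE : qbar P A C i 0 + t * pbar P p A i 0 = - fine (ub P i).
    by rewrite -iE /ratiou mulfVK ?gt_eqF //; ring.
  have E := @pivot_ok_change P p A B C (A :\ i) (i |: C) t i pA pA' dAC (part3_disj pt').
  have {}E j : qbar P (A :\ i) (i |: C) j 0 + t * pbar P p (A :\ i) j 0 =
    if j \in A :\ i then - pivot_point P p A C t j 0
    else if j \in A then 0 else qbar P A C j 0 + t * pbar P p A j 0.
    apply: E => [k ki| |].
    + by rewrite in_setD1 in_setU1 ki (negbTE ki).
    + by move=> _; rewrite mxE iA zE opprK setU11.
    by rewrite in_setD1 eqxx.
  split; last by rewrite (cardsD1 i A) iA ltn_add2l add1n.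
  split=> // [j|]; first by rewrite in_setU1 => /orP[/eqP ->|/Cfin].
  exists t => //; split=> j jX; rewrite E.
  + have jA : j \in A by move: jX; rewrite in_setD1 => /andP[].
    by rewrite jX opprK mxE jA; apply: okA.
  + have jA : j \notin A by have := pt j; rewrite jX; case: (j \in A) => //; case: (j \in C); case: (j \in vars P).
    by rewrite in_setD1 (negbTE jA) andbF; apply: okB.
  rewrite in_setD1; move: jX; rewrite in_setU1; case: eqVneq => [->|ji] /= jC.
    by rewrite iA.
  have jA : j \notin A by rewrite (disjointFl dAC).
  by rewrite (negbTE jA); apply: okC.
- have [ci] := ei; rewrite tE => -[iE]; have /andP[iB pi] := ci.
  have iA : i \notin A by have := pt i; rewrite iB; case: (i \in A) => //; case: (i \in C); case: (i \in vars P).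
  have iC : i \notin C by have := pt i; rewrite iB; case: (i \in C) => //; case: (i \in A); case: (i \in vars P).
  have pA' : pd_on (mat P) (i |: A) by apply: pd_adjoin.
  have pt' : part3 (vars P) (i |: A) (B :\ i) C.
    move=> j; have := pt j; rewrite in_setD1 in_setU1; case: eqVneq => [->|//].
    by rewrite iB (negbTE iA) (negbTE iC).
  have zE : qbar P A C i 0 + t * pbar P p A i 0 = 0.
    by rewrite -iE /Defs.ratio0 mulfVK ?gt_eqF //; ring.
  have E := @pivot_ok_change P p A B C (i |: A) C t i pA pA' dAC (part3_disj pt').
  have {}E j : qbar P (i |: A) C j 0 + t * pbar P p (i |: A) j 0 =
    if j \in i |: A then - pivot_point P p A C t j 0
    else if j \in A then 0 else qbar P A C j 0 + t * pbar P p A j 0.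
    apply: E => [k ki| |]; rewrite ?setU11 //; last by right.
    by rewrite in_setU1 (negbTE ki).
  split.
    2: by rewrite (cardsD1 i B) iB cardsU1 iA /= mulnDr; move: #|B :\ i| #|A| => a b; clear; lia.
  split=> //; exists t => //; split=> j jX; rewrite E.
  + rewrite jX opprK mxE; move: jX; rewrite in_setU1; case: eqVneq => [->|ji] /= jA.
      by rewrite (negbTE iA) (negbTE iC); split=> //; apply/ltW/(wf_ub wP).
    by rewrite jA; apply: okA.
  + move: jX; rewrite in_setD1 in_setU1 => /andP[ji jB].
    have jA : j \notin A by have := pt j; rewrite jB; case: (j \in A) => //; case: (j \in C); case: (j \in vars P).
    by rewrite (negbTE ji) (negbTE jA); apply: okB.
  have jA : j \notin A by rewrite (disjointFl dAC).
  have ji : j != i by apply: contraTneq jX => ->.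
  by rewrite in_setU1 (negbTE ji) (negbTE jA); apply: okC.
(* The degenerate pivots ask for a zero Schur pivot of an entering index, which [spos] excludes. *)
all: by have := spos i ei; rewrite s0 ltxx.
Qed.

Lemma no_ray P d A B C : let p := param_vec P d in
  wfqp P -> valid_d P d -> pivoting_ok P p A B C -> ~ ray P p A B C.
Proof.
move=> p wP vd [pt _ pA _] [i [[/andP[iB pi] _] s0 _]].
suff : 0 < schur (mat P) A i i by rewrite s0 ltxx.
apply: (valid_schur wP vd (part3_sub pt) pA) => //.
  by rewrite -(part3_U pt) !inE iB orbT.
by have := pt i; rewrite iB; case: (i \in A) => //; case: (i \in C); case: (i \in vars P).
Qed.

Lemma optimal_kkt P d A B C : let p := param_vec P d in
  wfqp P -> valid_d P d -> pivoting_ok P p A B C -> tau_new P p A B C = 0%E ->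
  kkt P (pivot_solution P A C).
Proof.
move=> p wP vd [pt Cfin pA [t0 t00 ok0]] /tau_specP st.
have pb i : i \in A :|: B :|: C -> 0 <= pbar P p A i 0.
  by rewrite (part3_U pt) => iV; apply: valid_pbar => //; apply: part3_sub pt.
have [_ [okA okB okC]] := pivot_ok_tau pb t00 ok0 st.
have E := pivot_pointE p 0 (pd_unit pA) (part3_disj pt).
have xE : pivot_point P p A C 0 = pivot_solution P A C.
  by apply/colP => i; rewrite !mxE mul0r addr0.
rewrite -xE; split=> i iV.
  have := pt i; rewrite (negbTE iV) mxE.
  by case: (i \in A) => //; case: (i \in C) => //; case: (i \in B).
have -> : grad P (pivot_point P p A C 0) i 0 =
  (lin P + 0 *: p + mat P *m pivot_point P p A C 0) i 0 by rewrite scale0r addr0.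
rewrite E [pivot_point _ _ _ _ _ _ _]mxE; case: ifPn => iA.
  by have [a b] := okA i iA; split.
case: ifPn => iC.
  have ui := Cfin i iC; have up := wf_ub wP i.
  have ge : (fine (ub P i))%:E = ub P i by case: (ub P i) ui up.
  split; rewrite ?ge ?lexx //.
  - by rewrite -lee_fin ge ltW.
  - by move=> _; apply: okC.
  by rewrite ltxx.
have iB : i \in B by have := pt i; rewrite (negbTE iA) (negbTE iC) iV; case: (i \in B).
by split=> //; [exact: ltW (wf_ub wP i)|rewrite ltxx|move=> _; apply: okB].
Qed.

(** A block of [N] variables has [qp_size] at most [2 N], so its preparation starts with a charge of
    at most [6 N + 3], which is below [12 N] because [N] is positive. *)
Definition todo_size todo : nat := (1 + \sum_(S <- todo) 12 * #|S|)%N.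

Definition qp_size P : nat :=
  (#|vars P| + #|[set i in vars P | (ub P i < +oo)%E]|)%N.

(** A reduction together with the preparation after it takes two steps, hence the factor 2 on
    [qp_size]. Pivoting starts with [B] the whole block; a move from [B] to [A] or from [A] to [C]
    lowers its charge by 1. *)
Definition config_size (c : config R n) : nat :=
  match c with
  | Idle todo _ => todo_size todo
  | Preparing todo P _ => todo_size todo + 2 * qp_size P + 2 * #|vars P| + 3
  | Prepared todo P _ _ _ => todo_size todo + 2 * qp_size P + 2 * #|vars P| + 2
  | Pivoting todo P _ _ A B _ => todo_size todo + 2 * #|B| + #|A| + 1
  | Answered _ => 0
  end.

Lemma eliminate_size P i : i \in vars P ->
  (qp_size (eliminate P i) < qp_size P)%N /\
  (#|vars (eliminate P i)| <= #|vars P|)%N.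
Proof.
move=> iV; rewrite /qp_size /= [in X in (_ < X)%N /\ _](cardsD1 i (vars P)) iV.
split; last exact: subset_leq_card (subD1set _ _).
rewrite -addnA add1n ltnS leq_add2l subset_leq_card //; apply/subsetP => j.
by rewrite !inE => /andP[/andP[_ ->] ->].
Qed.

Lemma reflect_size P i v : i \in vars P -> ub P i = v%:E ->
  (qp_size (reflect_var P i v) < qp_size P)%N.
Proof.
move=> iV ui; rewrite /qp_size /= -addnS leq_add2l; apply: proper_card.
apply/properP; split.
  by apply/subsetP => j; rewrite !inE; case: eqP => // _ /andP[_]; rewrite ltxx.
by exists i; rewrite !inE ?eqxx ?ltxx ?andbF // iV ui ltey.
Qed.

Lemma step_inv c c' : config_ok M q u c -> step M q u c c' ->
  config_ok M q u c' /\ (config_size c' < config_size c)%N.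
Proof.
move=> ic st; case: st ic => [x|S todo x|todo P rec i zi li|todo P rec i v zi li ui
  |todo P rec i zi li ui|todo P rec d nz vd|todo P rec d p i iV p0 li ui
  |todo P rec d p i v iV p0 li ui|todo P rec d p [t t0 rt]
  |todo P rec p A B C A' B' C' tp pv|todo P rec p A B C tp ry
  |todo P rec p A B C t0] /=.
- move=> [_ gx]; split; last by rewrite /todo_size.
  exact: (kkt_optimal_good sM pM gx).
- move=> [okt gx]; split; first exact: block_inv.
  have [_ bl] := okt; have bS : S \in blocks M by apply: bl; rewrite mem_head.
  have [i iS] := block_ne bS.
  have : (0 < #|S|)%N by apply/card_gt0P; exists i.
  have : (#|[set i in S | (u i < +oo)%E]| <= #|S|)%N.
    by apply: subset_leq_card; apply/subsetP => j; rewrite !inE => /andP[].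
  by rewrite /qp_size /todo_size /= big_cons; lia.
- move=> [okt wP [r1 _]]; split; last by rewrite /todo_size; lia.
  split=> //; apply: r1; rewrite -[0](scale0r (delta_mx i 0)).
  apply: zero_block_kkt => //; try exact: (wf_sym wP); try exact: (wf_psd wP).
  by split; rewrite ?ltxx //; apply/ltW/(wf_ub wP).
- move=> [okt wP [r1 _]]; split; last by rewrite /todo_size; lia.
  split=> //; apply: r1.
  apply: zero_block_kkt => //; try exact: (wf_sym wP); try exact: (wf_psd wP).
  split; rewrite ?ui ?lexx // ?ltxx //; last by move=> _; apply: ltW.
  by have := wf_ub wP i; rewrite ui lte_fin => /ltW.
- move=> pr; split; last by rewrite /todo_size.
  exact: inspect_ray pr zi li ui.
- by move=> pr; split=> //; lia.
- move=> [pr [nz vd pE]]; rewrite pE in p0; split; first exact: eliminate_inv p0 li ui.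
  by have [] := eliminate_size iV; rewrite /=; lia.
- move=> [pr [nz vd pE]]; rewrite pE in p0; split; first exact: reflect_inv p0 li ui.
  by have := reflect_size iV ui; rewrite /=; lia.
- move=> [pr [nz vd pE]]; rewrite pE in rt *; have [_ wP _] := pr.
  split; last by rewrite cards0; lia.
  by split=> //; split; [exists d|apply: ready_inv rt].
- move=> [pr [[d [vd pE]] ok]]; rewrite pE in ok tp pv *; have [_ wP _] := pr.
  have [ok' lt] := pivot_inv wP vd ok tp pv.
  split; first by split=> //; split=> //; exists d.
  have key t a b a' b' : (2 * b' + a' < 2 * b + a ->
      t + 2 * b' + a' + 1 < t + 2 * b + a + 1)%N by clear; lia.
  exact: key lt.
- move=> [pr [[d [vd pE]] ok]]; rewrite pE in ok ry *; have [_ wP _] := pr.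
  by have := no_ray wP vd ok ry.
move=> [pr [[d [vd pE]] ok]]; rewrite pE in ok t0 *; have [okt wP [r1 _]] := pr.
split; last by lia.
by split=> //; apply: r1; apply: optimal_kkt vd ok t0.
Qed.

Lemma initial_inv c : initial M c -> config_ok M q u c /\ (config_size c <= 1 + 12 * n)%N.
Proof.
move=> [bs pb ->] /=; split; last first.
  rewrite /todo_size leq_add2l -big_distrr /= leq_mul2l /= (perm_big _ pb) /=.
  by rewrite big_enum sum_blocks.
have okb : todo_ok M bs.
  split; first by rewrite (perm_uniq pb) enum_uniq.
  by move=> S; rewrite (perm_mem pb) mem_enum.
split=> //; split=> [i|i]; first by rewrite mxE; split=> //; apply: ltW.
have [S bS iS] := block_cover M i.
by move=> /hasP[]; exists S; rewrite ?(perm_mem pb) ?mem_enum.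
Qed.

Lemma steps_inv c cs : config_ok M q u c -> steps M q u c cs ->
  config_ok M q u (last c cs) /\ (size cs + config_size (last c cs) <= config_size c)%N.
Proof.
elim: cs c => [|c' cs IH] c ic /=; first by rewrite add0n.
move=> [st sts]; have [ic' lt] := step_inv ic st.
by have [il le] := IH _ ic' sts; split=> //; lia.
Qed.
End Steps.

(** * Tridiagonal systems *)

Section Links.
Variables (R : realType) (n : nat).
Implicit Types (M : 'M[R]_n) (x y : 'cV[R]_n) (i j k a b c : 'I_n).
Implicit Types (A V : {set 'I_n}).

(** The view that a program has of a chain: pointers to the two neighbours and the entries that link
    them. An absent neighbour has coefficient 0, and its pointer is then arbitrary. *)
Definition links V M (prf nxf : nat -> nat) (L U : nat -> R) : Prop :=
  forall i, i \in V ->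
  ((exists j, [/\ consec V j i, prf i = j & L i = M i j]) \/
   ((forall j, ~~ consec V j i) /\ L i = 0)) /\
  ((exists j, [/\ consec V i j, nxf i = j & U i = M i j]) \/
   ((forall j, ~~ consec V i j) /\ U i = 0)).

(** Neighbours are taken in [V]; a predecessor outside [A] gets coefficient 0, so that indices
    consecutive in [A] but not in [V] are not linked. *)
Definition links_in V A M (prf : nat -> nat) (LA : nat -> R) : Prop :=
  forall i, i \in A ->
  (exists j, [/\ consec V j i, j \in A, prf i = j & LA i = M i j]) \/
  ((forall j, j \in A -> ~~ consec V j i) /\ LA i = 0).

Lemma links_self V M prf nxf L U : links V M prf nxf L U -> links_in V V M prf L.
Proof.
move=> lk i iV; have [[[j [c pj Lj]]|[no L0]] _] := lk i iV.
  by left; exists j; split=> //; case/and4P: c.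
by right; split=> // j _; apply: no.
Qed.

Lemma tri_mul V M prf nxf L U x (X : nat -> R) : symmetric_mx M -> tri_on V M ->
  links V M prf nxf L U -> supported V x ->
  (forall i, i \in V -> X i = x i 0) -> forall i, i \in V ->
  (M *m x) i 0 = M i i * X i + L i * X (prf i) + U i * X (nxf i).
Proof.
move=> sM tV lk sx Xx i iV; rewrite mxE.
have split3 j : M i j * x j 0 = (if j == i then M i j * x j 0 else 0) +
    (if consec V j i then M i j * x j 0 else 0) +
    (if consec V i j then M i j * x j 0 else 0).
  have [->|ji] := eqVneq j i.
    have c : consec V i i = false by apply/negbTE/negP => /consec_lt; rewrite ltnn.
    by rewrite c !addr0.
  have [jV|jV] := boolP (j \in V); last first.
    by rewrite sx // !mulr0 !if_same !addr0.
  have c2 : consec V i j -> consec V j i = false.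
    by move=> /consec_lt ij; apply/negbTE/negP => /consec_lt; lia.
  have [cij|cij] := boolP (consec V i j); first by rewrite c2 // !add0r.
  have [cji|cji] := boolP (consec V j i); first by rewrite add0r addr0.
  suff -> : M i j = 0 by rewrite mul0r !addr0.
  have [h|h|/ord_inj h] := ltngtP i j; first exact: tV.
    by rewrite (sym_entry i j sM); apply: tV.
  by rewrite h eqxx in ji.
rewrite (eq_bigr _ (fun j _ => split3 j)) !big_split /= -!big_mkcond big_pred1_eq.
have [pL nU] := lk i iV; rewrite Xx //; congr (_ + _ + _).
  case: pL => [[j [c -> ->]]|[no ->]]; last first.
    by rewrite big1 ?mul0r // => j; rewrite (negbTE (no j)).
  rewrite Xx; last by case/and4P: c.
  rewrite (bigD1 j) //= big1 ?addr0 // => k /andP[ck kj].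
  by rewrite (consec_inj ck c) eqxx in kj.
case: nU => [[j [c -> ->]]|[no ->]]; last first.
  by rewrite big1 ?mul0r // => j; rewrite (negbTE (no j)).
rewrite Xx; last by case/and4P: c.
rewrite (bigD1 j) //= big1 ?addr0 // => k /andP[ck kj].
by rewrite (consec_inj_up ck c) eqxx in kj.
Qed.

(** Forward elimination, with pivots [v] and reduced right side [y], followed by back substitution
    [z]. A zero pivot is tolerated when the link to the successor vanishes: the division by 0 then
    meets a zero coefficient. *)
Lemma tri_solve V A M prf nxf L U LA (v y z r : nat -> R) : symmetric_mx M ->
  A \subset V -> links V M prf nxf L U -> links_in V A M prf LA ->
  (forall i, i \in A -> v i = M i i - LA i * LA i / v (prf i)) ->
  (forall i, i \in A -> y i = r i - LA i / v (prf i) * y (prf i)) ->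
  (forall i, i \in A -> v i * z i = y i - U i * z (nxf i)) ->
  (forall i, i \in V -> i \notin A -> z i = 0) ->
  (forall i j, i \in A -> consec V i j -> v i = 0 -> M i j = 0) ->
  forall i, i \in A -> M i i * z i + L i * z (prf i) + U i * z (nxf i) = r i.
Proof.
move=> sM AV lk lA vE yE zE z0 v0 i iA; have iV := subsetP AV _ iA.
have := zE i iA; have := yE i iA; have := vE i iA.
have [pL _] := lk i iV; case: pL => [[j [c pj Lj]]|[no L0]]; last first.
  have LA0 : LA i = 0.
    by case: (lA i iA) => [[j [c]]|[_ ->//]]; rewrite (negbTE (no j)) in c.
  by rewrite LA0 L0 !mul0r !subr0 addr0 => -> ->; lra.
have jV : j \in V by case/and4P: c.
have [jA|jA] := boolP (j \in A); last first.
  have LA0 : LA i = 0.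
    case: (lA i iA) => [[j' [c' j'A]]|[_ ->//]].
    by rewrite (consec_inj c' c) (negbTE jA) in j'A.
  by rewrite LA0 pj (z0 j jV jA) !mul0r !subr0 mulr0 addr0 => -> ->; lra.
have LAj : LA i = M i j.
  case: (lA i iA) => [[j' [c' _ _ ->]]|[no _]]; first by rewrite (consec_inj c' c).
  by have := no j jA; rewrite c.
have [_ [[i' [c' nj Uj]]|[no _]]] := lk j jV; last by rewrite (negbTE (no i)) in c.
rewrite (consec_inj_up c' c) {c'} in nj Uj.
rewrite LAj Lj pj; have := zE j jA; rewrite nj Uj (sym_entry j i sM).
have [vj|vj] := eqVneq (v j) 0.
  rewrite (sym_entry i j sM) (v0 j i jA c vj) vj invr0 !mulr0 !mul0r !subr0.
  by move=> _ -> ->; lra.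
move=> e1 e2 e3 e4.
have e5 : z j = (y j - M i j * z i) / v j by rewrite -e1 mulrC mulKf.
have e6 : M i i = v i + M i j * M i j / v j by rewrite e2; ring.
have e7 : U i * z (nxf i) = y i - v i * z i by rewrite e4; ring.
by rewrite e5 e6 e7 e3; field.
Qed.

(** The same fold as in [pivoted], with a natural bound in place of an ordinal so that induction on
    it is possible. *)
Definition pivk M A (k : nat) : 'M[R]_n :=
  foldl (fun (S : 'M[R]_n) (j : 'I_n) => schur S [set j]) M
        [seq j : 'I_n <- enum A | (j < k)%N].

Lemma enum_filter_ltS A i : [seq j : 'I_n <- enum A | (j < i.+1)%N] =
  [seq j : 'I_n <- enum A | (j < i)%N] ++ (if i \in A then [:: i] else [::]).
Proof.
have : sorted (fun a b : 'I_n => (a < b)%N) (enum A).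
  rewrite /enum_mem sorted_filter //; first by move=> a b c; apply: ltn_trans.
  rewrite -enumT; have := iota_ltn_sorted 0 n; rewrite -val_enum_ord sorted_map.
  by [].
rewrite -mem_enum; elim: (enum A) => //= a s IH pa.
have sS := path_sorted pa.
have as_ : all (fun b : 'I_n => (a < b)%N) s.
  by apply: order_path_min pa => x y z; apply: ltn_trans.
have nil_lt (m : nat) : (m <= a.+1)%N -> [seq j : 'I_n <- s | (j < m)%N] = [::].
  move=> ma; apply/eqP; rewrite -[_ == _]negbK -has_filter; apply/hasPn => b bs.
  by have := allP as_ b bs; rewrite -leqNgt; lia.
rewrite in_cons; have [ai|ai|ai] := ltngtP a i.
- have -> : (i == a) = false by apply/eqP => e; rewrite e ltnn in ai.
  by rewrite ltnS (ltnW ai) /= IH.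
- have -> : (i == a) = false by apply/eqP => e; rewrite e ltnn in ai.
  rewrite ltnS leqNgt ai /= !nil_lt; [|lia|lia].
  case: ifP => // is_; have := allP as_ i is_; lia.
have e : i = a by apply: ord_inj.
by rewrite e eqxx ltnSn /= !nil_lt.
Qed.

Lemma pivkS M A i :
  pivk M A i.+1 = if i \in A then schur (pivk M A i) [set i] else pivk M A i.
Proof.
by rewrite /pivk enum_filter_ltS foldl_cat; case: ifP.
Qed.

Lemma pivk_sympsd M A k : symmetric_mx M -> pos_semidef M ->
  symmetric_mx (pivk M A k) /\ pos_semidef (pivk M A k).
Proof.
rewrite /pivk; elim: {A k}[seq _ <- _ | _] M => //= a s IH M sM pM.
by apply: IH; [apply: schur_sym|apply: schur_psd].
Qed.

(** When [c] is pivoted on, its column has at most one nonzero entry further down, at the successor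
    of [c] in [V]; the rank one update therefore reaches only the diagonal entry there. *)
Lemma pivk_entries V A M (k : nat) : symmetric_mx M -> tri_on V M -> A \subset V ->
  forall a b, a \in V -> b \in V -> (k <= a)%N -> (k <= b)%N ->
  (a != b -> pivk M A k a b = M a b) /\
  (forall c, c \in A -> (c < k)%N -> consec V c a ->
     pivk M A k a a = M a a - M a c * M a c / pivk M A c c c) /\
  ((forall c, c \in A -> (c < k)%N -> ~~ consec V c a) -> pivk M A k a a = M a a).
Proof.
move=> sM tV AV; elim: k => [|k IH] a b aV bV ka kb.
  have -> : pivk M A 0 = M by rewrite /pivk (eq_filter (a2 := pred0)) ?filter_pred0.
  by split=> //; split.
have [i ik] : exists i : 'I_n, i = k :> nat.
  by exists (Ordinal (ltn_trans ka (ltn_ord a))).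
rewrite -ik in ka kb IH *; rewrite pivkS.
have [Eab [Ec Eno]] := IH a b aV bV (ltnW ka) (ltnW kb).
have ia : i != a by apply: contraTneq ka => ->; rewrite ltnn.
have ib : i != b by apply: contraTneq kb => ->; rewrite ltnn.
have lt1 c : (c < i.+1)%N -> c != i -> (c < i)%N.
  by rewrite ltnS leq_eqVlt => /orP[/eqP/ord_inj->|//]; rewrite eqxx.
case: ifPn => iA; last first.
  split=> //; split=> [c cA ci|no]; last by apply: Eno => c cA ci; apply: no => //; apply: ltnW.
  by apply: Ec => //; apply: lt1 => //; apply: contraNneq iA => <-.
have iV := subsetP AV _ iA.
have [Eai _] := IH a i aV iV (ltnW ka) (leqnn _).
have [Eib _] := IH i b iV bV (leqnn _) (ltnW kb).
have [Eia _] := IH i a iV aV (leqnn _) (ltnW ka).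
rewrite eq_sym in Eai; rewrite !schur1E.
rewrite (Eai ia) (Eib ib) (Eia ia) (sym_entry i a sM).
have z c : c \in V -> (i < c)%N -> ~~ consec V i c -> M i c = 0 by move=> cV ic; apply: tV.
split=> [ab|].
  rewrite Eab //; suff -> : M a i * M i b = 0 by rewrite mul0r subr0.
  have [ca|ca] := boolP (consec V i a); last first.
    by rewrite (sym_entry a i sM) (z a) // mul0r.
  rewrite (z b) ?mulr0 //; apply: contra ab => cb.
  by rewrite (consec_inj_up ca cb).
split=> [c cA ci cca|no].
  have [e|ci'] := eqVneq c i.
    rewrite e in cca *; rewrite Eno // => c' _ c'i; apply/negP => cc'.
    by rewrite (consec_inj cc' cca) ltnn in c'i.
  rewrite (Ec c) ?lt1 // (sym_entry a i sM) (z a) ?mul0r ?subr0 //.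
  by apply: contra ci' => ca; rewrite (consec_inj ca cca).
rewrite Eno => [|c cA ci]; last by apply: no => //; apply: ltnW.
by rewrite (sym_entry a i sM) (z a) ?mul0r ?subr0 // no.
Qed.

Section Pivots.
Variables (V A : {set 'I_n}) (M : 'M[R]_n) (prf : nat -> nat) (LA v : nat -> R).
Hypotheses (sM : symmetric_mx M) (pM : pos_semidef M) (tV : tri_on V M).
Hypotheses (AV : A \subset V) (lA : links_in V A M prf LA).
Hypothesis vE : forall i, i \in A -> v i = M i i - LA i * LA i / v (prf i).

Lemma pivots_eq i : i \in A -> v i = pivoted M A i i i.
Proof.
have [k] := ubnP (i : nat); elim: k i => // k IH i ik iA.
have iV := subsetP AV _ iA.
have [_ [Ec Eno]] := pivk_entries sM tV AV iV iV (leqnn i) (leqnn i).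
rewrite vE // -/(pivk M A i); case: (lA iA) => [[j [c jA -> ->]]|[no ->]].
  have ji := consec_lt c.
  by rewrite (Ec j) // IH //; apply: leq_trans ji _.
by rewrite Eno ?mul0r ?subr0 // => c cA _; apply: no.
Qed.

Lemma pivots_ge0 i : i \in A -> 0 <= v i.
Proof.
by move=> iA; rewrite pivots_eq // psd_diag //; case: (pivk_sympsd A i sM pM).
Qed.

(** A zero diagonal entry of a semidefinite Schur complement kills its row, and the off-diagonal
    entries of that row are still those of [M]. *)
Lemma pivots_eq0 i j : i \in A -> consec V i j -> v i = 0 -> M i j = 0.
Proof.
move=> iA c; rewrite pivots_eq // => v0.
have [sk pk] := pivk_sympsd A i sM pM.
have iV := subsetP AV _ iA; have jV : j \in V by case/and4P: c.
have ij := consec_lt c.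
have [Eij _] := pivk_entries sM tV AV iV jV (leqnn i) (ltnW ij).
rewrite -Eij; first exact: psd_diag0.
by apply: contraTneq ij => ->; rewrite ltnn.
Qed.
End Pivots.

Lemma enum_val_lt A (k l : 'I_#|A|) :
  ((enum_val k : nat) < enum_val l)%N = (k < l)%N.
Proof.
have srt : sorted (fun a b : 'I_n => (a < b)%N) (enum A).
  rewrite /enum_mem sorted_filter //; first by move=> a b c; apply: ltn_trans.
  by rewrite -enumT; have := iota_ltn_sorted 0 n; rewrite -val_enum_ord sorted_map.
have mono (k' l' : 'I_#|A|) : (k' < l')%N -> ((enum_val k' : nat) < enum_val l')%N.
  move=> kl; rewrite (enum_val_nth (enum_val k) k') (enum_val_nth (enum_val k) l').
  apply: (sorted_ltn_nth _ _ srt) => //; rewrite ?inE -?cardE //.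
  by move=> x y z; apply: ltn_trans.
apply/idP/idP; last exact: mono.
apply: contraLR; rewrite -!leqNgt leq_eqVlt => /orP[/eqP/ord_inj->//|/mono].
exact: ltnW.
Qed.

Lemma enum_val_consec A (k l : 'I_#|A|) :
  (l.+1 == k :> nat) = consec A (enum_val l) (enum_val k).
Proof.
apply/eqP/idP => [lk|c].
  apply: consecP; rewrite ?enum_valP // ?enum_val_lt -?lk // => b bA.
  have [m ->] := enum_val_ex bA; rewrite !enum_val_lt -lk; lia.
have := consec_lt c; rewrite enum_val_lt => lk.
have [//|h] := ltnP l.+1 k; last by apply/eqP; rewrite eqn_leq lk h.
move=> h; have h' : (l.+1 < #|A|)%N by apply: ltn_trans h (ltn_ord k).
have := consec_gap c (enum_valP (Ordinal h')); rewrite !enum_val_lt /= h ltnSn.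
by [].
Qed.

(** The subdiagonal of [bidiag] is defined by ranks in [A]. Here it is read on the indices
    themselves, as consecutiveness in [A]. *)
Definition bidiag_entry A (g s : nat -> R) a b : R :=
  if b == a then g a else if consec A b a then s a else 0.

Lemma bidiagE A (g s : nat -> R) (k l : 'I_#|A|) :
  bidiag A g s k l = bidiag_entry A g s (enum_val k) (enum_val l).
Proof.
by rewrite mxE /bidiag_entry enum_val_consec (inj_eq enum_val_inj).
Qed.

Lemma bidiag_mulT A (g s : nat -> R) (k l : 'I_#|A|) :
  let a := enum_val k in let c := enum_val l in (c <= a)%N ->
  (bidiag A g s *m (bidiag A g s)^T) k l =
  if c == a then g a * g a + (if [exists b, consec A b a] then s a * s a else 0)
  else if consec A c a then s a * g c else 0.
Proof.
move=> a c ca; have aA : a \in A := enum_valP k; have cA : c \in A := enum_valP l.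
rewrite mxE; under eq_bigr => m _ do rewrite [_^T _ _]mxE !bidiagE.
rewrite -(big_enum_val (fun b => bidiag_entry A g s a b * bidiag_entry A g s c b)) /=.
rewrite (bigD1 a) //= {1}/bidiag_entry eqxx.
have cons_ne b : consec A b a -> (b == a) = false.
  by move=> /consec_lt h; apply/negbTE; apply: contraTneq h => ->; rewrite ltnn.
have -> : \sum_(b in A | b != a) bidiag_entry A g s a b * bidiag_entry A g s c b =
  \sum_(b | consec A b a) s a * bidiag_entry A g s c b.
  rewrite big_mkcond [RHS]big_mkcond; apply: eq_bigr => b _.
  have [cb|cb] := boolP (consec A b a).
    have bA : b \in A by case/and4P: cb.
    by rewrite bA cons_ne //= {1}/bidiag_entry cons_ne // cb.
  case: ifP => // /andP[_ ba]; rewrite /bidiag_entry (negbTE ba) (negbTE cb).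
  by rewrite mul0r.
have pred1 F : \sum_(b | consec A b a) F b = 
  if [pick b | consec A b a] is Some b then F b else 0 :> R.
  case: pickP => [b cb|no]; last by rewrite big_pred0.
  rewrite (bigD1 b) //= big1 ?addr0 // => b' /andP[cb' bb'].
  by rewrite (consec_inj cb' cb) eqxx in bb'.
rewrite pred1; have [e|ne] := eqVneq c a.
  rewrite e /bidiag_entry eqxx; congr (_ + _).
  case: pickP => [b cb|no]; first by rewrite cons_ne // cb; case: existsP => // -[]; exists b.
  by case: existsP => // -[b]; rewrite no.
have {}ca : (c < a)%N by rewrite ltn_neqAle ca andbT.
have -> : bidiag_entry A g s c a = 0.
  rewrite /bidiag_entry eq_sym (negbTE ne); case: ifP => // /consec_lt; lia.
rewrite mulr0 add0r; case: pickP => [b cb|no]; last by rewrite no.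
rewrite /bidiag_entry; have [e|bc] := eqVneq b c; first by rewrite -e cb.
have -> : consec A c a = false.
  by apply/negbTE; apply: contra bc => cc; rewrite (consec_inj cb cc).
have -> : consec A b c = false; last by rewrite mulr0.
apply/negbTE/negP => /consec_lt bc'; have := consec_gap cb cA.
by rewrite bc' ca.
Qed.

Lemma consec_sub V A j i : A \subset V -> consec V j i -> j \in A -> i \in A ->
  consec A j i.
Proof.
move=> AV c jA iA; apply: consecP => //; first exact: consec_lt c.
by move=> k /(subsetP AV) kV; rewrite (consec_gap c).
Qed.

Lemma mulT_sym (k : nat) (G : 'M[R]_k) (i j : 'I_k) : (G *m G^T) i j = (G *m G^T) j i.
Proof. by rewrite -[in LHS](trmxK G) -trmx_mul mxE trmxK. Qed.

Section Cholesky.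
Variables (V A : {set 'I_n}) (M : 'M[R]_n) (prf : nat -> nat) (LA : nat -> R).
Hypotheses (sM : symmetric_mx M) (pM : pos_semidef M) (tV : tri_on V M).
Hypotheses (AV : A \subset V) (lA : links_in V A M prf LA).

Lemma cholesky_of_pivots (v g s : nat -> R) :
  (forall i, i \in A -> v i = M i i - LA i * LA i / v (prf i)) ->
  (forall i, i \in A -> g i = Num.sqrt (v i)) ->
  (forall i, i \in A -> s i = LA i / g (prf i)) ->
  is_cholesky (submx_on M A A) (bidiag A g s).
Proof.
move=> vE gE sE; have v0 := pivots_ge0 sM pM tV AV lA vE.
have gg i : i \in A -> g i * g i = v i.
  by move=> iA; rewrite gE // -expr2 sqr_sqrtr ?v0.
split.
- apply/is_trig_mxP => k l kl; rewrite mxE.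
  have -> : (l == k) = false by apply/eqP => e; rewrite e ltnn in kl.
  by case: eqP => // e; lia.
- by move=> k; rewrite bidiagE /bidiag_entry eqxx gE ?sqrtr_ge0 // enum_valP.
suff low (k l : 'I_#|A|) : (enum_val l <= enum_val k)%N ->
    submx_on M A A k l = (bidiag A g s *m (bidiag A g s)^T) k l.
  apply/matrixP => k l; case: (leqP (enum_val l) (enum_val k)) => [|/ltnW]; first exact: low.
  by move=> h; rewrite mulT_sym -low // !mxE sym_entry.
move=> h; rewrite bidiag_mulT // mxE.
set a := enum_val k in h *; set c := enum_val l in h *.
have aA : a \in A := enum_valP k; have cA : c \in A := enum_valP l.
have aV := subsetP AV _ aA; have cV := subsetP AV _ cA.
(* Two indices consecutive in [A] may be separated by an index of [V] outside [A]; the stored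
   subdiagonal entry is then 0. *)
have nolink b : consec A b a -> ~~ consec V b a -> s a = 0.
  move=> cb ncb; rewrite sE //; case: (lA aA) => [[j [cj jA _ _]]|[_ ->]]; last by rewrite mul0r.
  by have e := consec_inj (consec_sub AV cj jA aA) cb; rewrite e (negbTE ncb) in cj.
have link b : b \in A -> consec V b a -> prf a = b /\ LA a = M a b.
  move=> bA cb; case: (lA aA) => [[j [cj _ -> ->]]|[no _]].
    by rewrite (consec_inj cj cb).
  by have := no b bA; rewrite cb.
have [e|ne] := eqVneq c a.
  rewrite e gg // vE //; case: existsP => [[b cb]|no].
    have bA : b \in A by case/and4P: cb.
    have [cV'|ncV] := boolP (consec V b a); last first.
      have s0 := nolink b cb ncV; rewrite s0 mul0r.
      case: (lA aA) => [[j [cj jA _ _]]|[_ ->]]; last by rewrite !mul0r; lra.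
      by have e' := consec_inj (consec_sub AV cj jA aA) cb; rewrite e' (negbTE ncV) in cj.
    have [pa La] := link b bA cV'; rewrite sE // pa La.
    have -> : M a b / g b * (M a b / g b) = M a b * M a b / (g b * g b).
      by rewrite invfM; ring.
    by rewrite gg //; ring.
  case: (lA aA) => [[j [cj jA _ _]]|[_ ->]]; last by rewrite !mul0r; lra.
  by case: no; exists j; apply: consec_sub cj jA aA.
have {}h : (c < a)%N by rewrite ltn_neqAle h andbT.
case: ifPn => cc; last first.
  rewrite (sym_entry a c sM) (tV cV aV h) //.
  by apply: contra cc => cc; apply: consec_sub cc cA aA.
have [cV'|ncV] := boolP (consec V c a); last first.
  by rewrite (nolink c) // mul0r (sym_entry a c sM) (tV cV aV h).
have [pa La] := link c cA cV'; rewrite sE // pa La.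
(* For a zero pivot the subdiagonal entry is a division by 0, but the entry of [M] to be reproduced
   is 0 as well. *)
have [g0|g0] := eqVneq (g c) 0; last by rewrite divfK.
have vc : v c = 0 by rewrite -gg // g0 mul0r.
rewrite g0 mulr0 (sym_entry a c sM).
exact: (pivots_eq0 sM pM tV AV lA vE cA cV' vc).
Qed.

(** The determinant is the square of the product of the diagonal entries of the factor. *)
Lemma cholesky_unit (g s : nat -> R) :
  is_cholesky (submx_on M A A) (bidiag A g s) ->
  submx_on M A A \in unitmx <-> (forall i, i \in A -> g i != 0).
Proof.
move=> [tr _ E]; rewrite unitmxE E det_mulmx det_tr (det_trig tr) unitrM andbb.
rewrite unitfE; split=> [h i iA|h].
  have [k ->] := enum_val_ex iA; move: h; rewrite (bigD1 k) //= mulf_eq0 negb_or.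
  by rewrite bidiagE /bidiag_entry eqxx => /andP[].
by apply/prodf_neq0 => k _; rewrite bidiagE /bidiag_entry eqxx h // enum_valP.
Qed.

(** The factor is given as data here and not as the output of the recurrence; comparing the entries
    of [G G^T] with those of [M] recovers the recurrence for the squares of its diagonal. *)
Lemma pivots_of_cholesky (g s : nat -> R) :
  is_cholesky (submx_on M A A) (bidiag A g s) -> submx_on M A A \in unitmx ->
  forall i, i \in A -> g i != 0 /\
    g i * g i = M i i - LA i * LA i / (g (prf i) * g (prf i)).
Proof.
move=> ch uA; have g0 := (cholesky_unit ch).1 uA; have [_ _ E] := ch.
move=> a aA; split; first exact: g0.
have EE (k l : 'I_#|A|) : M (enum_val k) (enum_val l) =
    (bidiag A g s *m (bidiag A g s)^T) k l by rewrite -E mxE.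
have [k ak] := enum_val_ex aA.
have := EE k k; rewrite bidiag_mulT // eqxx -ak => ->.
have off b : consec A b a -> M a b = s a * g b.
  move=> cb; have bA : b \in A by case/and4P: cb.
  have [l bl] := enum_val_ex bA; have := EE k l.
  have ba := consec_lt cb; rewrite bidiag_mulT -?ak -?bl ?(ltnW ba) //.
  rewrite -?ak -?bl cb => ->; case: eqP => // e; by rewrite e ltnn in ba.
have [[j [cj jA -> ->]]|[no ->]] := lA aA.
  have cA := consec_sub AV cj jA aA.
  have -> : [exists b, consec A b a] by apply/existsP; exists j.
  by have gj := g0 j jA; rewrite (off j cA); field.
case: existsP => [[b cb]|_]; last by rewrite !mul0r; ring.
have bA : b \in A by case/and4P: cb.
suff -> : s a = 0 by ring.
have /eqP := off b cb; rewrite (sym_entry a b sM) (tV (subsetP AV _ bA) (subsetP AV _ aA) (consec_lt cb)) ?no //.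
by rewrite eq_sym mulf_eq0 (negbTE (g0 b bA)) orbF => /eqP.
Qed.
End Cholesky.
Lemma links_cmp (V : {set 'I_n}) (M : 'M[R]_n) prf nxf (L U : nat -> R) :
  links V M prf nxf L U ->
  links V (cmp_mx M) prf nxf (fun k : nat => - `|L k|) (fun k : nat => - `|U k|).
Proof.
move=> lk i iV; have [a b] := lk i iV; split.
  case: a => [[j [c pj Lj]]|[no ->]]; [left|by right; rewrite normr0 oppr0].
  exists j; split=> //; rewrite Lj mxE; case: eqP => // ij.
  by have := consec_lt c; rewrite ij ltnn.
case: b => [[j [c pj Uj]]|[no ->]]; [left|by right; rewrite normr0 oppr0].
exists j; split=> //; rewrite Uj mxE; case: eqP => // ij.
by have := consec_lt c; rewrite ij ltnn.
Qed.

Lemma tri_cmp (V : {set 'I_n}) (M : 'M[R]_n) : tri_on V M -> tri_on V (cmp_mx M).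
Proof.
move=> tV i j iV jV ij c; rewrite mxE tV // normr0 oppr0.
by case: eqP => // ij'; rewrite ij' ltnn in ij.
Qed.

End Links.

(** * The positive vector [d] from recurrences along the chain *)

Section ParametricVector.
Variables (R : realType) (n : nat) (P : qp R n).
Variables (prf nxf : nat -> nat) (L U e y d : nat -> R) (t : R).
Hypotheses (wP : wfqp P) (lk : links (vars P) (mat P) prf nxf L U).
Let V := vars P.
Let M := mat P.
Hypothesis eE : forall i : 'I_n, i \in V -> e i = M i i - L i * L i / e (prf i).
Hypothesis tE : (t = 0 /\ exists2 i : 'I_n, i \in V & e i = 0) \/
  (t = 1 /\ forall i : 'I_n, i \in V -> e i != 0).
Hypothesis yE : forall i : 'I_n, i \in V -> y i = t + `|L i| / e (prf i) * y (prf i).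
Hypothesis dE : forall i : 'I_n, i \in V ->
  d i = if e i == 0 then 1 else (y i + `|U i| * d (nxf i)) / e i.
Implicit Types i j k : 'I_n.

Let sM : symmetric_mx M := wf_sym wP.
Let pM : pos_semidef M := wf_psd wP.
Let cM : chain_on V M := wf_chain wP.
Let tV : tri_on V M := chain_tri cM.
Let lV : links_in V V M prf L := links_self lk.

Let e0 i : i \in V -> 0 <= e i.
Proof. exact: (pivots_ge0 sM pM tV (subxx _) lV eE). Qed.

(** Every link of a chain is nonzero, so only the last index can have a zero pivot. *)
Let elast i j : i \in V -> consec V i j -> e i != 0.
Proof.
move=> iV c; apply/eqP => ei.
have /and4P[_ jV ij _] := c; have : M i j != 0 by rewrite cM.
by rewrite (pivots_eq0 sM pM tV (subxx _) lV eE iV c ei) eqxx.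
Qed.

Let t0 : 0 <= t.
Proof. by case: tE => -[->]. Qed.

Let y_ge i : i \in V -> t <= y i.
Proof.
have [k] := ubnP (i : nat); elim: k i => // k IH i ik iV.
rewrite yE // lerDl; case: (lV iV) => [[j [c jV -> _]]|[_ ->]]; last first.
  by rewrite normr0 !mul0r.
rewrite mulr_ge0 ?divr_ge0 ?normr_ge0 ?e0 // (le_trans t0) // IH //.
by apply: leq_trans (consec_lt c) _.
Qed.

Let y_eq0 i : t = 0 -> i \in V -> y i = 0.
Proof.
move=> t00; have [k] := ubnP (i : nat); elim: k i => // k IH i ik iV.
rewrite yE // t00 add0r; case: (lV iV) => [[j [c jV -> _]]|[_ ->]]; last first.
  by rewrite normr0 !mul0r.
by rewrite IH ?mulr0 //; apply: leq_trans (consec_lt c) _.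
Qed.

Let d_pos i : i \in V -> 0 < d i.
Proof.
have [k] := ubnP (n - i)%N; elim: k i => // k IH i ik iV.
rewrite dE //; have [//|ei] := eqVneq (e i) 0.
apply: divr_gt0; last by rewrite lt_def ei e0.
have yi := y_ge iV.
have [_ [[j [c -> Uj]]|[no Ui]]] := lk iV.
  have /and4P[_ jV ij _] := c.
  have dj : 0 < d j by apply: IH => //; have := ltn_ord j; lia.
  have : 0 < `|U i| * d j.
    by rewrite mulr_gt0 // normr_gt0 Uj cM.
  by have := t0; lra.
(* Without a successor [i] is the last index, and its pivot is nonzero. No other pivot can vanish,
   so [t = 1]. *)
rewrite Ui normr0 mul0r addr0; apply: lt_le_trans yi.
case: tE => [[_ [l lV' el]]|[-> //]].
have [h|h|/ord_inj h] := ltngtP i l.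
- by have [j c _] := consec_up iV lV' h; have := no j; rewrite c.
- by have [j c _] := consec_up lV' iV h; have := elast lV' c; rewrite el eqxx.
by rewrite h el eqxx in ei.
Qed.

Let D : 'cV[R]_n := \col_i if i \in V then d i else 0.

Let lC : links V (cmp_mx M) prf nxf (fun k : nat => - `|L k|) (fun k : nat => - `|U k|) :=
  links_cmp lk.
Let tC : tri_on V (cmp_mx M) := tri_cmp tV.

(** The comparison matrix has the pivots of [M], because links enter squared. At a zero pivot [d] is
    set to 1; the equation there reduces to [y = 0], which holds since [t = 0] in this case. *)
Let cmpD i : i \in V -> (cmp_mx M *m D) i 0 = t.
Proof.
move=> iV; have sC := cmp_sym sM.
have DE j : j \in V -> d j = D j 0 by move=> jV; rewrite mxE jV.
have sD : supported V D by move=> j jV; rewrite mxE (negbTE jV).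
rewrite (tri_mul sC tC lC sD DE iV).
have lS := links_self lC.
apply: (tri_solve (A := V) (v := e) (y := y) sC (subxx _) lC lS) => //.
- move=> j jV; rewrite eE // !mulrNN; congr (_ - _ / _); first by rewrite mxE eqxx.
  by rewrite -normrM ger0_norm // -expr2 sqr_ge0.
- by move=> j jV; rewrite yE // !mulNr opprK.
- move=> j jV; rewrite dE // mulNr opprK; have [ej|ej] := eqVneq (e j) 0.
    have t00 : t = 0.
      by case: tE => [[]|[_ /(_ j jV)]] //; rewrite ej eqxx.
    have [_ [[k [c _ _]]|[_ ->]]] := lk jV; last by rewrite ej y_eq0 // normr0 !mul0r addr0.
    by have := elast jV c; rewrite ej eqxx.
  by rewrite mulrC divfK.
- by move=> j jV; rewrite jV.
by move=> j k jV c ej; have := elast jV c; rewrite ej eqxx.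
Qed.

(** For [t = 0] the comparison matrix is singular and [D] is its kernel vector with last component
    1. For [t = 1] it is nonsingular and [D] is the preimage of the all-ones vector. *)
Lemma valid_d_col : valid_d P D.
Proof.
have sD : supported V D by move=> j jV; rewrite mxE (negbTE jV).
split=> [i iV|i iV|].
- by rewrite mxE -/V iV d_pos.
- by rewrite cmpD.
case: tE => [[t00 [l lV' el]]|[t1 en]]; [left|right].
  split=> // [i iV|i [iV im]]; first by rewrite cmpD.
  have li : (l <= i)%N by apply: im.
  rewrite mxE -/V iV dE //; suff -> : i = l by rewrite el eqxx.
  apply/eqP; rewrite -val_eqE eqn_leq li andbT leqNgt; apply/negP => h.
  by have [j c _] := consec_up lV' iV h; have := elast lV' c; rewrite el eqxx.
have [s gM] := wf_sgn wP.
have sC := cmp_sym sM; have pC := cmp_psd gM pM.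
have lS := links_self lC.
have ch : is_cholesky (submx_on (cmp_mx M) V V)
    (bidiag V (fun k : nat => Num.sqrt (e k)) (fun k : nat => - `|L k| / Num.sqrt (e (prf k)))).
  apply: (cholesky_of_pivots sC pC tC (subxx _) lS (v := e)) => // i iV.
  rewrite eE // !mulrNN mxE eqxx; congr (_ - _ / _).
  by rewrite -normrM ger0_norm // -expr2 sqr_ge0.
have uC : submx_on (cmp_mx M) V V \in unitmx.
  apply/(cholesky_unit ch) => i iV.
  by rewrite sqrtr_eq0 -ltNge lt_def en //= e0.
have pd := unit_pd sC pC uC; split=> [f [sf f0 f1]|].
  have [i0 i0V] := wf_ne wP.
  case: (arg_maxnP (fun i : 'I_n => i : nat) i0V) => i iV im.
  have : f i 0 = 0.
    suff -> : f = 0 by rewrite mxE.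
    apply: pd => //; rewrite /bil (dot_supp _ sf) big1 // => j jV.
    by rewrite f0 // mulr0.
  by rewrite f1 => [/eqP|]; rewrite ?oner_eq0 //; split.
split=> //; exists (const_mx 1) => [k|]; first by rewrite mxE.
rewrite -[LHS](mulKmx uC) submx_on_mul //; congr (_ *m _).
by apply/colP => k; rewrite selE cmpD ?enum_valP // [RHS]mxE.
Qed.
End ParametricVector.

(** * Existence of the vector [d] *)

Section Existence.
Variable R : realType.

(** The steps of the PPPA are defined without a machine, so the recurrences behind [valid_d_col]
    have to be solvable in their own right. *)
Lemma fixpoint_up (T : Type) (n : nat) (F : (nat -> T) -> nat -> T) (g0 : nat -> T) :
  (forall g g' i, (i < n)%N -> (forall j, (j < i)%N -> g j = g' j) -> F g i = F g' i) ->
  exists g, forall i, (i < n)%N -> g i = F g i.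
Proof.
elim: n => [|n IH] loc; first by exists g0.
have [g gE] : exists g, forall i, (i < n)%N -> g i = F g i.
  by apply: IH => g g' i iN; apply: loc; apply: ltnW.
exists (fun i => if i == n then F g n else g i) => i.
rewrite ltnS leq_eqVlt => /orP[/eqP ->|iN].
  by rewrite eqxx; apply: loc => // j jn; rewrite (ltn_eqF jn).
rewrite (ltn_eqF iN) gE //; apply: loc; first exact: ltnW.
by move=> j ji; rewrite (ltn_eqF (ltn_trans ji iN)).
Qed.

Lemma fixpoint_down (T : Type) (n : nat) (F : (nat -> T) -> nat -> T) (g0 : nat -> T) :
  (forall g g' i, (i < n)%N -> (forall j, (i < j)%N -> g j = g' j) -> F g i = F g' i) ->
  exists g, forall i, (i < n)%N -> g i = F g i.
Proof.
move=> loc.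
have [k] := ubnP 0%N.
suff H m : (m <= n)%N -> exists g, forall i, (n - m <= i < n)%N -> g i = F g i.
  by have [g gE] := H n (leqnn n); exists g => i iN; apply: gE; rewrite subnn.
elim: m => [|m IH] mn; first by exists g0 => i; rewrite subn0; lia.
have [g gE] := IH (ltnW mn); set a := (n - m.+1)%N.
have an : (a < n)%N by rewrite /a; lia.
exists (fun i => if i == a then F g a else g i) => i /andP[ai iN].
have [->|ia] := eqVneq i a.
  by apply: loc => // j ja; rewrite (gtn_eqF ja).
rewrite gE; last by move: ai ia; rewrite /a; lia.
apply: loc => // j ij; suff -> : (j == a) = false by [].
by apply/eqP; move: ai; rewrite /a; lia.
Qed.

Lemma links_ex n (V : {set 'I_n}) (M : 'M[R]_n) :
  exists prf nxf L U, links V M prf nxf L U.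
Proof.
pose prf k := if [pick j : 'I_n | [exists i : 'I_n, (i == k :> nat) && consec V j i]]
  is Some j then nat_of_ord j else 0%N.
pose nxf k := if [pick j : 'I_n | [exists i : 'I_n, (i == k :> nat) && consec V i j]]
  is Some j then nat_of_ord j else 0%N.
(* A sum reads the entry at a natural index, with value 0 where there is none. *)
pose L k : R := \sum_(i : 'I_n | i == k :> nat) \sum_(j | consec V j i) M i j.
pose U k : R := \sum_(i : 'I_n | i == k :> nat) \sum_(j | consec V i j) M i j.
have s1 (F : 'I_n -> R) (i : 'I_n) : \sum_(a : 'I_n | a == i :> nat) F a = F i.
  by rewrite (eq_bigl (fun a => a == i)) // big_pred1_eq.
exists prf, nxf, L, U => i iV; rewrite /L /U !s1; split.
- case: (pickP (fun j => consec V j i)) => [j c|no]; [left|right].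
    exists j; split=> //.
      rewrite /prf; case: pickP => [j' /existsP[i' /andP[/eqP/ord_inj-> c']]|].
        by rewrite (consec_inj c' c).
      by move=> /(_ j)/existsP[]; exists i; rewrite eqxx c.
    rewrite (bigD1 j) //= big1 ?addr0 // => k /andP[ck kj].
    by rewrite (consec_inj ck c) eqxx in kj.
  by split=> [j|]; [rewrite no|rewrite big_pred0].
case: (pickP (fun j => consec V i j)) => [j c|no]; [left|right].
  exists j; split=> //.
    rewrite /nxf; case: pickP => [j' /existsP[i' /andP[/eqP/ord_inj-> c']]|].
      by rewrite (consec_inj_up c' c).
    by move=> /(_ j)/existsP[]; exists i; rewrite eqxx c.
  rewrite (bigD1 j) //= big1 ?addr0 // => k /andP[ck kj].
  by rewrite (consec_inj_up ck c) eqxx in kj.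
by split=> [j|]; [rewrite no|rewrite big_pred0].
Qed.

Lemma valid_d_ex n (P : qp R n) : wfqp P -> (forall i, ~ zero_block P i) ->
  exists d, valid_d P d.
Proof.
move=> wP nz; have [prf [nxf [L [U lk]]]] := links_ex (vars P) (mat P).
pose iV (k : nat) := [exists a : 'I_n, (a == k :> nat) && (a \in vars P)].
have iVE (i : 'I_n) : iV i = (i \in vars P).
  apply/existsP/idP => [[a /andP[/eqP/ord_inj-> //]]|iP].
  by exists i; rewrite eqxx.
have iVP k : iV k -> exists2 i : 'I_n, k = i & i \in vars P.
  by move=> /existsP[i /andP[/eqP ik iP]]; exists i.
have up (a b : nat -> R) : (forall k, L k = 0 -> b k = 0) ->
    exists g : nat -> R, forall i : 'I_n, i \in vars P -> g i = a i + b i * g (prf i).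
  move=> b0; have [|g gE] := @fixpoint_up R n
    (fun g k => if iV k then a k + b k * g (prf k) else 0) (fun _ => 0).
    move=> g g' k _ gg; case: ifP => // /iVP[i ki iP]; rewrite ki in gg *.
    have [[[j [cj pj _]]|[_ /b0 ->]] _] := lk i iP; last by rewrite !mul0r.
    by rewrite pj gg // (consec_lt cj).
  by exists g => i iP; rewrite gE // iVE iP.
have [|e eE] := @fixpoint_up R n (fun g k => if iV k then
   \sum_(i : 'I_n | i == k :> nat) mat P i i - L k * L k / g (prf k) else 0) (fun _ => 0).
  move=> g g' k _ gg; case: ifP => // /iVP[i ki iP]; rewrite ki in gg *.
  have [[[j [cj pj _]]|[_ ->]] _] := lk i iP; last by rewrite !mul0r.
  by rewrite pj gg // (consec_lt cj).
have {}eE (i : 'I_n) : i \in vars P -> e i = mat P i i - L i * L i / e (prf i).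
  move=> iP; rewrite eE // iVE iP (eq_bigl (fun a => a == i)) ?big_pred1_eq //.
have [t tE] : exists t : R, (t = 0 /\ exists2 i : 'I_n, i \in vars P & e i = 0) \/
    (t = 1 /\ forall i : 'I_n, i \in vars P -> e i != 0).
  case: (pickP [pred i : 'I_n | (i \in vars P) && (e i == 0)]) => [i /andP[iP /eqP ei]|no].
    by exists 0; left; split=> //; exists i.
  exists 1; right; split=> // i iP; have := no i; rewrite /= iP => /negbT.
  by [].
have [|y yE] := up (fun _ => t) (fun k => `|L k| / e (prf k)).
  by move=> k ->; rewrite normr0 mul0r.
have [|d dE] := @fixpoint_down R n (fun g k => if iV k then
   (if e k == 0 then 1 else (y k + `|U k| * g (nxf k)) / e k) else 0) (fun _ => 0).
  move=> g g' k _ gg; case: ifP => // /iVP[i ki iP]; rewrite ki in gg *.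
  have [_ [[j [cj pj _]]|[_ ->]]] := lk i iP; last by rewrite normr0 !mul0r.
  by rewrite pj gg // (consec_lt cj).
exists (\col_i if i \in vars P then d i else 0).
have {}dE (i : 'I_n) : i \in vars P ->
    d i = if e i == 0 then 1 else (y i + `|U i| * d (nxf i)) / e i.
  by move=> iP; rewrite dE // iVE iP.
exact: (valid_d_col wP lk eE tE yE dE).
Qed.
End Existence.

(** * Absence of stuck configurations *)

Section Progress.
Variables (R : realType) (n : nat) (M : 'M[R]_n) (q : 'cV[R]_n).
Variable (u : 'I_n -> \bar R).
Hypotheses (tM : tridiagonal M) (sM : symmetric_mx M) (pM : pos_semidef M).
Hypothesis (u0 : forall i, (0 < u i)%E).

Lemma ready_ex (P : qp R n) d : wfqp P -> valid_d P d ->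
  (forall i, i \in vars P -> param_vec P d i 0 = 0 -> 0 <= lin P i 0) ->
  exists2 t0, 0 < t0
    & forall i, i \in vars P -> 0 <= lin P i 0 + t0 * param_vec P d i 0.
Proof.
move=> wP vd h.
pose f (i : 'I_n) : R := `|lin P i 0 / param_vec P d i 0|.
have f0 i : 0 <= f i by apply: normr_ge0.
(* This exceeds every ratio [|q_i / p_i|], and the summand 1 makes it positive. *)
exists (1 + \sum_i f i); first by rewrite ltr_pwDl // sumr_ge0.
move=> i iV; have p0 := valid_p_ge0 wP vd iV.
have [pi|pi] := eqVneq (param_vec P d i 0) 0; first by rewrite pi mulr0 addr0 h.
have ppos : 0 < param_vec P d i 0 by rewrite lt_def pi.
have fi : f i <= 1 + \sum_i f i.
  rewrite (bigD1 i) //=; have : 0 <= \sum_(j | j != i) f j by apply: sumr_ge0.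
  by lra.
have : `|lin P i 0| <= (1 + \sum_i f i) * param_vec P d i 0.
  rewrite -ler_pdivrMr //; apply: le_trans fi.
  by rewrite /f normf_div (gtr0_norm ppos).
by rewrite ler_norml => /andP[]; lra.
Qed.

Lemma progress (c : config R n) : config_ok M q u c ->
  (exists c', step M q u c c') \/ exists2 a, c = Answered a & resolves M q u a.
Proof.
case: c => [[|S todo] x|todo P rec|todo P rec d p|todo P rec p A B C|a] ic.
- by left; eexists; apply: step_finish.
- by left; eexists; apply: step_block.
- left; have [_ wP _] := ic.
  case: (pickP [pred i : 'I_n | (vars P == [set i]) && (mat P i i == 0)]) => [i|no].
    move=> /andP[/eqP vP /eqP mii]; have zi : zero_block P i by [].
    have [li|li] := leP 0 (lin P i 0); first by eexists; apply: step_inspect_lower zi li.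
    have := wf_ub wP i; case E : (ub P i) => [v| |] // _.
      by eexists; apply: step_inspect_upper zi li E.
    by eexists; apply: step_inspect_ray zi li E.
  have nz i : ~ zero_block P i.
    by move=> [vP mii]; have := no i; rewrite /= vP mii !eqxx.
  by have [d vd] := valid_d_ex wP nz; eexists; apply: step_prepare vd.
- left; have [[_ wP _] [nz vd pE]] := ic; rewrite pE.
  case: (pickP [pred i : 'I_n | [&& i \in vars P, param_vec P d i 0 == 0 & lin P i 0 < 0]]) => [i|no].
    move=> /and3P[iV /eqP p0 li].
    have := wf_ub wP i; case E : (ub P i) => [v| |] // _.
      by eexists; apply: step_reflect E.
    by eexists; apply: step_eliminate E.
  have [|t0 t00 rt] := ready_ex wP vd; last by eexists; apply: step_ready; exists t0.
  move=> i iV p0; rewrite leNgt; apply/negP => li; have := no i.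
  by rewrite /= iV p0 eqxx li.
- left; have [[_ wP _] [[d [vd pE]] ok]] := ic; rewrite pE in ok *.
  have [pt _ pA _] := ok; have AV := part3_sub pt.
  have [t [st tE]] := tau_new_ex P (param_vec P d) A B C.
  have [t00 _ _ att] := st; case: att => [t0|[i ci iE]|[i ci iE]].
  + by eexists; apply: step_optimal; rewrite tE t0.
  + have [tz|tz] := eqVneq t 0; first by eexists; apply: step_optimal; rewrite tE tz.
    have tpos : (0 < tau_new P (param_vec P d) A B C)%E by rewrite tE lte_fin lt_def tz.
    eexists; apply: step_pivot tpos (pivot_diagonal (i := i) _ _).
      by split; rewrite // tE -iE.
    have /andP[iB pi] := ci; apply: (valid_schur wP vd AV pA) => //.
      by rewrite -(part3_U pt) !inE iB orbT.
    by have := pt i; rewrite iB; case: (i \in A) => //; case: (i \in C); case: (i \in vars P).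
  have [tz|tz] := eqVneq t 0; first by eexists; apply: step_optimal; rewrite tE tz.
  have tpos : (0 < tau_new P (param_vec P d) A B C)%E by rewrite tE lte_fin lt_def tz.
  by eexists; apply: step_pivot tpos (pivot_upper (i := i) _); split; rewrite // tE -iE.
by right; exists a.
Qed.

Lemma pppa_steps_bound (c : config R n) cs : initial M c -> steps M q u c cs ->
  (size cs <= 1 + 12 * n)%N /\
  ((forall c', ~ step M q u (last c cs) c') ->
   exists2 a, last c cs = Answered a & resolves M q u a).
Proof.
move=> ini st; have [ic le] := initial_inv q sM u0 ini.
have [il le'] := steps_inv tM sM pM u0 ic st; split; first by move: le le'; lia.
by move=> stuck; have [[c' sc]|//] := progress il; have := stuck _ sc.
Qed.
End Progress.

(** * Execution and cost of commands *)

Section Machine.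
Variable R : rcfType.
Implicit Types (m : memory R) (s : machine R) (c : cmd).

Definition naset (a : nat) (g : nat -> nat) m : memory R :=
  Memory (fun a' => if Nat.eqb a' a then g else nmem m a') (rmem m).

Definition raset (a : nat) (g : nat -> R) m : memory R :=
  Memory (nmem m) (fun a' => if Nat.eqb a' a then g else rmem m a').

Definition put (T : Type) (f : nat -> T) (i : nat) (v : T) : nat -> T :=
  fun j => if j == i then v else f j.

(** The memory component of [exec], without clock and log: correctness is argued on [run], cost only
    on the syntax. *)
Fixpoint run c m : memory R :=
  match c with
  | Skip => m
  | Seq c1 c2 => run c2 (run c1 m)
  | NSet a i e => naset a (put (nmem m a) (nval m i) (nval m e)) m
  | RSet a i e => raset a (put (rmem m a) (nval m i) (rval m e)) m
  | If b c1 c2 => if bval m b then run c1 m else run c2 m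
  | For a e c1 =>
      iteri (nval m e) (fun k m' => run c1 (naset a (put (nmem m' a) 0 k) m')) m
  | Probe _ => m
  end.

Lemma run_seq c1 c2 m : run (Seq c1 c2) m = run c2 (run c1 m).
Proof. by []. Qed.

Lemma natEqbE (a b : nat) : Nat.eqb a b = (a == b).
Proof. by apply/idP/eqP => [/PeanoNat.Nat.eqb_eq|->]; last exact: PeanoNat.Nat.eqb_refl. Qed.

Lemma upd_put (T : Type) (f : nat -> nat -> T) a i v :
  upd f a i v = fun a' => if Nat.eqb a' a then put (f a) i v else f a'.
Proof.
apply: functional_extensionality => a'; apply: functional_extensionality => j.
by rewrite /upd natEqbE /put; case: eqP => [->|].
Qed.

Lemma store_exec c s : store (exec c s) = run c (store s).
Proof.
elim: c s => //= [c1 IH1 c2 IH2|a i e|a i e|b c1 IH1 c2 IH2|a e c1 IH] s.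
- by rewrite IH2 IH1.
- by rewrite /nstore /= upd_put.
- by rewrite /rstore /= upd_put.
- by case: ifP => _; rewrite ?IH1 ?IH2.
rewrite -[RHS]/(iteri _ _ (store (tick (ncost e).+1 s))).
elim: (nval _ e) (tick _ s) => //= k IHk s'.
by rewrite IH /nstore /= upd_put IHk.
Qed.

Fixpoint nwrites c : seq nat :=
  match c with
  | Seq c1 c2 | If _ c1 c2 => nwrites c1 ++ nwrites c2
  | NSet a _ _ => [:: a]
  | For a _ c1 => a :: nwrites c1
  | _ => [::]
  end.

Fixpoint rwrites c : seq nat :=
  match c with
  | Seq c1 c2 | If _ c1 c2 => rwrites c1 ++ rwrites c2
  | RSet a _ _ => [:: a]
  | For _ _ c1 => rwrites c1
  | _ => [::]
  end.

Lemma run_nframe c m a : a \notin nwrites c -> nmem (run c m) a = nmem m a.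
Proof.
elim: c m => //= [c1 IH1 c2 IH2|b i e|b c1 IH1 c2 IH2|b e c1 IH] m.
- by rewrite mem_cat negb_or => /andP[h1 h2]; rewrite IH2 // IH1.
- by rewrite inE natEqbE => /negbTE ->.
- by rewrite mem_cat negb_or => /andP[h1 h2]; case: ifP => _; rewrite ?IH1 ?IH2.
rewrite in_cons negb_or => /andP[/negbTE ab h].
elim: (nval m e) => //= k IHk; rewrite IH //= natEqbE ab; exact: IHk.
Qed.

Lemma run_rframe c m a : a \notin rwrites c -> rmem (run c m) a = rmem m a.
Proof.
elim: c m => //= [c1 IH1 c2 IH2|b i e|b c1 IH1 c2 IH2|b e c1 IH] m.
- by rewrite mem_cat negb_or => /andP[h1 h2]; rewrite IH2 // IH1.
- by rewrite inE natEqbE => /negbTE ->.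
- by rewrite mem_cat negb_or => /andP[h1 h2]; case: ifP => _; rewrite ?IH1 ?IH2.
by move=> h; elim: (nval m e) => //= k IHk; rewrite IH.
Qed.

Lemma run_nsub (l : seq nat) c m b : all (mem l) (nwrites c) -> b \notin l ->
  nmem (run c m) b = nmem m b.
Proof.
by move=> /allP h bl; apply: run_nframe; apply: contra bl; apply: h.
Qed.

Lemma run_rsub (l : seq nat) c m b : all (mem l) (rwrites c) -> b \notin l ->
  rmem (run c m) b = rmem m b.
Proof.
by move=> /allP h bl; apply: run_rframe; apply: contra bl; apply: h.
Qed.

Definition cells : nexp := NGet nSize (NLit 0).

(** Every loop runs over the size cell, which nothing overwrites, so each loop makes [n] iterations
    whatever the data. *)
Fixpoint sized c : bool :=
  match c with
  | Seq c1 c2 | If _ c1 c2 => sized c1 && sized c2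
  | For a (NGet 0 (NLit 0)) c1 => (a != nSize) && sized c1
  | For _ _ _ => false
  | NSet a _ _ => a != nSize
  | _ => true
  end.

Fixpoint silent c : bool :=
  match c with
  | Seq c1 c2 | If _ c1 c2 => silent c1 && silent c2
  | For _ _ c1 => silent c1
  | Probe _ => false
  | _ => true
  end.

Fixpoint depth c : nat :=
  match c with
  | Seq c1 c2 | If _ c1 c2 => maxn (depth c1) (depth c2)
  | For _ _ c1 => (depth c1).+1
  | _ => 0
  end.

Fixpoint weight c : nat :=
  match c with
  | Skip | Probe _ => 0
  | Seq c1 c2 => weight c1 + weight c2
  | NSet a i e => (ncost i + ncost e).+1
  | RSet a i e => (ncost i + rcost e).+1
  | If b c1 c2 => (bcost b).+1 + (weight c1 + weight c2)
  | For _ e c1 => (ncost e).+2 + weight c1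
  end.

Lemma silent_log c s : silent c -> log (exec c s) = log s.
Proof.
elim: c s => //= [c1 IH1 c2 IH2|b c1 IH1 c2 IH2|b e c1 IH] s.
- by move=> /andP[h1 h2]; rewrite IH2 // IH1.
- by move=> /andP[h1 h2]; case: ifP => _; rewrite ?IH1 ?IH2.
move=> h; rewrite -[RHS]/(log (tick (ncost e).+1 s)).
by elim: (nval _ e) (tick _ s) => //= k IHk s'; rewrite IH //= IHk.
Qed.

Lemma sized_nsize c m : sized c -> nmem (run c m) nSize = nmem m nSize.
Proof.
elim: c m => //= [c1 IH1 c2 IH2|b i e|b c1 IH1 c2 IH2|b e c1 IH] m.
- by move=> /andP[h1 h2]; rewrite IH2 // IH1.
- by case: b.
- by move=> /andP[h1 h2]; case: ifP => _; rewrite ?IH1 ?IH2.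
case: e => // -[//|] [] // [] //= /andP[b0 h].
by elim: (nmem m 0 0) => //= k IHk; rewrite IH //=; case: b b0 IHk.
Qed.

(** [weight] counts the body of a loop once and both branches of a test; each level of nesting
    contributes a factor [n]. *)
Lemma sized_clock c s n : (0 < n)%N -> sized c -> nmem (store s) nSize 0 = n ->
  (clock (exec c s) <= clock s + weight c * n ^ depth c)%N.
Proof.
move=> n0; have pw d d' w w' : (w * n ^ d + w' * n ^ d' <= (w + w') * n ^ maxn d d')%N.
  by rewrite mulnDl leq_add // leq_mul2l leq_pexp2l ?leq_maxl ?leq_maxr ?orbT.
elim: c s => [|c1 IH1 c2 IH2|a i e|a i e|b c1 IH1 c2 IH2|b e c1 IH|k] s /=.
- by rewrite mul0n addn0.
- move=> /andP[h1 h2] sz; apply: leq_trans (IH2 _ h2 _) _.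
    by rewrite store_exec sized_nsize.
  apply: leq_trans (leq_add (IH1 _ h1 sz) (leqnn _)) _.
  by rewrite -addnA leq_add2l pw.
- by rewrite expn0 muln1.
- by rewrite expn0 muln1.
- move=> /andP[h1 h2] sz.
  have step w d : (w * n ^ d <= (weight c1 + weight c2) * n ^ maxn (depth c1) (depth c2))%N ->
     (clock s + (bcost b).+1 + w * n ^ d <=
      clock s + (bcost b + (weight c1 + weight c2)).+1 * n ^ maxn (depth c1) (depth c2))%N.
    move=> le; rewrite -addnA leq_add2l -addSn mulnDl leq_add //.
    by rewrite -{1}[_.+1]muln1 leq_mul2l expn_gt0 n0.
  case: ifP => _.
    apply: leq_trans (IH1 _ h1 _) _ => //=; apply: step.
    by apply: leq_trans (pw _ _ _ _); apply: leq_addr.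
  apply: leq_trans (IH2 _ h2 _) _ => //=; apply: step.
  by apply: leq_trans (pw _ _ _ _); apply: leq_addl.
- case: e => // -[//|] [] // [] //= /andP[b0 h] sz; rewrite sz.
  set F := fun k s' => exec c1 _; set s0 := tick _ s.
  have sz0 : nmem (store s0) nSize 0 = n by [].
  have H j : (clock (iteri j F s0) <= clock s0 + j * (1 + weight c1 * n ^ depth c1))%N /\
      nmem (store (iteri j F s0)) nSize 0 = n.
    elim: j => [|k [IHk IHsz]]; first by rewrite mul0n addn0.
    have szk : nmem (store (tick 1 (nstore b 0 k (iteri k F s0)))) nSize 0 = n.
      by rewrite /= /upd eq_sym (negbTE b0).
    rewrite [iteri _ _ _]/= {1}/F; split.
      apply: leq_trans (IH _ h szk) _; rewrite /= mulSn.
      rewrite -addnA; apply: leq_trans (leq_add IHk (leqnn _)) _.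
      by rewrite -addnA leq_add2l addnC.
    by rewrite store_exec sized_nsize.
  have [le _] := H n; apply: leq_trans le _; rewrite /s0 /= -addnA leq_add2l.
  (* Entering the loop costs 3 and each iteration 1; the weight [4 + w] of the loop absorbs both, as
     [n] and [x] are positive. *)
  have key x w : (0 < x)%N -> (3 + n * (1 + w * x) <= (4 + w) * (n * x))%N.
    move=> x0; have h1 : (n <= n * x)%N by rewrite leq_pmulr.
    have -> : ((4 + w) * (n * x) = 4 * (n * x) + n * (w * x))%N by lia.
    by rewrite mulnDr muln1; lia.
  by rewrite expnS; apply: key; rewrite expn_gt0 n0.
by rewrite mul0n addn0.
Qed.

End Machine.

Local Open Scope nat_scope.

(** * Array fills *)

(* A fill stores in each entry of an array the value of a decision tree in the
   current memory.  When the tree reads its own array only at indices already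
   visited, the final memory satisfies the tree equation at every index.  Cell 0
   of array 5 holds the index, array 6 the counter of the decreasing loops. *)
Definition idx : nexp := NGet 5 (NLit 0).

Inductive ntree := NLeaf of nexp | NNode of bexp & ntree & ntree.
Inductive rtree := RLeaf of rexp | RNode of bexp & rtree & rtree.

Inductive fill := NFill of bool & nat & ntree | RFill of bool & nat & rtree.

Fixpoint ntcmd a (t : ntree) : cmd :=
  match t with
  | NLeaf e => NSet a idx e
  | NNode b t1 t2 => If b (ntcmd a t1) (ntcmd a t2)
  end.

Fixpoint rtcmd a (t : rtree) : cmd :=
  match t with
  | RLeaf e => RSet a idx e
  | RNode b t1 t2 => If b (rtcmd a t1) (rtcmd a t2)
  end.

Definition loop (down : bool) (c : cmd) : cmd :=
  if down then
    For 6 cells (Seq (NSet 5 (NLit 0)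
                        (NSub (NSub cells (NLit 1)) (NGet 6 (NLit 0)))) c)
  else For 5 cells c.

Definition fcmd (f : fill) : cmd :=
  match f with
  | NFill down a t => loop down (ntcmd a t)
  | RFill down a t => loop down (rtcmd a t)
  end.

Fixpoint prog (fs : seq fill) : cmd :=
  if fs is f :: fs' then Seq (fcmd f) (prog fs') else Skip.

(** Array 5 is read at cell 0 only and array 6 never, so the value does not depend on what the loop
    counters leave behind. *)
Fixpoint nfine (e : nexp) : bool :=
  match e with
  | NLit _ => true
  | NGet a i => if a == 5 then (if i is NLit 0 then true else false)
                else (a != 6) && nfine i
  | NAdd e1 e2 | NSub e1 e2 => nfine e1 && nfine e2
  end.

Fixpoint rfine (e : rexp) : bool :=
  match e with
  | RLit _ => true
  | RGet _ i => nfine i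
  | RAdd e1 e2 | RSub e1 e2 | RMul e1 e2 | RDiv e1 e2 => rfine e1 && rfine e2
  | RSqrt e1 => rfine e1
  end.

Fixpoint bfine (e : bexp) : bool :=
  match e with
  | BLt e1 e2 => nfine e1 && nfine e2
  | BLe e1 e2 => rfine e1 && rfine e2
  | BNot e1 => bfine e1
  | BAnd e1 e2 => bfine e1 && bfine e2
  end.

Fixpoint nnreads (e : nexp) : seq nat :=
  match e with
  | NLit _ => [::]
  | NGet a i => a :: nnreads i
  | NAdd e1 e2 | NSub e1 e2 => nnreads e1 ++ nnreads e2
  end.

Fixpoint rnreads (e : rexp) : seq nat :=
  match e with
  | RLit _ => [::]
  | RGet _ i => nnreads i
  | RAdd e1 e2 | RSub e1 e2 | RMul e1 e2 | RDiv e1 e2 => rnreads e1 ++ rnreads e2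
  | RSqrt e1 => rnreads e1
  end.

Fixpoint rrreads (e : rexp) : seq nat :=
  match e with
  | RLit _ => [::]
  | RGet a _ => [:: a]
  | RAdd e1 e2 | RSub e1 e2 | RMul e1 e2 | RDiv e1 e2 => rrreads e1 ++ rrreads e2
  | RSqrt e1 => rrreads e1
  end.

Fixpoint bnreads (e : bexp) : seq nat :=
  match e with
  | BLt e1 e2 => nnreads e1 ++ nnreads e2
  | BLe e1 e2 => rnreads e1 ++ rnreads e2
  | BNot e1 => bnreads e1
  | BAnd e1 e2 => bnreads e1 ++ bnreads e2
  end.

Fixpoint brreads (e : bexp) : seq nat :=
  match e with
  | BLt e1 e2 => [::]
  | BLe e1 e2 => rrreads e1 ++ rrreads e2
  | BNot e1 => brreads e1
  | BAnd e1 e2 => brreads e1 ++ brreads e2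
  end.

Fixpoint ntfine t := match t with NLeaf e => nfine e
  | NNode b t1 t2 => [&& bfine b, ntfine t1 & ntfine t2] end.
Fixpoint rtfine t := match t with RLeaf e => rfine e
  | RNode b t1 t2 => [&& bfine b, rtfine t1 & rtfine t2] end.
Fixpoint ntnreads t := match t with NLeaf e => nnreads e
  | NNode b t1 t2 => bnreads b ++ ntnreads t1 ++ ntnreads t2 end.
Fixpoint ntrreads t := match t with NLeaf e => [::]
  | NNode b t1 t2 => brreads b ++ ntrreads t1 ++ ntrreads t2 end.
Fixpoint rtnreads t := match t with RLeaf e => rnreads e
  | RNode b t1 t2 => bnreads b ++ rtnreads t1 ++ rtnreads t2 end.
Fixpoint rtrreads t := match t with RLeaf e => rrreads e
  | RNode b t1 t2 => brreads b ++ rtrreads t1 ++ rtrreads t2 end.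

Definition fnreads f := match f with NFill _ _ t => ntnreads t | RFill _ _ t => rtnreads t end.
Definition frreads f := match f with NFill _ _ t => ntrreads t | RFill _ _ t => rtrreads t end.
Definition fntarget f := match f with NFill _ a _ => [:: a] | RFill _ _ _ => [::] end.
Definition frtarget f := match f with NFill _ _ _ => [::] | RFill _ a _ => [:: a] end.

Definition fill_fine f : bool :=
  match f with
  | NFill _ a t => [&& a \notin [:: 0; 5; 6], ntfine t & 6 \notin ntnreads t]
  | RFill _ a t => rtfine t && (6 \notin rtnreads t)
  end.

Definition recursive f : bool :=
  match f with NFill _ a t => a \in ntnreads t | RFill _ a t => a \in rtrreads t end.

(** A later pass spares everything that [f] reads or writes, so the equations of [f] still hold at
    the end. *)
Definition later_ok (f g : fill) : bool :=
  match g with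
  | NFill _ a _ => (a \notin fnreads f) && (a \notin fntarget f)
  | RFill _ a _ => (a \notin frreads f) && (a \notin frtarget f)
  end.

Fixpoint static (fs : seq fill) : bool :=
  if fs is f :: fs' then [&& fill_fine f, all (later_ok f) fs' & static fs'] else true.

Section Fills.
Variable R : rcfType.
Implicit Types (m : memory R) (f : fill) (fs : seq fill).

(** Filling the whole of array 5 is harmless, as [nfine] expressions read only its cell 0. *)
Definition at_ (i : nat) m : memory R := naset 5 (fun _ => i) m.

Fixpoint ntval m t : nat := match t with NLeaf e => nval m e
  | NNode b t1 t2 => if bval m b then ntval m t1 else ntval m t2 end.
Fixpoint rtval m t : R := match t with RLeaf e => rval m e
  | RNode b t1 t2 => if bval m b then rtval m t1 else rtval m t2 end.

Definition eq_at f m (i : nat) : Prop :=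
  match f with
  | NFill _ a t => nmem m a i = ntval (at_ i m) t
  | RFill _ a t => rmem m a i = rtval (at_ i m) t
  end.

Definition before (down : bool) (j i : nat) : bool := if down then (i < j)%N else (j < i)%N.

Definition local n f m : Prop :=
  match f with
  | NFill down a t => forall i (g g' : nat -> nat), (i < n)%N ->
      (forall j, before down j i -> g j = g' j) ->
      ntval (at_ i (naset a g m)) t = ntval (at_ i (naset a g' m)) t
  | RFill down a t => forall i (g g' : nat -> R), (i < n)%N ->
      (forall j, before down j i -> g j = g' j) ->
      rtval (at_ i (raset a g m)) t = rtval (at_ i (raset a g' m)) t
  end.

Fixpoint eqs n fs m : Prop :=
  if fs is f :: fs' then (forall i, (i < n)%N -> eq_at f m i) /\ eqs n fs' m else True.

(** Besides the arrays that are not targets, all cells from [n] on are preserved; the sentinels of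
    the downward scans are stored there. *)
Definition same_off (nts rts : seq nat) n m m' : Prop :=
  [/\ forall b, b \notin nts -> b \notin [:: 5; 6] -> nmem m' b = nmem m b,
      forall b, b \notin rts -> rmem m' b = rmem m b,
      forall b j, (n <= j)%N -> b \notin [:: 5; 6] -> nmem m' b j = nmem m b j
    & forall b j, (n <= j)%N -> rmem m' b j = rmem m b j].

Section Agree.
Variables m m' : memory R.

Lemma nval_agree e : {in nnreads e, forall b, nmem m b = nmem m' b} ->
  nval m e = nval m' e.
Proof.
elim: e => //= [a i IH|e1 IH1 e2 IH2|e1 IH1 e2 IH2] h.
- by rewrite h ?mem_head // IH // => b bi; apply: h; rewrite inE bi orbT.
- by rewrite IH1 1?IH2 // => b bi; apply: h; rewrite mem_cat bi ?orbT.
by rewrite IH1 1?IH2 // => b bi; apply: h; rewrite mem_cat bi ?orbT.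
Qed.

Lemma rval_agree e : {in rnreads e, forall b, nmem m b = nmem m' b} ->
  {in rrreads e, forall b, rmem m b = rmem m' b} -> rval m e = rval m' e.
Proof.
elim: e => //= [a i|e1 IH1 e2 IH2|e1 IH1 e2 IH2|e1 IH1 e2 IH2|e1 IH1 e2 IH2|e IH] hn hr;
  try by rewrite IH1 1?IH2 // => b bi; [apply: hn|apply: hr|apply: hn|apply: hr];
    rewrite mem_cat bi ?orbT.
- by rewrite hr ?mem_head // (nval_agree hn).
by rewrite IH.
Qed.

Lemma bval_agree e : {in bnreads e, forall b, nmem m b = nmem m' b} ->
  {in brreads e, forall b, rmem m b = rmem m' b} -> bval m e = bval m' e.
Proof.
elim: e => //= [e1 e2|e1 e2|e IH|e1 IH1 e2 IH2] hn hr.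
- by rewrite !nval_agree // => b bi; apply: hn; rewrite mem_cat bi ?orbT.
- by rewrite !rval_agree // => b bi; [apply: hn|apply: hr|apply: hn|apply: hr];
    rewrite mem_cat bi ?orbT.
- by rewrite IH.
by rewrite IH1 1?IH2 // => b bi; [apply: hn|apply: hr|apply: hn|apply: hr];
    rewrite mem_cat bi ?orbT.
Qed.

Lemma ntval_agree t : {in ntnreads t, forall b, nmem m b = nmem m' b} ->
  {in ntrreads t, forall b, rmem m b = rmem m' b} -> ntval m t = ntval m' t.
Proof.
elim: t => //= [e|b t1 IH1 t2 IH2] hn hr; first by rewrite (nval_agree hn).
rewrite bval_agree ?IH1 ?IH2 // => k kb; try (by apply: hn; rewrite !mem_cat kb ?orbT);
  by apply: hr; rewrite !mem_cat kb ?orbT.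
Qed.

Lemma rtval_agree t : {in rtnreads t, forall b, nmem m b = nmem m' b} ->
  {in rtrreads t, forall b, rmem m b = rmem m' b} -> rtval m t = rtval m' t.
Proof.
elim: t => //= [e|b t1 IH1 t2 IH2] hn hr; first by rewrite (rval_agree hn).
rewrite bval_agree ?IH1 ?IH2 // => k kb; try (by apply: hn; rewrite !mem_cat kb ?orbT);
  by apply: hr; rewrite !mem_cat kb ?orbT.
Qed.

Hypothesis nE : forall b, b \notin [:: 5; 6] -> nmem m b = nmem m' b.
Hypothesis iE : nmem m 5 0 = nmem m' 5 0.
Hypothesis rE : forall b, rmem m b = rmem m' b.

Lemma nval_fine e : nfine e -> nval m e = nval m' e.
Proof.
elim: e => //= [a i IH|e1 IH1 e2 IH2|e1 IH1 e2 IH2]; last 2 first.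
- by move=> /andP[f1 f2]; rewrite IH1 // IH2.
- by move=> /andP[f1 f2]; rewrite IH1 // IH2.
case: eqP => [->|a5 /andP[a6 fi]]; first by case: i IH => // -[].
by rewrite IH // nE // !inE negb_or a6 andbT; apply/eqP.
Qed.

Lemma rval_fine e : rfine e -> rval m e = rval m' e.
Proof.
elim: e => //= [a i|e1 IH1 e2 IH2|e1 IH1 e2 IH2|e1 IH1 e2 IH2|e1 IH1 e2 IH2|e IH];
  try by move=> /andP[f1 f2]; rewrite IH1 // IH2.
- by move=> fi; rewrite rE nval_fine.
by move=> /IH ->.
Qed.

Lemma bval_fine e : bfine e -> bval m e = bval m' e.
Proof.
elim: e => //= [e1 e2|e1 e2|e IH|e1 IH1 e2 IH2].
- by move=> /andP[f1 f2]; rewrite !nval_fine.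
- by move=> /andP[f1 f2]; rewrite !rval_fine.
- by move=> /IH ->.
by move=> /andP[f1 f2]; rewrite IH1 // IH2.
Qed.

Lemma ntval_fine t : ntfine t -> ntval m t = ntval m' t.
Proof.
elim: t => /= [e|b t1 IH1 t2 IH2]; first exact: nval_fine.
by move=> /and3P[f0 f1 f2]; rewrite bval_fine // IH1 // IH2.
Qed.

Lemma rtval_fine t : rtfine t -> rtval m t = rtval m' t.
Proof.
elim: t => /= [e|b t1 IH1 t2 IH2]; first exact: rval_fine.
by move=> /and3P[f0 f1 f2]; rewrite bval_fine // IH1 // IH2.
Qed.
End Agree.

Lemma run_ntcmd a t m :
  run (ntcmd a t) m = naset a (put (nmem m a) (nmem m 5 0) (ntval m t)) m.
Proof. by elim: t => //= b t1 IH1 t2 IH2; case: ifP. Qed.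

Lemma run_rtcmd a t m :
  run (rtcmd a t) m = raset a (put (rmem m a) (nmem m 5 0) (rtval m t)) m.
Proof. by elim: t => //= b t1 IH1 t2 IH2; case: ifP. Qed.

(** The value written at [pos k] looks at visited cells only. Later writes go to other cells, so the
    equation persists in the final array. *)
Lemma fill_array (T : Type) (n : nat) (down : bool) (V : nat -> (nat -> T) -> T)
    (a0 : nat -> T) :
  let pos k := if down then (n - 1 - k)%N else k in
  let a := iteri n (fun k a => put a (pos k) (V (pos k) a)) a0 in
  (forall i g g', (i < n)%N -> (forall j, before down j i -> g j = g' j) ->
     V i g = V i g') ->
  (forall i, (i < n)%N -> a i = V i a) /\ (forall i, (n <= i)%N -> a i = a0 i).
Proof.
move=> pos; set F := fun k a => _; move=> a loc.
have posn k : (k < n)%N -> (pos k < n)%N by rewrite /pos; case: (down); lia.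
have inv k : (k <= n)%N ->
    (forall k', (k' < k)%N -> iteri k F a0 (pos k') = V (pos k') (iteri k F a0)) /\
    (forall i, (n <= i)%N -> iteri k F a0 i = a0 i).
  elim: k => [|k IH] kn; first by split.
  have [IH1 IH2] := IH (ltnW kn); rewrite [iteri _ _ _]/=; set g := iteri k F a0 in IH1 IH2 *.
  have bef k' : (k' <= k)%N -> forall j, before down j (pos k') -> g j = F k g j.
    move=> kk j; rewrite /F /put; case: eqP => // ->; rewrite /before /pos.
    by case: (down); lia.
  split=> [k'|i ni]; last by rewrite {1}/F /put IH2 //; case: eqP => // e; move: (posn k kn); lia.
  rewrite ltnS leq_eqVlt => /orP[/eqP ->|kk].
    by rewrite {1}/F /put eqxx; apply: loc; [apply: posn|apply: bef].
  have -> : F k g (pos k') = g (pos k').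
    rewrite /F /put; case: eqP => // e; move: e kn kk; rewrite /pos.
    by case: (down); lia.
  by rewrite IH1 //; apply: loc; [apply: posn; lia|apply: bef; apply: ltnW].
have [i1 i2] := inv n (leqnn n); split=> // i iN.
have [k kn ->] : exists2 k, (k < n)%N & i = pos k; last exact: i1.
by rewrite /pos; case: (down); [exists (n - 1 - i)%N; lia|exists i].
Qed.

Lemma loop_spec n (Q : nat -> memory R -> Prop) down c m :
  nmem m 0 0 = n -> Q 0%N m ->
  (forall k m1 m2, (k < n)%N -> Q k m1 ->
     (forall b, b \notin [:: 5; 6] -> nmem m2 b = nmem m1 b) -> rmem m2 = rmem m1 ->
     nmem m2 5 0 = (if down then (n - 1 - k)%N else k) -> Q k.+1 (run c m2)) ->
  (forall k m1, Q k m1 -> nmem m1 0 0 = n) ->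
  Q n (run (loop down c) m).
Proof.
move=> m0 Q0 QS Qn.
have ne b : b \notin [:: 5; 6] -> Nat.eqb b 5 = false /\ Nat.eqb b 6 = false.
  by rewrite !natEqbE !inE negb_or => /andP[/negbTE -> /negbTE ->].
rewrite /loop; case: down QS => QS /=; rewrite m0.
  have H k : (k <= n)%N -> Q k (iteri k (fun k m1 => run c (naset 5 (put (nmem (naset 6 (put (nmem m1 6) 0 k) m1) 5) 0 (nmem (naset 6 (put (nmem m1 6) 0 k) m1) 0 0 - 1 - put (nmem m1 6) 0 k 0)) (naset 6 (put (nmem m1 6) 0 k) m1))) m).
    elim: k => // k IH kn; have Qk := IH (ltnW kn); apply: (QS k _ _ kn Qk) => //.
      by move=> b bn; have [e5 e6] := ne b bn; rewrite /= e5 e6.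
    by rewrite /= /put /= (Qn _ _ Qk).
  exact: H.
have H k : (k <= n)%N -> Q k (iteri k (fun k m1 => run c (naset 5 (put (nmem m1 5) 0 k) m1)) m).
  elim: k => // k IH kn; have Qk := IH (ltnW kn); apply: (QS k _ _ kn Qk) => //.
  by move=> b bn; have [e5 e6] := ne b bn; rewrite /= e5.
exact: H.
Qed.

Lemma fill_spec n f m : nmem m 0 0 = n -> fill_fine f -> local n f m ->
  let m' := run (fcmd f) m in
  (forall i, (i < n)%N -> eq_at f m' i) /\
  same_off (fntarget f) (frtarget f) n m m'.
Proof.
move=> m0 ff lf m'.
case: f => [down a t|down a t] in ff lf m' *; pose pos k := if down then (n - 1 - k)%N else k.
  move: ff => /and3P[a056 tf _].
  have [a0 a5 a6] : [/\ a != 0%N, a != 5 & a != 6].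
    by move: a056; rewrite !inE !negb_or => /and3P[].
  pose V i g := ntval (at_ i (naset a g m)) t.
  pose F k g := put g (pos k) (V (pos k) g).
  have : [/\ forall b, b != a -> b \notin [:: 5; 6] -> nmem m' b = nmem m b,
      rmem m' = rmem m & nmem m' a = iteri n F (nmem m a)].
    apply: (loop_spec (n := n) (Q := fun k mk => [/\ forall b, b != a -> b \notin [:: 5; 6] -> nmem mk b = nmem m b,
      rmem mk = rmem m & nmem mk a = iteri k F (nmem m a)])) => // [k m1 m2 kn [Q1 Q2 Q3] n2 r2 p2|k m1 [Q1 _ _]].
      have a56 : a \notin [:: 5; 6] by rewrite !inE negb_or a5.
      rewrite run_ntcmd; split=> [b ba b56| |] /=.
      - by rewrite natEqbE (negbTE ba) n2 // Q1.
      - by rewrite r2.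
      rewrite natEqbE eqxx n2 // Q3 p2 /F -/(pos k); congr put.
      apply: ntval_fine => // [b b56|b].
        move: (b56); rewrite !inE negb_or => /andP[/negbTE b5 _].
        rewrite n2 // /= !natEqbE b5; case: eqP => [->//|/eqP ba]; exact: Q1.
      by rewrite r2 Q2.
    by rewrite Q1 // eq_sym.
  move=> [Q1 Q2 Q3].
  have [e1 e2] := fill_array (n := n) (down := down) (V := V) (nmem m a) lf.
  rewrite -/pos -/F -Q3 in e1 e2; split=> [i iN|].
    rewrite /eq_at e1 // /V; apply: ntval_fine => // [b b56|b]; last by rewrite /= Q2.
    move: (b56); rewrite !inE negb_or => /andP[/negbTE b5 _].
    rewrite /= !natEqbE b5; case: eqP => [->//|/eqP ba]; by rewrite Q1.
  split=> [b|b|b j nj b56|b j nj] /=.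
  - by rewrite inE => ba b56; apply: Q1.
  - by rewrite Q2.
  - by have [->|ba] := eqVneq b a; [apply: e2|rewrite Q1].
  by rewrite Q2.
move: ff => /andP[tf _].
pose V i g := rtval (at_ i (raset a g m)) t.
pose F k g := put g (pos k) (V (pos k) g).
have : [/\ forall b, b \notin [:: 5; 6] -> nmem m' b = nmem m b,
    forall b, b != a -> rmem m' b = rmem m b & rmem m' a = iteri n F (rmem m a)].
  apply: (loop_spec (n := n) (Q := fun k mk => [/\ forall b, b \notin [:: 5; 6] -> nmem mk b = nmem m b,
    forall b, b != a -> rmem mk b = rmem m b & rmem mk a = iteri k F (rmem m a)])) => // [k m1 m2 kn [Q1 Q2 Q3] n2 r2 p2|k m1 [Q1 _ _]]; last by rewrite Q1.
  rewrite run_rtcmd; split=> [b b56|b ba|] /=.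
  - by rewrite n2 // Q1.
  - by rewrite natEqbE (negbTE ba) r2 Q2.
  rewrite natEqbE eqxx r2 Q3 p2 /F -/(pos k); congr put.
  apply: rtval_fine => // [b b56|b].
    move: (b56); rewrite !inE negb_or => /andP[/negbTE b5 _].
    by rewrite n2 // /= !natEqbE b5; exact: Q1.
  by rewrite r2 /= natEqbE; case: eqP => [->//|/eqP ba]; exact: Q2.
move=> [Q1 Q2 Q3].
have [e1 e2] := fill_array (n := n) (down := down) (V := V) (rmem m a) lf.
rewrite -/pos -/F -Q3 in e1 e2; split=> [i iN|].
  rewrite /eq_at e1 // /V; apply: rtval_fine => // [b b56|b].
    move: (b56); rewrite !inE negb_or => /andP[/negbTE b5 _].
    by rewrite /= !natEqbE b5 Q1.
  by rewrite /= natEqbE; case: eqP => [->//|/eqP ba]; rewrite Q2.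
split=> [b _ b56|b|b j nj b56|b j nj] /=.
- exact: Q1.
- by rewrite inE; exact: Q2.
- by rewrite Q1.
by have [->|ba] := eqVneq b a; [apply: e2|rewrite Q2].
Qed.

Lemma local_nonrec n f m : ~~ recursive f -> fill_fine f -> local n f m.
Proof.
case: f => [down a t|down a t] /= na fi i g g' iN _.
  apply: ntval_agree => b bt //=; rewrite !natEqbE; case: eqP => // _.
  by case: eqP => // e; rewrite e (negbTE na) in bt.
apply: rtval_agree => b bt //=; rewrite natEqbE; case: eqP => // e.
by rewrite e (negbTE na) in bt.
Qed.

Lemma eq_at_later f g m m' n i : fill_fine f -> later_ok f g ->
  same_off (fntarget g) (frtarget g) n m m' -> eq_at f m i -> eq_at f m' i.
Proof.
move=> ff lt [s1 s2 _ _].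
have f6 : 6 \notin fnreads f.
  by move: ff; clear; case: f => [d a t /and3P[_ _]|d a t /andP[_]].
have nn b : b \in fnreads f ++ fntarget f -> b \notin fntarget g.
  rewrite mem_cat; case: g lt {s1 s2} => //= d a t /andP[a1 a2] h.
  by rewrite inE; apply: contraTneq h => ->; rewrite negb_or a1.
have rr b : b \in frreads f ++ frtarget f -> b \notin frtarget g.
  rewrite mem_cat; case: g lt {s1 s2 nn} => //= d a t /andP[a1 a2] h.
  by rewrite inE; apply: contraTneq h => ->; rewrite negb_or a1.
have nr b : b \in fnreads f -> nmem (at_ i m) b = nmem (at_ i m') b.
  move=> bf /=; rewrite !natEqbE; case: eqP => // /eqP b5; rewrite s1 //.
    by apply: nn; rewrite mem_cat bf.
  by rewrite !inE negb_or b5; apply: contraNneq f6 => <-.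
have rd b : b \in frreads f -> rmem (at_ i m) b = rmem (at_ i m') b.
  by move=> bf /=; rewrite s2 // rr // mem_cat bf.
case: f ff lt f6 nn rr nr rd => [d a t|d a t] /= ff lt _ nn rr nr rd.
  rewrite s1; first by rewrite (@ntval_agree (at_ i m) (at_ i m') t nr rd).
    by apply: nn; rewrite mem_cat inE eqxx orbT.
  by move: ff => /and3P[]; rewrite !inE !negb_or => /and3P[_ -> ->].
by rewrite s2 ?(@rtval_agree (at_ i m) (at_ i m') t nr rd) //; apply: rr; rewrite mem_cat inE eqxx orbT.
Qed.

(** Locality is asked only of passes that read their own target, and may be proved from the
    equations of earlier passes: a pointer to a missing neighbour is tolerated because its
    coefficient is known to be 0. *)
Fixpoint obligations n (all : seq fill) m0 (done todo : seq fill) : Prop :=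
  if todo is f :: todo' then
    (if recursive f then
       forall m, same_off (flatten (map fntarget all)) (flatten (map frtarget all)) n m0 m ->
         eqs n done m -> local n f m
     else True) /\ obligations n all m0 (rcons done f) todo'
  else True.

Lemma same_off_trans nts rts n m1 m2 m3 : same_off nts rts n m1 m2 ->
  same_off nts rts n m2 m3 -> same_off nts rts n m1 m3.
Proof.
move=> [a1 a2 a3 a4] [b1 b2 b3 b4]; split=> [b h1 h2|b h1|b j h1 h2|b j h1].
- by rewrite b1 // a1.
- by rewrite b2 // a2.
- by rewrite b3 // a3.
by rewrite b4 // a4.
Qed.

Lemma same_off_sub nts rts nts' rts' n m1 m2 : {subset nts <= nts'} ->
  {subset rts <= rts'} -> same_off nts rts n m1 m2 -> same_off nts' rts' n m1 m2.
Proof.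
move=> sn sr [a1 a2 a3 a4]; split=> // [b h1 h2|b h].
  by apply: a1 => //; apply: contra h1; apply: sn.
by apply: a2; apply: contra h; apply: sr.
Qed.

Lemma eqs_rcons n fs f m : eqs n (rcons fs f) m <->
  eqs n fs m /\ forall i, (i < n)%N -> eq_at f m i.
Proof. by elim: fs => /= [|g fs IH]; tauto. Qed.

Lemma static_fine fs : static fs -> all fill_fine fs.
Proof. by elim: fs => //= f fs IH /and3P[-> _ /IH]. Qed.

Lemma fine_size fs : all fill_fine fs -> 0 \notin flatten (map fntarget fs).
Proof.
elim: fs => //= f fs IH /andP[ff /IH h]; rewrite mem_cat negb_or h andbT.
case: f ff => //= d a t /and3P[a0 _ _]; rewrite inE.
by apply: contraNneq a0 => <-.
Qed.

Theorem prog_spec n fs m : nmem m 0 0 = n -> static fs ->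
  obligations n fs m [::] fs ->
  let m' := run (prog fs) m in
  eqs n fs m' /\
  same_off (flatten (map fntarget fs)) (flatten (map frtarget fs)) n m m'.
Proof.
move=> m0 st ob m'.
set nts := flatten _; set rts := flatten _.
suff gen done todo m1 : fs = done ++ todo -> static todo ->
    all fill_fine done -> all (fun f => all (later_ok f) todo) done ->
    obligations n fs m done todo -> same_off nts rts n m m1 -> eqs n done m1 ->
    let m2 := run (prog todo) m1 in eqs n fs m2 /\ same_off nts rts n m m2.
  exact: (gen [::] fs m).
elim: todo done m1 => [|f todo IH] done m1 fsE; first by rewrite cats0 in fsE; rewrite fsE.
move=> /= /and3P[ff fl st'] fd lt [obf obt] so eqd.
have m10 : nmem m1 0 0 = n.
  by have [s1 _ _ _] := so; rewrite s1 //; apply/fine_size/static_fine.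
have lf : local n f m1.
  case E : (recursive f) obf => obf; first exact: obf.
  by apply: local_nonrec => //; rewrite E.
have [e1 so1] := fill_spec m10 ff lf.
apply: (IH (rcons done f)) => //.
- by rewrite fsE cat_rcons.
- by rewrite all_rcons ff.
- rewrite all_rcons fl /=; apply: sub_all lt => g /andP[_ ->] //.
- apply: same_off_trans so _; apply: same_off_sub so1 => b bf.
    by rewrite /nts fsE map_cat flatten_cat !mem_cat bf orbT.
  by rewrite /rts fsE map_cat flatten_cat !mem_cat bf orbT.
apply/eqs_rcons; split=> //; elim: done fd lt eqd {fsE obf obt} => //= g done IHd.
move=> /andP[gf fd] /andP[/andP[gl _] lt] [eg ed]; split; last exact: IHd.
by move=> i iN; apply: eq_at_later so1 (eg i iN).
Qed.

End Fills.

Local Open Scope ring_scope.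

(** * Linear algebra on the machine *)

Definition N1 := NLit 1.
Definition N0 := NLit 0.
Definition beqn (x y : nexp) := BAnd (BNot (BLt x y)) (BNot (BLt y x)).
Definition beqr (x y : rexp) := BAnd (BLe x y) (BLe y x).
Definition rabs (x : rexp) := RSqrt (RMul x x).
(** For a missing predecessor the truncated subtraction yields index 0, whose content is then
    multiplied by 0. *)
Definition pred_idx := NSub (NGet 9 idx) N1.
Definition succ_idx := NGet 10 idx.
Definition is_var := beqn (NGet nVars idx) N1.
Definition status_is (k : nat) := beqn (NGet nStatus idx) (NLit k).

(* Arrays 9 and 10 hold, for each index, 1 + the previous index in nVars (0 if there
   is none) and the next one (the size if there is none); the real arrays 13 and
   14 hold the entries of the matrix that link the index with these two. *)
Definition link_fills : seq fill := [::
  NFill false 9 (NNode (BLt N0 idx)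
    (NNode (beqn (NGet nVars (NSub idx N1)) N1)
       (NLeaf idx) (NLeaf (NGet 9 (NSub idx N1)))) (NLeaf N0));
  NFill true 10 (NNode (BLt (NAdd idx N1) cells)
    (NNode (beqn (NGet nVars (NAdd idx N1)) N1)
       (NLeaf (NAdd idx N1)) (NLeaf (NGet 10 (NAdd idx N1)))) (NLeaf cells));
  RFill false 13 (RNode (beqn (NGet 9 idx) N0)
    (RLeaf (RLit 0)) (RLeaf (RGet rOff pred_idx)));
  RFill false 14 (RNode (BLt succ_idx cells)
    (RLeaf (RGet rOff idx)) (RLeaf (RLit 0))) ].

(** The lower link restricted to [A]. Without a predecessor the status that is read does not matter,
    since both branches give 0. *)
Definition neighbor_fill : fill :=
  RFill false 19 (RNode (beqn (NGet nStatus pred_idx) N1)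
    (RLeaf (RGet 13 idx)) (RLeaf (RLit 0))).

Definition chol_fills : seq fill := [:: neighbor_fill;
  RFill false rPivot (RLeaf (RSub (RGet rDiag idx)
    (RDiv (RMul (RGet 19 idx) (RGet 19 idx)) (RGet rPivot pred_idx))));
  RFill false rGdiag (RLeaf (RSqrt (RGet rPivot idx)));
  RFill false rGsub (RLeaf (RDiv (RGet 19 idx) (RGet rGdiag pred_idx))) ].

Definition row_product (a : nat) : rexp :=
  RAdd (RAdd (RMul (RGet rDiag idx) (RGet a idx))
             (RMul (RGet 13 idx) (RGet a pred_idx)))
       (RMul (RGet 14 idx) (RGet a succ_idx)).

(** [r] is the right side, [y] the forward and [z] the backward pass. The pivots in array 29 are the
    squares of the diagonal of the stored factor. *)
Definition solve_one (r y z out : nat) : seq fill := [::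
  RFill false y (RLeaf (RSub (RGet r idx)
    (RMul (RDiv (RGet 19 idx) (RGet 29 pred_idx)) (RGet y pred_idx))));
  RFill true z (RNode (status_is 1)
    (RLeaf (RDiv (RSub (RGet y idx) (RMul (RGet 14 idx) (RGet z succ_idx)))
                 (RGet 29 idx)))
    (RLeaf (RLit 0)));
  RFill false out (RNode (status_is 1) (RLeaf (RGet z idx))
    (RLeaf (RSub (RGet r idx) (row_product z)))) ].

Definition solve_fills : seq fill := [:: neighbor_fill;
  RFill false 29 (RLeaf (RMul (RGet rGdiag idx) (RGet rGdiag idx)));
  RFill false 22 (RNode (status_is 2) (RLeaf (RGet rUb idx)) (RLeaf (RLit 0)));
  RFill false 18 (RLeaf (RAdd (RGet rLin idx) (row_product 22))) ]
  ++ solve_one 18 27 20 rQbar ++ solve_one rP 28 21 rPbar.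

Definition cand_fills : seq fill := [::
  NFill false 16 (NNode (BNot (BLe (RGet rPbar idx) (RLit 0)))
    (NNode (status_is 0) (NLeaf N1)
      (NNode (BAnd (status_is 1) (beqn (NGet nFinite idx) N1)) (NLeaf N1) (NLeaf N0)))
    (NLeaf N0));
  RFill false 26 (RNode (status_is 0)
    (RLeaf (RDiv (RSub (RLit 0) (RGet rQbar idx)) (RGet rPbar idx)))
    (RLeaf (RDiv (RSub (RLit 0) (RAdd (RGet rUb idx) (RGet rQbar idx)))
                 (RGet rPbar idx)))) ].

Definition next_idx := NAdd idx N1.
Definition is_cand := beqn (NGet 16 idx) N1.

(** The sentinel at index [n], set to 0 by [tau_cmd], is the 0 in the maximum [tau_new]; the
    downward scan leaves that maximum in cell 0. *)
Definition tau_fill : fill :=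
  RFill true rTau (RNode
    (BAnd is_cand (BNot (BLe (RGet 26 idx) (RGet rTau next_idx))))
    (RLeaf (RGet 26 idx)) (RLeaf (RGet rTau next_idx))).

(** Scanning downwards leaves in cell 0 the first index that satisfies [b], or else the sentinel
    [n]. *)
Definition find_fill (b : bexp) : fill :=
  NFill true 11 (NNode b (NLeaf idx) (NLeaf (NGet 11 next_idx))).

Lemma nlt_eqE (x y : nat) : ~~ (x < y)%N && ~~ (y < x)%N = (x == y).
Proof. by rewrite -!leqNgt andbC eqn_leq. Qed.

(** * Equations satisfied by the arrays after the passes *)

Section Specs.
Variable R : realType.
Variable n : nat.
Implicit Types (m : memory R) (M : 'M[R]_n) (V A : {set 'I_n}) (i : 'I_n).

Definition linked (vs pr1 nx : nat -> nat) (off L U : nat -> R) : Prop :=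
  forall i : nat, (i < n)%N ->
  [/\ pr1 i = (if 0 < i then if vs (i - 1) == 1 then i else pr1 (i - 1) else 0)%N,
      nx i = (if i + 1 < n then if vs (i + 1) == 1 then i + 1 else nx (i + 1) else n)%N,
      L i = (if pr1 i == 0%N then 0 else off (pr1 i - 1)%N)
    & U i = (if (nx i < n)%N then off i else 0)].

Section Linked.
Variables (vs pr1 nx : nat -> nat) (off L U : nat -> R).
Hypothesis lk : linked vs pr1 nx off L U.

Lemma linked_pred (i : nat) : (i < n)%N -> (pr1 i <= i)%N /\
  (forall j : nat, (pr1 i <= j < i)%N -> vs j != 1%N) /\
  (forall j : nat, pr1 i = j.+1 -> vs j == 1%N).
Proof.
elim: i => [|i IH] iN; have [-> _ _ _] := lk iN.
  by split=> //; split=> j //; rewrite ltn0 andbF.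
rewrite /= subn1 /=; case: eqP => [vi|/eqP vi].
  split=> //; split=> j; first by case: ltngtP => //; lia.
  by move=> [<-]; rewrite vi.
have [h1 [h2 h3]] := IH (ltnW iN); split; first exact: ltnW.
split=> // j; have [->//|ji h] := eqVneq j i.
by apply: h2; move: h; have : j != i :> nat := ji; lia.
Qed.

Lemma linked_succ (i : nat) : (i < n)%N -> (i < nx i <= n)%N /\
  (forall j : nat, (i < j < nx i)%N -> vs j != 1%N) /\ ((nx i < n)%N -> vs (nx i) == 1%N).
Proof.
move=> iN; have [k] := ubnP (n - i)%N; elim: k i iN => // k IH i iN ik.
have [_ -> _ _] := lk iN; case: ifP => i1; last first.
  by rewrite ltnn; split; [lia|split=> // j; lia].
case: eqP => [vi|/eqP vi]; first by split; [lia|split=> [j|_]; [lia|rewrite vi]].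
have [||h1 [h2 h3]] := IH (i + 1)%N; [lia|lia|split; [lia|split=> // j]].
have [->//|ji h] := eqVneq j (i + 1)%N.
by apply: h2; move: h; have : j != (i + 1)%N :> nat := ji; lia.
Qed.

Lemma linked_L0 (i : nat) : (i < n)%N -> pr1 i = 0%N -> L i = 0.
Proof. by move=> iN p0; have [_ _ -> _] := lk iN; rewrite p0. Qed.

Lemma linked_links V M : symmetric_mx M ->
  (forall i, (i \in V) = (vs i == 1%N)) ->
  (forall i j, consec V i j -> off i = M i j) ->
  links V M (fun k => (pr1 k - 1)%N) nx L U.
Proof.
move=> sM Vv offE i iV; have iN := ltn_ord i; have [_ _ EL EU] := lk iN.
have [p1 [p2 p3]] := linked_pred iN; have [s1 [s2 s3]] := linked_succ iN.
split.
  case E : (pr1 i) => [|j]; [right|left].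
    split; last by rewrite EL E.
    move=> j; apply/negP => c; have /and4P[jV _ ji _] := c.
    by have := p2 j; rewrite E ji -Vv jV => /(_ isT).
  have jN : (j < n)%N by apply: leq_trans (ltnW iN); rewrite -E.
  have jV : Ordinal jN \in V by rewrite Vv; apply: p3.
  have c : consec V (Ordinal jN) i.
    apply: consecP => //=; first by rewrite -E.
    move=> k kV; apply/negP => /andP[jk ki]; have := p2 k.
    by rewrite E jk ki -Vv kV => /(_ isT).
  exists (Ordinal jN); split=> //=; first by rewrite subn1.
  by rewrite EL E /= subn1 /= (offE _ _ c) sym_entry.
have [h|h] := ltnP (nx i) n; [left|right].
  have jV : Ordinal h \in V by rewrite Vv; apply: s3.
  have c : consec V i (Ordinal h).
    apply: consecP => //=; first by case/andP: s1.
    by move=> k kV; apply/negP => /s2; rewrite -Vv kV.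
  by exists (Ordinal h); split=> //; rewrite EU h (offE _ _ c).
split; last by rewrite EU ltnNge h.
move=> j; apply/negP => c; have /and4P[_ jV ij _] := c.
have := s2 j; rewrite ij -Vv jV (leq_trans (ltn_ord j) h).
by move=> /(_ isT).
Qed.

Lemma linked_in V A M (sts : nat -> nat) (LA : nat -> R) : symmetric_mx M ->
  (forall i, (i \in V) = (vs i == 1%N)) ->
  (forall i j, consec V i j -> off i = M i j) -> A \subset V ->
  (forall i, (i \in A) = (sts i == 1%N)) ->
  (forall i : nat, (i < n)%N ->
     LA i = if sts (pr1 i - 1)%N == 1%N then L i else 0) ->
  links_in V A M (fun k => (pr1 k - 1)%N) LA.
Proof.
move=> sM Vv offE AV As LAE i iA; have iV := subsetP AV _ iA.
have [pL _] := linked_links sM Vv offE iV; rewrite LAE //.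
case: pL => [[j [c pj Lj]]|[no L0]]; last first.
  by right; rewrite L0 if_same; split=> // j _; apply: no.
rewrite pj -As; have [jA|jA] := boolP (j \in A); [left|right].
  by exists j.
by split=> // j' jA'; apply: contra jA => c'; rewrite -(consec_inj c' c).
Qed.
End Linked.

Lemma first_index (b : nat -> bool) (F : nat -> nat) :
  (forall i : nat, (i < n)%N -> F i = if b i then i else F (i + 1)%N) -> F n = n ->
  [/\ (F 0 <= n)%N, forall j : nat, (j < F 0)%N -> ~~ b j & (F 0 < n)%N -> b (F 0)].
Proof.
move=> FE Fn.
have H (k : nat) : forall i : nat, (i + k = n)%N -> [/\ (i <= F i <= n)%N,
    forall j : nat, (i <= j < F i)%N -> ~~ b j & (F i < n)%N -> b (F i)].
  elim: k => [|k IH] i ik.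
    have -> : i = n by lia.
    by rewrite Fn leqnn ltnn; split=> // j; lia.
  have iN : (i < n)%N by lia.
  rewrite FE //; case: ifP => bi; first by split=> // [|j]; lia.
  have [|h1 h2 h3] := IH (i + 1)%N; first by lia.
  split=> // [|j /andP[ij jF]]; first by lia.
  have [e|ne] := eqVneq i j; first by rewrite -e bi.
  by apply: h2; rewrite jF andbT addn1 ltn_neqAle ne.
by have [] := H n 0%N (add0n n); split=> //; lia.
Qed.

Lemma link_run m : nmem m nSize 0 = n ->
  let m' := run (prog link_fills) m in
  linked (nmem m' nVars) (nmem m' 9) (nmem m' 10) (rmem m' rOff) (rmem m' 13) (rmem m' 14).
Proof.
move=> m0 m'.
have [|] := prog_spec (fs := link_fills) m0 erefl.
  split=> [m1 so _ i g g' iN gg /=|].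
    by case: ifP => // i0; rewrite gg //= /before; lia.
  split=> [m1 so _ i g g' iN gg /=|//].
  by case: ifP => // i0; rewrite gg //= /before; lia.
rewrite -/m'; clearbody m' => -[e1 [e2 [e3 [e4 _]]]] [s1 _ _ _].
have n0 : nmem m' 0 0 = n by rewrite s1.
move=> i iN; have := e1 i iN; have := e2 i iN; have := e3 i iN; have := e4 i iN.
by rewrite /= !nlt_eqE -?eqn0Ngt n0.
Qed.

Lemma chol_run m : nmem m nSize 0 = n ->
  linked (nmem m nVars) (nmem m 9) (nmem m 10) (rmem m rOff) (rmem m 13) (rmem m 14) ->
  let m' := run (prog chol_fills) m in
  let pr := fun k => (nmem m 9 k - 1)%N in
  forall i : nat, (i < n)%N ->
  [/\ rmem m' 19 i = if nmem m nStatus (pr i) == 1%N then rmem m 13 i else 0,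
      rmem m' rPivot i = rmem m rDiag i -
        rmem m' 19 i * rmem m' 19 i / rmem m' rPivot (pr i),
      rmem m' rGdiag i = Num.sqrt (rmem m' rPivot i)
    & rmem m' rGsub i = rmem m' 19 i / rmem m' rGdiag (pr i)].
Proof.
move=> m0 lk m' pr.
have [|] := prog_spec (fs := chol_fills) m0 erefl.
  split=> //; split=> [m1 [s1 s2 _ _] [E _] i g g' iN gg /=|//].
  have := E i iN; rewrite /= !nlt_eqE !s1 // (s2 13%N) //.
  have [p1 _] := linked_pred lk iN; have L0 := linked_L0 lk iN.
  (* Without a predecessor the pointer is 0, which need not have been visited; the zero coefficient
     makes the value read there irrelevant. *)
  case P : (nmem m 9 i) p1 L0 => [|k] p1 L0.
    by rewrite L0 // if_same => ->; rewrite !mul0r.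
  by rewrite gg // /before subn1.
rewrite -/m'; clearbody m' => -[e1 [e2 [e3 [e4 _]]]] [s1 s2 _ _].
move=> i iN; have := e1 i iN; have := e2 i iN; have := e3 i iN; have := e4 i iN.
by rewrite /= !nlt_eqE !s1 // !(s2 0%N) // (s2 13%N).
Qed.

Lemma solve_run m : nmem m nSize 0 = n ->
  linked (nmem m nVars) (nmem m 9) (nmem m 10) (rmem m rOff) (rmem m 13) (rmem m 14) ->
  let m' := run (prog solve_fills) m in
  let pr := fun k => (nmem m 9 k - 1)%N in let nx := nmem m 10 in
  let st := nmem m nStatus in
  let row := fun (a i : nat) => rmem m rDiag i * rmem m' a i + rmem m 13 i * rmem m' a (pr i)
    + rmem m 14 i * rmem m' a (nx i) in
  let vv := rmem m' 29 in
  let one := fun r y z out => forall i : nat, (i < n)%N ->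
    [/\ rmem m' y i = rmem m' r i - rmem m' 19 i / vv (pr i) * rmem m' y (pr i),
        rmem m' z i = (if st i == 1%N then
          (rmem m' y i - rmem m 14 i * rmem m' z (nx i)) / vv i else 0)
      & rmem m' out i = (if st i == 1%N then rmem m' z i else rmem m' r i - row z i)] in
  (forall i : nat, (i < n)%N ->
    [/\ rmem m' 19 i = if st (pr i) == 1%N then rmem m 13 i else 0,
      vv i = rmem m rGdiag i * rmem m rGdiag i,
      rmem m' 22 i = if st i == 2%N then rmem m rUb i else 0
    & rmem m' 18 i = rmem m rLin i + row 22%N i]) /\
  one 18%N 27%N 20%N rQbar /\ one rP 28%N 21%N rPbar.
Proof.
move=> m0 lk m' pr nx st row vv one.
have [|] := prog_spec (fs := solve_fills) m0 erefl.
  have locy m1 (i : nat) (g g' : nat -> R) : same_off (flatten (map fntarget solve_fills)) (flatten (map frtarget solve_fills)) n m m1 ->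
    eq_at neighbor_fill m1 i -> (i < n)%N ->
    (forall j : nat, before false j i -> g j = g' j) ->
    forall c : R, rmem m1 19 i / c * g (nmem m1 9 i - 1)%N =
      rmem m1 19 i / c * g' (nmem m1 9 i - 1)%N.
    move=> [s1 s2 _ _] /= E iN gg c; move: E; rewrite !nlt_eqE !s1 // (s2 13%N) //.
    have [p1 _] := linked_pred lk iN; have L0 := linked_L0 lk iN.
    case P : (nmem m 9 i) p1 L0 => [|k] p1 L0.
      by rewrite L0 // if_same => ->; rewrite !mul0r.
    by rewrite gg // /before subn1.
  have locz m1 (i : nat) (g g' : nat -> R) : same_off (flatten (map fntarget solve_fills)) (flatten (map frtarget solve_fills)) n m m1 ->
    (i < n)%N -> (forall j : nat, before true j i -> g j = g' j) ->
    g (nmem m1 10 i) = g' (nmem m1 10 i).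
    move=> [s1 s2 _ _] iN gg; rewrite s1 // gg // /before.
    by have [/andP[]] := linked_succ lk iN.
  split=> //; split=> //; split=> //; split=> //.
  split=> [m1 so [E _] i g g' iN gg /=|].
    by rewrite (locy m1 i g g' so (E i iN) iN gg).
  split=> [m1 so [E _] i g g' iN gg /=|].
    by rewrite (locz m1 i g g' so iN gg).
  split=> //; split=> [m1 so [E _] i g g' iN gg /=|].
    by rewrite (locy m1 i g g' so (E i iN) iN gg).
  split=> [m1 so [E _] i g g' iN gg /=|//].
  by rewrite (locz m1 i g g' so iN gg).
rewrite -/m' {}/one {}/row {}/vv; clearbody m'.
move=> -[e1 [e2 [e3 [e4 [e5 [e6 [e7 [e8 [e9 [e10 _]]]]]]]]]] [s1 s2 _ _].
split=> [i iN|].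
  have := e1 i iN; have := e2 i iN; have := e3 i iN; have := e4 i iN.
  by rewrite /= !nlt_eqE !s1 // !(s2 0%N) // (s2 13%N) // (s2 14%N) // (s2 rGdiag) // (s2 rUb) // (s2 rLin).
split=> i iN.
  have := e5 i iN; have := e6 i iN; have := e7 i iN.
  by rewrite /= !nlt_eqE !s1 // !(s2 0%N) // (s2 13%N) // (s2 14%N).
have := e8 i iN; have := e9 i iN; have := e10 i iN.
by rewrite /= !nlt_eqE !s1 // !(s2 0%N) // (s2 13%N) // (s2 14%N).
Qed.
End Specs.

Definition tau_cmd : cmd :=
  Seq (RSet rTau cells (RLit 0)) (prog (cand_fills ++ [:: tau_fill])).

Definition compute_cmd : cmd :=
  Seq (prog link_fills) (Seq (prog chol_fills) (Seq (prog solve_fills) tau_cmd)).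

(** * Correctness of the computed vectors, factor and parameter *)

Section Compute.
Variables (R : realType) (n : nat).
Implicit Types (m : memory R) (M : 'M[R]_n) (V A B C : {set 'I_n}).
Implicit Types (P : qp R n) (p : 'cV[R]_n).

Lemma holds_mat_off m V M : holds_mat m V M ->
  forall i j, consec V i j -> rmem m rOff i = M i j.
Proof.
move=> [_ h] i j c; have /and4P[iV jV ij _] := c; apply: h => // k kV.
by rewrite (consec_gap c).
Qed.

(** Outside [V] the arrays hold arbitrary data, whence the disjunctions. The recurrences for [y] and
    [z] are stated at every index because the passes cover all of them. *)
Lemma pivot_solved V A M (rr : 'cV[R]_n) prf nxf L U LA (v r y z out : nat -> R) :
  symmetric_mx M -> tri_on V M -> A \subset V -> submx_on M A A \in unitmx ->
  links V M prf nxf L U -> links_in V A M prf LA ->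
  (forall i : 'I_n, i \in A -> v i != 0 /\ v i = M i i - LA i * LA i / v (prf i)) ->
  (forall i : 'I_n, r i = rr i 0 \/ i \notin V) ->
  (forall i : 'I_n, y i = r i - LA i / v (prf i) * y (prf i)) ->
  (forall i : 'I_n, z i = if i \in A then (y i - U i * z (nxf i)) / v i else 0) ->
  (forall i : 'I_n, out i = (if i \in A then z i else
     r i - (M i i * z i + L i * z (prf i) + U i * z (nxf i))) \/ i \notin V) ->
  forall i : 'I_n, i \in V -> out i = principal_pivot M A rr i 0.
Proof.
move=> sM tV AV uA lk lA vE rE yE zE outE.
pose Z : 'cV[R]_n := \col_i if i \in A then z i else 0.
have sZ : supported A Z by move=> i iA; rewrite mxE (negbTE iA).
have zZ (i : 'I_n) : i \in V -> z i = Z i 0.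
  by move=> iV; rewrite mxE; case: ifPn => // iA; rewrite zE (negbTE iA).
have sZV : supported V Z.
  by move=> i iV; apply: sZ; apply: contra iV; apply: (subsetP AV).
have MZ := tri_mul sM tV lk sZV zZ.
have rV (i : 'I_n) : i \in V -> r i = rr i 0.
  by move=> iV; case: (rE i) => //; rewrite iV.
have sol : forall i : 'I_n, i \in A -> M i i * z i + L i * z (prf i) + U i * z (nxf i) = r i.
  apply: (tri_solve sM AV lk lA (v := v) (y := y)).
  - by move=> i /vE[].
  - by move=> i _; apply: yE.
  - by move=> i iA; rewrite zE iA mulrC divfK //; case: (vE i iA).
  - by move=> i _ iA; rewrite zE (negbTE iA).
  by move=> i j iA _ v0; case: (vE i iA); rewrite v0 eqxx.
move=> i iV; rewrite (principal_pivotE i uA sZ) => [|j jA]; last first.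
  by rewrite MZ ?(subsetP AV) // sol // rV // (subsetP AV).
case: (outE i) => [->|]; last by rewrite iV.
case: ifP => iA; first by rewrite mxE iA.
by rewrite colB MZ // rV.
Qed.

Section Solve.
Variables (P : qp R n) (p : 'cV[R]_n) (A B C : {set 'I_n}).
Let V := vars P.
Let M := mat P.
Hypotheses (sM : symmetric_mx M) (pM : pos_semidef M) (tV : tri_on V M).
Hypotheses (AV : A \subset V) (CV : C \subset V).
Hypothesis Cfin : forall i, i \in C -> (ub P i < +oo)%E.
Hypothesis u0 : forall i, (0 < ub P i)%E.
Hypothesis uA : submx_on M A A \in unitmx.

Lemma solve_correct m : nmem m nSize 0 = n ->
  linked n (nmem m nVars) (nmem m 9) (nmem m 10) (rmem m rOff) (rmem m 13) (rmem m 14) ->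
  holds_set m nVars 1 V -> holds_qp m P -> holds_vec m rP V p ->
  holds_status m A B C -> is_cholesky (submx_on M A A) (held_factor m A) ->
  let m' := run (prog solve_fills) m in
  holds_vec m' rQbar V (qbar P A C) /\ holds_vec m' rPbar V (pbar P p A).
Proof.
move=> m0 lk hV [hM hl hu] hp [_ hA hC] ch m'.
have [E0 [E1 E2]] := solve_run m0 lk; rewrite -/m' in E0 E1 E2.
have rP' : rmem m' rP = rmem m rP by apply: run_rframe.
rewrite rP' in E2; clearbody m'.
set prf := fun k => (nmem m 9 k - 1)%N in E0 E1 E2.
have offE := holds_mat_off hM.
have lks : links V M prf (nmem m 10) (rmem m 13) (rmem m 14).
  exact (linked_links lk sM hV offE).
have lA : links_in V A M prf (rmem m' 19).
  apply: (linked_in lk sM hV offE AV hA) => i iN.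
  by have [-> _ _ _] := E0 i iN.
have DE (i : 'I_n) : i \in V -> rmem m rDiag i = M i i by move=> iV; case: hM => + _; apply.
have prN (i : 'I_n) : (prf i < n)%N.
  have [p1 _] := linked_pred lk (ltn_ord i); rewrite /prf.
  by apply: leq_ltn_trans (ltn_ord i); apply: leq_trans p1; apply: leq_subr.
have vE (i : 'I_n) : i \in A -> rmem m' 29 i != 0 /\
    rmem m' 29 i = M i i - rmem m' 19 i * rmem m' 19 i / rmem m' 29 (prf i).
  move=> iA; have [g0 gE] := pivots_of_cholesky sM tV AV lA ch uA iA.
  have [_ -> _ _] := E0 i (ltn_ord i); have [_ -> _ _] := E0 (prf i) (prN i).
  by split=> //; rewrite mulf_neq0.
have rowE (a : nat) (x : 'cV[R]_n) : supported V x ->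
    (forall i : 'I_n, i \in V -> rmem m' a i = x i 0) -> forall i : 'I_n, i \in V ->
    rmem m rDiag i * rmem m' a i + rmem m 13 i * rmem m' a (prf i) +
    rmem m 14 i * rmem m' a (nmem m 10 i) = (M *m x) i 0.
  by move=> sx xE i iV; rewrite (tri_mul sM tV lks sx xE iV) DE.
have uE : forall i : 'I_n, i \in V -> rmem m' 22 i = at_ub C (ub P) i 0.
  move=> i iV; have [_ _ -> _] := E0 i (ltn_ord i); rewrite -(hC i) mxE.
  case: ifP => // iC; have := hu i iV; have := Cfin iC; have := u0 i.
  by case: (ub P i) => //= r _ _ [].
have su : supported V (at_ub C (ub P)).
  by move=> i iV; rewrite mxE; case: ifP => // /(subsetP CV); rewrite (negbTE iV).
have rE : forall i : 'I_n, rmem m' 18 i = (lin P + M *m at_ub C (ub P)) i 0 \/ i \notin V.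
  move=> i; case: (boolP (i \in V)) => iV; [left|by right].
  by have [_ _ _ ->] := E0 i (ltn_ord i); rewrite (rowE 22 _ su uE) // colD hl.
split=> i iV.
  apply: (pivot_solved sM tV AV uA lks lA vE rE (y := rmem m' 27) (z := rmem m' 20)) => //.
  - by move=> j; have [-> _ _] := E1 j (ltn_ord j).
  - by move=> j; have [_ -> _] := E1 j (ltn_ord j); rewrite -(hA j).
  move=> j; case: (boolP (j \in V)) => jV; [left|by right].
  by have [_ _ ->] := E1 j (ltn_ord j); rewrite -(hA j) DE.
apply: (pivot_solved sM tV AV uA lks lA vE (r := rmem m rP) (y := rmem m' 28) (z := rmem m' 21)) => //.
- by move=> j; case: (boolP (j \in V)) => jV; [left; apply: hp|right].
- by move=> j; have [-> _ _] := E2 j (ltn_ord j).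
- by move=> j; have [_ -> _] := E2 j (ltn_ord j); rewrite -(hA j).
move=> j; case: (boolP (j \in V)) => jV; [left|by right].
by have [_ _ ->] := E2 j (ltn_ord j); rewrite -(hA j) DE.
Qed.

Lemma chol_correct m : nmem m nSize 0 = n ->
  linked n (nmem m nVars) (nmem m 9) (nmem m 10) (rmem m rOff) (rmem m 13) (rmem m 14) ->
  holds_set m nVars 1 V -> holds_mat m V M -> holds_set m nStatus 1 A ->
  let m' := run (prog chol_fills) m in
  is_cholesky (submx_on M A A) (held_factor m' A).
Proof.
move=> m0 lk hV hM hA m'.
have E := chol_run m0 lk; rewrite -/m' in E; clearbody m'.
set prf := fun k => (nmem m 9 k - 1)%N in E.
have offE := holds_mat_off hM.
have lA : links_in V A M prf (rmem m' 19).
  apply: (linked_in lk sM hV offE AV hA) => i iN.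
  by have [-> _ _ _] := E i iN.
apply: (cholesky_of_pivots sM pM tV AV lA (v := rmem m' rPivot)) => i iA.
- have [_ -> _ _] := E i (ltn_ord i); case: hM => hD _; rewrite hD //.
  exact: (subsetP AV).
- by have [_ _ -> _] := E i (ltn_ord i).
by have [_ _ _ ->] := E i (ltn_ord i).
Qed.
End Solve.

Lemma max_spec (c : nat -> bool) (r T : nat -> R) : T n = 0 ->
  (forall i : nat, (i < n)%N -> T i =
     if c i && ~~ (r i <= T (i + 1)%N) then r i else T (i + 1)%N) ->
  [/\ 0 <= T 0%N, forall i : nat, (i < n)%N -> c i -> r i <= T 0%N
    & T 0%N = 0 \/ exists i : 'I_n, c i /\ r i = T 0%N].
Proof.
move=> Tn TE.
have H (k : nat) : forall i : nat, (i + k = n)%N -> [/\ 0 <= T i,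
    forall j : nat, (i <= j < n)%N -> c j -> r j <= T i
  & T i = 0 \/ exists j : 'I_n, c j /\ r j = T i].
  elim: k => [|k IH] i ik.
    have -> : i = n by lia.
    by rewrite Tn; split=> // [j|]; [lia|left].
  have iN : (i < n)%N by lia.
  have [|h1 h2 h3] := IH (i + 1)%N; first by lia.
  rewrite TE //; case: ifP => [/andP[ci]|ci].
    rewrite -ltNge => lt; split; first by rewrite (le_trans h1) // ltW.
      move=> j /andP[ij jn] cj; have [->//|ji] := eqVneq j i.
      by apply: le_trans (ltW lt); apply: h2 => //; lia.
    by right; exists (Ordinal iN).
  split=> // j /andP[ij jn] cj; have [ji|ji] := eqVneq j i; last by apply: h2 => //; lia.
  by move: ci; rewrite -ji cj /= => /negbT; rewrite negbK.
have [h1 h2 h3] := H n 0%N (add0n n); split=> // i iN ci; exact: h2.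
Qed.

(** One array of ratios serves both kinds of candidates, because an index cannot be in [A] and in
    [B]. *)
Definition cand_ok P p A B C m : Prop := forall i : 'I_n,
  (nmem m 16 i == 1%N) = cand0 P p A B i || candu P p A i /\
  (cand0 P p A B i -> rmem m 26 i = Defs.ratio0 P p A C i) /\
  (candu P p A i -> rmem m 26 i = ratiou P p A C i).

Lemma cand_eqs P p A B C m : part3 (vars P) A B C ->
  (forall i : nat, (i < n)%N -> eq_at (nth (find_fill is_cand) cand_fills 0) m i) ->
  (forall i : nat, (i < n)%N -> eq_at (nth (find_fill is_cand) cand_fills 1) m i) ->
  holds_ub m (vars P) (ub P) -> (forall i, (0 < ub P i)%E) ->
  holds_status m A B C ->
  holds_vec m rQbar (vars P) (qbar P A C) -> holds_vec m rPbar (vars P) (pbar P p A) ->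
  cand_ok P p A B C m.
Proof.
move=> pt e1 e2 hu u0 [hB hA hC] hq hp i.
have := e1 i (ltn_ord i); have := e2 i (ltn_ord i).
rewrite /= !nlt_eqE -?eqn0Ngt -(hB i) -(hA i) => -> ->.
rewrite /cand0 /candu /Defs.ratio0 /ratiou.
have [iV|iV] := boolP (i \in vars P); last first.
  have := pt i; rewrite (negbTE iV); case: (i \in A) => //; case: (i \in B) => //=.
  by rewrite if_same.
rewrite hq // hp // -ltNge; set q' := qbar _ _ _ _ _; set p' := pbar _ _ _ _ _.
have uE : (nmem m nFinite i == 1%N) = (ub P i < +oo)%E /\
    ((ub P i < +oo)%E -> rmem m rUb i = fine (ub P i)).
  have := hu i iV; have := u0 i; case: (ub P i) => [r| |] //= _; last by move=> ->.
  by move=> [-> ->]; rewrite ltey.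
have := pt i; rewrite iV; case: (i \in A) => /=; case: (i \in B) => //= _.
  case: uE => -> uE; case: (0 < p') => //=; case: ifP => //= ui; split=> //; split=> // _.
  by rewrite uE // sub0r opprD.
  by case: (0 < p') => //=; split=> //; split=> // _; rewrite sub0r.
by rewrite if_same.
Qed.

Lemma tau_correct P p A B C m : part3 (vars P) A B C -> nmem m nSize 0 = n ->
  holds_ub m (vars P) (ub P) -> (forall i, (0 < ub P i)%E) ->
  holds_status m A B C ->
  holds_vec m rQbar (vars P) (qbar P A C) -> holds_vec m rPbar (vars P) (pbar P p A) ->
  let m' := run tau_cmd m in
  (rmem m' rTau 0)%:E = tau_new P p A B C.
Proof.
move=> pt m0 hu u0 hs hq hp m'.
set m1 := run (RSet rTau cells (RLit 0)) m.
have [|] := prog_spec (fs := cand_fills ++ [:: tau_fill]) (m := m1) m0 erefl.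
  split=> //; split=> //; split=> // m2 so _ i g g' iN gg /=.
  by rewrite gg // /before addn1.
rewrite -[run (prog _) m1]/m'; have m1E : rmem m1 rTau n = 0 by rewrite /= /put /= m0 eqxx.
have f1 b : b \notin [:: rTau] -> rmem m1 b = rmem m b by move=> h; apply: run_rframe.
have f2 b : nmem m1 b = nmem m b by [].
clearbody m' m1 => -[e1 [e2 [e3 _]]] [s1 s2 _ s4].
have ck : cand_ok P p A B C m'.
  apply: cand_eqs => //.
  - by move=> i iV; have := hu i iV; rewrite !s1 // s2 // f1 // !f2.
  - by case: hs => a b c; split=> i; rewrite s1 // f2.
  - by move=> i iV; rewrite s2 // f1 // hq.
  - by move=> i iV; rewrite s2 // f1 // hp.
have [||t0 tc att] := max_spec (c := fun i => nmem m' 16 i == 1%N) (r := rmem m' 26) (T := rmem m' rTau).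
- by rewrite s4 // m1E.
- by move=> i iN; have := e3 i iN; rewrite /= !nlt_eqE.
apply/esym/tau_specP; split=> // [i ci|i ci|].
- have [h1 [h2 _]] := ck i; rewrite -h2 //; apply: tc => //.
  by rewrite h1 ci.
- have [h1 [_ h2]] := ck i; rewrite -h2 //; apply: tc => //.
  by rewrite h1 ci orbT.
case: att => [->|[i [ci ri]]]; first by constructor 1.
have [h1 [h2 h3]] := ck i; move: ci; rewrite h1 => /orP[ci|ci].
  by constructor 2; exists i; rewrite // -h2.
by constructor 3; exists i; rewrite // -h3.
Qed.
End Compute.

(** * The computations of one iteration, composed *)

Section Transport.
Variables (R : realType) (n : nat).
Implicit Types (m : memory R) (V A B C : {set 'I_n}) (P : qp R n).

Lemma holds_set_eq m m' a k V : nmem m' a = nmem m a ->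
  holds_set m a k V -> holds_set m' a k V.
Proof. by move=> e h i; rewrite e. Qed.

Lemma holds_vec_eq m m' a V (v : 'cV[R]_n) : rmem m' a = rmem m a ->
  holds_vec m a V v -> holds_vec m' a V v.
Proof. by move=> e h i iV; rewrite e h. Qed.

Lemma holds_qp_eq m m' P : nmem m' nFinite = nmem m nFinite ->
  rmem m' rDiag = rmem m rDiag -> rmem m' rOff = rmem m rOff ->
  rmem m' rLin = rmem m rLin -> rmem m' rUb = rmem m rUb ->
  holds_qp m P -> holds_qp m' P.
Proof.
move=> e1 e2 e3 e4 e5 [[hD hO] hl hu]; split=> [|i iV|i iV].
- by split=> [i iV|i j iV jV ij h]; rewrite ?e2 ?e3; [apply: hD|apply: hO].
- by rewrite e4 hl.
by have := hu i iV; rewrite e1 e5.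
Qed.

Lemma holds_status_eq m m' A B C : nmem m' nStatus = nmem m nStatus ->
  holds_status m A B C -> holds_status m' A B C.
Proof. by move=> e [a b c]; split; apply: holds_set_eq e _. Qed.

Lemma compute_correct m P p A B C : nmem m nSize 0 = n -> wfqp P ->
  part3 (vars P) A B C -> (forall i, i \in C -> (ub P i < +oo)%E) ->
  pd_on (mat P) A -> holds_set m nVars 1 (vars P) -> holds_qp m P ->
  holds_vec m rP (vars P) p -> holds_status m A B C ->
  let m' := run compute_cmd m in
  [/\ is_cholesky (submx_on (mat P) A A) (held_factor m' A),
      holds_vec m' rQbar (vars P) (qbar P A C),
      holds_vec m' rPbar (vars P) (pbar P p A)
    & (rmem m' rTau 0)%:E = tau_new P p A B C].
Proof.
move=> m0 wP pt Cf pA hV hP hp hs m'.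
have sM := wf_sym wP; have pM := wf_psd wP; have tV := chain_tri (wf_chain wP).
have AV := part3_sub pt; have uA := pd_unit pA; have up := wf_ub wP.
have CV : C \subset vars P.
  apply/subsetP => i iC; have := pt i; rewrite iC.
  by case: (i \in vars P) => //; case: (i \in A); case: (i \in B).
set m1 := run (prog link_fills) m.
have lk1 : linked n (nmem m1 nVars) (nmem m1 9) (nmem m1 10) (rmem m1 rOff) (rmem m1 13) (rmem m1 14).
  exact: link_run.
have n1 b : b \notin [:: 5; 6; 9; 10]%N -> nmem m1 b = nmem m b by exact: run_nsub.
have r1 b : b \notin [:: 13; 14]%N -> rmem m1 b = rmem m b by exact: run_rsub.
set m2 := run (prog chol_fills) m1.
have ch2 : is_cholesky (submx_on (mat P) A A) (held_factor m2 A).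
  apply: (chol_correct sM pM tV AV) lk1 _ _ _; rewrite ?n1 //.
  - by apply: holds_set_eq hV; rewrite n1.
  - by have [h _ _] := holds_qp_eq (n1 2%N isT) (r1 0%N isT) (r1 1%N isT) (r1 2%N isT) (r1 3%N isT) hP.
  by case: hs => _ h _; apply: holds_set_eq h; rewrite n1.
have n2 b : b \notin [:: 5; 6]%N -> nmem m2 b = nmem m1 b by exact: run_nsub.
have r2 b : b \notin [:: 19; 6; 7; 8]%N -> rmem m2 b = rmem m1 b by exact: run_rsub.
set m3 := run (prog solve_fills) m2.
have n3 b : b \notin [:: 5; 6]%N -> nmem m3 b = nmem m2 b by exact: run_nsub.
have r3 b : b \notin [:: 19; 29; 22; 18; 27; 20; 9; 28; 21; 10]%N -> rmem m3 b = rmem m2 b.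
  exact: run_rsub.
have hP2 : holds_qp m2 P.
  by apply: holds_qp_eq hP; rewrite ?n2 ?n1 ?r2 ?r1.
have [q3 p3] : holds_vec m3 rQbar (vars P) (qbar P A C) /\
    holds_vec m3 rPbar (vars P) (pbar P p A).
  apply: (solve_correct sM tV AV CV Cf up uA) => //.
  - by rewrite n2 // n1.
  - by rewrite !n2 // !r2.
  - by apply: holds_set_eq hV; rewrite n2 // n1.
  - by apply: holds_vec_eq hp; rewrite r2 // r1.
  by apply: holds_status_eq hs; rewrite n2 // n1.
have m'E : m' = run tau_cmd m3 by rewrite /m' /compute_cmd !run_seq.
rewrite m'E; clear m' m'E; set m' := run tau_cmd m3.
have n4 b : b \notin [:: 5; 6; 16]%N -> nmem m' b = nmem m3 b by exact: run_nsub.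
have r4 b : b \notin [:: 26; 11]%N -> rmem m' b = rmem m3 b by exact: run_rsub.
split.
- by rewrite /held_factor r4 // r4 // r3 // r3.
- by apply: holds_vec_eq q3; rewrite r4.
- by apply: holds_vec_eq p3; rewrite r4.
apply: tau_correct => //.
- by rewrite n3 // n2 // n1.
- by have [_ _ h] := hP2; move=> i iV; have := h i iV; rewrite n3 // r3.
by apply: holds_status_eq hs; rewrite n3 // n2 // n1.
Qed.
End Transport.

(** The input does not mark the variables, so all indices are marked before neighbours are
    linked. *)
Definition solve_program : cmd :=
  Seq (prog [:: NFill false nVars (NLeaf N1)])
      (Seq (prog link_fills) (prog solve_fills)).

Lemma tridiagonal_tri (R : realType) n (M : 'M[R]_n) : tridiagonal M ->
  tri_on [set: 'I_n] M.
Proof.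
move=> tM i j _ _ ij c; apply: tM; apply/orP; left.
rewrite ltn_neqAle ij andbT; apply: contra c => /eqP e.
by apply: consecP; rewrite ?inE // => k _; rewrite -e; lia.
Qed.

Lemma solve_program_correct (R : realType) (n : nat) (M : 'M[R]_n)
    (q p : 'cV[R]_n) (u : 'I_n -> \bar R) (A B C : {set 'I_n}) (m : memory R) :
  (0 < n)%N -> tridiagonal M -> symmetric_mx M -> pos_semidef M ->
  (forall i, 0 < u i)%E -> [disjoint A & C] ->
  (forall i, i \in C -> (u i < +oo)%E) -> submx_on M A A \in unitmx ->
  let P := QP [set: 'I_n] M q u in
  holds_size n m -> holds_qp m P -> holds_vec m rP [set: 'I_n] p ->
  holds_status m A B C ->
  is_cholesky (submx_on M A A) (held_factor m A) ->
  let s := exec solve_program (start m) in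
  [/\ (clock s <= weight solve_program * n)%N,
      holds_vec (store s) rQbar [set: 'I_n] (qbar P A C)
    & holds_vec (store s) rPbar [set: 'I_n] (pbar P p A)].
Proof.
move=> n0 tM sM pM up dAC Cf uA P m0 hP hp hs ch s.
have cl : (clock s <= weight solve_program * n)%N.
  have := @sized_clock R solve_program (start m) n n0 isT m0.
  by rewrite add0n expn1.
rewrite /s store_exec [store _]/= /solve_program !run_seq.
set m1 := run (prog [:: NFill false nVars (NLeaf N1)]) m.
have n1 b : b \notin [:: 3; 5; 6]%N -> nmem m1 b = nmem m b by exact: run_nsub.
have r1 b : rmem m1 b = rmem m b by apply: run_rframe.
have v1 i : (i < n)%N -> nmem m1 nVars i = 1%N.
  by have [//|[e _] _] := prog_spec (fs := [:: NFill false nVars (NLeaf N1)]) m0 erefl; exact: e.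
set m2 := run (prog link_fills) m1.
have m10 : nmem m1 nSize 0 = n by rewrite n1.
have lk2 : linked n (nmem m2 nVars) (nmem m2 9) (nmem m2 10) (rmem m2 rOff) (rmem m2 13) (rmem m2 14).
  exact: link_run.
have n2 b : b \notin [:: 5; 6; 9; 10]%N -> nmem m2 b = nmem m1 b by exact: run_nsub.
have r2 b : b \notin [:: 13; 14]%N -> rmem m2 b = rmem m1 b by exact: run_rsub.
suff [h1 h2] : holds_vec (run (prog solve_fills) m2) rQbar [set: 'I_n] (qbar P A C) /\
    holds_vec (run (prog solve_fills) m2) rPbar [set: 'I_n] (pbar P p A) by split.
apply: (solve_correct (P := P) sM (tridiagonal_tri tM) _ _ Cf up uA) => //; rewrite ?subsetT //.
- by rewrite n2.
- by move=> i; rewrite n2 // v1 // inE.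
- by apply: holds_qp_eq hP; rewrite ?n2 ?n1 ?r2 ?r1.
- by apply: holds_vec_eq hp; rewrite r2 // r1.
- by apply: holds_status_eq hs; rewrite n2 // n1.
by rewrite /held_factor !r2 // !r1.
Qed.

Definition before_idx := NSub idx N1.

(** One loop body in place of four passes, because a probe has to follow each pivot. With all
    indices present the predecessor is [idx - 1]. *)
Definition chol_step : cmd :=
  Seq (rtcmd 19 (RNode (BAnd (BLt N0 idx) (beqn (NGet nStatus before_idx) N1))
                   (RLeaf (RGet rOff before_idx)) (RLeaf (RLit 0))))
 (Seq (rtcmd rPivot (RLeaf (RSub (RGet rDiag idx)
         (RDiv (RMul (RGet 19 idx) (RGet 19 idx)) (RGet rPivot before_idx)))))
 (Seq (rtcmd rGdiag (RLeaf (RSqrt (RGet rPivot idx))))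
      (rtcmd rGsub (RLeaf (RDiv (RGet 19 idx) (RGet rGdiag before_idx)))))).

Definition chol_program : cmd := For 5 cells (Seq chol_step (Probe 0)).

(** * Cholesky factorization with constant cost per pivot *)

Section CholeskyProgram.
Variables (R : realType) (n : nat).
Implicit Types (m : memory R) (s : machine R).

(** Later iterations write only later cells, so the snapshot at [j] already shows the final values
    there. Entering the loop costs 3 and an iteration adds 1 to its body, whence the pace
    [weight chol_step + 4]. *)
Definition chol_inv m (c : nat) (k : nat) s : Prop :=
  let t := [seq time e | e <- log s] in
  [/\ (forall b, b != 5 -> nmem (store s) b = nmem m b) /\
      (forall b, b \notin [:: 19; 6; 7; 8]%N -> rmem (store s) b = rmem m b),
      forall j : nat, (j < k)%N ->
        [/\ rmem (store s) 19 j = if (0 < j)%N && (nmem m nStatus (j - 1) == 1)%N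
              then rmem m rOff (j - 1)%N else 0,
            rmem (store s) rPivot j = rmem m rDiag j -
              rmem (store s) 19 j * rmem (store s) 19 j / rmem (store s) rPivot (j - 1),
            rmem (store s) rGdiag j = Num.sqrt (rmem (store s) rPivot j)
          & rmem (store s) rGsub j = rmem (store s) 19 j / rmem (store s) rGdiag (j - 1)],
      size (log s) = k,
      forall j : nat, (j < k)%N -> let e := nth (Snapshot 0 0 m) (log s) j in
        rmem (snap e) rPivot j = rmem (store s) rPivot j /\
        rmem (snap e) rGdiag j = rmem (store s) rGdiag j
    & paced c (log s) /\ (clock s <= last 0%N t + 3)%N].

Lemma chol_step_run m (k : nat) : nmem m 5 0 = k ->
  let m' := run chol_step m in
  [/\ nmem m' = nmem m, forall b, b \notin [:: 19; 6; 7; 8]%N -> rmem m' b = rmem m b,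
      forall b j, j != k -> rmem m' b j = rmem m b j
    & [/\ rmem m' 19 k = if (0 < k)%N && (nmem m nStatus (k - 1) == 1)%N
              then rmem m rOff (k - 1)%N else 0,
            rmem m' rPivot k = rmem m rDiag k -
              rmem m' 19 k * rmem m' 19 k / rmem m' rPivot (k - 1),
            rmem m' rGdiag k = Num.sqrt (rmem m' rPivot k)
          & rmem m' rGsub k = rmem m' 19 k / rmem m' rGdiag (k - 1)]].
Proof.
move=> k5 m'.
have E : m' = run chol_step m by [].
rewrite /chol_step !run_seq !run_rtcmd in E.
split.
- by rewrite E.
- by move=> b h; apply: run_rsub h.
- have pE (m1 : memory R) a v b j : j != k ->
      rmem (raset a (put (rmem m1 a) k v) m1) b j = rmem m1 b j.
    move=> jk; rewrite [LHS]/= natEqbE; case: eqP => // ->.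
    by rewrite /put (negbTE jk).
  have nE (m1 : memory R) a g : nmem (raset a g m1) = nmem m1 by [].
  by move=> b j jk; rewrite E !nE k5 !pE.
rewrite E /= k5 /put !eqxx nlt_eqE; case: k {k5} => [|k] /=.
  by rewrite mul0r !mul0r !subr0.
by rewrite subn1 /= (ltn_eqF (ltnSn k)).
Qed.

Lemma exec_probe (c : cmd) t s : exec (Seq c (Probe t)) s =
  let s1 := exec c s in
  Machine (store s1) (clock s1) (rcons (log s1) (Snapshot t (clock s1) (store s1))).
Proof. by []. Qed.

Lemma chol_step_inv m (k : nat) s : (0 < n)%N -> nmem m nSize 0 = n ->
  chol_inv m (weight chol_step + 4) k s ->
  chol_inv m (weight chol_step + 4) k.+1
    (exec (Seq chol_step (Probe 0)) (tick 1 (nstore 5 0 k s))).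
Proof.
move=> n0 m0 [[I1 I2] I3 I4 I5 [I6 I7]].
set s0 := tick 1 _; rewrite exec_probe.
have sE : store (exec chol_step s0) = run chol_step (store s0) by apply: store_exec.
have n5 : nmem (store s0) 5 0 = k by [].
have nE b : b != 5 -> nmem (store s0) b = nmem m b.
  by move=> b5; rewrite -(I1 b b5) /= /upd (negbTE b5).
have cE : (clock (exec chol_step s0) <= clock s0 + weight chol_step)%N.
  have := @sized_clock R chol_step s0 n n0 isT; rewrite nE // => /(_ m0).
  by rewrite expn0 muln1.
have lE : log (exec chol_step s0) = log s by apply: silent_log.
have [r1 r2 r3 [v1 v2 v3 v4]] := chol_step_run n5.
set s1 := exec chol_step s0 in sE cE lE *.
rewrite -sE in r1 r2 r3 v1 v2 v3 v4; clearbody s1.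
have old b j : (j < k)%N -> rmem (store s1) b j = rmem (store s) b j.
  by move=> jk; rewrite r3 // ltn_eqF.
rewrite /chol_inv [store _]/= [log _]/= [clock _]/= lE; split.
- by split=> b hb; [rewrite r1 nE|rewrite r2 // I2].
- move=> j; rewrite ltnS leq_eqVlt => /orP[/eqP ->|jk]; last first.
    by rewrite !old ?(leq_ltn_trans (leq_subr _ _) jk) //; apply: I3.
  by rewrite nE // I2 // in v1; split; rewrite ?v1 // -?v1 //; move: v2; rewrite I2.
- by rewrite size_rcons I4.
- move=> j; rewrite ltnS leq_eqVlt => /orP[/eqP ->|jk].
    by rewrite nth_rcons I4 ltnn eqxx.
  by rewrite nth_rcons I4 jk !old //; apply: I5.
have h : (clock s1 <= last 0%N [seq time e | e <- log s] + (weight chol_step + 4))%N.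
  by apply: leq_trans cE _; rewrite /s0 /=; move: I7; lia.
rewrite /paced in I6 *; rewrite map_rcons rcons_path last_rcons I6 /=.
by split=> //; apply: leq_addr.
Qed.

Lemma chol_program_correct (M : 'M[R]_n) (A : {set 'I_n}) m :
  (0 < n)%N -> tridiagonal M -> symmetric_mx M -> pos_semidef M ->
  holds_size n m -> holds_mat m [set: 'I_n] M -> holds_set m nStatus 1 A ->
  let s := exec chol_program (start m) in
  [/\ size (log s) = n,
      paced (weight chol_step + 4) (log s),
      (forall i : 'I_n, i \in A ->
         let m' := snap (nth (Snapshot 0 0 m) (log s) i) in
         rmem m' rPivot i = pivoted M A i i i /\
         rmem m' rGdiag i = Num.sqrt (rmem m' rPivot i)),
      (clock s <= weight chol_program * n)%N
    & is_cholesky (submx_on M A A) (held_factor (store s) A)].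
Proof.
move=> n0 tM sM pM m0 hM hA s.
have cl : (clock s <= weight chol_program * n)%N.
  have := @sized_clock R chol_program (start m) n n0 isT m0.
  by rewrite add0n expn1.
have Inv (k : nat) : chol_inv m (weight chol_step + 4) k
   (iteri k (fun k s' => exec (Seq chol_step (Probe 0)) (tick 1 (nstore 5 0 k s')))
      (tick 3 (start m))).
  by elim: k => [|k IH]; [split|apply: chol_step_inv].
have [[I1 I2] I3 I4 I5 [I6 I7]] : chol_inv m (weight chol_step + 4) n s.
  have -> : s = iteri n (fun k s' => exec (Seq chol_step (Probe 0)) (tick 1 (nstore 5 0 k s')))
      (tick 3 (start m)); last exact: Inv.
  rewrite /s /chol_program; set c := Seq _ _.
  by rewrite -{1}m0.
have tV := tridiagonal_tri tM; have AV := subsetT A.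
have offE := holds_mat_off hM; have [hD _] := hM.
have lA : links_in [set: 'I_n] A M (fun k => (k - 1)%N) (rmem (store s) 19).
  move=> i iA; have [-> _ _ _] := I3 i (ltn_ord i).
  case: (posnP i) => [i0|i0].
    by right; split=> // j _; apply/negP => /consec_lt; rewrite i0.
  have jn : (i - 1 < n)%N by apply: leq_ltn_trans (ltn_ord i); apply: leq_subr.
  have c : consec [set: 'I_n] (Ordinal jn) i.
    by apply: consecP => [||/=|k _ /=]; rewrite ?inE //; move: i0; clear; lia.
  case: ifP => st; [left|right].
    exists (Ordinal jn); split=> //; first by rewrite hA.
    by rewrite (offE _ _ c) sym_entry.
  split=> // j jA; apply/negP => c'; move: jA.
  by rewrite (consec_inj c' c) hA /=; rewrite /= in st; rewrite st.
have vE (i : 'I_n) : i \in A -> rmem (store s) rPivot i = M i i -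
    rmem (store s) 19 i * rmem (store s) 19 i / rmem (store s) rPivot (i - 1)%N.
  by move=> iA; have [_ -> _ _] := I3 i (ltn_ord i); rewrite hD ?inE.
split=> // [i iA|].
  move=> m'; have [e1 e2] := I5 i (ltn_ord i).
  rewrite /m' e1 e2; split; last by have [] := I3 i (ltn_ord i).
  exact: (pivots_eq sM tV AV lA (v := rmem (store s) rPivot) vE iA).
apply: (cholesky_of_pivots sM pM tV AV lA vE) => i iA.
  by have [_ _ -> _] := I3 i (ltn_ord i).
by have [_ _ _ ->] := I3 i (ltn_ord i).
Qed.
End CholeskyProgram.

(** * The phases of the PPPA on the machine *)

Definition ptr := NGet 8 N0.
Definition dep := NGet 12 N0.
Definition found := NGet 11 N0.
Definition set_phase (k : nat) : cmd := NSet 7 N0 (NLit k).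

Definition find_cmd (b : bexp) : cmd := Seq (NSet 11 cells cells) (prog [:: find_fill b]).

(* The reductions are kept on a stack in the arrays 13-15 and 23-25, whose height is
   in array 12: an entry (i, j, k, a, b, c) stands for x_i := a + b x_j + c x_k.
   A block with N variables is reduced at most 2 N times, since every reduction
   removes a variable or a bound. *)
Definition pop_cmd : cmd :=
  If (BLt N0 dep)
    (Seq (NSet 12 N0 (NSub dep N1))
         (RSet rSol (NGet 13 dep)
            (RAdd (RGet 23 dep)
               (RAdd (RMul (RGet 24 dep) (RGet rSol (NGet 14 dep)))
                     (RMul (RGet 25 dep) (RGet rSol (NGet 15 dep)))))))
    Skip.

Definition finish_cmd : cmd :=
  Seq (For 6 cells pop_cmd) (Seq (For 6 cells pop_cmd) (set_phase 0)).

Section Machine.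
Variables (R : realType) (n : nat).
Implicit Types (m : memory R) (V : {set 'I_n}).

Lemma run_NSet a i e m :
  run (NSet a i e) m = naset a (put (nmem m a) (nval m i) (nval m e)) m.
Proof. by []. Qed.

Lemma run_RSet a i e m :
  run (RSet a i e) m = raset a (put (rmem m a) (nval m i) (rval m e)) m.
Proof. by []. Qed.

Lemma run_If b c1 c2 m : run (If b c1 c2) m = if bval m b then run c1 m else run c2 m.
Proof. by []. Qed.

Lemma nmem_naset a g m b : nmem (naset a g m) b = if b == a then g else nmem m b.
Proof. by rewrite /= natEqbE. Qed.

Lemma rmem_raset a g m b : rmem (raset a g m) b = if b == a then g else rmem m b.
Proof. by rewrite /= natEqbE. Qed.

Lemma nmem_raset a g m b : nmem (raset a g m) b = nmem m b.
Proof. by []. Qed.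

Lemma rmem_naset a g m b : rmem (naset a g m) b = rmem m b.
Proof. by []. Qed.

(** The test must not depend on the cells that the search itself overwrites. *)
Definition find_ok (b : bexp) : bool :=
  [&& bfine b, 11%N \notin bnreads b & 6%N \notin bnreads b].

Lemma find_run b m : nmem m nSize 0 = n -> find_ok b ->
  let m' := run (find_cmd b) m in
  [/\ (nmem m' 11 0 <= n)%N,
      forall j : nat, (j < nmem m' 11 0)%N -> ~~ bval (at_ j m) b
    & (nmem m' 11 0 < n)%N -> bval (at_ (nmem m' 11 0) m) b].
Proof.
move=> m0 /and3P[bf b11 b6] m'.
have E : m' = run (prog [:: find_fill b]) (naset 11 (put (nmem m 11) n n) m).
  by rewrite /m' /find_cmd run_seq run_NSet /= m0.
set m1 := naset 11 _ m in E.
have m10 : nmem m1 nSize 0 = n by [].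
have st : static [:: find_fill b].
  by rewrite /= !andbT bf /= !mem_cat /= (negbTE b6).
have bE g i : bval (at_ i (naset 11 g m1)) b = bval (at_ i m) b.
  apply: bval_agree => // k kb; rewrite /at_ !nmem_naset.
  by case: eqP => // _; case: eqP => // e; rewrite e (negbTE b11) in kb.
have [|] := prog_spec m10 st.
  split; last by [].
  case: ifP => // _ m2 [s1 s2 s3 s4] _ i g g' iN gg.
  have bE' h : bval (at_ i (naset 11 h m2)) b = bval (at_ i m) b.
    apply: bval_agree => k kb; last by rewrite /= s2.
    rewrite /at_ !nmem_naset; case: eqP => // /eqP k5.
    case: eqP => [e|/eqP k11]; first by rewrite e (negbTE b11) in kb.
    have k56 : k \notin [:: 5; 6]%N.
      by rewrite !inE negb_or k5 /=; apply: contraNneq b6 => <-.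
    rewrite s1 //; last by rewrite /= inE.
    by rewrite /m1 nmem_naset (negbTE k11).
  rewrite [LHS]/= [RHS]/= -/(at_ i (naset 11 g m2)) -/(at_ i (naset 11 g' m2)) !bE'.
  by case: ifP => // _; apply: gg; rewrite /before addn1.
rewrite -E; clearbody m' => -[e1 _] [s1 s2 s3 s4].
apply: (first_index (b := fun j => bval (at_ j m) b)) => [i iN|]; last first.
  by rewrite s3 // /m1 nmem_naset eqxx /put eqxx.
have := e1 i iN; rewrite [eq_at _ _ _]/= => ->.
rewrite -/(at_ i m') (_ : bval _ b = bval (at_ i m) b) //.
apply: bval_agree => k kb; last by rewrite /= s2.
rewrite /at_ !nmem_naset; case: eqP => // /eqP k5.
have k11 : k != 11%N by apply: contraNneq b11 => <-.
have k56 : k \notin [:: 5; 6]%N.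
  by rewrite !inE negb_or k5 /=; apply: contraNneq b6 => <-.
rewrite s1 //; last by rewrite /= inE.
by rewrite /m1 nmem_naset (negbTE k11).
Qed.

(** The most recent reduction is undone first: an entry may refer to variables that entries above it
    restore. *)
Fixpoint unw (ix j1 j2 : nat -> nat) (c0 c1 c2 : nat -> R) (t : nat)
    (f : nat -> R) : nat -> R :=
  if t is t'.+1 then
    unw ix j1 j2 c0 c1 c2 t'
      (put f (ix t') (c0 t' + (c1 t' * f (j1 t') + c2 t' * f (j2 t'))))
  else f.

Lemma unw_put ix j1 j2 c0 c1 c2 t k1 k2 k3 a1 a2 a3 f :
  unw (put ix t k1) (put j1 t k2) (put j2 t k3) (put c0 t a1) (put c1 t a2) (put c2 t a3) t f =
  unw ix j1 j2 c0 c1 c2 t f.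
Proof.
suff H s : (s <= t)%N -> unw (put ix t k1) (put j1 t k2) (put j2 t k3) (put c0 t a1)
  (put c1 t a2) (put c2 t a3) s f = unw ix j1 j2 c0 c1 c2 s f by apply: H.
elim: s f => //= s IH f st; rewrite IH ?(ltnW st) //.
have pE (T : Type) (g : nat -> T) v : put g t v s = g s by rewrite /put (ltn_eqF st).
by rewrite !pE.
Qed.

Definition unwind m (f : nat -> R) : nat -> R :=
  unw (nmem m 13) (nmem m 14) (nmem m 15) (rmem m 23) (rmem m 24) (rmem m 25)
    (nmem m 12 0) f.

(** Popping an empty stack does nothing, so [2 n] attempts clear any stack of height at most
    [2 n]. *)
Lemma finish_run m : nmem m nSize 0 = n -> (nmem m 12 0 <= 2 * n)%N ->
  rmem (run finish_cmd m) rSol = unwind m (rmem m rSol).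
Proof.
move=> m0 dn; rewrite /finish_cmd !run_seq run_NSet.
set t := nmem m 12 0 in dn *.
pose Q k mk := [/\ nmem mk nSize 0 = n, nmem mk 12 0 = (t - k)%N,
  forall b, b \notin [:: 5; 6; 12]%N -> nmem mk b = nmem m b,
  forall b, b != rSol -> rmem mk b = rmem m b
  & unwind mk (rmem mk rSol) = unwind m (rmem m rSol)].
have step k mk j : Q k mk -> Q k.+1 (run pop_cmd (naset 6 (put (nmem mk 6) 0 j) mk)).
  move=> [q1 q2 q3 q4 q5]; rewrite /pop_cmd run_If [bval _ _]/= q2.
  case: ltnP => tk; last first.
    split=> //; rewrite ?nmem_naset //=; first by rewrite q2; lia.
    move=> b hb; rewrite natEqbE; case: eqP => [e|_]; last exact: q3.
    by rewrite e in hb.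
  rewrite run_seq run_NSet run_RSet; split.
  - by [].
  - by rewrite /= /put /= q2; lia.
  - move=> b hb; have := hb; rewrite !inE !negb_or => /and3P[_ b6 b12].
    by rewrite nmem_raset !nmem_naset (negbTE b6) (negbTE b12) q3.
  - by move=> b hb; rewrite rmem_raset (negbTE hb) q4.
  rewrite -q5 /unwind /= /put /= q2; have -> : (t - k = (t - k - 1).+1)%N by lia.
  by rewrite subn1 /=.
have loopQ k mk : Q k mk -> Q (k + n)%N (run (For 6 cells pop_cmd) mk).
  move=> qk; have m00 : nmem mk 0 0 = n by case: qk.
  rewrite [run _ _]/= m00.
  have H j : Q (k + j)%N (iteri j (fun k m' => run pop_cmd (naset 6 (put (nmem m' 6) 0 k) m')) mk).
    by elim: j => [|j IH]; rewrite ?addn0 // addnS; apply: step.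
  exact: H.
have q0 : Q 0%N m by split=> //; rewrite subn0.
have [_ d12 _ _ <-] := loopQ _ _ (loopQ _ _ q0).
rewrite /unwind d12; have -> : (t - (0 + n + n) = 0)%N by lia.
by [].
Qed.

End Machine.

(* Cell 0 of array 7 holds the phase, numbered as the labels of the probes, and cell
   0 of array 8 the first index not yet treated. *)
Section Representation.
Variables (R : realType) (n : nat) (M : 'M[R]_n) (q : 'cV[R]_n).
Variable (u : 'I_n -> \bar R).
Hypotheses (tM : tridiagonal M) (sM : symmetric_mx M) (pM : pos_semidef M).
Hypothesis (u0 : forall i, (0 < u i)%E).
Implicit Types (m : memory R) (P : qp R n) (todo : seq {set 'I_n}).
Implicit Types (rec : 'cV[R]_n -> 'cV[R]_n) (V S : {set 'I_n}).

(* The blocks still to be treated are the consecutive intervals from s on. *)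
Fixpoint todo_rep (s : nat) todo : Prop :=
  if todo is T :: todo' then
    exists s', [/\ (s < s')%N, forall i : 'I_n, (i \in T) = (s <= i < s')%N
                 & todo_rep s' todo']
  else s = n.

(** Reductions overwrite data of the current block only, so from the pointer on the memory still
    holds the original problem. *)
Definition raw (s : nat) m : Prop :=
  [/\ forall i : 'I_n, (s <= i)%N -> rmem m rDiag i = M i i,
      forall i j : 'I_n, (s <= i)%N -> j = i.+1 :> nat -> rmem m rOff i = M i j,
      holds_vec m rLin [set i : 'I_n | (s <= i)%N] q
    & holds_ub m [set i : 'I_n | (s <= i)%N] u].

(** The values of the block are not known yet, so [f] ranges over all arrays that extend a solution
    [y] of the current problem by the present contents of [rSol]. *)
Definition rec_rep m V rec : Prop :=
  forall (y : 'cV[R]_n) (f : nat -> R),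
    (forall i : 'I_n, i \in V -> f i = y i 0) ->
    (forall i : 'I_n, i \notin V -> f i = rmem m rSol i) ->
    forall i : 'I_n, unwind m f i = rec y i 0.

(** The last bound pays for the stack: a reduction pushes one entry and lowers [qp_size] by at least
    1. *)
Definition preparing_rep todo P rec m : Prop :=
  [/\ todo_rep (nmem m 8 0) todo, raw (nmem m 8 0) m,
      holds_set m nVars 1 (vars P), holds_qp m P
    & [/\ forall i, i \in vars P -> (i < nmem m 8 0)%N,
          rec_rep m (vars P) rec & (nmem m 12 0 + qp_size P <= 2 * n)%N]].

Definition rep (c : config R n) m : Prop :=
  nmem m nSize 0 = n /\
  match c with
  | Idle todo x => nmem m 7 0 = 0%N /\
      [/\ todo_rep (nmem m 8 0) todo, raw (nmem m 8 0) m & holds_vec m rSol [set: 'I_n] x]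
  | Preparing todo P rec => nmem m 7 0 = 1%N /\ preparing_rep todo P rec m
  | Prepared todo P rec d p => nmem m 7 0 = 2%N /\
      [/\ preparing_rep todo P rec m, holds_vec m rD (vars P) d
        & holds_vec m rP (vars P) p]
  | Pivoting todo P rec p A B C => nmem m 7 0 = 3%N /\
      [/\ preparing_rep todo P rec m, holds_vec m rP (vars P) p &
      [/\ holds_status m A B C,
          is_cholesky (submx_on (mat P) A A) (held_factor m A),
          holds_vec m rQbar (vars P) (qbar P A C),
          holds_vec m rPbar (vars P) (pbar P p A)
        & (rmem m rTau 0)%:E = tau_new P p A B C]]
  | Answered a => nmem m 7 0 = 4%N /\ holds_answer m a
  end.

Lemma rep_records c m t : rep c m -> records c (Snapshot (nmem m 7 0) t m).
Proof.
case: c => [todo x|todo P rec|todo P rec d p|todo P rec p A B C|a] [m0 [ph h]];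
  rewrite /records /= ph //.
- by have [_ _ h3 h4 _] := h.
- by have [[_ _ h3 h4 _] h5 h6] := h.
by have [_ _ h6] := h.
Qed.

Lemma todo_rep_le s todo : todo_rep s todo -> (s <= n)%N.
Proof.
by elim: todo s => [|S todo IH] s /= => [->|[s' [ss _ /IH]]]; lia.
Qed.

Lemma preparing_rep_eq m m' todo P rec :
  (forall b, b \in [:: 2; 3; 8; 12; 13; 14; 15]%N -> nmem m' b = nmem m b) ->
  (forall b, b \in [:: 0; 1; 2; 3; 12; 23; 24; 25]%N -> rmem m' b = rmem m b) ->
  preparing_rep todo P rec m -> preparing_rep todo P rec m'.
Proof.
move=> en er [h1 h2 h3 h4 [h5 h6 h7]].
rewrite /preparing_rep !en //; split=> //.
- have [r1 r2 r3 r4] := h2; split=> [i si|i j si ij|i si|i si].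
  + by rewrite er // r1.
  + by rewrite er // (r2 _ _ si ij).
  + by rewrite er // r3.
  by have := r4 i si; rewrite en // er.
- by apply: holds_set_eq h3; rewrite en.
- by apply: holds_qp_eq h4; rewrite ?en ?er.
split=> // y f fy fo i; rewrite -(h6 y f fy) => [|j jV]; last by rewrite fo // er.
by rewrite /unwind !en // !er.
Qed.

Lemma finish_correct m m0 todo P rec (y : 'cV[R]_n) : nmem m0 nSize 0 = n ->
  preparing_rep todo P rec m0 ->
  (forall b, b \in [:: 0; 2; 3; 8; 12; 13; 14; 15]%N -> nmem m b = nmem m0 b) ->
  (forall b, b \in [:: 0; 1; 2; 3; 23; 24; 25]%N -> rmem m b = rmem m0 b) ->
  (forall i : 'I_n, i \in vars P -> rmem m rSol i = y i 0) ->
  (forall i : 'I_n, i \notin vars P -> rmem m rSol i = rmem m0 rSol i) ->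
  rep (Idle todo (rec y)) (run finish_cmd m).
Proof.
move=> m00 [h1 h2 h3 h4 [h5 h6 h7]] en er yV yo.
set m' := run finish_cmd m.
have nE b : b \notin [:: 6; 12; 7]%N -> nmem m' b = nmem m b by exact: run_nsub.
have rE b : b \notin [:: rSol] -> rmem m' b = rmem m b by exact: run_rsub.
have ph : nmem m' 7 0 = 0%N by rewrite /m' /finish_cmd !run_seq run_NSet nmem_naset.
have solE : rmem m' rSol = unwind m (rmem m rSol).
  by apply: (@finish_run _ n); rewrite en //; lia.
clearbody m'; split; first by rewrite nE // en.
split=> //; rewrite nE // en //; split=> //.
  have [r1 r2 r3 r4] := h2; split=> [i si|i j si ij|i si|i si].
  - by rewrite rE // er // r1.
  - by rewrite rE // er // (r2 _ _ si ij).
  - by rewrite rE // er // r3.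
  by have := r4 i si; rewrite nE // en // rE // er.
move=> i _; rewrite solE -(h6 y (rmem m rSol) yV yo).
by rewrite /unwind !en // (er 23%N) // (er 24%N) // (er 25%N).
Qed.

(** Marks the block that starts at the pointer: a later index joins when its predecessor belongs and
    their link is nonzero. *)
Definition vars_fill : fill :=
  NFill false nVars (NNode (BLt idx ptr) (NLeaf N0) (NNode (beqn idx ptr) (NLeaf N1)
    (NNode (BAnd (beqn (NGet nVars (NSub idx N1)) N1)
                 (BNot (beqr (RGet rOff (NSub idx N1)) (RLit 0))))
       (NLeaf N1) (NLeaf N0)))).

Definition idle_cmd : cmd :=
  If (BLt ptr cells)
    (Seq (prog [:: vars_fill])
    (Seq (find_cmd (BAnd (BLt ptr idx) (BNot is_var)))
    (Seq (NSet 8 N0 found) (Seq (NSet 12 N0 N0) (set_phase 1)))))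
    (Seq (NSet nVerdict N0 N1) (set_phase 4)).

Lemma block_interval S (s s' : nat) (i j : 'I_n) : S \in blocks M ->
  (forall i : 'I_n, (i \in S) = (s <= i < s')%N) -> (s <= i)%N -> (i < s')%N ->
  j = i.+1 :> nat -> (M i j == 0) = (j == s' :> nat).
Proof.
move=> bS SE si is_ ij; have iS : i \in S by rewrite SE si.
have [js|js] := eqVneq (j : nat) s'.
  by apply/eqP; apply: (block_cross bS iS); rewrite SE js ltnn andbF.
have jS : j \in S by rewrite SE; lia.
have lt : (i < j)%N by rewrite ij.
apply/negbTE; rewrite (block_chain tM sM bS iS jS lt).
by apply: consecP => // k _; rewrite ij; lia.
Qed.

Lemma idle_step todo x m : config_ok M q u (Idle todo x) -> rep (Idle todo x) m ->
  exists2 c, step M q u (Idle todo x) c & rep c (run idle_cmd m).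
Proof.
move=> [[ut bl] gx] [m0 [ph [tr rw sol]]]; rewrite /idle_cmd run_If [bval _ _]/= m0.
case: todo tr ut bl gx => [|S todo] tr ut bl gx.
  exists (Answered (Optimal x)); first exact: step_finish.
  rewrite -/(nmem m 8 0) tr ltnn !run_seq /set_phase !run_NSet; split.
    by [].
  split=> //; split=> //.
have [s' [ss' SE tr']] := tr; set s := nmem m 8 0 in tr ss' SE rw *.
have bS : S \in blocks M by apply: bl; rewrite mem_head.
have s'n := todo_rep_le tr'; have sn : (s < n)%N by apply: leq_trans s'n.
rewrite sn; exists (Preparing todo (QP S M q u) (paste S x)); first exact: step_block.
have [r1 r2 r3 r4] := rw.
rewrite 4!run_seq; set m1 := run (prog [:: vars_fill]) m.
have n1 b : b \notin [:: 3; 5; 6]%N -> nmem m1 b = nmem m b by exact: run_nsub.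
have r1E b : rmem m1 b = rmem m b by exact: (@run_rsub _ [::]).
have v1 (i : nat) : (i < n)%N -> nmem m1 nVars i = (s <= i < s')%N.
  have [|] := prog_spec (fs := [:: vars_fill]) m0 erefl.
    split=> // m2 [s1 _ _ _] _ i' g g' iN gg /=.
    rewrite nlt_eqE !s1 // -/s; case: ltnP => // si.
    case: eqP => // /eqP is_; rewrite gg // /before; lia.
  rewrite -/m1; clearbody m1 => -[e1 _] [s1 s2 _ _].
  have {}e1 (i' : nat) : (i' < n)%N -> nmem m1 nVars i' =
     (if i' < s then 0 else if i' == s then 1 else
      if (nmem m1 nVars (i' - 1) == 1) && ~~ (rmem m rOff (i' - 1)%N == 0)%R then 1 else 0)%N.
    by move=> iN; have := e1 i' iN; rewrite /= !nlt_eqE (s1 8%N) // s2 // -eq_le.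
  elim: i => [|i IH] iN; rewrite e1 //.
    case: ltnP => s0 //.
    have -> : (0%N == s) = true by move: s0; rewrite leqn0 eq_sym.
    by rewrite (leq_ltn_trans (leq0n s) ss').
  case: ltnP => // si.
  case: eqP => [->|ne]; first by rewrite ss'.
  have {}si : (s <= i)%N by lia.
  rewrite subn1 /= IH ?(ltnW iN) // si /=.
  case: (ltnP i s') => is_ /=; last by have -> : (i.+1 < s')%N = false by lia.
  have := block_interval (i := Ordinal (ltnW iN)) (j := Ordinal iN) bS SE si is_ erefl.
  rewrite -(r2 (Ordinal (ltnW iN)) (Ordinal iN)) //= => ->.
  by case: eqP => [->|ne']; [rewrite ltnn|have -> : (i.+1 < s')%N by lia].
set m2 := run (find_cmd _) m1.
have [F1 F2 F3] := @find_run R n (BAnd (BLt ptr idx) (BNot is_var)) m1 (etrans (congr1 (fun g => g 0%N) (n1 0%N isT)) m0) isT.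
rewrite -/m2 in F1 F2 F3.
have n2 b : b \notin [:: 11; 5; 6]%N -> nmem m2 b = nmem m1 b by exact: run_nsub.
have r2E b : rmem m2 b = rmem m1 b by exact: (@run_rsub _ [::]).
have bE (j : nat) : bval (at_ j m1) (BAnd (BLt ptr idx) (BNot is_var)) =
    (s < j)%N && (nmem m1 nVars j != 1%N).
  by rewrite /= nlt_eqE n1.
(* The search stops at the first index past the block, or at the sentinel [n] when the block is the
   last one. *)
have Fs : nmem m2 11 0 = s'.
  apply/eqP; rewrite eqn_leq; apply/andP; split; rewrite leqNgt; apply/negP => lt.
    have := F2 s' lt; rewrite bE ss' v1 ?ltnn ?andbF //.
    exact: leq_trans lt F1.
  have := F3 (leq_trans lt s'n); rewrite bE => /andP[sF].
  by rewrite (v1 _ (leq_trans lt s'n)) lt (ltnW sF).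
clearbody m2; rewrite /set_phase !run_NSet.
set m3 := naset 7 _ _.
have n3 b : b \notin [:: 3; 5; 6; 11; 7; 8; 12]%N -> nmem m3 b = nmem m b.
  rewrite !inE !negb_or => /and5P[b3 b5 b6 b11 /and3P[b7 b8 b12]].
  rewrite /m3 !nmem_naset (negbTE b7) (negbTE b8) (negbTE b12) n2 ?n1 //.
    by rewrite !inE !negb_or b3 b5.
  by rewrite !inE !negb_or b11 b5.
have p3 : nmem m3 8 0 = s'.
  by rewrite /m3 !nmem_naset /= /put /= Fs.
have r3E b : rmem m3 b = rmem m b by rewrite /m3 !rmem_naset r2E r1E.
have d3 : nmem m3 12 0 = 0%N by rewrite /m3 !nmem_naset.
have v3 : nmem m3 3 = nmem m1 3 by rewrite /m3 !nmem_naset /= n2.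
have ph3 : nmem m3 7 0 = 1%N by rewrite /m3 !nmem_naset.
clearbody m3; split; first by rewrite n3.
split=> //; rewrite /preparing_rep p3; split=> //.
- split=> [i si|i j si ij|i si|i si].
  + by rewrite r3E r1 //; lia.
  + by rewrite r3E (r2 i j) //; lia.
  + by rewrite r3E r3 // inE; move: si; rewrite inE; lia.
  by have := r4 i; rewrite !inE n3 // r3E; apply; move: si; rewrite inE; lia.
- by move=> i; rewrite v3 v1 // SE; case: (_ <= _ < _)%N.
- split=> /= [|i iS|i iS].
  + split=> [i iS|i j iS jS ij h]; rewrite r3E.
      by apply: r1; move: iS; rewrite SE; lia.
    apply: r2; first by move: iS; rewrite SE; lia.
    apply/eqP; rewrite eqn_leq ij andbT leqNgt; apply/negP => lt.
    have kn : (i.+1 < n)%N := ltn_trans lt (ltn_ord j).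
    have kS : Ordinal kn \in S by move: iS jS; rewrite !SE /=; lia.
    by have := h _ kS; rewrite /= ltnSn lt.
  + by rewrite r3E r3 // inE; move: iS; rewrite SE; lia.
  by have := r4 i; rewrite inE n3 // r3E; apply; move: iS; rewrite SE; lia.
split=> /= [i|y f fy fo i|].
- by rewrite SE => /andP[].
- rewrite /unwind d3 /= mxE; case: ifPn => iS; first exact: fy.
  by rewrite fo // r3E sol // inE.
rewrite d3 add0n /qp_size /= mul2n -addnn leq_add //.
  by rewrite -[X in (_ <= X)%N](card_ord n); apply: max_card.
by rewrite -[X in (_ <= X)%N](card_ord n); apply: max_card.
Qed.

End Representation.

(** Array 15 holds the pivots, cell 0 of array 16 the value [t] (0 if a pivot vanishes, else the
    sentinel 1), array 17 the forward pass. The last pass is a row of half of [M + cmp_mx M], in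
    which only negative links survive. *)
Definition param_fills : seq fill := [::
  RFill false 15 (RLeaf (RSub (RGet rDiag idx)
    (RDiv (RMul (RGet 13 idx) (RGet 13 idx)) (RGet 15 pred_idx))));
  RFill true 16 (RNode (BAnd is_var (beqr (RGet 15 idx) (RLit 0)))
    (RLeaf (RLit 0)) (RLeaf (RGet 16 next_idx)));
  RFill false 17 (RLeaf (RAdd (RGet 16 N0)
    (RMul (RDiv (rabs (RGet 13 idx)) (RGet 15 pred_idx)) (RGet 17 pred_idx))));
  RFill true rD (RNode (beqr (RGet 15 idx) (RLit 0)) (RLeaf (RLit 1))
    (RLeaf (RDiv (RAdd (RGet 17 idx) (RMul (rabs (RGet 14 idx)) (RGet rD succ_idx)))
                 (RGet 15 idx))));
  RFill false rP (RLeaf (RAdd (RMul (RGet rDiag idx) (RGet rD idx))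
    (RDiv (RAdd
       (RMul (RSub (RGet 13 idx) (rabs (RGet 13 idx))) (RGet rD pred_idx))
       (RMul (RSub (RGet 14 idx) (rabs (RGet 14 idx))) (RGet rD succ_idx)))
     (RLit 2)))) ].

Definition inspect_cmd : cmd :=
  If (BLe (RLit 0) (RGet rLin found))
    (Seq (RSet rSol found (RLit 0)) finish_cmd)
    (If (beqn (NGet nFinite found) N1)
      (Seq (RSet rSol found (RGet rUb found)) finish_cmd)
      (Seq (NSet nVerdict N0 (NLit 2)) (set_phase 4))).

(** By [wf_zero_block] a zero diagonal entry can only be a zero block, so inspecting the diagonal is
    enough. *)
Definition zero_diag : bexp := BAnd is_var (beqr (RGet rDiag idx) (RLit 0)).

Definition preparing_cmd : cmd :=
  Seq (prog link_fills) (Seq (find_cmd zero_diag)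
    (If (BLt found cells) inspect_cmd
       (Seq (RSet 16 cells (RLit 1)) (Seq (prog param_fills) (set_phase 2))))).

(** * Preparation of a block on the machine *)

Section Preparing.
Variables (R : realType) (n : nat).
Implicit Types (m : memory R) (V : {set 'I_n}).

Lemma sqrt_sqr_abs (x : R) : Num.sqrt (x * x) = `|x|.
Proof. by rewrite -expr2 sqrtr_sqr. Qed.

Lemma beqrE (x y : R) : (x <= y) && (y <= x) = (x == y).
Proof. by rewrite eq_le. Qed.

Lemma param_run m : nmem m nSize 0 = n -> rmem m 16 n = 1 ->
  linked n (nmem m nVars) (nmem m 9) (nmem m 10) (rmem m rOff) (rmem m 13) (rmem m 14) ->
  let m' := run (prog param_fills) m in
  let pr := fun k => (nmem m 9 k - 1)%N in let nx := nmem m 10 in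
  let e := rmem m' 15 in let t := rmem m' 16 in let y := rmem m' 17 in
  let d := rmem m' rD in let L := rmem m 13 in let U := rmem m 14 in
  t n = 1 /\ forall i : nat, (i < n)%N ->
  [/\ e i = rmem m rDiag i - L i * L i / e (pr i),
      t i = if (nmem m nVars i == 1%N) && (e i == 0) then 0 else t (i + 1)%N,
      y i = t 0%N + `|L i| / e (pr i) * y (pr i),
      d i = if e i == 0 then 1 else (y i + `|U i| * d (nx i)) / e i
    & rmem m' rP i = rmem m rDiag i * d i +
        ((L i - `|L i|) * d (pr i) + (U i - `|U i|) * d (nx i)) / 2%:R].
Proof.
move=> m0 m16 lk m' pr nx e t y d L U.
have [|] := prog_spec (fs := param_fills) m0 erefl.
  have loc (i : nat) (g g' : nat -> R) : (i < n)%N -> (forall j : nat, before false j i -> g j = g' j) ->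
    L i = 0 \/ g (pr i) = g' (pr i).
    move=> iN gg; have [p1 _] := linked_pred lk iN; have L0 := linked_L0 lk iN.
    rewrite /pr; case P : (nmem m 9 i) p1 L0 => [|k] p1 L0; first by left; apply: L0.
    by right; rewrite gg // /before subn1.
  split=> [m1 [s1 s2 _ _] _ i g g' iN gg /=|].
    rewrite !s1 // (s2 13%N) // -/(pr i) -/L.
    by case: (loc i g g' iN gg) => ->; rewrite ?mul0r.
  split=> [m1 so _ i g g' iN gg /=|].
    by rewrite gg // /before addn1.
  split=> [m1 [s1 s2 _ _] _ i g g' iN gg /=|].
    rewrite !s1 // (s2 13%N) // -/(pr i) -/L.
    by case: (loc i g g' iN gg) => ->; rewrite ?mul0r ?sqrtr0 ?mul0r.
  split=> [m1 [s1 s2 _ _] _ i g g' iN gg /=|//].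
  rewrite !s1 // gg // /before.
  by have [/andP[]] := linked_succ lk iN.
rewrite -/m' {}/e {}/t {}/y {}/d; clearbody m' => -[e1 [e2 [e3 [e4 [e5 _]]]]] [s1 s2 s3 s4].
split; first by rewrite s4.
move=> i iN; have := e1 i iN; have := e2 i iN; have := e3 i iN.
have := e4 i iN; have := e5 i iN.
by rewrite /= !nlt_eqE !beqrE !sqrt_sqr_abs !s1 // (s2 rDiag) // (s2 13%N) // (s2 14%N).
Qed.

Lemma zero_scan (b : nat -> bool) (t : nat -> R) : t n = 1 ->
  (forall i : nat, (i < n)%N -> t i = if b i then 0 else t (i + 1)%N) ->
  (t 0%N = 0 /\ exists i : 'I_n, b i) \/ (t 0%N = 1 /\ forall i : 'I_n, ~~ b i).
Proof.
move=> tn tE.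
have H (k : nat) : forall i : nat, (i + k = n)%N ->
   (t i = 0 /\ exists i : 'I_n, b i) \/ (t i = 1 /\ forall j : 'I_n, (i <= j)%N -> ~~ b j).
  elim: k => [|k IH] i ik.
    have -> : i = n by lia.
    by right; split=> // j; rewrite leqNgt ltn_ord.
  have iN : (i < n)%N by lia.
  rewrite tE //; case: ifPn => bi; first by left; split=> //; exists (Ordinal iN).
  case: (IH (i + 1)%N) => [|[t0 ex]|[t1 al]]; first by lia.
    by left.
  right; split=> // j; rewrite leq_eqVlt => /orP[/eqP <-//|ij].
  by apply: al; rewrite addn1.
by case: (H n 0%N (add0n n)) => [|[t1 al]]; [left|right; split=> // i; apply: al].
Qed.

Lemma param_correct m (P : qp R n) : nmem m nSize 0 = n -> rmem m 16 n = 1 ->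
  wfqp P -> holds_set m nVars 1 (vars P) -> holds_qp m P ->
  linked n (nmem m nVars) (nmem m 9) (nmem m 10) (rmem m rOff) (rmem m 13) (rmem m 14) ->
  let m' := run (prog param_fills) m in
  exists d, [/\ valid_d P d, holds_vec m' rD (vars P) d
    & holds_vec m' rP (vars P) (param_vec P d)].
Proof.
move=> m0 m16 wP hV [hM _ _] lk m'.
have sM := wf_sym wP; have tV := chain_tri (wf_chain wP).
have [tn E] := param_run m0 m16 lk; rewrite -/m' in tn E; clearbody m'.
have lks : links (vars P) (mat P) (fun k => (nmem m 9 k - 1)%N) (nmem m 10) (rmem m 13) (rmem m 14).
  exact (linked_links lk sM hV (holds_mat_off hM)).
have DE (i : 'I_n) : i \in vars P -> rmem m rDiag i = mat P i i by case: hM => + _; apply.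
have [eE tE yE dE] : [/\ (forall i : 'I_n, i \in vars P -> rmem m' 15 i = mat P i i -
     rmem m 13 i * rmem m 13 i / rmem m' 15 (nmem m 9 i - 1)%N),
   (rmem m' 16 0 = 0 /\ exists2 i : 'I_n, i \in vars P & rmem m' 15 i = 0) \/
   (rmem m' 16 0 = 1 /\ forall i : 'I_n, i \in vars P -> rmem m' 15 i != 0),
   (forall i : 'I_n, i \in vars P -> rmem m' 17 i = rmem m' 16 0 +
      `|rmem m 13 i| / rmem m' 15 (nmem m 9 i - 1)%N * rmem m' 17 (nmem m 9 i - 1)%N) &
   (forall i : 'I_n, i \in vars P -> rmem m' rD i = if rmem m' 15 i == 0 then 1 else
      (rmem m' 17 i + `|rmem m 14 i| * rmem m' rD (nmem m 10 i)) / rmem m' 15 i)].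
  split=> [i iV| |i iV|i iV].
  - by have [-> _ _ _ _] := E i (ltn_ord i); rewrite DE.
  - have [|[t0 [i]]|[t1 al]] := zero_scan (b := fun i => (nmem m nVars i == 1%N) && (rmem m' 15 i == 0)) tn.
    + by move=> i iN; have [_ -> _ _ _] := E i iN.
    + by rewrite -hV => /andP[iV /eqP e0]; left; split=> //; exists i.
    by right; split=> // i iV; have := al i; rewrite -hV iV.
  - by have [_ _ -> _ _] := E i (ltn_ord i).
  by have [_ _ _ -> _] := E i (ltn_ord i).
have vd := valid_d_col wP lks eE tE yE dE.
set d : 'cV[R]_n := \col_i _ in vd.
have dV (i : 'I_n) : i \in vars P -> rmem m' rD i = d i 0 by move=> iV; rewrite mxE iV.
exists d; split=> // i iV; have [_ _ _ _ ->] := E i (ltn_ord i).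
have sd : supported (vars P) d by have [] := valid_dP vd.
have e1 := tri_mul sM tV lks sd dV iV.
have sC : symmetric_mx (cmp_mx (mat P)) := cmp_sym sM.
have e2 := tri_mul sC (tri_cmp tV) (links_cmp lks) sd dV iV.
rewrite /param_vec [in RHS]mxE mulmxDl colD e1 e2 [cmp_mx _ i i]mxE eqxx DE //.
by field.
Qed.
End Preparing.

Section PreparingStep.
Variables (R : realType) (n : nat) (M : 'M[R]_n) (q : 'cV[R]_n).
Variable (u : 'I_n -> \bar R).
Implicit Types (m : memory R) (P : qp R n) (todo : seq {set 'I_n}).
Implicit Types (rec : 'cV[R]_n -> 'cV[R]_n) (V S : {set 'I_n}).

Lemma preparing_step todo P rec m : config_ok M q u (Preparing todo P rec) ->
  rep M q u (Preparing todo P rec) m ->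
  exists2 c, step M q u (Preparing todo P rec) c & rep M q u c (run preparing_cmd m).
Proof.
move=> [_ wP _] [m0 [ph pr]]; rewrite /preparing_cmd 2!run_seq.
set m1 := run (prog link_fills) m.
have lk1 : linked n (nmem m1 nVars) (nmem m1 9) (nmem m1 10) (rmem m1 rOff) (rmem m1 13) (rmem m1 14).
  exact: link_run.
have n1 b : b \notin [:: 5; 6; 9; 10]%N -> nmem m1 b = nmem m b by exact: run_nsub.
have r1 b : b \notin [:: 13; 14]%N -> rmem m1 b = rmem m b by exact: run_rsub.
clearbody m1; have m10 : nmem m1 nSize 0 = n by rewrite n1.
set m2 := run (find_cmd zero_diag) m1.
have [F1 F2 F3] := @find_run R n zero_diag m1 m10 isT.
rewrite -/m2 in F1 F2 F3.
have n2 b : b \notin [:: 11; 5; 6]%N -> nmem m2 b = nmem m1 b by exact: run_nsub.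
have r2 b : rmem m2 b = rmem m1 b by exact: (@run_rsub _ [::]).
clearbody m2.
have bE (j : nat) : bval (at_ j m1) zero_diag = (nmem m nVars j == 1%N) && (rmem m rDiag j == 0).
  by rewrite /= nlt_eqE beqrE n1 // r1.
have n12 b : b \notin [:: 5; 6; 9; 10; 11]%N -> nmem m2 b = nmem m b.
  move=> hb; rewrite n2 ?n1 //; move: hb; rewrite !inE !negb_or => /and5P[b5 b6 b9 b10 b11].
    by rewrite b5 b6 b9.
  by rewrite b5 b6 b11.
have r12 b : b \notin [:: 13; 14]%N -> rmem m2 b = rmem m b by move=> hb; rewrite r2 r1.
have [h1 h2 h3 hP h5] := pr; have [[hD _] hl hu] := hP.
rewrite run_If [bval _ _]/= (n2 0%N) // m10; set F := nmem m2 11 0 in F1 F2 F3 *.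
case: ltnP => FN; last first.
  have nz i : ~ zero_block P i.
    move=> [Vi Mi]; have iV : i \in vars P by rewrite Vi set11.
    by have := F2 i (leq_trans (ltn_ord i) FN); rewrite bE -h3 iV hD // Mi eqxx.
  rewrite 2!run_seq; set m3 := run (RSet _ _ _) m2.
  have n3 b : nmem m3 b = nmem m2 b by [].
  have r3 b : b != 16%N -> rmem m3 b = rmem m2 b.
    by move=> hb; rewrite /m3 run_RSet rmem_raset (negbTE hb).
  have m316 : rmem m3 16 n = 1.
    by rewrite /m3 run_RSet rmem_raset eqxx /put /= n2 // m10 eqxx.
  clearbody m3; set m4 := run (prog param_fills) m3.
  have m30 : nmem m3 nSize 0 = n by rewrite n3 n2.
  have [d [vd dE pE]] : exists d, [/\ valid_d P d, holds_vec m4 rD (vars P) d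
      & holds_vec m4 rP (vars P) (param_vec P d)].
    apply: param_correct => //.
    - by move=> i; rewrite n3 n12 // h3.
    - by apply: holds_qp_eq hP; rewrite ?n3 ?r3 // ?n12 ?r12.
    by rewrite !n3 !r3 // !r2 !n2.
  have n4 b : b \notin [:: 5; 6]%N -> nmem m4 b = nmem m3 b by exact: run_nsub.
  have r4 b : b \notin [:: 15; 16; 17; rD; rP]%N -> rmem m4 b = rmem m3 b by exact: run_rsub.
  clearbody m4; rewrite run_NSet.
  exists (Prepared todo P rec d (param_vec P d)); first exact: step_prepare.
  split; first by rewrite nmem_naset /= n4 // n3 n2.
  split; first by rewrite nmem_naset.
  split=> //; apply: preparing_rep_eq pr => b.
    rewrite nmem_naset !inE => hb.
    have b7 : (b == 7)%N = false by apply/eqP => e; rewrite e in hb.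
    have hb' : b \notin [:: 5; 6; 9; 10; 11]%N by apply/negP; rewrite !inE; move: hb; lia.
    rewrite b7 n4 ?n3 ?n12 //; apply/negP; rewrite !inE; move: hb; lia.
  rewrite rmem_naset !inE => hb.
  have hb' : b \notin [:: 13; 14; 15; 16; 17; 4; 5]%N by apply/negP; rewrite !inE; move: hb; lia.
  have [b1 b2 b3] : [/\ b \notin [:: 15; 16; 17; rD; rP], b != 16%N & b \notin [:: 13; 14]%N].
    by rewrite /rD /rP; split; move: hb'; rewrite !inE; clear; lia.
  by rewrite r4 // r3 // r12.
have := F3 FN; rewrite bE.
pose i := Ordinal FN; rewrite -[F]/(i : nat) -h3 => /andP[iV /eqP Di].
have zi : zero_block P i by apply: wf_zero_block => //; rewrite -hD.
have [Vi _] := zi.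
rewrite run_If [bval _ _]/= r12 // -[nmem m2 11 0]/(i : nat) hl //.
have fin v (y : 'cV[R]_n) : y i 0 = v ->
    rep M q u (Idle todo (rec y)) (run finish_cmd (raset rSol (put (rmem m2 rSol) F v) m2)).
  move=> yi; apply: (finish_correct (m0 := m) m0 pr) => [b|b|j|j].
  - by rewrite nmem_raset !inE => hb; rewrite n12 // !inE; move: hb; lia.
  - rewrite rmem_raset !inE => hb; have -> : (b == rSol) = false by rewrite /rSol; move: hb; lia.
    by rewrite r12 // !inE; move: hb; lia.
  - rewrite Vi inE => /eqP ->; rewrite rmem_raset eqxx /put eqxx; exact: esym.
  rewrite Vi inE => ji; rewrite rmem_raset eqxx /put -[F]/(i : nat).
  by rewrite (negbTE (ji : j != i :> nat)) r12.
case: ifPn => li.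
  exists (Idle todo (rec 0)); first exact: step_inspect_lower zi li.
  by rewrite run_seq run_RSet; apply: fin; rewrite mxE.
rewrite -ltNge in li; rewrite run_If [bval _ _]/= nlt_eqE -/F n12 //.
have := hu i iV; have := wf_ub wP i; case uE : (ub P i) => [ui| |] // _; last first.
  move=> ->; exists (Answered (Unbounded R n)); first exact: step_inspect_ray zi li uE.
  rewrite -[X in rep _ _ _ _ X]/(run (Seq (NSet nVerdict N0 (NLit 2)) (set_phase 4)) m2).
  rewrite run_seq /set_phase !run_NSet; split; first by rewrite !nmem_naset /= n12.
  by split.
move=> [-> ubE]; rewrite eqxx; exists (Idle todo (rec (ui *: delta_mx i 0))).
  exact: step_inspect_upper zi li uE.
rewrite run_seq run_RSet; apply: fin.
by rewrite !mxE !eqxx mulr1 /= r12 // -[nmem m2 11 0]/(i : nat) ubE.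
Qed.
End PreparingStep.

(** Since [p] is nonnegative, [p <= 0] tests [p = 0]. *)
Definition violated : bexp :=
  BAnd is_var (BAnd (BLe (RGet rP idx) (RLit 0)) (BNot (BLe (RLit 0) (RGet rLin idx)))).

Definition push_cmd (j1 j2 : nexp) (c0 c1 c2 : rexp) : cmd :=
  Seq (NSet 13 dep found) (Seq (NSet 14 dep j1) (Seq (NSet 15 dep j2)
  (Seq (RSet 23 dep c0) (Seq (RSet 24 dep c1) (Seq (RSet 25 dep c2)
  (NSet 12 N0 (NAdd dep N1))))))).

(** The off-diagonal part of column [found], which is nonzero at the two neighbours only. *)
Definition column_fill : fill :=
  RFill false 32 (RNode (beqn succ_idx found) (RLeaf (RGet 14 idx))
    (RNode (beqn (NGet 9 idx) (NAdd found N1)) (RLeaf (RGet 13 idx)) (RLeaf (RLit 0)))).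

Definition on_vars (a : nat) (t : rtree) : rtree :=
  RNode is_var t (RLeaf (RGet a idx)).

(** The updates need the old data at [found] from every index, so new data are collected in scratch
    arrays and copied afterwards. *)
Definition copy_fills : seq fill := [::
  RFill false rLin (RLeaf (RGet 30 idx)); RFill false rDiag (RLeaf (RGet 31 idx));
  RFill false rOff (RLeaf (RGet 33 idx)) ].

Definition eliminate_fills : seq fill := [:: column_fill;
  RFill false 30 (on_vars rLin (RLeaf (RSub (RGet rLin idx)
    (RMul (RDiv (RGet 32 idx) (RGet rDiag found)) (RGet rLin found)))));
  RFill false 31 (on_vars rDiag (RLeaf (RSub (RGet rDiag idx)
    (RDiv (RMul (RGet 32 idx) (RGet 32 idx)) (RGet rDiag found)))));
  RFill false 33 (on_vars rOff (RNode (beqn succ_idx found)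
    (RLeaf (RSub (RLit 0) (RDiv (RMul (RGet 14 idx) (RGet 14 found)) (RGet rDiag found))))
    (RLeaf (RGet rOff idx)))) ].

Definition reflect_fills : seq fill := [:: column_fill;
  RFill false 30 (on_vars rLin (RNode (beqn idx found)
    (RLeaf (RSub (RLit 0) (RAdd (RGet rLin idx) (RMul (RGet rDiag idx) (RGet rUb found)))))
    (RLeaf (RAdd (RGet rLin idx) (RMul (RGet 32 idx) (RGet rUb found))))));
  RFill false 31 (RLeaf (RGet rDiag idx));
  RFill false 33 (on_vars rOff (RNode (beqn idx found) (RLeaf (RSub (RLit 0) (RGet rOff idx)))
    (RNode (beqn succ_idx found) (RLeaf (RSub (RLit 0) (RGet rOff idx)))
       (RLeaf (RGet rOff idx))))) ].

(** The old row goes onto the stack before the data change. *)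
Definition eliminate_cmd : cmd :=
  let quot e := RSub (RLit 0) (RDiv e (RGet rDiag found)) in
  Seq (push_cmd (NSub (NGet 9 found) N1) (NGet 10 found)
         (quot (RGet rLin found)) (quot (RGet 13 found)) (quot (RGet 14 found)))
  (Seq (prog eliminate_fills) (Seq (prog copy_fills) (NSet nVars found N0))).

Definition reflect_cmd : cmd :=
  Seq (push_cmd found found (RGet rUb found) (RSub (RLit 0) (RLit 1)) (RLit 0))
  (Seq (prog reflect_fills) (Seq (prog copy_fills) (NSet nFinite found N0))).

(** Status 3 keeps the indices outside the block apart from the three index sets. *)
Definition ready_cmd : cmd :=
  Seq (prog [:: NFill false nStatus (NNode is_var (NLeaf N0) (NLeaf (NLit 3)))])
      (Seq compute_cmd (set_phase 3)).

Definition prepared_cmd : cmd :=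
  Seq (prog link_fills) (Seq (find_cmd violated)
    (If (BLt found cells)
       (Seq (If (beqn (NGet nFinite found) N1) reflect_cmd eliminate_cmd) (set_phase 1))
       ready_cmd)).

(** * The two reductions on the machine *)

Section Reduction.
Variables (R : realType) (n : nat).
Implicit Types (m : memory R) (V : {set 'I_n}) (M : 'M[R]_n) (P : qp R n).

Section Linked.
Variables (vs pr1 nx : nat -> nat) (off L U : nat -> R) (V : {set 'I_n}) (M : 'M[R]_n).
Hypothesis lk : linked n vs pr1 nx off L U.
Hypothesis (sM : symmetric_mx M) (tV : tri_on V M).
Hypothesis Vv : forall i : 'I_n, (i \in V) = (vs i == 1%N).
Hypothesis offE : forall i j, consec V i j -> off i = M i j.

Lemma linked_nx (i j : 'I_n) : i \in V -> j \in V -> (nx j == i) = consec V j i.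
Proof.
move=> iV jV; have [s1 [s2 s3]] := linked_succ lk (ltn_ord j).
apply/eqP/idP => [e|/and4P[_ _ ji /forall_inP gap]].
  apply: consecP => //; first by case/andP: s1; rewrite e.
  by move=> k kV; apply/negP; rewrite -e => /s2; rewrite -Vv kV.
apply/eqP; rewrite eqn_leq; apply/andP; split; rewrite leqNgt; apply/negP => lt.
  by have := s2 i; rewrite ji lt -Vv iV => /(_ isT).
have kn : (nx j < n)%N := ltn_trans lt (ltn_ord i).
have kV : Ordinal kn \in V by rewrite Vv; apply: s3.
by have := gap _ kV; rewrite lt; case/andP: s1 => -> _.
Qed.

Lemma linked_pr (i j : 'I_n) : i \in V -> j \in V -> (pr1 j == i.+1) = consec V i j.
Proof.
move=> iV jV; have [p1 [p2 p3]] := linked_pred lk (ltn_ord j).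
apply/eqP/idP => [e|/and4P[_ _ ji /forall_inP gap]].
  apply: consecP => //; first by rewrite -e.
  by move=> k kV; apply/negP; rewrite -[(i < k)%N]/(i.+1 <= k)%N -e => /p2; rewrite -Vv kV.
apply/eqP; rewrite eqn_leq; apply/andP; split; rewrite leqNgt; apply/negP => lt; last first.
  by have := p2 i; rewrite ji -ltnS lt -Vv iV => /(_ isT).
case E : (pr1 j) lt p3 p1 => [//|k] lt p3 p1.
have kn : (k < n)%N := leq_trans p1 (ltnW (ltn_ord j)).
have kV : Ordinal kn \in V by rewrite Vv; apply: p3.
by have := gap _ kV; rewrite -ltnS lt p1.
Qed.

Lemma linked_column (i j : 'I_n) : i \in V -> j \in V -> j != i ->
  M j i = if nx j == i then U j else if pr1 j == i.+1 then L j else 0.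
Proof.
move=> iV jV ji; rewrite linked_nx // linked_pr //.
have [_ _ EL EU] := lk (ltn_ord j).
case: ifPn => [c|c1].
  by rewrite EU (eqP (etrans (linked_nx iV jV) c)) ltn_ord (offE c).
case: ifPn => [c|c2].
  by rewrite EL (eqP (etrans (linked_pr iV jV) c)) /= subn1 (offE c) sym_entry.
have : j != i :> nat by [].
by rewrite neq_ltn => /orP[lt|lt]; [apply: tV|rewrite sym_entry //; apply: tV].
Qed.

(* The pivot i links its two neighbours. *)
Lemma linked_schur (i j k : 'I_n) : i \in V -> consec (V :\ i) j k ->
  schur M [set i] j k = if nx j == i then 0 - U j * U i / M i i else off j.
Proof.
move=> iV /and4P[]; rewrite !inE => /andP[ji jV] /andP[ki kV] jk /forall_inP gap.
rewrite schur1E linked_nx //.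
have [_ _ _ Ui] := lk (ltn_ord i); have [_ _ _ Uj] := lk (ltn_ord j).
have gap' l : l \in V -> (j < l < k)%N -> l = i.
  move=> lV h; apply/eqP; apply/negPn/negP => li.
  by have := gap l; rewrite !inE li lV h => /(_ isT).
case: ifPn => c.
  have /and4P[_ _ ltji _] := c.
  have ik : (i < k)%N.
    rewrite ltnNge leq_eqVlt; apply/negP => /orP[/eqP e|lt].
      by case/eqP: ki; apply: val_inj.
    by have := consec_gap c kV; rewrite jk lt.
  have cik : consec V i k.
    apply: consecP => // l lV; apply/negP => /andP[il lk'].
    have := gap' l lV; rewrite (ltn_trans ltji il) lk' => /(_ isT) e.
    by rewrite e ltnn in il.
  have ncjk : ~~ consec V j k.
    by apply/negP => c'; have := consec_gap c' iV; rewrite ltji ik.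
  rewrite (tV jV kV jk ncjk) Uj (eqP (etrans (linked_nx iV jV) c)) ltn_ord (offE c).
  by rewrite Ui (eqP (etrans (linked_nx kV iV) cik)) ltn_ord (offE cik).
have cjk : consec V j k.
  apply: consecP => // l lV; apply/negP => h; have li := gap' l lV h.
  case/negP: c; apply: consecP => //; first by move: h; rewrite li => /andP[].
  move=> l' l'V; apply/negP => h'; have := gap' l' l'V.
  rewrite (_ : (j < l' < k)%N) => [/(_ isT) e|]; last by move: h h'; rewrite li; clear; lia.
  by move: h'; rewrite e ltnn andbF.
rewrite -(offE cjk); suff -> : M j i * M i k = 0 by rewrite mul0r subr0.
have [lt|ge] := ltnP j i.
  by rewrite tV // mul0r.
have ij : (i < j)%N by rewrite ltn_neqAle ge andbT eq_sym.
rewrite [M i k]tV ?mulr0 //; first exact: ltn_trans jk.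
by apply/negP => c'; have := consec_gap c' jV; rewrite ij jk.
Qed.
End Linked.

Definition col_at m (i : nat) : R :=
  if nmem m 10 i == nmem m 11 0 then rmem m 14 i
  else if nmem m 9 i == (nmem m 11 0 + 1)%N then rmem m 13 i else 0.

Lemma eliminate_run m : nmem m nSize 0 = n ->
  let m' := run (prog copy_fills) (run (prog eliminate_fills) m) in
  let f := nmem m 11 0 in let D := rmem m rDiag in
  forall i : nat, (i < n)%N ->
  [/\ rmem m' rLin i = if nmem m nVars i == 1%N
        then rmem m rLin i - col_at m i / D f * rmem m rLin f else rmem m rLin i,
      rmem m' rDiag i = if nmem m nVars i == 1%N
        then D i - col_at m i * col_at m i / D f else D i
    & rmem m' rOff i = if nmem m nVars i == 1%N
        then if nmem m 10 i == f then 0 - rmem m 14 i * rmem m 14 f / D f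
             else rmem m rOff i
        else rmem m rOff i].
Proof.
move=> m0 m' f D; set m1 := run (prog eliminate_fills) m in m' *.
have [//|] := prog_spec (fs := eliminate_fills) m0 erefl.
rewrite -/m1; clearbody m1 => -[e1 [e2 [e3 [e4 _]]]] [s1 s2 _ _].
have m10 : nmem m1 nSize 0 = n by rewrite s1.
have [//|] := prog_spec (fs := copy_fills) m10 erefl.
rewrite -/m'; clearbody m' => -[c1 [c2 [c3 _]]] [t1 t2 _ _] i iN.
have := c1 i iN; have := c2 i iN; have := c3 i iN; rewrite /= => -> -> ->.
rewrite !t2 //; have := e1 i iN; have := e2 i iN; have := e3 i iN; have := e4 i iN.
rewrite /= !nlt_eqE !s1 // !(s2 0%N) // !(s2 1%N) // !(s2 2%N) // (s2 13%N) // !(s2 14%N) //.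
by rewrite -/(col_at m i) => -> -> -> ->.
Qed.

Lemma reflect_run m : nmem m nSize 0 = n ->
  let m' := run (prog copy_fills) (run (prog reflect_fills) m) in
  let f := nmem m 11 0 in let b := rmem m rUb f in
  forall i : nat, (i < n)%N ->
  [/\ rmem m' rLin i = if nmem m nVars i == 1%N
        then if i == f then 0 - (rmem m rLin i + rmem m rDiag i * b)
             else rmem m rLin i + col_at m i * b
        else rmem m rLin i,
      rmem m' rDiag i = rmem m rDiag i
    & rmem m' rOff i = if nmem m nVars i == 1%N
        then if i == f then 0 - rmem m rOff i else
             if nmem m 10 i == f then 0 - rmem m rOff i else rmem m rOff i
        else rmem m rOff i].
Proof.
move=> m0 m' f b; set m1 := run (prog reflect_fills) m in m' *.
have [//|] := prog_spec (fs := reflect_fills) m0 erefl.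
rewrite -/m1; clearbody m1 => -[e1 [e2 [e3 [e4 _]]]] [s1 s2 _ _].
have m10 : nmem m1 nSize 0 = n by rewrite s1.
have [//|] := prog_spec (fs := copy_fills) m10 erefl.
rewrite -/m'; clearbody m' => -[c1 [c2 [c3 _]]] [t1 t2 _ _] i iN.
have := c1 i iN; have := c2 i iN; have := c3 i iN; rewrite /= => -> -> ->.
rewrite !t2 //; have := e1 i iN; have := e2 i iN; have := e3 i iN; have := e4 i iN.
rewrite /= !nlt_eqE !s1 // !(s2 0%N) // !(s2 1%N) // !(s2 2%N) // !(s2 3%N) // (s2 13%N) // !(s2 14%N) //.
by rewrite -/(col_at m i) => -> -> -> ->.
Qed.

Lemma unw_push ix j1 j2 (c0 c1 c2 : nat -> R) t k k1 k2 a0 a1 a2 f :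
  unw (put ix t k) (put j1 t k1) (put j2 t k2) (put c0 t a0) (put c1 t a1) (put c2 t a2) t.+1 f =
  unw ix j1 j2 c0 c1 c2 t (put f k (a0 + (a1 * f k1 + a2 * f k2))).
Proof.
have pE (T : Type) (g : nat -> T) v : put g t v t = v by rewrite /put eqxx.
by rewrite /= unw_put !pE.
Qed.

Lemma push_reflect m f :
  unwind (run (push_cmd found found (RGet rUb found) (RSub (RLit 0) (RLit 1)) (RLit 0)) m) f =
  let i := nmem m 11 0 in unwind m (put f i (rmem m rUb i + ((0 - 1) * f i + 0 * f i))).
Proof. by rewrite /unwind /= [put (nmem m 12) _ _ _]/put /= addn1 unw_push. Qed.

Lemma push_eliminate m f :
  let quot e := RSub (RLit 0) (RDiv e (RGet rDiag found)) in
  unwind (run (push_cmd (NSub (NGet 9 found) N1) (NGet 10 found)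
    (quot (RGet rLin found)) (quot (RGet 13 found)) (quot (RGet 14 found))) m) f =
  let i := nmem m 11 0 in let D := rmem m rDiag i in
  unwind m (put f i (0 - rmem m rLin i / D + ((0 - rmem m 13 i / D) * f (nmem m 9 i - 1)%N
     + (0 - rmem m 14 i / D) * f (nmem m 10 i)))).
Proof. by rewrite /unwind /= [put (nmem m 12) _ _ _]/put /= addn1 unw_push. Qed.

Section Step.
Variables (M : 'M[R]_n) (q : 'cV[R]_n) (u : 'I_n -> \bar R).
Variables (todo : seq {set 'I_n}) (P : qp R n) (rec : 'cV[R]_n -> 'cV[R]_n).
Variables (m : memory R) (i : 'I_n).
Hypotheses (wP : wfqp P) (nz : forall i, ~ zero_block P i).
Hypotheses (m0 : nmem m nSize 0 = n) (pr : preparing_rep M q u todo P rec m).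
Hypothesis lk : linked n (nmem m nVars) (nmem m 9) (nmem m 10) (rmem m rOff) (rmem m 13) (rmem m 14).
Hypotheses (fi : nmem m 11 0 = i) (iV : i \in vars P).

Let sM : symmetric_mx (mat P) := wf_sym wP.
Let tV : tri_on (vars P) (mat P) := chain_tri (wf_chain wP).

Let hV : holds_set m nVars 1 (vars P). Proof. by case: pr. Qed.
Let hP : holds_qp m P. Proof. by case: pr. Qed.
Let Dv (j : 'I_n) : j \in vars P -> rmem m rDiag j = mat P j j.
Proof. by case: hP => -[h _] _ _; apply: h. Qed.
Let lv (j : 'I_n) : j \in vars P -> rmem m rLin j = lin P j 0.
Proof. by case: hP => _ h _; apply: h. Qed.
Let offE := holds_mat_off (let: And3 h _ _ := hP in h).

Let colE (j : 'I_n) : j \in vars P -> j != i -> col_at m j = mat P j i.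
Proof.
by move=> jV ji; rewrite /col_at fi addn1 (linked_column lk sM tV hV offE iV jV ji).
Qed.

Lemma raw_eq s m' : raw M q u s m ->
  (forall j : 'I_n, (s <= j)%N -> [/\ rmem m' rDiag j = rmem m rDiag j,
     rmem m' rOff j = rmem m rOff j, rmem m' rLin j = rmem m rLin j,
     rmem m' rUb j = rmem m rUb j & nmem m' nFinite j = nmem m nFinite j]) ->
  raw M q u s m'.
Proof.
move=> [r1 r2 r3 r4] E; split=> [j sj|j k sj jk|j|j].
- by have [-> _ _ _ _] := E j sj; apply: r1.
- by have [_ -> _ _ _] := E j sj; apply: r2.
- by move=> sj; have [_ _ -> _ _] := E j (ltac:(by rewrite inE in sj)); apply: r3.
by move=> sj; have := r4 j sj; have [_ _ _ -> ->] := E j (ltac:(by rewrite inE in sj)).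
Qed.

Lemma eliminate_correct : let m' := run eliminate_cmd m in
  nmem m' nSize 0 = n /\ preparing_rep M q u todo (eliminate P i) (fun x => rec (recover_eliminated P i x)) m'.
Proof.
rewrite /eliminate_cmd 3!run_seq.
have := push_eliminate m; cbv zeta; set m1 := run (push_cmd _ _ _ _ _) m => uw.
have n1 b : b \notin [:: 12; 13; 14; 15]%N -> nmem m1 b = nmem m b by exact: run_nsub.
have r1 b : b \notin [:: 23; 24; 25]%N -> rmem m1 b = rmem m b by exact: run_rsub.
have d1 : nmem m1 12 0 = (nmem m 12 0).+1 by rewrite /m1 /= /put /= addn1.
clearbody m1; have m10 : nmem m1 nSize 0 = n by rewrite n1.
have E := eliminate_run m10.
set m2 := run (prog copy_fills) _ in E *.
have n2 b : b \notin [:: 5; 6]%N -> nmem m2 b = nmem m1 b.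
  by move=> hb; rewrite /m2 !(@run_nsub _ [:: 5; 6]%N).
have r2 b : b \notin [:: 32; 30; 31; 33; 2; 0; 1]%N -> rmem m2 b = rmem m1 b.
  by move=> hb; rewrite /m2 !(@run_rsub _ [:: 32; 30; 31; 33; 2; 0; 1]%N).
clearbody m2; rewrite run_NSet; set m' := naset _ _ m2.
have cE (j : nat) : col_at m1 j = col_at m j by rewrite /col_at !n1 // !r1.
have {}E (j : 'I_n) : [/\ rmem m' rLin j = if j \in vars P
        then rmem m rLin j - col_at m j / rmem m rDiag i * rmem m rLin i else rmem m rLin j,
      rmem m' rDiag j = if j \in vars P
        then rmem m rDiag j - col_at m j * col_at m j / rmem m rDiag i else rmem m rDiag j
    & rmem m' rOff j = if j \in vars P
        then if nmem m 10 j == i then 0 - rmem m 14 j * rmem m 14 i / rmem m rDiag i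
             else rmem m rOff j
        else rmem m rOff j].
  by have := E j (ltn_ord j); rewrite !n1 // !r1 // cE -hV fi.
have nE b : b \notin [:: 3; 5; 6; 12; 13; 14; 15]%N -> nmem m' b = nmem m b.
  rewrite !inE => hb; rewrite nmem_naset; have -> : (b == nVars) = false by move: hb; rewrite /nVars; clear; lia.
  by rewrite n2 ?n1 // !inE; move: hb; clear; lia.
have rE b : b \notin [:: 32; 30; 31; 33; 2; 0; 1; 23; 24; 25]%N -> rmem m' b = rmem m b.
  by rewrite !inE => hb; rewrite rmem_naset r2 ?r1 // !inE; move: hb; clear; lia.
have vE (j : 'I_n) : (nmem m' nVars j == 1%N) = (j \in vars P :\ i).
  rewrite nmem_naset eqxx /put /= (n2 11%N) // (n1 11%N) // fi !inE.
  rewrite -[(j == i :> nat)]/(j == i); have [//|_] := eqVneq j i; rewrite /=.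
  by rewrite n2 // n1 // hV.
have d' : nmem m' 12 0 = (nmem m 12 0).+1 by rewrite nmem_naset /= n2.
have uw' f : unwind m' f = unwind m1 f.
  by rewrite /unwind !nmem_naset /= !n2 // !r2.
clearbody m'; split; first by rewrite nE.
have Mi : 0 < mat P i i by apply: wf_diag_gt0.
have [h1 h2 _ _ [h5 h6 h7]] := pr.
have iN : (i < nmem m 8 0)%N by apply: h5.
rewrite /preparing_rep nE // d'; split=> //.
- apply: raw_eq h2 _ => j sj.
  have jV : (j \in vars P) = false by apply/negbTE/negP => /h5; rewrite ltnNge sj.
  have [-> -> ->] := E j; rewrite jV rE // nE //.
- split=> [|j|j] /=.
  + split=> [j|j k jV' kV' jk gap].
      rewrite !inE => /andP[ji jV]; have [_ -> _] := E j.
      by rewrite jV colE // !Dv // schur1E (sym_entry i j sM).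
    have cjk : consec (vars P :\ i) j k by apply: consecP.
    have jV : j \in vars P by move: jV'; rewrite !inE => /andP[].
    have [_ _ ->] := E j; rewrite jV Dv //.
    by rewrite (linked_schur lk tV hV offE iV cjk).
  + rewrite !inE => /andP[ji jV]; have [-> _ _] := E j.
    by rewrite jV colE // !Dv // !lv // mxE.
  + rewrite !inE => /andP[ji jV]; rewrite nE // rE //.
    by case: hP => _ _; apply.
split=> [j||].
- by rewrite inE => /andP[_ /h5].
- move=> y f fy fo; rewrite uw' uw fi.
  apply: h6 => j jV.
    rewrite /put; have [->|ji] := eqVneq j i; last first.
      rewrite (negbTE (ji : j != i :> nat)) recover_eliminated_ne //.
      by apply: fy; rewrite !inE ji.
    rewrite eqxx mxE eqxx.
    (* The recovered value is a row product with component [i] set to 0, which [tri_mul] reduces to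
       the two neighbours. *)
    pose y' : 'cV[R]_n := \col_j if j \in vars P :\ i then y j 0 else 0.
    have sy' : supported (vars P) y'.
      by move=> k kV; rewrite mxE !inE (negbTE kV) andbF.
    have fE (k : 'I_n) : k \in vars P -> put f i 0 k = y' k 0.
      move=> kV; rewrite mxE !inE kV andbT /put -[(k == i :> nat)]/(k == i).
      by case: eqP => //= /eqP ki; apply: fy; rewrite !inE ki.
    have lks := linked_links lk sM hV offE.
    have := tri_mul sM tV lks sy' fE iV; rewrite mul_diagE {1}/y' !mxE !inE eqxx mulr0 add0r.
    have -> : \sum_(k in vars P | k != i) mat P i k * y k 0 = \sum_(k | k != i) mat P i k * y' k 0.
      rewrite [RHS](bigID (mem (vars P))) /= [X in _ + X]big1 ?addr0 => [|k /andP[_ kV]].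
        by apply: eq_big => [k|k /andP[kV ki]]; rewrite 1?andbC // mxE !inE ki kV.
      by rewrite sy' // mulr0.
    move=> ->; rewrite {1}/put eqxx mulr0 add0r.
    have -> : rmem m 13 i * put f i 0 (nmem m 9 i - 1)%N = rmem m 13 i * f (nmem m 9 i - 1)%N.
      have [p1 _] := linked_pred lk (ltn_ord i).
      case p9 : (nmem m 9 i) p1 => [|k] p1; first by rewrite (linked_L0 lk) ?mul0r.
      by rewrite /put subn1 /= ltn_eqF.
    have -> : put f i 0 (nmem m 10 i) = f (nmem m 10 i).
      have [/andP[s1 _] _] := linked_succ lk (ltn_ord i).
      by rewrite /put gtn_eqF.
    rewrite Dv // lv //; by field; rewrite gt_eqF.
  rewrite /put; have [e|_] := eqVneq (j : nat) i; first by rewrite (ord_inj e) iV in jV.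
  by rewrite fo ?inE ?(negbTE jV) ?andbF // rE.
by have [lt _] := eliminate_size iV; move: h7 lt; clear; lia.
Qed.

Lemma reflect_correct ui : ub P i = ui%:E -> let m' := run reflect_cmd m in
  nmem m' nSize 0 = n /\ 
  preparing_rep M q u todo (reflect_var P i ui) (fun x => rec (recover_reflected i ui x)) m'.
Proof.
move=> uE; rewrite /reflect_cmd 3!run_seq.
have := push_reflect m; cbv zeta; set m1 := run (push_cmd _ _ _ _ _) m => uw.
have n1 b : b \notin [:: 12; 13; 14; 15]%N -> nmem m1 b = nmem m b by exact: run_nsub.
have r1 b : b \notin [:: 23; 24; 25]%N -> rmem m1 b = rmem m b by exact: run_rsub.
have d1 : nmem m1 12 0 = (nmem m 12 0).+1 by rewrite /m1 /= /put /= addn1.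
clearbody m1; have m10 : nmem m1 nSize 0 = n by rewrite n1.
have E := reflect_run m10.
set m2 := run (prog copy_fills) _ in E *.
have n2 b : b \notin [:: 5; 6]%N -> nmem m2 b = nmem m1 b.
  by move=> hb; rewrite /m2 !(@run_nsub _ [:: 5; 6]%N).
have r2 b : b \notin [:: 32; 30; 31; 33; 2; 0; 1]%N -> rmem m2 b = rmem m1 b.
  by move=> hb; rewrite /m2 !(@run_rsub _ [:: 32; 30; 31; 33; 2; 0; 1]%N).
clearbody m2; rewrite run_NSet; set m' := naset _ _ m2.
have [_ ubi] : nmem m nFinite i = 1%N /\ rmem m rUb i = ui.
  by have [_ _ h] := hP; have := h i iV; rewrite uE.
have cE (j : nat) : col_at m1 j = col_at m j by rewrite /col_at !n1 // !r1.
have {}E (j : 'I_n) : [/\ rmem m' rLin j = if j \in vars P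
        then if j == i then 0 - (rmem m rLin j + rmem m rDiag j * ui)
             else rmem m rLin j + col_at m j * ui
        else rmem m rLin j,
      rmem m' rDiag j = rmem m rDiag j
    & rmem m' rOff j = if j \in vars P
        then if (j == i) || (nmem m 10 j == i) then 0 - rmem m rOff j else rmem m rOff j
        else rmem m rOff j].
  have := E j (ltn_ord j); rewrite !n1 // !r1 // cE -hV fi ubi.
  by case=> -> -> ->; split=> //; case: ifP => // _; rewrite -[(j == i :> nat)]/(j == i); case: (j == i).
have nE b : b \notin [:: 2; 5; 6; 12; 13; 14; 15]%N -> nmem m' b = nmem m b.
  rewrite !inE => hb; rewrite nmem_naset; have -> : (b == nFinite) = false by move: hb; rewrite /nFinite; clear; lia.
  by rewrite n2 ?n1 // !inE; move: hb; clear; lia.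
have rE b : b \notin [:: 32; 30; 31; 33; 2; 0; 1; 23; 24; 25]%N -> rmem m' b = rmem m b.
  by rewrite !inE => hb; rewrite rmem_naset r2 ?r1 // !inE; move: hb; clear; lia.
have finE (j : 'I_n) : nmem m' nFinite j = if j == i then 0%N else nmem m nFinite j.
  by rewrite nmem_naset eqxx /put /= (n2 11%N) // (n1 11%N) // fi n2 // n1.
have d' : nmem m' 12 0 = (nmem m 12 0).+1 by rewrite nmem_naset /= n2.
have uw' f : unwind m' f = unwind m1 f.
  by rewrite /unwind !nmem_naset /= !n2 // !r2.
clearbody m'; split; first by rewrite nE.
have [h1 h2 h3 _ [h5 h6 h7]] := pr.
have iN : (i < nmem m 8 0)%N by apply: h5.
rewrite /preparing_rep nE // d'; split=> //.
- apply: raw_eq h2 _ => j sj.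
  have jV : (j \in vars P) = false by apply/negbTE/negP => /h5; rewrite ltnNge sj.
  have ji : (j == i) = false by apply/negbTE; apply: contraTneq iV => <-; rewrite jV.
  by have [-> -> ->] := E j; rewrite jV rE // finE ji.
- by apply: holds_set_eq h3; rewrite nE.
- split=> [|j|j] /=.
  + split=> [j|j k jV kV jk gap].
      by move=> jV; have [_ -> _] := E j; rewrite mxE Dv // addbb.
    have cjk : consec (vars P) j k by apply: consecP.
    have [_ _ ->] := E j; rewrite jV mxE.
    have -> : (nmem m 10 j == i) = (k == i).
      rewrite (linked_nx lk hV iV jV); apply/idP/eqP => [c|<- //].
      exact: consec_inj_up cjk c.
    rewrite -(offE cjk); have [ji|ji] := eqVneq j i; last by case: (k == i); rewrite ?sub0r.
    have -> : (k == i) = false by apply/negbTE; apply: contraTneq jk => ->; rewrite ji ltnn.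
    by rewrite sub0r.
  + move=> jV; have [-> _ _] := E j.
    rewrite jV mxE; case: (eqVneq j i) => [->|ji]; first by rewrite sub0r lv // Dv.
    by rewrite colE // lv.
  + move=> jV; rewrite finE rE //; case: eqP => // _.
    by case: hP => _ _; apply.
split=> [j||].
- exact: h5.
- move=> y f fy fo; rewrite uw' uw fi.
  apply: h6 => j jV.
    rewrite /put mxE -[(j == i :> nat)]/(j == i); case: eqP => [->|_]; last exact: fy.
    by rewrite ubi fy //; ring.
  rewrite /put; have [e|_] := eqVneq (j : nat) i; first by rewrite (ord_inj e) iV in jV.
  by rewrite fo // rE.
by have lt := reflect_size iV uE; move: h7 lt; clear; lia.
Qed.
End Step.
End Reduction.

(** * From a prepared block to a reduction or to the pivoting phase *)

Section PreparedStep.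
Variables (R : realType) (n : nat) (M : 'M[R]_n) (q : 'cV[R]_n).
Variable (u : 'I_n -> \bar R).
Implicit Types (m : memory R) (P : qp R n) (todo : seq {set 'I_n}).
Implicit Types (rec : 'cV[R]_n -> 'cV[R]_n) (V S A B C : {set 'I_n}).

Lemma compute_rep todo P rec p A B C m : nmem m nSize 0 = n ->
  preparing_rep M q u todo P rec m -> wfqp P ->
  part3 (vars P) A B C -> (forall i, i \in C -> (ub P i < +oo)%E) ->
  pd_on (mat P) A -> holds_vec m rP (vars P) p -> holds_status m A B C ->
  rep M q u (Pivoting todo P rec p A B C) (run (set_phase 3) (run compute_cmd m)).
Proof.
move=> m0 pr wP pt Cf pA hp hs; have [h1 h2 hV hP h5] := pr.
have [c1 c2 c3 c4] := compute_correct m0 wP pt Cf pA hV hP hp hs.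
set m1 := run compute_cmd m in c1 c2 c3 c4 *.
have n1 b : b \notin [:: 5; 6; 9; 10; 16]%N -> nmem m1 b = nmem m b by exact: run_nsub.
have r1 b : b \notin [:: 13; 14; 19; 6; 7; 8; 29; 22; 18; 27; 20; 9; 28; 21; 10; 26; 11]%N ->
    rmem m1 b = rmem m b.
  exact: run_rsub.
clearbody m1; rewrite run_NSet.
have nE b : b \notin [:: 5; 6; 7; 9; 10; 16]%N ->
    nmem (naset 7 (put (nmem m1 7) (nval m1 N0) (nval m1 (NLit 3))) m1) b = nmem m b.
  rewrite !inE => hb; rewrite nmem_naset; have -> : (b == 7)%N = false by move: hb; clear; lia.
  by rewrite n1 // !inE; move: hb; clear; lia.
split; first by rewrite nE.
split; first by rewrite nmem_naset.
split.
- apply: preparing_rep_eq pr => b; rewrite !inE => hb.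
    by rewrite nE // !inE; move: hb; clear; lia.
  by rewrite rmem_naset r1 // !inE; move: hb; clear; lia.
- by apply: holds_vec_eq hp; rewrite rmem_naset r1.
split=> //.
by apply: holds_status_eq hs; rewrite nE.
Qed.

Lemma prepared_step todo P rec d p m : config_ok M q u (Prepared todo P rec d p) ->
  rep M q u (Prepared todo P rec d p) m ->
  exists2 c, step M q u (Prepared todo P rec d p) c & rep M q u c (run prepared_cmd m).
Proof.
move=> [[_ wP _] [nz vd pE]] [m0 [ph [pr hd hp]]]; rewrite /prepared_cmd 2!run_seq.
set m1 := run (prog link_fills) m.
have lk1 : linked n (nmem m1 nVars) (nmem m1 9) (nmem m1 10) (rmem m1 rOff) (rmem m1 13) (rmem m1 14).
  exact: link_run.
have n1 b : b \notin [:: 5; 6; 9; 10]%N -> nmem m1 b = nmem m b by exact: run_nsub.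
have r1 b : b \notin [:: 13; 14]%N -> rmem m1 b = rmem m b by exact: run_rsub.
clearbody m1; have m10 : nmem m1 nSize 0 = n by rewrite n1.
set m2 := run (find_cmd violated) m1.
have [F1 F2 F3] := @find_run R n violated m1 m10 isT.
rewrite -/m2 in F1 F2 F3.
have n2 b : b \notin [:: 11; 5; 6]%N -> nmem m2 b = nmem m1 b by exact: run_nsub.
have r2 b : rmem m2 b = rmem m1 b by exact: (@run_rsub _ [::]).
clearbody m2.
have bE (j : nat) : bval (at_ j m1) violated = (nmem m nVars j == 1%N) &&
    ((rmem m rP j <= 0) && ~~ (0 <= rmem m rLin j)).
  by rewrite /= nlt_eqE n1 // !r1.
have m20 : nmem m2 nSize 0 = n by rewrite n2.
have [h1 h2 h3 hP h5] := pr; have [hM hl hu] := hP.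
have pr2 : preparing_rep M q u todo P rec m2.
  apply: preparing_rep_eq pr => b; rewrite !inE => hb.
    by rewrite n2 ?n1 // !inE; move: hb; clear; lia.
  by rewrite r2 r1 // !inE; move: hb; clear; lia.
rewrite run_If [bval _ _]/= (n2 0%N) // m10; set F := nmem m2 11 0 in F1 F2 F3 *.
case: ltnP => FN; last first.
  have h i : i \in vars P -> param_vec P d i 0 = 0 -> 0 <= lin P i 0.
    move=> iV p0; rewrite leNgt; apply/negP => li.
    have := F2 i (leq_trans (ltn_ord i) FN).
    by rewrite bE -h3 iV hp // pE p0 lexx hl // -ltNge li.
  have [t t0 tE] := ready_ex wP vd h.
  exists (Pivoting todo P rec p set0 (vars P) set0).
    by apply: step_ready; exists t; rewrite // pE.
  rewrite /ready_cmd 2!run_seq; set fs := [:: _].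
  have := prog_spec (fs := fs) m20 erefl; set m3 := run (prog fs) m2.
  have n3 b : b \notin [:: 1; 5; 6]%N -> nmem m3 b = nmem m2 b by exact: run_nsub.
  have r3 b : rmem m3 b = rmem m2 b by exact: (@run_rsub _ [::]).
  clearbody m3 => -[//|[e1 _] [s1 _ _ _]].
  have stE (i : 'I_n) : nmem m3 nStatus i = if i \in vars P then 0%N else 3%N.
    by have := e1 i (ltn_ord i); rewrite /= nlt_eqE (s1 nVars) // n2 // n1 // -h3.
  apply: compute_rep => //.
  - by rewrite n3.
  - apply: preparing_rep_eq pr2 => b; rewrite !inE => hb.
      by rewrite n3 // !inE; move: hb; clear; lia.
    by rewrite r3.
  - by move=> i; rewrite !inE; case: (i \in vars P).
  - by move=> i; rewrite inE.
  - by have [_ _ ? _] := ready_inv wP vd t0 tE.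
  - by apply: holds_vec_eq hp; rewrite r3 r2 r1.
  by split=> i; rewrite stE ?inE; case: (i \in vars P).
have := F3 FN; rewrite bE.
pose i := Ordinal FN; rewrite -[F]/(i : nat) -h3 => /and3P[iV pi].
have p0 : p i 0 = 0.
  apply/eqP; rewrite eq_le -hp // pi hp //= pE; exact: valid_p_ge0.
rewrite hl // -ltNge => li.
have lk2 : linked n (nmem m2 nVars) (nmem m2 9) (nmem m2 10) (rmem m2 rOff) (rmem m2 13) (rmem m2 14).
  by rewrite !n2 // !r2.
have fin c' m' : nmem m' nSize 0 = n -> 
  preparing_rep M q u todo c'.1 c'.2 m' ->
  rep M q u (Preparing todo c'.1 c'.2) (run (set_phase 1) m').
  move=> z pr'; rewrite run_NSet; split; first by rewrite nmem_naset.
  split; first by rewrite nmem_naset.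
  apply: preparing_rep_eq pr' => b hb //; rewrite nmem_naset.
  by have -> : (b == 7)%N = false by move: hb; rewrite !inE; clear; lia.
rewrite run_seq run_If [bval _ _]/= nlt_eqE n2 // n1 //.
have := hu i iV; have := wf_ub wP i; case uE : (ub P i) => [ui| |] // _; last first.
  move=> f0.
  exists (Preparing todo (eliminate P i) (fun x => rec (recover_eliminated P i x))).
    exact: step_eliminate.
  rewrite -[nmem m2 11 0]/(i : nat) f0.
  have [z pr'] := eliminate_correct wP nz m20 pr2 lk2 (erefl _ : nmem m2 11 0 = i) iV.
  exact: (fin (eliminate P i, fun x => rec (recover_eliminated P i x))).
move=> [f1 _].
exists (Preparing todo (reflect_var P i ui) (fun x => rec (recover_reflected i ui x))).
  exact: step_reflect.
rewrite -[nmem m2 11 0]/(i : nat) f1 eqxx.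
have [z pr'] := reflect_correct wP m20 pr2 lk2 (erefl _ : nmem m2 11 0 = i) iV uE.
exact: (fin (reflect_var P i ui, fun x => rec (recover_reflected i ui x))).
Qed.
End PreparedStep.

(** Outside the block the old entries of [rSol] are kept. A pass may not overwrite what an earlier
    pass of the same program reads, so the values go through scratch array 30 and the two passes are
    run as separate programs. *)
Definition solution_fills : seq fill := [::
  RFill false 30 (RNode (status_is 1) (RLeaf (RSub (RLit 0) (RGet rQbar idx)))
    (RNode (status_is 2) (RLeaf (RGet rUb idx))
    (RNode (status_is 0) (RLeaf (RLit 0)) (RLeaf (RGet rSol idx)))));
  RFill false rSol (RLeaf (RGet 30 idx)) ].

Definition maximizer : bexp := BAnd is_cand (BLe (RGet rTau N0) (RGet 26 idx)).

(** Incrementing the status realizes both moves that occur, 0 to 1 and 1 to 2. The candidates are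
    recomputed, so that [rep] does not have to record them. *)
Definition pivoting_cmd : cmd :=
  If (BLe (RGet rTau N0) (RLit 0))
    (Seq (prog (take 1 solution_fills)) (Seq (prog (drop 1 solution_fills)) finish_cmd))
    (Seq (prog cand_fills) (Seq (find_cmd maximizer)
      (Seq (NSet nStatus found (NAdd (NGet nStatus found) N1))
           (Seq compute_cmd (set_phase 3))))).

(** * One iteration of the pivoting phase on the machine *)

Section PivotingStep.
Variables (R : realType) (n : nat) (M : 'M[R]_n) (q : 'cV[R]_n).
Variable (u : 'I_n -> \bar R).
Hypotheses (tM : tridiagonal M) (sM : symmetric_mx M) (pM : pos_semidef M).
Hypothesis (u0 : forall i, (0 < u i)%E).
Implicit Types (m : memory R) (P : qp R n) (todo : seq {set 'I_n}).
Implicit Types (rec : 'cV[R]_n -> 'cV[R]_n) (V S A B C : {set 'I_n}).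

Lemma solution_run m : nmem m nSize 0 = n ->
  let m' := run (prog (drop 1 solution_fills)) (run (prog (take 1 solution_fills)) m) in
  forall i : nat, (i < n)%N -> rmem m' rSol i =
    if nmem m nStatus i == 1%N then 0 - rmem m rQbar i else
    if nmem m nStatus i == 2%N then rmem m rUb i else
    if nmem m nStatus i == 0%N then 0 else rmem m rSol i.
Proof.
move=> m0 m'; set m1 := run (prog (take 1 solution_fills)) m in m' *.
have [//|] := prog_spec (fs := take 1 solution_fills) m0 erefl.
rewrite -/m1; clearbody m1 => -[e1 _] [s1 s2 _ _].
have m10 : nmem m1 nSize 0 = n by rewrite s1.
have [//|] := prog_spec (fs := drop 1 solution_fills) m10 erefl.
rewrite -/m'; clearbody m' => -[c1 _] [t1 t2 _ _] i iN.
have := c1 i iN; rewrite /= => ->.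
by rewrite !t2 //; have := e1 i iN; rewrite /= !nlt_eqE -?eqn0Ngt !s1 // (s2 rQbar) // (s2 rUb) // (s2 rSol).
Qed.

Lemma pivoting_step todo P rec p A B C m : config_ok M q u (Pivoting todo P rec p A B C) ->
  rep M q u (Pivoting todo P rec p A B C) m ->
  exists2 c, step M q u (Pivoting todo P rec p A B C) c & rep M q u c (run pivoting_cmd m).
Proof.
move=> ok [m0 [ph [pr hp [hs ch hq hpb tE]]]].
have [[_ wP _] [[d [vd pE]] [pt Cf pA _]]] := ok.
have [h1 h2 h3 hP h5] := pr; have [hM hl hu] := hP; have [hB hA hC] := hs.
have up := wf_ub wP.
have ts := proj2 (tau_specP P p A B C _) (esym tE).
rewrite /pivoting_cmd run_If [bval _ _]/=; case: ifPn => tau0.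
  have t0 : tau_new P p A B C = 0%E.
    rewrite -tE; congr (_%:E); apply/eqP; rewrite eq_le tau0 /=; by case: ts.
  exists (Idle todo (rec (pivot_solution P A C))); first exact: step_optimal.
  rewrite 2!run_seq; have := solution_run m0; cbv zeta.
  set m1 := run (prog (drop 1 _)) _ => E.
  have n1 b : b \notin [:: 5; 6]%N -> nmem m1 b = nmem m b.
    by move=> hb; rewrite /m1 !(@run_nsub _ [:: 5; 6]%N).
  have r1 b : b \notin [:: 30; 12]%N -> rmem m1 b = rmem m b.
    by move=> hb; rewrite /m1 !(@run_rsub _ [:: 30; 12]%N).
  clearbody m1; apply: (finish_correct (m0 := m) m0 pr) => [b|b|j jV|j jV].
  - by rewrite !inE => hb; rewrite n1 // !inE; move: hb; clear; lia.
  - by rewrite !inE => hb; rewrite r1 // !inE; move: hb; clear; lia.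
  - rewrite E // -hA -hC -hB mxE sub0r hq //.
    have := pt j; rewrite jV; case: (j \in A) => //; case jC: (j \in C) => /=; last by case: (j \in B).
    have := hu j jV; have := Cf j jC; have := up j.
    by case: (ub P j) => //= r _ _ [].
  rewrite E // -hA -hC -hB.
  by have := pt j; rewrite (negbTE jV); case: (j \in A); case: (j \in B); case: (j \in C).
rewrite -ltNge in tau0; rewrite 4!run_seq.
set T := rmem m rTau 0 in tE ts tau0.
have tn0 : (0 < tau_new P p A B C)%E by rewrite -tE lte_fin.
set m1 := run (prog cand_fills) m.
have n1 b : b \notin [:: 5; 6; 16]%N -> nmem m1 b = nmem m b by exact: run_nsub.
have r1 b : b \notin [:: 26]%N -> rmem m1 b = rmem m b by exact: run_rsub.
have ck : cand_ok P p A B C m1.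
  have [//|] := prog_spec (fs := cand_fills) m0 erefl.
  rewrite -/m1 => -[e1 [e2 _]] _; apply: cand_eqs => //.
  - by move=> i iV; have := hu i iV; rewrite n1 // r1.
  - by apply: holds_status_eq hs; rewrite n1.
  - by apply: holds_vec_eq hq; rewrite r1.
  by apply: holds_vec_eq hpb; rewrite r1.
clearbody m1; have m10 : nmem m1 nSize 0 = n by rewrite n1.
set m2 := run (find_cmd maximizer) m1.
have [F1 F2 F3] := @find_run R n maximizer m1 m10 isT.
rewrite -/m2 in F1 F2 F3.
have n2 b : b \notin [:: 11; 5; 6]%N -> nmem m2 b = nmem m1 b by exact: run_nsub.
have r2 b : rmem m2 b = rmem m1 b by exact: (@run_rsub _ [::]).
clearbody m2.
have bE (j : nat) : bval (at_ j m1) maximizer = (nmem m1 16 j == 1%N) && (T <= rmem m1 26 j).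
  by rewrite /= nlt_eqE (r1 rTau).
set F := nmem m2 11 0 in F1 F2 F3.
(* The parameter is positive, so a candidate attains it and the search succeeds. *)
have FN : (F < n)%N.
  case: ltnP => // nF; have key (i : 'I_n) : nmem m1 16 i == 1%N -> rmem m1 26 i = T -> False.
    move=> c1 r; have := F2 i (leq_trans (ltn_ord i) nF).
    by rewrite bE c1 r lexx.
  case: ts => _ _ _ [T0|[i ci r]|[i ci r]]; first by rewrite T0 ltxx in tau0.
    by have [k1 [k2 _]] := ck i; case: (key i); rewrite ?k1 ?ci // k2.
  by have [k1 [_ k2]] := ck i; case: (key i); rewrite ?k1 ?ci ?orbT // k2.
set m3 := run (NSet _ _ _) m2.
have := F3 FN; rewrite bE; pose i := Ordinal FN; rewrite -[F]/(i : nat).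
have [k1 [k2 k3]] := ck i; rewrite k1 => /andP[ci Tr].
have st3 (j : 'I_n) : nmem m3 nStatus j = if j == i then (nmem m nStatus i + 1)%N else nmem m nStatus j.
  rewrite /m3 run_NSet nmem_naset eqxx /put /= -[nmem m2 11 0]/(i : nat) n2 // n1 //.
have n3 b : b \notin [:: 1; 5; 6; 11; 16]%N -> nmem m3 b = nmem m b.
  rewrite !inE => hb; rewrite /m3 run_NSet nmem_naset.
  have -> : (b == nStatus) = false by move: hb; rewrite /nStatus; clear; lia.
  by rewrite n2 ?n1 // !inE; move: hb; clear; lia.
have r3 b : b != 26%N -> rmem m3 b = rmem m b.
  by move=> hb; rewrite /m3 run_NSet rmem_naset r2 r1 // inE.
clearbody m3.
have fin A' B' C' : pivot P p A B C A' B' C' -> holds_status m3 A' B' C' ->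
    exists2 c, step M q u (Pivoting todo P rec p A B C) c &
      rep M q u c (run (set_phase 3) (run compute_cmd m3)).
  move=> pv hs'; have stp := step_pivot M q u todo rec tn0 pv.
  exists (Pivoting todo P rec p A' B' C') => //.
  have [[_ [_ [pt' Cf' pA' _]]] _] := step_inv tM sM pM u0 ok stp.
  apply: compute_rep => //.
  - by rewrite n3.
  - apply: preparing_rep_eq pr => b; rewrite !inE => hb.
      by rewrite n3 // !inE; move: hb; clear; lia.
    by rewrite r3 //; move: hb; clear; lia.
  by apply: holds_vec_eq hp; rewrite r3.
have pti := pt i.
have iV : i \in vars P.
  by move: pti; case/orP: ci => [/andP[-> _]|/and3P[-> _ _]]; case: (i \in vars P); rewrite ?addn1 ?addSn.
have [cB|cB] := boolP (i \in B).
  have [iA iC] : i \notin A /\ i \notin C.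
    by move: pti; rewrite cB iV; case: (i \in A); case: (i \in C).
  have c0 : cand0 P p A B i by case/orP: ci => // /and3P[iA']; rewrite iA' in iA.
  have en : entering P p A B C i.
    split=> //; rewrite -tE; congr (_%:E); apply/eqP; rewrite eq_le -{2}k2 // Tr andbT.
    by case: ts => _ h _ _; apply: h.
  have s0 : 0 < schur (mat P) A i i.
    apply: (valid_schur wP vd (part3_sub pt)) => //; rewrite -pE.
    by case/andP: c0.
  apply: (fin _ _ _ (pivot_diagonal en s0)).
  have st0 : nmem m nStatus i = 0%N by apply/eqP; rewrite -hB.
  split=> j; rewrite st3 st0 ?inE; have [->|ji] := eqVneq j i => //=.
  - by rewrite (negbTE iC).
have cu : candu P p A i by move: ci; rewrite /cand0 (negbTE cB).
have iA : i \in A by case/and3P: cu.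
have le : leaving P p A B C i.
  split=> //; rewrite -tE; congr (_%:E); apply/eqP; rewrite eq_le -{2}k3 // Tr andbT.
  by case: ts => _ _ h _; apply: h.
apply: (fin _ _ _ (pivot_upper le)).
have st1 : nmem m nStatus i = 1%N by apply/eqP; rewrite -hA.
by split=> j; rewrite st3 st1 ?inE; have [->|ji] := eqVneq j i; rewrite //= ?(negbTE cB).
Qed.
End PivotingStep.

(** * Complexity of the PPPA *)

Section Intervals.
Variables (R : realType) (n : nat) (M : 'M[R]_n).
Hypotheses (tM : tridiagonal M) (sM : symmetric_mx M).
Implicit Types (i j k : 'I_n) (S T : {set 'I_n}).

(** The upper end of a block is a cut of the graph, which no block straddles. *)
Lemma block_side S T (k : 'I_n) i j : S \in blocks M -> k \in S ->
  (forall k' : 'I_n, k' = k.+1 :> nat -> k' \notin S) ->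
  T \in blocks M -> i \in T -> j \in T -> (i <= k)%N = (j <= k)%N.
Proof.
move=> bS kS nS bT iT jT; apply: (conn_cut tM sM (k := k)).
  move=> a b ak bk; rewrite (ord_inj ak); exact: (block_cross bS kS (nS b bk)).
have [a aE] := blocksP _ _ bT.
move: iT jT; rewrite aE !inE => ai aj.
by apply: connect_trans aj; rewrite (conn_sym sM).
Qed.

(** If [j] were missing, the index after the last element [a] of [S] below [j] would lie outside
    [S], and the cut at [a] would separate [i] from [k]. *)
Lemma block_convex S i j k : S \in blocks M -> i \in S -> k \in S ->
  (i < j < k)%N -> j \in S.
Proof.
move=> bS iS kS /andP[ij jk]; apply/negPn/negP => jS.
have [a /andP[aS aj] amax] := @arg_maxnP _ i (fun a => (a \in S) && (a < j)%N) (fun a => a : nat) (introT andP (conj iS ij)).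
have ia : (i <= a)%N by apply: amax; rewrite iS ij.
suff nS : forall b : 'I_n, b = a.+1 :> nat -> b \notin S.
  by have := block_side bS aS nS bS iS kS; rewrite ia leqNgt (ltn_trans aj jk).
move=> b ba; apply/negP => bS'.
have bj : (b < j)%N.
  rewrite ltn_neqAle ba aj andbT -ba; apply: contraNneq jS => e.
  by rewrite -(ord_inj e).
by have := amax b; rewrite bS' bj /= ba ltnn => /(_ isT).
Qed.

(** From left to right, the block of the first remaining index is an interval that starts there.
    This is the order in which the program treats the blocks. *)
Lemma todo_rep_from (k : nat) : (k <= n)%N ->
  (forall S i j, S \in blocks M -> i \in S -> j \in S -> (k <= i)%N = (k <= j)%N) ->
  exists bs, [/\ todo_rep k bs, uniq bs & forall S, (S \in bs) =
    (S \in blocks M) && [exists i in S, k <= i]%N].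
Proof.
move=> kn; have [s] := ubnP (n - k)%N; elim: s k kn => // s IH k kn ks cut.
have [e|kN] := eqVneq k n.
  exists [::]; split=> // S; rewrite in_nil; apply/esym/negP => /andP[_ /existsP[i /andP[_]]].
  by rewrite leqNgt e ltn_ord.
have {}kN : (k < n)%N by rewrite ltn_neqAle kN.
pose i0 := Ordinal kN; have [S bS iS] := block_cover M i0.
have [a aS amax] := @arg_maxnP _ i0 (fun a => a \in S) (fun a => a : nat) iS.
have ka : (k <= a)%N by apply: (amax i0).
have nS k' : k' = a.+1 :> nat -> k' \notin S.
  by move=> e; apply/negP => /amax; rewrite /= e ltnn.
have SE i : (i \in S) = (k <= i < a.+1)%N.
  apply/idP/andP => [h|[ki ia]].
    split; last exact: amax.
    by rewrite -(cut S i0 i bS iS h).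
  have [->//|ne] := eqVneq i i0; have [->//|ne'] := eqVneq i a.
  apply: (block_convex bS iS aS) (_ : i0 < i < a)%N.
  by rewrite !ltn_neqAle eq_sym ne ki ne' -ltnS ia.
have [|||bs [tb ub mb]] := IH a.+1.
- exact: ltn_ord.
- by lia.
- move=> T i j bT iT jT; rewrite !ltnNge; congr (~~ _).
  exact: (block_side bS aS nS bT iT jT).
exists (S :: bs); split.
- by exists a.+1.
- rewrite /= ub andbT mb bS /=; apply/existsP => -[i /andP[iS' ai]].
  by move: iS'; rewrite SE ltnNge ai andbF.
move=> T; rewrite inE mb; have [->|TS] := eqVneq T S.
  by rewrite bS /=; apply/esym/existsP; exists i0; rewrite iS /=.
have [bT|//] := boolP (T \in blocks M).
apply/existsP/existsP => -[i /andP[iT h]]; exists i; rewrite iT /=; first exact: leq_trans (leq_trans (leqnSn _) h).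
rewrite ltnNge; apply/negP => ia; case/eqP: TS; apply: (block_disjoint sM bT bS iT).
by rewrite SE h ltnS.
Qed.

Lemma initial_rep : exists2 bs, perm_eq bs (enum (blocks M)) & todo_rep 0 bs.
Proof.
have [//|bs [tb ub mb]] := todo_rep_from (leq0n n).
exists bs => //; apply: uniq_perm => // [|S]; first exact: enum_uniq.
rewrite mem_enum mb; case bS : (S \in blocks M) => //=.
by have [i iS] := block_ne bS; apply/existsP; exists i; rewrite iS.
Qed.
End Intervals.

Definition phase := NGet 7 N0.

Definition by_phase (c0 c1 c2 c3 c4 : cmd) : cmd :=
  If (BLt phase (NLit 1)) c0 (If (BLt phase (NLit 2)) c1
    (If (BLt phase (NLit 3)) c2 (If (BLt phase (NLit 4)) c3 c4))).

Definition move_cmd : cmd :=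
  by_phase idle_cmd preparing_cmd prepared_cmd pivoting_cmd Skip.

Definition probe_cmd : cmd :=
  by_phase (Probe 0) (Probe 1) (Probe 2) (Probe 3) (Probe 4).

Definition round : cmd := If (BLt phase (NLit 4)) (Seq move_cmd probe_cmd) Skip.

Definition repeat (k : nat) (c : cmd) : cmd := iter k (Seq c) Skip.

Definition reset_cmd : cmd :=
  Seq (prog [:: RFill false rSol (RLeaf (RLit 0))]) (Seq (NSet 8 N0 N0) (set_phase 0)).

(* A run has at most 1 + 12 n steps, fewer than the 14 n rounds unless the
   problem is answered earlier. *)
Definition pppa_program : cmd :=
  Seq (Seq reset_cmd (Probe 0)) (For 18 cells (repeat 14 round)).

Section Runs.
Variables (R : realType) (n : nat) (M : 'M[R]_n) (q : 'cV[R]_n).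
Variable (u : 'I_n -> \bar R).
Implicit Types (c : config R n) (cs : seq (config R n)) (s : machine R).

Lemma all_records_rcons cs (l : seq (snapshot R)) c e :
  all_records cs l -> records c e -> all_records (rcons cs c) (rcons l e).
Proof.
by elim: cs l => [|c' cs IH] [|e' l] //= [r1 r2] r; split=> //; apply: IH.
Qed.

Lemma steps_rcons c cs c' : steps M q u c cs -> step M q u (last c cs) c' ->
  steps M q u c (rcons cs c').
Proof.
by elim: cs c => [|c1 cs IH] c //= [h1 h2] h; split=> //; apply: IH.
Qed.

Lemma exec_probe_cmd s : (nmem (store s) 7 0 <= 4)%N ->
  let s' := exec probe_cmd s in store s' = store s /\
  log s' = rcons (log s) (Snapshot (nmem (store s) 7 0) (clock s') (store s)).
Proof.
by rewrite /=; move: (nmem (store s) 7 0) => -[|[|[|[|[|k]]]]].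
Qed.

Hypotheses (n0 : (0 < n)%N) (tM : tridiagonal M) (sM : symmetric_mx M).
Hypotheses (pM : pos_semidef M) (u0 : forall i, (0 < u i)%E).

Lemma move_step c m : config_ok M q u c -> rep M q u c m -> (nmem m 7 0 < 4)%N ->
  exists2 c', step M q u c c' & rep M q u c' (run move_cmd m).
Proof.
move=> ok rp; have [_ h] := rp; rewrite /move_cmd /by_phase 4!run_If.
have E k : bval m (BLt phase (NLit k)) = (nmem m 7 0 < k)%N by [].
rewrite 4!E {E}.
case: c ok rp h => [todo x|todo P rec|todo P rec d p|todo P rec p A B C|a] ok rp [ph _];
  rewrite ph // => _.
- exact: idle_step.
- exact: preparing_step.
- exact: prepared_step.
exact: pivoting_step.
Qed.

Lemma rep_phase c m : rep M q u c m -> (nmem m 7 0 <= 4)%N.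
Proof. by case: c => [??|???|?????|???????|?] [_ [-> _]]. Qed.

Lemma rep_phase4 c m : rep M q u c m -> (nmem m 7 0 < 4)%N = false ->
  exists2 a, c = Answered a & holds_answer m a.
Proof.
by case: c => [??|???|?????|???????|a] [_ [-> h]] // _; exists a.
Qed.

Lemma exec_if b (c1 c2 : cmd) s : exec (If b c1 c2) s =
  if bval (store s) b then exec c1 (tick (bcost b).+1 s) else exec c2 (tick (bcost b).+1 s).
Proof. by []. Qed.

Lemma exec_seq (c1 c2 : cmd) s : exec (Seq c1 c2) s = exec c2 (exec c1 s).
Proof. by []. Qed.

Lemma paced_rcons K (l : seq (snapshot R)) e :
  paced K (rcons l e) = paced K l && (time e <= last 0 [seq time e | e <- l] + K)%N.
Proof. by rewrite /paced map_rcons rcons_path. Qed.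

(* k counts the rounds made so far: unless the problem is answered, each of them
   is a step. *)
Definition run_inv c (K w k : nat) s : Prop := exists cs,
  [/\ steps M q u c cs, rep M q u (last c cs) (store s),
      all_records (c :: cs) (log s), paced K (log s)
    & (nmem (store s) 7 0 < 4)%N ->
      size cs = k /\ (clock s <= last 0 [seq time e | e <- log s] + w)%N].

Lemma silent_move : silent move_cmd. Proof. by []. Qed.

(** [w] bounds the cost of loop control since the last probe; the probe that ends the round resets
    it to 0. *)
Lemma round_inv c K w k s : config_ok M q u c -> (weight round * n + w <= K)%N ->
  run_inv c K w k s -> run_inv c K 0 k.+1 (exec round s).
Proof.
move=> ok; set W := (weight round * n)%N => wK [cs [st rp rc pc cl]].
have rc0 : nmem (store s) nSize 0 = n by case: rp.
have := @sized_clock R round s n n0 isT rc0.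
have -> : depth round = 1%N by [].
rewrite expn1 -/W; clearbody W.
rewrite /round exec_if; set s1 := tick _ s.
have E1 : store s1 = store s by [].
have E2 : log s1 = log s by [].
clearbody s1.
have -> : bval (store s) (BLt phase (NLit 4)) = (nmem (store s) 7 0 < 4)%N by [].
case: ifP => ph4 cW; last first.
  by exists cs; split=> //=; rewrite ?E1 ?E2 // ph4.
have [szk clk] := cl ph4.
have [okl _] := steps_inv tM sM pM u0 ok st.
have [c' stp rp'] := move_step okl rp ph4.
move: cW; rewrite exec_seq; set s2 := exec move_cmd s1.
have l2 : log s2 = log s by rewrite /s2 silent_log ?silent_move.
have st2 : store s2 = run move_cmd (store s) by rewrite /s2 store_exec E1.
clearbody s2.
have [|pst plg] := @exec_probe_cmd s2.
  by rewrite st2; apply: rep_phase rp'.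
set s3 := exec probe_cmd s2 in pst plg *; clearbody s3 => cW.
exists (rcons cs c'); rewrite last_rcons pst st2 plg l2 map_rcons last_rcons; split.
- exact: steps_rcons.
- exact: rp'.
- rewrite -rcons_cons; apply: all_records_rcons rc _.
  rewrite st2; exact: (rep_records (clock s3) rp').
- rewrite paced_rcons pc /=; apply: leq_trans cW _.
  by move: clk wK; clear; lia.
by move=> _; rewrite size_rcons szk addn0.
Qed.

Lemma rounds_inv c K w j k s : config_ok M q u c -> (weight round * n + w <= K)%N ->
  run_inv c K w k s -> run_inv c K 0 (j.+1 + k) (exec (repeat j.+1 round) s).
Proof.
move=> ok; elim: j w k s => [|j IH] w k s wK h; rewrite /repeat iterS exec_seq.
  exact: round_inv wK h.
rewrite addSnnS; apply: IH (round_inv ok wK h).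
by apply: leq_trans wK; rewrite leq_add2l.
Qed.

Lemma tick_inv c K w k s j : run_inv c K w k s -> run_inv c K (w + j) k (tick j s).
Proof.
move=> [cs [st rp rc pc cl]]; exists cs; split=> // ph4.
by have [h1 h2] := cl ph4; split=> //=; rewrite addnA leq_add2r.
Qed.

Lemma counter_inv c K w k s j : run_inv c K w k s ->
  run_inv c K w k (nstore 18 0 j s).
Proof.
move=> [cs [st rp rc pc cl]]; by exists cs.
Qed.

Lemma exec_for a e (c1 : cmd) s : exec (For a e c1) s =
  iteri (nval (store s) e) (fun k s' => exec c1 (tick 1 (nstore a 0 k s')))
    (tick (ncost e).+1 s).
Proof. by []. Qed.

(** Entering the loop costs 3 and starting an iteration 1, whence the 4 on top of the cost of a
    round. *)
Lemma loop_inv c K j s : config_ok M q u c -> (weight round * n + 4 <= K)%N ->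
  run_inv c K 0 0 s -> nmem (store s) nSize 0 = n ->
  run_inv c K 3 (j.+1 * n) (exec (For 18 cells (repeat j.+1 round)) s).
Proof.
move=> ok wK h s0; rewrite exec_for.
have -> : nval (store s) cells = n by [].
set F := fun _ _ => _; set sn := tick _ s.
have H k : run_inv c K 3 (j.+1 * k) (iteri k F sn).
  elim: k => [|k IH]; first by rewrite muln0; apply: (tick_inv 3 h).
  rewrite iteriS {1}/F mulnS.
  have [cs [a1 a2 a3 a4 a5]] := rounds_inv j ok wK (tick_inv 1 (counter_inv k IH)).
  exists cs; split=> // ph4; have [-> le] := a5 ph4.
  by split=> //; apply: leq_trans le _; rewrite leq_add2l.
exact: H.
Qed.

Lemma reset_correct m : nmem m nSize 0 = n -> holds_qp m (QP [set: 'I_n] M q u) ->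
  exists2 bs, perm_eq bs (enum (blocks M)) & rep M q u (Idle bs 0) (run reset_cmd m).
Proof.
move=> m0 [[hD hO] hl hu]; have [bs pb tb] := initial_rep tM sM.
exists bs => //; rewrite /reset_cmd 2!run_seq; set fs := [:: _].
have := prog_spec (fs := fs) m0 erefl; set m1 := run (prog fs) m.
have n1 b : b \notin [:: 5; 6]%N -> nmem m1 b = nmem m b by exact: run_nsub.
have r1 b : b \notin [:: rSol] -> rmem m1 b = rmem m b by exact: run_rsub.
clearbody m1 => -[//|[e1 _] _]; rewrite /set_phase !run_NSet; set m2 := naset _ _ _.
have n2 b : b \notin [:: 5; 6; 7; 8]%N -> nmem m2 b = nmem m b.
  rewrite !inE => hb; rewrite !nmem_naset.
  have [-> ->] : (b == 7)%N = false /\ (b == 8)%N = false by move: hb; clear; lia.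
  by rewrite n1 // !inE; move: hb; clear; lia.
have r2 b : rmem m2 b = rmem m1 b by [].
have c7 : nmem m2 7 0 = 0%N by [].
have c8 : nmem m2 8 0 = 0%N by [].
clearbody m2; split; first by rewrite n2.
split=> //; rewrite c8; split=> //.
  split=> [i _|i j _ ij|i _|i _].
  - by rewrite r2 r1 // hD ?inE.
  - rewrite r2 r1 // (hO i j) ?inE ?ij // => k _; lia.
  - by rewrite r2 r1 // hl ?inE.
  by have := hu i (in_setT i); rewrite n2 // r2 r1.
by move=> i _; rewrite r2 e1 // mxE.
Qed.


Lemma pppa_program_correct K m : (weight pppa_program <= K)%N ->
  (weight round + weight reset_cmd + 4 <= K)%N ->
  nmem m nSize 0 = n -> holds_qp m (QP [set: 'I_n] M q u) ->
  let s := exec pppa_program (start m) in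
  exists c cs a,
  [/\ initial M c, steps M q u c cs, all_records (c :: cs) (log s),
      last c cs = Answered a
    & [/\ resolves M q u a, holds_answer (store s) a,
          paced (K * n) (log s) & (clock s <= K * n ^ 2)%N]].
Proof.
move=> K1 K2 m0 hq s.
have cl : (clock s <= K * n ^ 2)%N.
  have := @sized_clock R pppa_program (start m) n n0 isT m0; rewrite add0n -/s.
  have -> : depth pppa_program = 2%N by [].
  by move=> h; apply: leq_trans h _; rewrite leq_mul2r K1 orbT.
have [bs pb rp0] := reset_correct m0 hq; set c := Idle bs 0 in rp0.
have ic : initial M c by exists bs.
have [okc _] := initial_inv q sM u0 ic.
have := @sized_clock R reset_cmd (start m) n n0 isT m0.
have -> : depth reset_cmd = 1%N by [].
rewrite add0n expn1 => cr.
(* The pace has to cover the reset before the first probe as well as every later round. *)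
have KE : (weight round * n + 4 + weight reset_cmd * n <= K * n)%N.
  rewrite addnAC -mulnDl; apply: leq_trans (leq_mul K2 (leqnn n)).
  by rewrite [leqRHS]mulnDl leq_add2l leq_pmulr.
have inv0 : run_inv c (K * n) 0 0 (exec (Seq reset_cmd (Probe 0)) (start m)).
  exists [::]; rewrite exec_probe; set s1 := exec reset_cmd (start m) in cr *.
  have E1 : store s1 = run reset_cmd m by rewrite /s1 store_exec.
  have E2 : log s1 = [::] by rewrite /s1 silent_log.
  clearbody s1; cbv zeta; rewrite E2 E1; split=> //=.
  - by rewrite /paced /= andbT add0n; apply: leq_trans cr (leq_trans (leq_addl _ _) KE).
  by rewrite addn0.
have sE : s = exec (For 18 cells (repeat 14 round)) (exec (Seq reset_cmd (Probe 0)) (start m)) by [].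
clearbody s.
set s0 := exec (Seq reset_cmd (Probe 0)) (start m) in inv0 sE.
have sz0 : nmem (store s0) nSize 0 = n.
  by have [cs0 [_ [h _] _ _ _]] := inv0.
clearbody s0.
have [cs [st rp rc pc fin]] := loop_inv 13 okc (leq_trans (leq_addr _ _) KE) inv0 sz0.
rewrite -sE in rp rc pc fin.
have [szb resb] := pppa_steps_bound tM sM pM u0 ic st.
case ph: (nmem (store s) 7 0 < 4)%N.
  have [sz _] := fin ph; move: szb n0; rewrite sz; clear; lia.
have [a ac ha] := rep_phase4 rp ph.
exists c, cs, a; split=> //; split=> //.
have [|a' ac' ra] := resb; first by rewrite ac => c' h; inversion h.
by move: ac'; rewrite ac => -[->].
Qed.
End Runs.

Theorem mainTheorem4 (R : realType) :
  exists (chol solve pppa : cmd) (K : nat),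
  [/\ (* Cholesky factorization of the principal submatrices: one probe per
         index, constant cost between consecutive probes, linear cost overall *)
      (forall (n : nat) (M : 'M[R]_n) (A : {set 'I_n}) (m : memory R),
         (0 < n)%N -> tridiagonal M -> symmetric_mx M -> pos_semidef M ->
         holds_size n m -> holds_mat m [set: 'I_n] M -> holds_set m nStatus 1 A ->
         let s := exec chol (start m) in
         [/\ size (log s) = n,
             paced K (log s),
             (forall i : 'I_n, i \in A ->
                let m' := snap (nth (Snapshot 0 0 m) (log s) i) in
                rmem m' rPivot i = pivoted M A i i i /\
                rmem m' rGdiag i = Num.sqrt (rmem m' rPivot i)),
             (clock s <= K * n)%N
           & is_cholesky (submx_on M A A) (held_factor (store s) A)]),
      (* computation of qbar and pbar from such a factorization *)
      (forall (n : nat) (M : 'M[R]_n) (q p : 'cV[R]_n) (u : 'I_n -> \bar R)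
         (A B C : {set 'I_n}) (m : memory R),
         (0 < n)%N -> tridiagonal M -> symmetric_mx M -> pos_semidef M ->
         (forall i, 0 < u i)%E ->
         [disjoint A & C] -> B = ~: (A :|: C) ->
         (forall i, i \in C -> (u i < +oo)%E) ->
         submx_on M A A \in unitmx ->
         let P := QP [set: 'I_n] M q u in
         holds_size n m -> holds_qp m P -> holds_vec m rP [set: 'I_n] p ->
         holds_status m A B C ->
         is_cholesky (submx_on M A A) (held_factor m A) ->
         let s := exec solve (start m) in
         [/\ (clock s <= K * n)%N,
             holds_vec (store s) rQbar [set: 'I_n] (qbar P A C)
           & holds_vec (store s) rPbar [set: 'I_n] (pbar P p A)]),
      (* whatever the choices made, the PPPA takes linearly many steps and stops
         with a resolution of the quadratic program *)
      (forall (n : nat) (M : 'M[R]_n) (q : 'cV[R]_n) (u : 'I_n -> \bar R)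
         (c : config R n) (cs : seq (config R n)),
         (0 < n)%N -> tridiagonal M -> symmetric_mx M -> pos_semidef M ->
         (forall i, 0 < u i)%E ->
         initial M c -> steps M q u c cs ->
         (size cs <= K * n)%N /\
         ((forall c', ~ step M q u (last c cs) c') ->
          exists2 a, last c cs = Answered a & resolves M q u a))
    & (* total complexity of the PPPA: linear cost between consecutive
         configurations, quadratic cost overall *)
      (forall (n : nat) (M : 'M[R]_n) (q : 'cV[R]_n) (u : 'I_n -> \bar R)
         (m : memory R),
         (0 < n)%N -> tridiagonal M -> symmetric_mx M -> pos_semidef M ->
         (forall i, 0 < u i)%E ->
         holds_size n m -> holds_qp m (QP [set: 'I_n] M q u) ->
         let s := exec pppa (start m) in
         exists (c : config R n) (cs : seq (config R n)) (a : answer R n),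
         [/\ initial M c,
             steps M q u c cs,
             all_records (c :: cs) (log s),
             last c cs = Answered a
           & [/\ resolves M q u a, holds_answer (store s) a,
                 paced (K * n) (log s)
               & (clock s <= K * n ^ 2)%N]])].
Proof.
(* [K] sums the syntactic weights of the programs. The 13 turns the bound [1 + 12 n] on the number
   of steps into [13 n], as [n] is positive. *)
have [K [K1 K2 K3 K4 [K5 K6]]] : exists K : nat, [/\ weight chol_step + 4 <= K,
    weight chol_program <= K, weight solve_program <= K, 13 <= K
  & weight pppa_program <= K /\ weight round + weight reset_cmd + 4 <= K]%N.
  exists (weight chol_step + 4 + (weight chol_program + (weight solve_program + (13 +
    (weight pppa_program + (weight round + weight reset_cmd + 4))))))%N.
  move: (weight chol_step) (weight chol_program) (weight solve_program) => a b c.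
  move: (weight pppa_program) (weight round) (weight reset_cmd) => d e f.
  by split; [| | | |split]; lia.
exists chol_program, solve_program, pppa_program, K; split.
- move=> n M A m n0 tM sM pM m0 hM hA s.
  have [h1 h2 h3 h4 h5] := chol_program_correct n0 tM sM pM m0 hM hA.
  split=> //; last by apply: leq_trans h4 _; rewrite leq_mul2r K2 orbT.
  apply: sub_path h2 => x y h; apply: leq_trans h _; by rewrite leq_add2l.
- move=> n M q p u A B C m n0 tM sM pM u0 dAC BE Cf uA P m0 hP hp hs ch s.
  have [h1 h2 h3] := solve_program_correct n0 tM sM pM u0 dAC Cf uA m0 hP hp hs ch.
  by split=> //; apply: leq_trans h1 _; rewrite leq_mul2r K3 orbT.
- move=> n M q u c cs n0 tM sM pM u0 ic st.
  have [h1 h2] := pppa_steps_bound tM sM pM u0 ic st; split=> //.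
  apply: leq_trans h1 _; apply: leq_trans (leq_mul K4 (leqnn n)).
  by move: n0; clear; lia.
move=> n M q u m n0 tM sM pM u0 m0 hq.
exact: pppa_program_correct.
Qed.
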